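(* Let $G$ be a simple graph on $n$ nodes whose degeneracy $d$ satisfies $d=O(\mathrm{polylog}(n))$, and let $H$ be any simple pattern graph on $k$ nodes. Then one can compute $\hom(H,G)$, $\mathrm{sub}(H,G)$ and $\mathrm{ind}(H,G)$ in time $f(k)\cdot\tilde{O}(n^{0.25k+2})$, for some computable function $f$.
   Context: The degeneracy of $G$ is the smallest $d$ such that $G$ admits an acyclic orientation in which every node has out-degree at most $d$. $\hom(H,G)$ is the number of homomorphisms from $H$ to $G$ (maps $V_H\to V_G$ sending edges to edges); $\mathrm{sub}(H,G)$ is the number of subgraphs of $G$ isomorphic to $H$; $\mathrm{ind}(H,G)$ is the number of induced subgraphs of $G$ isomorphic to $H$. Conventions: $k=O(1)$, asymptotic notation hides $\mathrm{poly}(k)$ factors, and $\tilde O(\cdot)$ additionally hides $\mathrm{polylog}(ndk)$ factors. *)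

(* Defs.v *)
From mathcomp Require Import all_boot all_order all_algebra.
From mathcomp Require Import reals exp.

Set Implicit Arguments.
Unset Strict Implicit.
Unset Printing Implicit Defensive.

(** * Simple graphs and the three counting functions *)

Record sgraph (V : finType) := SGraph {
  adj :> rel V;
  adj_sym : symmetric adj;
  adj_irrefl : irreflexive adj
}.

Section Counting.
Variables (VH VG : finType) (H : sgraph VH) (G : sgraph VG).

Definition is_hom (phi : {ffun VH -> VG}) : bool :=
  [forall u, forall v, adj H u v ==> adj G (phi u) (phi v)].

Definition edges (V : finType) (K : sgraph V) : {set {set V}} :=
  [set [set p.1; p.2] | p : V * V & adj K p.1 p.2].

(** A subgraph is a pair of a vertex set and an edge set. *)
Definition is_subgraph (S : {set VG} * {set {set VG}}) : bool :=
  (S.2 \subset edges G) && [forall e in S.2, e \subset S.1].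

Definition isomorphic_to_H (S : {set VG} * {set {set VG}}) : bool :=
  [exists phi : {ffun VH -> VG},
    [&& injectiveb phi,
        [set phi x | x : VH] == S.1
      & [set phi @: (e : {set VH}) | e in edges H] == S.2]].

Definition induced (U : {set VG}) : {set VG} * {set {set VG}} :=
  (U, [set e in edges G | e \subset U]).

Definition num_homs : nat := #|[set phi | is_hom phi]|.
Definition num_subgraphs : nat := #|[set S | is_subgraph S && isomorphic_to_H S]|.
Definition num_induced : nat := #|[set U | isomorphic_to_H (induced U)]|.

End Counting.

(** * Degeneracy *)

Section Degeneracy.
Variables (V : finType) (G : sgraph V).

(** [A] contains exactly one of [(u, v)], [(v, u)] for each edge [uv] of [G],
    and nothing else. *)
Definition orientation (A : {set V * V}) : bool :=
  [forall u, forall v,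
    if adj G u v then ((u, v) \in A) (+) ((v, u) \in A) else (u, v) \notin A].

(** No arc [(u, v)] closes a directed cycle. *)
Definition acyclic (A : {set V * V}) : bool :=
  [forall u, forall v,
    ((u, v) \in A) ==> ~~ connect [rel x y | (x, y) \in A] v u].

Definition outdeg (A : {set V * V}) (u : V) : nat := #|[set v | (u, v) \in A]|.

Definition has_acyclic_orientation (d : nat) : bool :=
  [exists A : {set V * V},
    [&& orientation A, acyclic A & [forall u, outdeg A u <= d]]].

Lemma acyclic_orientation_exists : exists d, has_acyclic_orientation d.
Proof.
exists #|V|; apply/existsP.
pose A := [set p : V * V | adj G p.1 p.2 && (enum_rank p.1 < enum_rank p.2)].
exists A; apply/and3P; split.
- apply/forallP=> u; apply/forallP=> v; rewrite !inE /= (adj_sym G v u).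
  case: ifP => [Guv|-> //]; rewrite Guv /=; case: ltngtP => // uv.
  by rewrite (enum_rank_inj (val_inj uv)) adj_irrefl in Guv.
- apply/forallP=> u; apply/forallP=> v; apply/implyP.
  rewrite inE /= => /andP[_ ltuv]; apply/negP => /connectP[p].
  suff mono x : path [rel x y | (x, y) \in A] x p ->
      enum_rank x <= enum_rank (last x p).
    by move=> /mono le_v u_last; move: ltuv; rewrite u_last ltnNge le_v.
  elim: p x => //= y p IHp x /andP[]; rewrite inE /= => /andP[_ /ltnW xy].
  by move=> /IHp; apply: leq_trans.
- by apply/forallP=> u; apply: max_card.
Qed.

Definition degeneracy : nat := ex_minn acyclic_orientation_exists.

End Degeneracy.

(** * Random access machines with logarithmic cost

    The memory consists of cells indexed by natural numbers, each holding a
    natural number.  As in Aho, Hopcroft and Ullman, every access is charged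
    the bit length of each address and each value involved; up to
    polylogarithmic factors this is the running time on a machine with
    logarithmic word size.  Jumps are replaced by the structured [If] and
    [While], which changes costs by at most a constant factor per program. *)

(** The bit length; at least 1, also for 0. *)
Definition lg (n : nat) : nat := (trunc_log 2 n).+1.

Definition memory := nat -> nat.

Definition update (m : memory) (a v : nat) : memory :=
  fun b => if b == a then v else m b.

(** [Dir a] is cell [a]; [Ind a] is the cell whose index is stored in [a]. *)
Inductive place := Dir of nat | Ind of nat.
Inductive operand := Cst of nat | At of place.
Inductive binop := Add | Sub | Mul | Div.

Inductive program :=
  | Skip
  | Assign of place & binop & operand & operand
  | Seq of program & program
  | If of operand & program & program
  | While of operand & program.

Definition address (m : memory) (p : place) : nat :=
  match p with Dir a => a | Ind a => m a end.

Definition address_cost (m : memory) (p : place) : nat :=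
  match p with Dir a => lg a | Ind a => lg a + lg (m a) end.

Definition value (m : memory) (x : operand) : nat :=
  match x with Cst c => c | At p => m (address m p) end.

Definition value_cost (m : memory) (x : operand) : nat :=
  match x with
  | Cst c => lg c
  | At p => address_cost m p + lg (m (address m p))
  end.

(** Subtraction is truncated, and division by 0 returns 0. *)
Definition apply_binop (o : binop) (x y : nat) : nat :=
  match o with Add => x + y | Sub => x - y | Mul => x * y | Div => x %/ y end.

(** [exec c m t m']: started in memory [m], [c] halts in memory [m'] after
    time [t].  The tests of [If] and [While] succeed on nonzero values. *)
Inductive exec : program -> memory -> nat -> memory -> Prop :=
  | ExecSkip m : exec Skip m 0 m
  | ExecAssign m p o x y :
      let v := apply_binop o (value m x) (value m y) in
      exec (Assign p o x y) m
        (value_cost m x + value_cost m y + address_cost m p + lg v)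
        (update m (address m p) v)
  | ExecSeq c1 c2 m m1 m2 t1 t2 :
      exec c1 m t1 m1 -> exec c2 m1 t2 m2 ->
      exec (Seq c1 c2) m (t1 + t2) m2
  | ExecIfT x c1 c2 m m1 t :
      value m x != 0 -> exec c1 m t m1 ->
      exec (If x c1 c2) m (value_cost m x + t) m1
  | ExecIfF x c1 c2 m m1 t :
      value m x = 0 -> exec c2 m t m1 ->
      exec (If x c1 c2) m (value_cost m x + t) m1
  | ExecWhileT x c m m1 m2 t1 t2 :
      value m x != 0 -> exec c m t1 m1 -> exec (While x c) m1 t2 m2 ->
      exec (While x c) m (value_cost m x + t1 + t2) m2
  | ExecWhileF x c m :
      value m x = 0 -> exec (While x c) m (value_cost m x) m.

(** On input [s], stored in cells [0, ..., size s - 1] of an otherwise zero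
    memory, [c] halts after time [t] with [v] in cell 0. *)
Definition runs (c : program) (s : seq nat) (t v : nat) : Prop :=
  exists2 m : memory, exec c (nth 0 s) t m & m 0 = v.

Definition computable (f : nat -> nat) : Prop :=
  exists c : program, forall k, exists t, runs c [:: k] t (f k).

(** * Counting problems *)

(** For each vertex in turn: its degree, then its neighbours in increasing
    order. *)
Definition adjacency_lists (n : nat) (G : sgraph 'I_n) : seq nat :=
  flatten [seq #|[set v | adj G u v]| ::
               [seq val v | v <- enum 'I_n & adj G u v] | u <- enum 'I_n].

Definition encode (k n : nat) (H : sgraph 'I_k) (G : sgraph 'I_n) : seq nat :=
  [:: k, n & adjacency_lists H ++ adjacency_lists G].

(** [D n] is [O(polylog n)].  Since [lg n >= 1], the constant [C] takes care of
    small [n]. *)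
Definition polylogarithmic (D : nat -> nat) : Prop :=
  exists C c : nat, forall n, D n <= C * lg n ^ c.

(** One program, which receives both [H] and [G], computes [count H G] for all
    patterns and all graphs of degeneracy at most [D n]; its running time is at
    most [T k n d] with [d] the degeneracy of [G].  The time bound is only
    claimed for [n > 0], as powers of [n] vanish at 0. *)
Definition computed_in_time (R : realType)
    (count : forall VH VG : finType, sgraph VH -> sgraph VG -> nat)
    (D : nat -> nat) (T : nat -> nat -> nat -> R) : Prop :=
  exists c : program,
    forall (k n : nat) (H : sgraph 'I_k) (G : sgraph 'I_n),
      degeneracy G <= D n ->
      exists2 t : nat,
        runs c (encode H G) t (count 'I_k 'I_n H G)
        & 0 < n -> (t%:R <= T k n (degeneracy G) :> R)%R.

(** The bound [f(k) * n^(0.25 k + 2) * polylog(n d k)].  The degree [e k] of the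
    polylogarithmic factor may depend on [k], because [d ^ O(k)] counts as
    polylogarithmic; it must be required to be computable, or else this factor
    could absorb an uncomputable function of [k].  The successors keep the logarithm positive when [d] or [k]
    is 0. *)
Definition time_bound (R : realType) (f e : nat -> nat) (k n d : nat) : R :=
  ((f k)%:R * n%:R `^ (k%:R / 4%:R + 2%:R)
     * (lg (n * d.+1 * k.+1))%:R ^+ e k)%R.

(* Main.v *)
(* The indicator of an edge of [G] is [arc x y + arc y x] for an orientation
   whose out-degrees are bounded by a polylogarithmic [delta], found by removing
   the vertices with few remaining neighbours in [lg n] rounds.  Expanding the
   conditions on all pairs of vertices of [H] turns each count into a signed sum,
   over the labellings of these pairs, of numbers of maps [phi] with prescribed
   arcs and equalities.  Call the prescribed relation [e]: once [phi v] is known,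
   there are at most [(delta + 1) ^ k] possibilities for the images of all vertices
   that [v] reaches along [e].  A set [B] of at most [k / 4] vertices can be chosen such
   that the vertices not reached from [B] are placed in two more stages: beyond
   [B], [e] falls apart into pieces, each having a root, and the vertices of a
   piece that the root does not reach are pairwise unrelated.  Summing over the
   images of [B], and independently for each piece over the image of its root
   and then of each remaining vertex, takes [n ^ (k / 4) * n * n] steps.

   The algorithm is written in a small language of bounded loops and compiled to
   the machine.  Its running time is read off from a type system whose types
   bound numbers by [n ^ (j + q * (k / 4))] up to powers of [lg n] and factors
   depending on [k], which are below some member of a hierarchy of computable
   functions. *)

Require Import Defs.
From mathcomp Require Import all_boot all_order all_algebra.
From mathcomp Require Import reals exp.
From mathcomp Require Import zify.

Set Implicit Arguments.
Unset Strict Implicit.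
Unset Printing Implicit Defensive.

(** The quarter comes from a charging argument. Take a minimal set of sources that reach every
    vertex of [H]. The potential counts the non-sources not yet reached from [B], and the sources
    from which at least two of these are reached; it is at most [k] at first. [B] is a maximal set
    of sources such that four units for each of them, plus the remaining potential, stay within [k].
    No further source then saves four units, so each one reaches at most two unreached non-sources,
    and two sources reaching two each share none. This is what leaves only pieces made of a root,
    what it reaches, and isolated leaves.

    The other obstacle is uniformity. [f] and [e] have to be computable and every access is charged
    by bit length, so neither factors depending on [k] nor the sizes of intermediate numbers can be
    neglected, while explicit constants for the nested searches would be unmanageable. Hence each
    bound concerns a whole family of instances with one rank in the hierarchy, and a loop is treated
    by adding its index to the instance. Only the existence of a rank is ever used. *)

(** * Expressions and statements with bounded loops *)

Inductive aop := AAdd | ASub | AMul | ADiv | AMod | AMin | AEq | ALt.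

Definition aval (o : aop) (x y : nat) : nat :=
  match o with
  | AAdd => x + y | ASub => x - y | AMul => x * y | ADiv => x %/ y
  | AMod => x %% y | AMin => minn x y | AEq => x == y | ALt => x < y
  end.

Inductive lmode := LSet | LSum | LProd.

Definition comb (md : lmode) (acc v : nat) : nat :=
  match md with LSet => v | LSum => acc + v | LProd => acc * v end.

(** Variables are numbered from the outermost binder, so the register of a variable is fixed and a
    variable keeps its number below further binders. A loop evaluates its bound once, which makes
    evaluation a total function. *)
Inductive expr :=
  | ECst of nat
  | EVar of nat
  | EOp of aop & expr & expr
  | ERead of expr
  | ELet of expr & expr
  | ELoop of lmode & expr & expr & expr.

(** The environment mirrors the registers at each moment of the compiled code: a second operand is
    evaluated with the first one already stored, a loop bound with the start value and the index 0
    in place. The body of a loop sees the accumulator, the index and the number of rounds left; the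
    last of these drives the compiled [While]. *)
Fixpoint eval (delta : nat -> nat) (env : seq nat) (e : expr) : nat :=
  match e with
  | ECst c => c
  | EVar j => nth 0 env j
  | EOp o a b =>
      aval o (eval delta env a) (eval delta (env ++ [:: eval delta env a]) b)
  | ERead a => delta (eval delta env a)
  | ELet a b => eval delta (env ++ [:: eval delta env a]) b
  | ELoop md b a c =>
      let x := eval delta env b in
      let N := eval delta (env ++ [:: x; 0]) a in
      iteri N (fun i acc =>
        comb md acc (eval delta (env ++ [:: acc; i; N - i]) c)) x
  end.

Definition loop_acc delta md (env : seq nat) (c : expr) (x N i : nat) : nat :=
  iteri i (fun i acc =>
    comb md acc (eval delta (env ++ [:: acc; i; N - i]) c)) x.

(** Unit-cost time. The logarithmic cost is this number times the bit length of the numbers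
    involved, which [safe] controls. *)
Fixpoint steps (delta : nat -> nat) (env : seq nat) (e : expr) : nat :=
  match e with
  | ECst _ => 1
  | EVar _ => 1
  | EOp o a b =>
      steps delta env a + steps delta (env ++ [:: eval delta env a]) b + 1
  | ERead a => steps delta env a + 1
  | ELet a b =>
      steps delta env a + steps delta (env ++ [:: eval delta env a]) b + 1
  | ELoop md b a c =>
      let x := eval delta env b in
      let N := eval delta (env ++ [:: x; 0]) a in
      steps delta env b + steps delta (env ++ [:: x; 0]) a + 1 +
      \sum_(i < N) (steps delta
        (env ++ [:: loop_acc delta md env c x N i; nat_of_ord i; N - i]) c).+1
  end.

(** All values met on the way are bounded, not only the result: addresses, loop bounds and every
    running value of an accumulator. *)
Fixpoint safe (delta : nat -> nat) (V : nat) (env : seq nat) (e : expr) : Prop :=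
  match e with
  | ECst c => c <= V
  | EVar j => nth 0 env j <= V
  | EOp o a b =>
      [/\ safe delta V env a, safe delta V (env ++ [:: eval delta env a]) b
      & eval delta env (EOp o a b) <= V]
  | ERead a => safe delta V env a /\ delta (eval delta env a) <= V
  | ELet a b =>
      safe delta V env a /\ safe delta V (env ++ [:: eval delta env a]) b
  | ELoop md b a c =>
      let x := eval delta env b in
      let N := eval delta (env ++ [:: x; 0]) a in
      [/\ safe delta V env b, safe delta V (env ++ [:: x; 0]) a &
       forall i, i < N ->
         safe delta V (env ++ [:: loop_acc delta md env c x N i; i; N - i]) c
         /\ loop_acc delta md env c x N i.+1 <= V]
  end.

Lemma steps_op delta env o a b : steps delta env (EOp o a b) =
  steps delta env a + steps delta (env ++ [:: eval delta env a]) b + 1.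
Proof. by []. Qed.

Lemma steps_read delta env a : steps delta env (ERead a) = steps delta env a + 1.
Proof. by []. Qed.

Lemma steps_let delta env a b : steps delta env (ELet a b) =
  steps delta env a + steps delta (env ++ [:: eval delta env a]) b + 1.
Proof. by []. Qed.

Lemma steps_loop delta env md b a c : steps delta env (ELoop md b a c) =
  let x := eval delta env b in
  let N := eval delta (env ++ [:: x; 0]) a in
  steps delta env b + steps delta (env ++ [:: x; 0]) a + 1 +
  \sum_(i < N) (steps delta
    (env ++ [:: loop_acc delta md env c x N i; nat_of_ord i; N - i]) c).+1.
Proof. by []. Qed.

Definition stepsE := (steps_op, steps_read, steps_let, steps_loop).

Lemma safe_op delta V env o a b : safe delta V env (EOp o a b) <->
  [/\ safe delta V env a, safe delta V (env ++ [:: eval delta env a]) b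
      & eval delta env (EOp o a b) <= V].
Proof. by []. Qed.

Lemma safe_read delta V env a : safe delta V env (ERead a) <->
  safe delta V env a /\ delta (eval delta env a) <= V.
Proof. by []. Qed.

Lemma safe_let delta V env a b : safe delta V env (ELet a b) <->
  safe delta V env a /\ safe delta V (env ++ [:: eval delta env a]) b.
Proof. by []. Qed.

Lemma safe_loop delta V env md b a c : safe delta V env (ELoop md b a c) <->
  let x := eval delta env b in
  let N := eval delta (env ++ [:: x; 0]) a in
  [/\ safe delta V env b, safe delta V (env ++ [:: x; 0]) a &
   forall i, i < N ->
     safe delta V (env ++ [:: loop_acc delta md env c x N i; i; N - i]) c
     /\ loop_acc delta md env c x N i.+1 <= V].
Proof. by []. Qed.

#[global] Arguments steps : simpl never.
#[global] Arguments safe : simpl never.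

Lemma safe_eval delta V env e : safe delta V env e -> eval delta env e <= V.
Proof.
elim: e env => // [o a IHa b IHb env /safe_op[]|a IHa env /safe_read[]|
    a IHa b IHb env /safe_let[]| md b IHb a IHa c IHc env /safe_loop[hb ha hc]] //.
- by move=> _; apply: IHb.
move: hc => /=; case: (eval delta (env ++ _) a) => [|N] hc; first exact: IHb.
by have [_] := hc N (leqnn _).
Qed.

(** Stores are kept out of expressions, so that the data are constant during the evaluation of an
    expression and only statements have to thread them. *)
Inductive stmt :=
  | SStore of expr & expr
  | SSeq of stmt & stmt
  | SLet of expr & stmt
  | SFor of expr & stmt.

Fixpoint srun (env : seq nat) (s : stmt) (delta : nat -> nat) : nat -> nat :=
  match s with
  | SStore a b =>
      let x := eval delta env a in
      update delta x (eval delta (env ++ [:: x]) b)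
  | SSeq s1 s2 => srun env s2 (srun env s1 delta)
  | SLet a s => srun (env ++ [:: eval delta env a]) s delta
  | SFor a s =>
      let N := eval delta (env ++ [:: 0]) a in
      iteri N (fun i d => srun (env ++ [:: i; N - i]) s d) delta
  end.

Definition for_state env s N delta i :=
  iteri i (fun i d => srun (env ++ [:: i; N - i]) s d) delta.

Fixpoint ssteps (env : seq nat) (s : stmt) (delta : nat -> nat) : nat :=
  match s with
  | SStore a b => steps delta env a + steps delta (env ++ [:: eval delta env a]) b + 1
  | SSeq s1 s2 => ssteps env s1 delta + ssteps env s2 (srun env s1 delta)
  | SLet a s => steps delta env a + ssteps (env ++ [:: eval delta env a]) s delta
  | SFor a s =>
      let N := eval delta (env ++ [:: 0]) a in
      steps delta (env ++ [:: 0]) a + 1 +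
      \sum_(i < N) (ssteps (env ++ [:: nat_of_ord i; N - i]) s (for_state env s N delta i)).+1
  end.

Fixpoint ssafe (V : nat) (env : seq nat) (s : stmt) (delta : nat -> nat) : Prop :=
  match s with
  | SStore a b => safe delta V env a /\ safe delta V (env ++ [:: eval delta env a]) b
  | SSeq s1 s2 => ssafe V env s1 delta /\ ssafe V env s2 (srun env s1 delta)
  | SLet a s => safe delta V env a /\ ssafe V (env ++ [:: eval delta env a]) s delta
  | SFor a s =>
      let N := eval delta (env ++ [:: 0]) a in
      safe delta V (env ++ [:: 0]) a /\
      forall i, i < N -> ssafe V (env ++ [:: i; N - i]) s (for_state env s N delta i)
  end.

(** * Compilation *)

(* Registers are the even cells from 2 on. Cell 0 holds an odd number F, and
   the datum with address [a] is in the odd cell F + 2a. *)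
Definition reg (j : nat) : nat := j.+1.*2.

Definition rg (j : nat) : operand := At (Dir (reg j)).
Definition asg (j : nat) (o : binop) (x y : operand) : program :=
  Assign (Dir (reg j)) o x y.

(** Everything beyond the four machine operations is built from truncated subtraction: a minimum is
    [x - (x - y)], equality is [1 - ((x - y) + (y - x))], and [x < y] is [1 - (1 - (y - x))].
    Register [l.+2] is scratch. *)
Definition compop (o : aop) (l : nat) : program :=
  match o with
  | AAdd => asg l Add (rg l) (rg l.+1)
  | ASub => asg l Defs.Sub (rg l) (rg l.+1)
  | AMul => asg l Mul (rg l) (rg l.+1)
  | ADiv => asg l Div (rg l) (rg l.+1)
  | AMod => Seq (asg l.+2 Div (rg l) (rg l.+1))
            (Seq (asg l.+2 Mul (rg l.+2) (rg l.+1))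
                 (asg l Defs.Sub (rg l) (rg l.+2)))
  | AMin => Seq (asg l.+2 Defs.Sub (rg l) (rg l.+1)) (asg l Defs.Sub (rg l) (rg l.+2))
  | AEq => Seq (asg l.+2 Defs.Sub (rg l) (rg l.+1))
           (Seq (asg l.+1 Defs.Sub (rg l.+1) (rg l))
           (Seq (asg l.+2 Add (rg l.+2) (rg l.+1))
                (asg l Defs.Sub (Cst 1) (rg l.+2))))
  | ALt => Seq (asg l.+1 Defs.Sub (rg l.+1) (rg l))
           (Seq (asg l.+2 Defs.Sub (Cst 1) (rg l.+1))
                (asg l Defs.Sub (Cst 1) (rg l.+2)))
  end.

Definition combop (md : lmode) (l : nat) : program :=
  match md with
  | LSet => asg l Add (rg l.+3) (Cst 0)
  | LSum => asg l Add (rg l) (rg l.+3)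
  | LProd => asg l Mul (rg l) (rg l.+3)
  end.

Definition loop_code (l : nat) (body : program) : program :=
  While (rg l.+2)
    (Seq body (Seq (asg l.+1 Add (rg l.+1) (Cst 1))
                   (asg l.+2 Defs.Sub (rg l.+2) (Cst 1)))).

Definition data_addr (l : nat) : program :=
  Seq (asg l Add (rg l) (rg l)) (asg l Add (rg l) (At (Dir 0))).

Fixpoint compile (e : expr) (l : nat) : program :=
  match e with
  | ECst c => asg l Add (Cst c) (Cst 0)
  | EVar j => asg l Add (rg j) (Cst 0)
  | EOp o a b => Seq (compile a l) (Seq (compile b l.+1) (compop o l))
  | ERead a =>
      Seq (compile a l) (Seq (data_addr l) (asg l Add (At (Ind (reg l))) (Cst 0)))
  | ELet a b =>
      Seq (compile a l) (Seq (compile b l.+1) (asg l Add (rg l.+1) (Cst 0)))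
  | ELoop md b a c =>
      Seq (compile b l) (Seq (asg l.+1 Add (Cst 0) (Cst 0))
     (Seq (compile a l.+2) (loop_code l (Seq (compile c l.+3) (combop md l)))))
  end.

Fixpoint height (e : expr) : nat :=
  match e with
  | ECst _ => 0
  | EVar j => j
  | EOp _ a b => maxn (height a) (maxn (height b).+1 2)
  | ERead a => height a
  | ELet a b => maxn (height a) (maxn (height b).+1 1)
  | ELoop _ b a c => maxn (height b) (maxn (height a).+2 (height c).+3)
  end.

Fixpoint scompile (s : stmt) (l : nat) : program :=
  match s with
  | SStore a b => Seq (compile a l) (Seq (compile b l.+1)
      (Seq (data_addr l) (Assign (Ind (reg l)) Add (rg l.+1) (Cst 0))))
  | SSeq s1 s2 => Seq (scompile s1 l) (scompile s2 l)
  | SLet a s => Seq (compile a l) (scompile s l.+1)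
  | SFor a s => Seq (asg l Add (Cst 0) (Cst 0)) (Seq (compile a l.+1)
      (While (rg l.+1) (Seq (scompile s l.+2)
         (Seq (asg l Add (rg l) (Cst 1)) (asg l.+1 Defs.Sub (rg l.+1) (Cst 1))))))
  end.

Fixpoint scoped (n : nat) (e : expr) : bool :=
  match e with
  | ECst _ => true
  | EVar j => j < n
  | EOp _ a b => scoped n a && scoped n.+1 b
  | ERead a => scoped n a
  | ELet a b => scoped n a && scoped n.+1 b
  | ELoop _ b a c => [&& scoped n b, scoped n.+2 a & scoped n.+3 c]
  end.

Fixpoint sscoped (n : nat) (s : stmt) : bool :=
  match s with
  | SStore a b => scoped n a && scoped n.+1 b
  | SSeq s1 s2 => sscoped n s1 && sscoped n s2
  | SLet a s => scoped n a && sscoped n.+1 s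
  | SFor a s => scoped n.+1 a && sscoped n.+2 s
  end.

Fixpoint sheight (s : stmt) : nat :=
  match s with
  | SStore a b => maxn (height a) (maxn (height b).+1 1)
  | SSeq s1 s2 => maxn (sheight s1) (sheight s2)
  | SLet a s => maxn (height a) (sheight s).+1
  | SFor a s => maxn (height a).+1 (maxn (sheight s).+2 1)
  end.

#[global] Arguments lg : simpl never.

Lemma lg_mono m n : m <= n -> lg m <= lg n.
Proof. by rewrite /lg ltnS; apply: leq_trunc_log. Qed.

Lemma lg_gt0 n : 0 < lg n. Proof. by []. Qed.

Lemma reg_inj i j : (reg i == reg j) = (i == j).
Proof. by apply/eqP/eqP => [|->//]; rewrite /reg; lia. Qed.

Lemma update_same m a v : update m a v a = v.
Proof. by rewrite /update eqxx. Qed.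

(** The odd cells hold the data and the smaller registers hold the variables. Cell 0, the base of
    the data, lies below every register and is covered as well. *)
Definition preserves (l : nat) (m m' : memory) : Prop :=
  forall a, odd a || (a < reg l) -> m' a = m a.

Lemma preserves_trans l m1 m2 m3 :
  preserves l m1 m2 -> preserves l m2 m3 -> preserves l m1 m3.
Proof. by move=> h1 h2 a ha; rewrite h2 // h1. Qed.

Lemma preserves_le l l' m m' : l <= l' -> preserves l' m m' -> preserves l m m'.
Proof. by move=> hl h a ha; apply: h; move: ha; rewrite /reg; lia. Qed.

Lemma preserves_update l i m v : l <= i -> preserves l m (update m (reg i) v).
Proof.
move=> li a ha; rewrite /update; case: eqP => // e.
by move: ha; rewrite e /reg; lia.
Qed.

Lemma preserves_reg l i m m' : preserves l m m' -> i < l -> m' (reg i) = m (reg i).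
Proof. by move=> h il; apply: h; rewrite /reg; lia. Qed.

(** The constant 24 stands for at most four assignments between directly addressed registers, each
    of cost at most [6 * L]. *)
Lemma compop_ok o l m : exists m' t,
  [/\ exec (compop o l) m t m',
      m' (reg l) = aval o (m (reg l)) (m (reg l.+1)),
      preserves l m m' &
      forall L, lg (reg l.+2) <= L -> lg (m (reg l)) <= L ->
        lg (m (reg l.+1)) <= L ->
        lg (aval o (m (reg l)) (m (reg l.+1))) <= L -> t <= 24 * L].
Proof.
have lgr L : lg (reg l.+2) <= L ->
    [/\ lg (reg l) <= L, lg (reg l.+1) <= L & lg 1 <= L].
  by move=> h; split; apply: leq_trans h; apply: lg_mono; rewrite /reg; lia.
have e01 : (l == l.+1) = false by lia.
have e02 : (l == l.+2) = false by lia.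
have e10 : (l.+1 == l) = false by lia.
have e12 : (l.+1 == l.+2) = false by lia.
have e20 : (l.+2 == l) = false by lia.
have e21 : (l.+2 == l.+1) = false by lia.
have sub_lg x y L : lg x <= L -> lg (x - y) <= L.
  by move=> h; apply: leq_trans h; apply: lg_mono; lia.
have div_lg x y L : lg x <= L -> lg (x %/ y) <= L.
  by move=> h; apply: leq_trans h; apply: lg_mono; apply: leq_div.
have muldiv_lg x y L : lg x <= L -> lg (x %/ y * y) <= L.
  by move=> h; apply: leq_trans h; apply: lg_mono; apply: leq_trunc_div.
have dist_lg x y L : lg x <= L -> lg y <= L -> lg (x - y + (y - x)) <= L.
  by move=> hx hy; case: (leqP x y) => h;
    [apply: leq_trans hy | apply: leq_trans hx]; apply: lg_mono; lia.
set x := m (reg l); set y := m (reg l.+1).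
have fin P (pp : preserves l m P) : preserves l m P by [].
(* All eight programs are run symbolically; the value, the untouched cells and the cost are left to
   arithmetic. *)
case: o; do 2!eexists; split; try (by repeat econstructor);
 rewrite /= /update ?reg_inj ?eqxx ?e01 ?e02 ?e10 ?e12 ?e20 ?e21 ?eqxx -/x -/y //.
all: try (by move=> a ha; rewrite /= /update; repeat (case: eqP; [move=> ea; move: ha; rewrite ea /reg; lia | move=> _]) ).
all: try (by have := divn_eq x y; lia).
all: try (by rewrite minnE).
all: try (by case: eqP => h; lia).
all: try (by case: ltnP => h; lia).
all: move=> L hL hx hy hv; have [h0 h1 h2] := lgr L hL.
all: have := sub_lg x y L hx; have := sub_lg y x L hy; have := div_lg x y L hx; have := muldiv_lg x y L hx; have := dist_lg x y L hx hy;
     have := sub_lg 1 (x - y + (y - x)) L h2; have := sub_lg 1 (y - x) L h2; have := sub_lg 1 (1 - (y - x)) L h2.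
all: have := sub_lg x (x %/ y * y) L hx; have := sub_lg x (x - y) L hx.
all: clear - h0 h1 h2 hL hx hy hv; simpl in hv; rewrite ?mul0n; lia.
Qed.
Lemma asg_ok i o x y m : exists2 t,
    exec (asg i o x y) m t
      (update m (reg i) (apply_binop o (value m x) (value m y))) &
    forall L, lg (reg i) <= L -> value_cost m x <= 3 * L -> value_cost m y <= 3 * L ->
      lg (apply_binop o (value m x) (value m y)) <= L -> t <= 8 * L.
Proof. by eexists; first exact: ExecAssign; move=> L; rewrite /=; lia. Qed.

Lemma value_cost_rg m i L : lg (reg i) <= L -> lg (m (reg i)) <= L ->
  value_cost m (rg i) <= 3 * L.
Proof. by rewrite /=; lia. Qed.

(** [Q] carries what is known about the time of one round. It is an arbitrary predicate because the
    bit length [L] that bounds this time is chosen only after the execution has been exhibited. *)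
Lemma while_ok r body N (Inv : nat -> memory -> Prop) (Q : nat -> nat -> Prop) m0 :
  (forall i m, i < N -> Inv i m -> m (reg r) = N - i ->
    exists t m', [/\ exec body m t m', Inv i.+1 m', m' (reg r) = N - i.+1 & Q i t]) ->
  Inv 0 m0 -> m0 (reg r) = N ->
  exists t m', [/\ exec (While (rg r) body) m0 t m', Inv N m' &
    forall L (b : nat -> nat), lg (reg r) <= L -> lg N <= L ->
      (forall i t, i < N -> Q i t -> t <= b i * L) ->
      t <= (\sum_(i < N) (b i + 2) + 2) * L].
Proof.
move=> hb I0 r0.
suff: forall d i m, i + d = N -> Inv i m -> m (reg r) = N - i ->
  exists t m', [/\ exec (While (rg r) body) m t m', Inv N m' &
    forall L (b : nat -> nat), lg (reg r) <= L -> lg N <= L ->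
      (forall i t, i < N -> Q i t -> t <= b i * L) ->
      t <= (\sum_(i <= j < N) (b j + 2) + 2) * L].
  move=> /(_ N 0 m0 (erefl _) I0); rewrite subn0 => /(_ r0) [t [m' [h1 h2 h3]]].
  by exists t, m'; split => // L b; rewrite -(big_mkord xpredT (fun i => b i + 2)); apply: h3.
elim=> [|d IHd] i m hi Ii ri.
  exists (value_cost m (rg r)), m; split.
  - by apply: ExecWhileF; rewrite /= ri; lia.
  - by have -> : N = i by lia.
  - move=> L b hr hN _; rewrite /= ri big_geq; last by lia.
    have : lg (N - i) <= lg N by apply: lg_mono; lia.
    by lia.
have iN : i < N by lia.
have [t1 [m1 [e1 I1 r1 q1]]] := hb i m iN Ii ri.
have [|t2 [m2 [e2 I2 T2]]] := IHd i.+1 m1 _ I1 r1; first by lia.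
exists (value_cost m (rg r) + t1 + t2), m2; split => //.
  by apply: ExecWhileT e1 e2; rewrite /= ri; lia.
move=> L b hr hN hQ; have := T2 L b hr hN hQ; have := hQ i t1 iN q1.
have : lg (N - i) <= lg N by apply: lg_mono; lia.
rewrite /= ri (big_ltn iN); nia.
Qed.

(** Even cells beyond the environment and odd cells below [m 0] are left unconstrained, so scratch
    values and remains of the input never have to be cleared. *)
Definition sim (delta : nat -> nat) (env : seq nat) (m : memory) : Prop :=
  [/\ odd (m 0), forall j, j < size env -> m (reg j) = nth 0 env j
    & forall a, m (m 0 + a.*2) = delta a].

Lemma sim_preserves delta env m m' :
  sim delta env m -> preserves (size env) m m' -> sim delta env m' /\ m' 0 = m 0.
Proof.
move=> [h0 h1 h2] p.
have e0 : m' 0 = m 0 by apply: p; rewrite /reg; lia.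
split=> //; split.
- by rewrite e0.
- by move=> j hj; rewrite (preserves_reg p) // h1.
- by move=> a; rewrite e0 p ?h2 // oddD odd_double addbF h0.
Qed.

Lemma sim_rcons delta env m v :
  sim delta env m -> m (reg (size env)) = v -> sim delta (env ++ [:: v]) m.
Proof.
move=> [h0 h1 h2] hv; split=> // j; rewrite size_cat nth_cat /= addn1 ltnS leq_eqVlt.
case: ltnP => [jl _|jl]; first exact: h1.
by rewrite orbF => /eqP ->; rewrite subnn.
Qed.

Lemma size_rcons' (env : seq nat) v : size (env ++ [:: v]) = (size env).+1.
Proof. by rewrite size_cat /= addn1. Qed.

Lemma preserves_neq l m m' : (forall a, a != reg l -> m' a = m a) -> preserves l m m'.
Proof.
by move=> h a ha; apply: h; apply: contraTneq ha => ->; rewrite odd_double ltnn.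
Qed.

Lemma data_addr_ok l m : odd (m 0) -> exists t m',
  [/\ exec (data_addr l) m t m', m' (reg l) = m 0 + (m (reg l)).*2,
      forall a, a != reg l -> m' a = m a &
      forall L, lg (reg l) <= L -> lg (m 0 + (m (reg l)).*2) <= L -> t <= 16 * L].
Proof.
move=> o0.
have [t1 e1 T1] := asg_ok l Add (rg l) (rg l) m.
set m1 := update _ _ _ in e1.
have [t2 e2 T2] := asg_ok l Add (rg l) (At (Dir 0)) m1.
have r1 : m1 (reg l) = (m (reg l)).*2 by rewrite /m1 update_same /= addnn.
have r0 : m1 0 = m 0 by [].
exists (t1 + t2), (update m1 (reg l) (m 0 + (m (reg l)).*2)); split.
- apply: ExecSeq e1 _; move: e2.
  by rewrite [apply_binop _ _ _]/= r1 r0 [_.*2 + _]addnC.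
- by rewrite update_same.
- by move=> a ha; rewrite /m1 /update (negPf ha).
move=> L hl hv.
have hx x : x <= m 0 + (m (reg l)).*2 -> lg x <= L.
  by move=> h; apply: leq_trans hv; apply: lg_mono.
have h1 : t1 <= 8 * L.
  apply: T1 => //.
  - by apply: value_cost_rg => //; apply: hx; lia.
  - by apply: value_cost_rg => //; apply: hx; lia.
  - by apply: hx; rewrite /=; lia.
have h2 : t2 <= 8 * L.
  apply: T2 => //.
  - by apply: value_cost_rg => //; apply: hx; rewrite r1; lia.
  - rewrite /= r0; have : lg 0 <= L by apply: hx. 
    have : lg (m 0) <= L by apply: hx; lia. 
    lia.
  - by apply: hx; rewrite /= r1 r0; lia.
lia.
Qed.

Lemma combop_ok md l m : exists t,
  [/\ exec (combop md l) m t
        (update m (reg l) (comb md (m (reg l)) (m (reg l.+3)))) &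
      forall L, lg (reg l.+3) <= L -> lg (m (reg l)) <= L -> lg (m (reg l.+3)) <= L ->
        lg (comb md (m (reg l)) (m (reg l.+3))) <= L -> t <= 8 * L].
Proof.
have lgr L : lg (reg l.+3) <= L -> lg (reg l) <= L.
  by move=> h; apply: leq_trans h; apply: lg_mono; rewrite /reg; lia.
case: md.
- have [t e T] := asg_ok l Add (rg l.+3) (Cst 0) m.
  exists t; split; first by move: e; rewrite /= addn0.
  move=> L h1 h2 h3 h4; apply: T => //; [exact: lgr|exact: value_cost_rg| |].
    by rewrite /=; move: (lg_gt0 (reg l.+3)); rewrite {2}/lg trunc_log0; lia.
  by rewrite /= addn0.
- have [t e T] := asg_ok l Add (rg l) (rg l.+3) m.
  exists t; split => // L h1 h2 h3 h4; have := lgr L h1 => h0.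
  by apply: T => //; apply: value_cost_rg.
- have [t e T] := asg_ok l Mul (rg l) (rg l.+3) m.
  exists t; split => // L h1 h2 h3 h4; have := lgr L h1 => h0.
  by apply: T => //; apply: value_cost_rg.
Qed.
Lemma lg_reg_le i j L : i <= j -> lg (reg j) <= L -> lg (reg i) <= L.
Proof. by move=> h; apply: leq_trans; apply: lg_mono; rewrite /reg; lia. Qed.

Lemma lg0 : lg 0 = 1. Proof. by rewrite /lg trunc_log0. Qed.

Definition comp_spec delta env m e p h :=
  exists t m',
  [/\ exec p m t m', m' (reg (size env)) = eval delta env e,
      preserves (size env) m m' &
      forall V L, 0 < V -> lg (m 0 + V.*2) <= L -> lg (reg (size env + h)) <= L ->
        safe delta V env e -> t <= 40 * L * steps delta env e].

(** The factor 40 covers the bookkeeping of any construct: at most [24 * L] for an operation or a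
    read, and [26 * L] for each round of a loop besides its body. One execution serves all [V] and
    [L], which are chosen later. *)
Lemma compile_ok delta e env m : scoped (size env) e -> sim delta env m ->
  comp_spec delta env m e (compile e (size env)) (height e).
Proof.
elim: e env m => [c|j|o a IHa b IHb|a IHa|a IHa b IHb|md b IHb a IHa c IHc] env m.
- move=> _ S; have [t e T] := asg_ok (size env) Add (Cst c) (Cst 0) m.
  exists t, (update m (reg (size env)) c); split.
  + by move: e; rewrite /= addn0.
  + exact: update_same.
  + exact: preserves_update.
  move=> V L V0 hV; have -> : steps delta env (ECst c) = 1 by []; rewrite /= addn0 muln1 => hr hc.
  have {}hc : c <= V by [].
  have cL : lg c <= L by apply: leq_trans hV; apply: lg_mono; lia.
  suff: t <= 8 * L by lia.
  by have c0 := lg_gt0 c; apply: T => //=; rewrite ?lg0 ?addn0; lia.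
- rewrite /= => jl S; have [t e T] := asg_ok (size env) Add (rg j) (Cst 0) m.
  exists t, (update m (reg (size env)) (m (reg j))); split.
  + by move: e; rewrite /= addn0.
  + by rewrite update_same; have [_ /(_ j jl) -> _] := S.
  + exact: preserves_update.
  move=> V L V0 hV; have -> : steps delta env (EVar j) = 1 by []; rewrite /= muln1 => hr hc.
  have {}hc : nth 0 env j <= V by [].
  have [_ ej _] := S.
  have cL : lg (m (reg j)) <= L by rewrite ej //; apply: leq_trans hV; apply: lg_mono; lia.
  have rL : lg (reg j) <= L by apply: lg_reg_le hr; lia.
  suff: t <= 8 * L by lia.
  apply: T => //=; rewrite ?lg0 ?addn0 //; last by move: (lg_gt0 (reg j)); lia.
    by apply: lg_reg_le hr; lia.
  by lia.
- rewrite /= => /andP [sa sb] S.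
  have [t1 [m1 [e1 v1 p1 T1]]] := IHa env m sa S.
  have [S1 z1] := sim_preserves S p1.
  have S1' := sim_rcons S1 v1.
  have [] := IHb _ m1 _ S1'; rewrite size_rcons' // => t2 [m2 [e2 v2 p2 T2]].
  have [m3 [t3 [e3 v3 p3 T3]]] := compop_ok o (size env) m2.
  have w1 : m2 (reg (size env)) = eval delta env a by rewrite (preserves_reg p2) ?leqnn.
  exists (t1 + (t2 + t3)), m3; split.
  + exact: ExecSeq e1 (ExecSeq e2 e3).
  + by rewrite v3 w1 v2.
  + by apply: preserves_trans p1 (preserves_trans (preserves_le (leqnSn _) p2) p3).
  move=> V L V0 hV hr /safe_op [s1 s2 s3]; rewrite steps_op.
  have val_lg x : x <= V -> lg x <= L.
    by move=> h; apply: leq_trans hV; apply: lg_mono; lia.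
  have h1 : t1 <= 40 * L * steps delta env a.
    by apply: T1 V0 hV _ s1; apply: lg_reg_le hr; lia.
  have h2 : t2 <= 40 * L * steps delta (env ++ [:: eval delta env a]) b.
    by apply: T2 V0 _ _ s2; rewrite ?z1 //; apply: lg_reg_le hr; lia.
  have h3 : t3 <= 24 * L.
    apply: T3; rewrite ?w1 ?v2.
    + by apply: lg_reg_le hr; lia.
    + by apply: val_lg (safe_eval s1).
    + by apply: val_lg (safe_eval s2).
    + exact: val_lg s3.
  by lia.
- rewrite /= => sa S.
  have [t1 [m1 [e1 v1 p1 T1]]] := IHa env m sa S.
  have [[o1 j1 d1] z1] := sim_preserves S p1.
  have [t2 [m2 [e2 v2 /preserves_neq p2 T2]]] := data_addr_ok (size env) o1.
  have [t3 e3 T3] := asg_ok (size env) Add (At (Ind (reg (size env)))) (Cst 0) m2.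
  have dv : m2 (m2 (reg (size env))) = delta (eval delta env a).
    rewrite v2 v1 -d1 p2 //.
    by rewrite oddD odd_double addbF o1.
  exists (t1 + (t2 + t3)), (update m2 (reg (size env)) (delta (eval delta env a))); split.
  + by apply: ExecSeq e1 (ExecSeq e2 _); move: e3; rewrite /= addn0 dv.
  + exact: update_same.
  + by apply: preserves_trans p1 (preserves_trans p2 _); apply: preserves_update.
  move=> V L V0 hV hr /safe_read [s1 s2]; rewrite steps_read.
  have val_lg x : x <= V -> lg x <= L.
    by move=> h; apply: leq_trans hV; apply: lg_mono; lia.
  have r0 : lg (reg (size env)) <= L by apply: lg_reg_le hr; lia.
  have aL : lg (m 0 + (eval delta env a).*2) <= L.
    by apply: leq_trans hV; apply: lg_mono; move: (safe_eval s1); lia.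
  have h1 := T1 V L V0 hV hr s1.
  have h2 : t2 <= 16 * L by apply: T2; rewrite // v1 z1.
  have dL : lg (delta (eval delta env a)) <= L by apply: val_lg.
  have h3 : t3 <= 8 * L.
    apply: T3; rewrite //= ?dv ?addn0 ?lg0 //; last by move: (lg_gt0 (reg (size env))); lia.
    by rewrite v2 v1 z1; lia.
  by lia.
- rewrite /= => /andP [sa sb] S.
  have [t1 [m1 [e1 v1 p1 T1]]] := IHa env m sa S.
  have [S1 z1] := sim_preserves S p1.
  have S1' := sim_rcons S1 v1.
  have [] := IHb _ m1 _ S1'; rewrite size_rcons' // => t2 [m2 [e2 v2 p2 T2]].
  have [t3 e3 T3] := asg_ok (size env) Add (rg (size env).+1) (Cst 0) m2.
  exists (t1 + (t2 + t3)), (update m2 (reg (size env)) (m2 (reg (size env).+1))); split.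
  + by apply: ExecSeq e1 (ExecSeq e2 _); move: e3; rewrite /= addn0.
  + by rewrite update_same v2.
  + apply: preserves_trans p1 (preserves_trans (preserves_le (leqnSn _) p2) _).
    exact: preserves_update.
  move=> V L V0 hV hr /safe_let [s1 s2]; rewrite steps_let.
  have val_lg x : x <= V -> lg x <= L.
    by move=> h; apply: leq_trans hV; apply: lg_mono; lia.
  have h1 : t1 <= 40 * L * steps delta env a.
    by apply: T1 V0 hV _ s1; apply: lg_reg_le hr; lia.
  have h2 : t2 <= 40 * L * steps delta (env ++ [:: eval delta env a]) b.
    by apply: T2 V0 _ _ s2; rewrite ?z1 //; apply: lg_reg_le hr; lia.
  have r1 : lg (reg (size env).+1) <= L by apply: lg_reg_le hr; lia.
  have r0 : lg (reg (size env)) <= L by apply: lg_reg_le r1; lia.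
  have bL := val_lg _ (safe_eval s2).
  have h3 : t3 <= 8 * L.
    apply: T3 => //=; rewrite ?addn0 ?lg0 ?v2 //; last by move: (lg_gt0 (reg (size env))); lia.
    by lia.
  by lia.
rewrite /= => /and3P [sb sa sc] S.
set l := size env in sb sa sc *.
have [t1 [m1 [e1 v1 p1 T1]]] := IHb env m sb S.
have [S1 z1] := sim_preserves S p1.
set x := eval delta env b in v1 *.
have [t2 e2 T2] := asg_ok l.+1 Add (Cst 0) (Cst 0) m1.
set m2 := update _ _ _ in e2.
have p2 : preserves l.+1 m1 m2 by apply: preserves_update.
have [S2 z2] := sim_preserves S1 (preserves_le (leqnSn _) p2).
have S2' : sim delta (env ++ [:: x; 0]) m2.
  rewrite -cat1s catA; apply: sim_rcons; first apply: sim_rcons S2 _.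
    by rewrite (preserves_reg p2).
  by rewrite size_rcons' /m2 update_same.
have se : size (env ++ [:: x; 0]) = l.+2 by rewrite size_cat /= addn2.
have [] := IHa _ m2 _ S2'; rewrite se // => t3 [m3 [e3 v3 p3 T3]].
set N := eval delta (env ++ [:: x; 0]) a in v3 *.
have p13 : preserves l m1 m3.
  apply: preserves_trans (preserves_le (leqnSn _) p2) _.
  by apply: preserves_le p3; lia.
have [S3 z3] := sim_preserves S1 p13.
have r13 : m3 (reg l.+1) = 0.
  by rewrite (preserves_reg p3) // /m2 update_same.
have r03 : m3 (reg l) = x.
  by rewrite (preserves_reg p3) ?ltnS ?leqnSn // (preserves_reg p2).
pose acc := loop_acc delta md env c x N.
pose Inv i mm := [/\ preserves l m mm, mm (reg l) = acc i & mm (reg l.+1) = i].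
pose envi i := env ++ [:: acc i; i; N - i].
pose Q i t := forall V L, 0 < V -> lg (m 0 + V.*2) <= L ->
  lg (reg (l.+3 + height c)) <= L -> safe delta V (envi i) c ->
  acc i <= V -> acc i.+1 <= V -> N <= V -> t <= (40 * steps delta (envi i) c + 24) * L.
have body i mm : i < N -> Inv i mm -> mm (reg l.+2) = N - i ->
    exists t m', [/\ exec (Seq (Seq (compile c l.+3) (combop md l))
      (Seq (asg l.+1 Add (rg l.+1) (Cst 1)) (asg l.+2 Defs.Sub (rg l.+2) (Cst 1)))) mm t m',
      Inv i.+1 m', m' (reg l.+2) = N - i.+1 & Q i t].
  move=> iN [pm am im] rm.
  have [Sm zm] := sim_preserves S pm.
  have Sm' : sim delta (envi i) mm.
    have -> : envi i = ((env ++ [:: acc i]) ++ [:: i]) ++ [:: N - i] by rewrite -!catA.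
    (apply: sim_rcons; first apply: sim_rcons; first apply: sim_rcons).
    + exact: Sm. + exact: am.
    + by rewrite size_rcons'. + by rewrite !size_rcons'.
  have si : size (envi i) = l.+3 by rewrite size_cat /= addn3.
  have [] := IHc _ mm _ Sm'; rewrite si // => t4 [m4 [e4 v4 p4 T4]].
  have [t5 [e5 T5]] := combop_ok md l m4.
  set m5 := update _ _ _ in e5.
  have [t6 e6 T6] := asg_ok l.+1 Add (rg l.+1) (Cst 1) m5.
  set m6 := update _ _ _ in e6.
  have [t7 e7 T7] := asg_ok l.+2 Defs.Sub (rg l.+2) (Cst 1) m6.
  set m7 := update _ _ _ in e7.
  have a4 : m4 (reg l) = acc i by rewrite (preserves_reg p4) //; lia.
  have i4 : m4 (reg l.+1) = i by rewrite (preserves_reg p4) //; lia.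
  have r4 : m4 (reg l.+2) = N - i by rewrite (preserves_reg p4) //; lia.
  have accS : comb md (m4 (reg l)) (m4 (reg l.+3)) = acc i.+1 by rewrite a4 v4.
  have i5 : m5 (reg l.+1) = i by rewrite /m5 /update reg_inj i4; case: eqP => //; lia.
  have r6 : m6 (reg l.+2) = N - i.
    by rewrite /m6 /m5 /update !reg_inj r4; do 2 (case: eqP => [|_]; first by lia).
  exists (t4 + t5 + (t6 + t7)), m7; split.
  - exact: ExecSeq (ExecSeq e4 e5) (ExecSeq e6 e7).
  - split.
    + apply: preserves_trans pm _; apply: preserves_trans (preserves_le _ p4) _; first by lia.
      by do ![apply: preserves_trans; last by apply: preserves_update; lia].
    + rewrite /m7 /m6 /m5 /update !reg_inj accS.
      by do 2 (case: eqP => [|_]; first by lia); rewrite eqxx.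
    + rewrite /m7 /update reg_inj; case: eqP => [|_]; first by lia.
      by rewrite /m6 update_same /= i5 addn1.
  - by rewrite /m7 update_same /= r6; lia.
  move=> V L V0 hV hr sV aV aSV NV.
  have val_lg z : z <= V -> lg z <= L.
    by move=> h; apply: leq_trans hV; apply: lg_mono; lia.
  have rl j : j <= l.+3 -> lg (reg j) <= L by move=> h; apply: lg_reg_le hr; lia.
  have h4 : t4 <= 40 * L * steps delta (envi i) c by apply: T4 sV; rewrite ?zm.
  have h5 : t5 <= 8 * L.
    apply: T5; first (by apply: rl; lia); rewrite ?accS ?v4 ?a4; apply: val_lg => //.
    exact: safe_eval sV.
  have h1 : lg 1 <= L by apply: val_lg.
  have h6 : t6 <= 8 * L.
    apply: T6; first (by apply: rl; lia).
    - by apply: value_cost_rg; rewrite ?i5; [apply: rl; lia|apply: val_lg; lia].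
    - by rewrite /=; lia.
    - by rewrite /= i5; apply: val_lg; lia.
  have h7 : t7 <= 8 * L.
    apply: T7; first (by apply: rl; lia).
    - by apply: value_cost_rg; rewrite ?r6; [apply: rl; lia|apply: val_lg; lia].
    - by rewrite /=; lia.
    - by rewrite /= r6; apply: val_lg; lia.
  by lia.
have I0 : Inv 0 m3 by split=> //; apply: preserves_trans p1 p13.
have [t4 [m4 [e4 [p4 a4 _] T4]]] := while_ok body I0 v3.
exists (t1 + (t2 + (t3 + t4))), m4; split.
- exact: ExecSeq e1 (ExecSeq e2 (ExecSeq e3 e4)).
- exact: a4.
- exact: p4.
move=> V L V0 hV hr /safe_loop; cbv zeta; rewrite -/x -/N => -[s1 s2 s3].
rewrite steps_loop; cbv zeta; rewrite -/x -/N.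
have val_lg z : z <= V -> lg z <= L.
  by move=> h; apply: leq_trans hV; apply: lg_mono; lia.
have h1 : t1 <= 40 * L * steps delta env b.
  by apply: T1 V0 hV _ s1; apply: lg_reg_le hr; lia.
have h2 : t2 <= 8 * L.
  have h0 : lg 0 <= L by apply: val_lg.
  have hr1 : lg (reg l.+1) <= L by apply: lg_reg_le hr; lia.
  by apply: T2 => //=; lia.
have NV : N <= V by apply: safe_eval s2.
have xV : x <= V by apply: safe_eval s1.
have h3 : t3 <= 40 * L * steps delta (env ++ [:: x; 0]) a.
  by apply: T3 V0 _ _ s2; rewrite ?z2 ?z1 //; apply: lg_reg_le hr; lia.
have accV i : i <= N -> acc i <= V by case: i => // i /s3 [].
have h4 : t4 <= (\sum_(i < N) (40 * steps delta (envi i) c + 24 + 2) + 2) * L.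
  apply: (T4 L (fun i => 40 * steps delta (envi i) c + 24)).
  - by apply: lg_reg_le hr; lia.
  - exact: val_lg.
  - move=> i t iN q; apply: (q V L) => //; try (by apply: accV; lia).
      by apply: lg_reg_le hr; lia.
    by case: (s3 i iN).
have h5 : \sum_(i < N) (40 * steps delta (envi i) c + 24 + 2) <=
    40 * \sum_(i < N) (steps delta (envi i) c).+1.
  by rewrite big_distrr /=; apply: leq_sum => i _; lia.
rewrite -/(envi _) in h4 h5 *.
set q1 := \sum_(i < N) _ in h4 h5; set q2 := \sum_(i < N) _ in h5 *.
nia.
Qed.
Lemma ssteps_for env a s delta : ssteps env (SFor a s) delta =
  let N := eval delta (env ++ [:: 0]) a in
  steps delta (env ++ [:: 0]) a + 1 +
  \sum_(i < N) (ssteps (env ++ [:: nat_of_ord i; N - i]) s (for_state env s N delta i)).+1.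
Proof. by []. Qed.

Lemma ssafe_for V env a s delta : ssafe V env (SFor a s) delta <->
  let N := eval delta (env ++ [:: 0]) a in
  safe delta V (env ++ [:: 0]) a /\
  forall i, i < N -> ssafe V (env ++ [:: i; N - i]) s (for_state env s N delta i).
Proof. by []. Qed.

Lemma ssteps_seq env s1 s2 delta : ssteps env (SSeq s1 s2) delta =
  ssteps env s1 delta + ssteps env s2 (srun env s1 delta).
Proof. by []. Qed.

Lemma ssteps_let env a s delta : ssteps env (SLet a s) delta =
  steps delta env a + ssteps (env ++ [:: eval delta env a]) s delta.
Proof. by []. Qed.

Lemma ssteps_store env a b delta : ssteps env (SStore a b) delta =
  steps delta env a + steps delta (env ++ [:: eval delta env a]) b + 1.
Proof. by []. Qed.

Lemma ssafe_store V env a b delta : ssafe V env (SStore a b) delta <->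
  safe delta V env a /\ safe delta V (env ++ [:: eval delta env a]) b.
Proof. by []. Qed.

Lemma ssafe_seq V env s1 s2 delta : ssafe V env (SSeq s1 s2) delta <->
  ssafe V env s1 delta /\ ssafe V env s2 (srun env s1 delta).
Proof. by []. Qed.

Lemma ssafe_let V env a s delta : ssafe V env (SLet a s) delta <->
  safe delta V env a /\ ssafe V (env ++ [:: eval delta env a]) s delta.
Proof. by []. Qed.

#[global] Arguments ssteps : simpl never.
#[global] Arguments ssafe : simpl never.

Lemma sim_prefix delta env env' m : sim delta (env ++ env') m -> sim delta env m.
Proof.
move=> [h0 h1 h2]; split=> // j hj; rewrite h1 ?nth_cat ?hj //.
by rewrite size_cat; lia.
Qed.

(** A store changes odd cells, so [preserves] is too strong here; what survives a statement is [sim]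
    with the new data, together with cell 0. *)
Lemma scompile_ok s env m delta : sscoped (size env) s -> sim delta env m ->
  exists t m',
  [/\ exec (scompile s (size env)) m t m', sim (srun env s delta) env m', m' 0 = m 0 &
      forall V L, 0 < V -> lg (m 0 + V.*2) <= L -> lg (reg (size env + sheight s)) <= L ->
        ssafe V env s delta -> t <= 40 * L * ssteps env s delta].
Proof.
elim: s env m delta => [a b|s1 IH1 s2 IH2|a s IHs|a s IHs] env m delta /=.
- move=> /andP [sa sb] S.
  have [t1 [m1 [e1 v1 p1 T1]]] := compile_ok sa S.
  have [S1 z1] := sim_preserves S p1.
  have S1' := sim_rcons S1 v1.
  have [] := @compile_ok delta b _ m1 _ S1'; rewrite size_rcons' // => t2 [m2 [e2 v2 p2 T2]].
  have [S2 z2] := sim_preserves S1 (preserves_le (leqnSn _) p2).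
  have [o2 r2 d2] := S2.
  have [t3 [m3 [e3 v3 p3 T3]]] := data_addr_ok (size env) o2.
  have z3 : m3 0 = m2 0 by apply: p3.
  set x := eval delta env a in v1 v2 T2 S1' *.
  set y := eval delta _ b in v2 *.
  have a2 : m2 (reg (size env)) = x by rewrite (preserves_reg p2) ?leqnn.
  have b3 : m3 (reg (size env).+1) = y by rewrite p3 ?reg_inj //; lia.
  have oF : odd (m2 0 + x.*2) by rewrite oddD odd_double addbF.
  exists (t1 + (t2 + (t3 + (value_cost m3 (rg (size env).+1) + value_cost m3 (Cst 0) +
     address_cost m3 (Ind (reg (size env))) + lg (y + 0))))), (update m3 (m2 0 + x.*2) y); split.
  + apply: ExecSeq e1 (ExecSeq e2 (ExecSeq e3 _)).
    have := ExecAssign m3 (Ind (reg (size env))) Add (rg (size env).+1) (Cst 0).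
    by rewrite /= b3 v3 a2 addn0.
  (* The target of the store is an odd cell, hence neither cell 0 nor a register. *)
  + have n0 : (0 == m2 0 + x.*2) = false by case: (m2 0 + x.*2) oF.
    split.
    * by rewrite /update n0 z3.
    * move=> j hj; have nj : (reg j == m2 0 + x.*2) = false.
        by apply/eqP => h; move: oF; rewrite -h /reg odd_double.
      rewrite /update nj p3 ?r2 // reg_inj; lia.
    * move=> c; rewrite {2}/update n0 z3 /update eqn_add2l -!muln2 eqn_pmul2r //.
      case: eqP => // _; rewrite p3 muln2 ?d2 //.
      by apply/eqP => h; have := odd_double (size env).+1; rewrite -/(reg _) -h oddD odd_double addbF o2.
  + rewrite /update; case: eqP => [h|_]; first by move: oF; rewrite -h.
    by rewrite z3 z2 z1.
  move=> V L V0 hV hr /ssafe_store [s1 s2]; rewrite ssteps_store.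
  have val_lg z : z <= V -> lg z <= L.
    by move=> h; apply: leq_trans hV; apply: lg_mono; lia.
  have h1 : t1 <= 40 * L * steps delta env a.
    by apply: T1 V0 hV _ s1; apply: lg_reg_le hr; lia.
  have h2 : t2 <= 40 * L * steps delta (env ++ [:: x]) b.
    by apply: T2 V0 _ _ s2; rewrite ?z1 //; apply: lg_reg_le hr; lia.
  have r1 : lg (reg (size env).+1) <= L by apply: lg_reg_le hr; lia.
  have r0 : lg (reg (size env)) <= L by apply: lg_reg_le r1; lia.
  have xL : lg (m2 0 + x.*2) <= L.
    by apply: leq_trans hV; apply: lg_mono; move: (safe_eval s1); rewrite z2 z1 -/x; lia.
  have h3 : t3 <= 16 * L by apply: T3; rewrite ?a2.
  have yL : lg y <= L := val_lg _ (safe_eval s2).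
  have h0 : lg 0 <= L by apply: val_lg.
  rewrite /= v3 a2 b3 addn0 -/x; clear - h1 h2 r1 r0 xL h3 yL h0; lia.
- move=> /andP [s1s s2s] S.
  have [t1 [m1 [e1 S1 z1 T1]]] := IH1 env m delta s1s S.
  have [t2 [m2 [e2 S2 z2 T2]]] := IH2 env m1 _ s2s S1.
  exists (t1 + t2), m2; split=> //; first exact: ExecSeq e1 e2.
    by rewrite z2.
  move=> V L V0 hV hr /ssafe_seq [p1 p2]; rewrite ssteps_seq.
  have h1 : t1 <= 40 * L * ssteps env s1 delta.
    by apply: T1 V0 hV _ p1; apply: lg_reg_le hr; lia.
  have h2 : t2 <= 40 * L * ssteps env s2 (srun env s1 delta).
    by apply: T2 V0 _ _ p2; rewrite ?z1 //; apply: lg_reg_le hr; lia.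
  lia.
- move=> /andP [sa ss] S.
  have [t1 [m1 [e1 v1 p1 T1]]] := compile_ok sa S.
  have [S1 z1] := sim_preserves S p1.
  have S1' := sim_rcons S1 v1.
  have [] := IHs _ m1 delta _ S1'; rewrite size_rcons' // => t2 [m2 [e2 S2 z2 T2]].
  exists (t1 + t2), m2; split; first exact: ExecSeq e1 e2.
  + exact: sim_prefix S2.
  + by rewrite z2.
  move=> V L V0 hV hr /ssafe_let [p2 p3]; rewrite ssteps_let.
  have h1 : t1 <= 40 * L * steps delta env a.
    by apply: T1 V0 hV _ p2; apply: lg_reg_le hr; lia.
  have h2 : t2 <= 40 * L * ssteps (env ++ [:: eval delta env a]) s delta.
    by apply: T2 V0 _ _ p3; rewrite ?z1 //; apply: lg_reg_le hr; lia.
  lia.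
move=> /andP [sa ss] S; set l := size env in sa ss *.
have [t1 e1 T1] := asg_ok l Add (Cst 0) (Cst 0) m.
set m1 := update _ _ _ in e1.
have p1 : preserves l m m1 by apply: preserves_update.
have [S1 z1] := sim_preserves S p1.
have S1' : sim delta (env ++ [:: 0]) m1 by apply: sim_rcons S1 _; rewrite /m1 update_same.
have [] := @compile_ok delta a _ m1 _ S1'; rewrite size_rcons' // => t2 [m2 [e2 v2 p2 T2]].
set N := eval delta (env ++ [:: 0]) a in v2 *.
have [S2 z2] := sim_preserves S1 (preserves_le (leqnSn _) p2).
pose st i := for_state env s N delta i.
pose envi i := env ++ [:: i; N - i].
pose Inv i mm := [/\ sim (st i) env mm, mm 0 = m 0 & mm (reg l) = i].
pose Q i t := forall V L, 0 < V -> lg (m 0 + V.*2) <= L ->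
  lg (reg (l.+2 + sheight s)) <= L -> ssafe V (envi i) s (st i) ->
  N <= V -> t <= (40 * ssteps (envi i) s (st i) + 16) * L.
have body i mm : i < N -> Inv i mm -> mm (reg l.+1) = N - i ->
    exists t m', [/\ exec (Seq (scompile s l.+2)
      (Seq (asg l Add (rg l) (Cst 1)) (asg l.+1 Defs.Sub (rg l.+1) (Cst 1)))) mm t m',
      Inv i.+1 m', m' (reg l.+1) = N - i.+1 & Q i t].
  move=> iN [Sm zm im] rm.
  have Sm' : sim (st i) (envi i) mm.
    have -> : envi i = (env ++ [:: i]) ++ [:: N - i] by rewrite -!catA.
    by apply: sim_rcons; first apply: sim_rcons; rewrite ?size_rcons'.
  have si : size (envi i) = l.+2 by rewrite size_cat /= addn2.
  have [] := IHs _ mm _ _ Sm'; rewrite si // => t4 [m4 [e4 S4 z4 T4]].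
  have [t6 e6 T6] := asg_ok l Add (rg l) (Cst 1) m4.
  set m6 := update _ _ _ in e6.
  have [t7 e7 T7] := asg_ok l.+1 Defs.Sub (rg l.+1) (Cst 1) m6.
  set m7 := update _ _ _ in e7.
  have i4 : m4 (reg l) = i.
    by have [_ rS4 _] := S4; rewrite rS4 ?si // nth_cat ltnn subnn.
  have r4 : m4 (reg l.+1) = N - i.
    by have [_ rS4 _] := S4; rewrite rS4 ?si // nth_cat ltnNge leqnSn /= subSnn.
  have r6 : m6 (reg l.+1) = N - i.
    by rewrite /m6 /update !reg_inj r4; case: eqP => [|_ //]; lia.
  exists (t4 + (t6 + t7)), m7; split.
  - exact: ExecSeq e4 (ExecSeq e6 e7).
  - have p7 : preserves l m4 m7.
      apply: preserves_trans (preserves_update _ _ (leqnn _)) _.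
      exact: preserves_update.
    have [S7 z7] := sim_preserves (sim_prefix S4) p7.
    split; [exact: S7|by rewrite z7 z4|].
    rewrite /m7 /update reg_inj; case: eqP => [|_]; first by lia.
    by rewrite /m6 update_same /= i4 addn1.
  - by rewrite /m7 update_same /= r6; lia.
  move=> V L V0 hV hr sV NV.
  have val_lg z : z <= V -> lg z <= L.
    by move=> h; apply: leq_trans hV; apply: lg_mono; lia.
  have rl j : j <= l.+2 -> lg (reg j) <= L by move=> h; apply: lg_reg_le hr; lia.
  have h4 : t4 <= 40 * L * ssteps (envi i) s (st i) by apply: T4 sV; rewrite ?zm.
  have h1 : lg 1 <= L by apply: val_lg.
  have h6 : t6 <= 8 * L.
    apply: T6; first (by apply: rl; lia).
    - by apply: value_cost_rg; rewrite ?i4; [apply: rl; lia|apply: val_lg; lia].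
    - by rewrite /=; lia.
    - by rewrite /= i4; apply: val_lg; lia.
  have h7 : t7 <= 8 * L.
    apply: T7; first (by apply: rl; lia).
    - by apply: value_cost_rg; rewrite ?r6; [apply: rl; lia|apply: val_lg; lia].
    - by rewrite /=; lia.
    - by rewrite /= r6; apply: val_lg; lia.
  by lia.
have I0 : Inv 0 m2.
  by split=> //; rewrite (preserves_reg p2) // /m1 update_same.
have [t4 [m4 [e4 [S4 z4 _] T4]]] := while_ok body I0 v2.
exists (t1 + (t2 + t4)), m4; split=> //.
  exact: ExecSeq e1 (ExecSeq e2 e4).
move=> V L V0 hV hr /ssafe_for; cbv zeta; rewrite -/N => -[s1 s2].
rewrite ssteps_for; cbv zeta; rewrite -/N.
have val_lg z : z <= V -> lg z <= L.
  by move=> h; apply: leq_trans hV; apply: lg_mono; lia.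
have h0 : lg 0 <= L by apply: val_lg.
have r0 : lg (reg l) <= L by apply: lg_reg_le hr; lia.
have h1 : t1 <= 8 * L by apply: T1 => //=; lia.
have NV : N <= V by apply: safe_eval s1.
have h2 : t2 <= 40 * L * steps delta (env ++ [:: 0]) a.
  by apply: T2 V0 _ _ s1; rewrite ?z1 //; apply: lg_reg_le hr; lia.
have h4 : t4 <= (\sum_(i < N) (40 * ssteps (envi i) s (st i) + 16 + 2) + 2) * L.
  apply: (T4 L (fun i => 40 * ssteps (envi i) s (st i) + 16)).
  - by apply: lg_reg_le hr; lia.
  - exact: val_lg.
  - move=> i t iN q; apply: (q V L) => //; last exact: s2.
    by apply: lg_reg_le hr; lia.
have h5 : \sum_(i < N) (40 * ssteps (envi i) s (st i) + 16 + 2) <=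
    40 * \sum_(i < N) (ssteps (envi i) s (st i)).+1.
  by rewrite big_distrr /=; apply: leq_sum => i _; lia.
rewrite -/(envi _) in h4 h5 *.
set q1 := \sum_(i < N) _ in h4 h5; set q2 := \sum_(i < N) _ in h5 *.
nia.
Qed.

(** * A hierarchy of computable bounds *)

(* Any finite composition of these functions is below one of them, and so is
   iteration, hence every quantity computed from [k] alone. *)
Fixpoint grow (r x : nat) : nat :=
  if r is r'.+1 then iter (x + 2) (grow r') x else (x + 2) ^ (x + 2).

Lemma iter_grow_mono (f : nat -> nat) :
  (forall x, x < f x) -> (forall x y, x <= y -> f x <= f y) ->
  forall i j x y, i <= j -> x <= y -> iter i f x <= iter j f y.
Proof.
move=> hf mf i j x y; elim: j i => [|j IH] i.
  by rewrite leqn0 => /eqP ->.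
rewrite leq_eqVlt => /orP [/eqP -> xy|ij xy].
  by rewrite !iterS; apply: mf; apply: IH.
by rewrite iterS; apply: leq_trans (ltnW (hf _)); apply: IH.
Qed.

Lemma grow_spec r : (forall x, x < grow r x) /\ (forall x y, x <= y -> grow r x <= grow r y).
Proof.
elim: r => [|r [IH1 IH2]] /=; split=> [x|x y xy].
- by apply: (@leq_trans ((x + 2) ^ 1)); [rewrite expn1; lia|rewrite leq_exp2l; lia].
- by apply: (@leq_trans ((x + 2) ^ (y + 2))); [rewrite leq_exp2l; lia|rewrite leq_exp2r; lia].
- apply: leq_trans (IH1 x) _; rewrite -[grow r x]/(iter 1 (grow r) x).
  by apply: iter_grow_mono => //; lia.
- by apply: iter_grow_mono => //; lia.
Qed.

Lemma grow_gt r x : x < grow r x. Proof. by have [h _] := grow_spec r. Qed.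
Lemma grow_mono r x y : x <= y -> grow r x <= grow r y.
Proof. by have [_ h] := grow_spec r; apply: h. Qed.
Lemma grow_ge r x : x <= grow r x. Proof. exact: ltnW (grow_gt r x). Qed.

Lemma grow_mono_rank r s x : r <= s -> grow r x <= grow s x.
Proof.
elim: s => [|s IH]; first by rewrite leqn0 => /eqP ->.
rewrite leq_eqVlt => /orP [/eqP -> //|/IH h]; apply: leq_trans h _.
rewrite -[leqLHS]/(iter 1 (grow s) x).
by apply: iter_grow_mono => //; [exact: grow_gt|exact: grow_mono|lia].
Qed.

Lemma grow_mono2 r s x y : r <= s -> x <= y -> grow r x <= grow s y.
Proof. by move=> rs xy; apply: leq_trans (grow_mono_rank x rs) (grow_mono s xy). Qed.

#[global] Arguments grow : simpl never.

Definition rcomp (r s : nat) : nat := (maxn r s).+1.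

(** Both functions are below the one of the larger rank, and two applications of it fit into the
    [x + 2] iterations of the next rank. *)
Lemma grow_comp r s x : grow r (grow s x) <= grow (rcomp r s) x.
Proof.
apply: (@leq_trans (iter 2 (grow (maxn r s)) x)).
  by apply: grow_mono2; rewrite ?leq_maxl // grow_mono2 ?leq_maxr.
by apply: iter_grow_mono; [exact: grow_gt|exact: grow_mono|lia|].
Qed.

Lemma grow_gt1 r x : 1 < grow r x.
Proof.
apply: (@leq_trans (grow 0 x)); last exact: grow_mono_rank.
by rewrite /grow -(expn1 2); apply: (@leq_trans (2 ^ (x + 2)));
  [rewrite leq_exp2l; lia|rewrite leq_exp2r; lia].
Qed.

(** This is how constants are absorbed: [c] is below the function of rank [c] everywhere. *)
Lemma grow_rank_ge r : r < grow r 0.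
Proof.
elim: r => [|r IH] //.
change (r.+1 < grow r (grow r 0)).
exact: leq_ltn_trans IH (grow_gt _ _).
Qed.

Lemma grow0_exp x a b : a <= x + 2 -> b <= x + 2 -> 0 < a -> a ^ b <= grow 0 x.
Proof.
move=> ha hb a0; apply: (@leq_trans ((x + 2) ^ b)).
  by case: b hb => // b _; rewrite leq_exp2r.
by rewrite /grow leq_exp2l; lia.
Qed.

Lemma grow0_sq x : (x + 2) ^ 2 <= grow 0 x.
Proof. by apply: grow0_exp; lia. Qed.

(** * Size types *)

(* [VK]: bounded in terms of [k] alone; [VQ4]: at most [k / 4]; [VP j q]:
   [n ^ (j + q * (k / 4))] times a power of [lg n]; [VBig]: polynomial in [n]
   for fixed [k]; [VTop]: unknown. *)
Inductive vtype := VQ4 | VK | VP of nat & nat | VBig | VTop.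

Definition isK (t : vtype) : bool := match t with VQ4 | VK => true | _ => false end.

(** Reads are excluded, since a datum may be of the order of [n] even when its address depends on
    [k] alone. *)
Fixpoint kexp (G : seq vtype) (e : expr) : bool :=
  match e with
  | ECst _ => true
  | EVar j => isK (nth VTop G j)
  | EOp _ a b => kexp G a && kexp (G ++ [:: VK]) b
  | ERead _ => false
  | ELet a b => kexp G a && kexp (G ++ [:: VK]) b
  | ELoop _ b a c =>
      [&& kexp G b, kexp (G ++ [:: VK; VK]) a & kexp (G ++ [:: VK; VK; VK]) c]
  end.

Definition kenv (G : seq vtype) (env : seq nat) (X : nat) : Prop :=
  size G = size env /\ forall j, isK (nth VTop G j) -> nth 0 env j <= X.

Lemma kenv_le G env X Y : X <= Y -> kenv G env X -> kenv G env Y.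
Proof. by move=> XY [h1 h2]; split=> // j /h2 h; apply: leq_trans XY. Qed.

Lemma kenv_cat G env X vs : kenv G env X -> all (leq^~ X) vs ->
  kenv (G ++ nseq (size vs) VK) (env ++ vs) X.
Proof.
move=> [h1 h2] /allP hv; split; first by rewrite !size_cat size_nseq h1.
move=> j; rewrite !nth_cat h1; case: ltnP => [jl /h2 //|_ _].
case: (ltnP (j - size env) (size vs)) => h; first by apply: hv; rewrite mem_nth.
by rewrite nth_default.
Qed.

Lemma safe_le V V' delta env e : V <= V' -> safe delta V env e -> safe delta V' env e.
Proof.
move=> VV; elim: e env => [c|j|o a IHa b IHb|a IHa|a IHa b IHb|md b IHb a IHa c IHc] env.
- by move=> h; apply: leq_trans VV.
- by move=> h; apply: leq_trans VV.
- move=> /safe_op [h1 h2 h3]; apply/safe_op.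
  by split; [exact: IHa|exact: IHb|apply: leq_trans VV].
- by move=> /safe_read [h1 h2]; apply/safe_read; split; [exact: IHa|apply: leq_trans VV].
- by move=> /safe_let [h1 h2]; apply/safe_let; split; [exact: IHa|exact: IHb].
- move=> /safe_loop [h1 h2 h3]; apply/safe_loop; split; [exact: IHb|exact: IHa|].
  by move=> i /h3 [h4 h5]; split; [exact: IHc|apply: leq_trans VV].
Qed.

Lemma aval_le o x y z : x <= z -> y <= z -> aval o x y <= (z + 2) ^ 2.
Proof.
have sq : (z + 2) ^ 2 = z * z + 4 * z + 4 by rewrite -mulnn; lia.
rewrite sq => hx hy; by case: o => /=; nia.
Qed.

Lemma comb_le md x y z : x <= z -> y <= z -> comb md x y <= (z + 2) ^ 2.
Proof.
have sq : (z + 2) ^ 2 = z * z + 4 * z + 4 by rewrite -mulnn; lia.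
by rewrite sq => hx hy; case: md => /=; nia.
Qed.

(** The rank depends on the expression only, and the bound [X] on the variables is arbitrary; this
    lets the induction pass binders with a larger [X]. A loop makes at most as many rounds as its
    bound allows and iterates the growth of one round, which raises the rank by one. *)
Lemma kexp_bound e : exists r, forall G env delta X, kenv G env X -> kexp G e ->
  [/\ eval delta env e <= grow r X, steps delta env e <= grow r X &
      safe delta (grow r X) env e].
Proof.
elim: e => [c|j|o a [ra IHa] b [rb IHb]|a _|a [ra IHa] b [rb IHb]|md b [rb IHb] a [ra IHa] c [rc IHc]].
- exists c => G env delta X _ _ /=.
  have h : c <= grow c X by apply: leq_trans (ltnW (grow_rank_ge c)) (grow_mono _ _).
  by split=> //; apply: leq_trans (ltnW (grow_gt1 _ _)).
- exists 0 => G env delta X [_ hX] /= /hX h.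
  have h0 := leq_trans h (grow_ge 0 X).
  by split=> //; apply: leq_trans (ltnW (grow_gt1 0 X)).
- exists (rcomp 0 (rcomp rb ra)) => G env delta X hX /= /andP [ka kb].
  have [a1 a2 a3] := IHa G env delta X hX ka.
  set Y := grow ra X in a1 a2 a3.
  have XY : X <= Y by apply: grow_ge.
  have [b1 b2 b3] := IHb _ _ delta Y (kenv_cat (vs := [:: _]) (kenv_le XY hX) (introT andP (conj a1 isT))) kb.
  set Z := grow rb Y in b1 b2 b3.
  have YZ : Y <= Z by apply: grow_ge.
  have ZW : grow 0 Z <= grow (rcomp 0 (rcomp rb ra)) X.
    by apply: leq_trans (grow_comp _ _ _); apply: grow_mono; apply: grow_comp.
  have W0 := grow0_sq Z; set W := grow 0 Z in ZW W0.
  have o1 := aval_le o (leq_trans a1 YZ) b1.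
  have sq : (Z + 2) ^ 2 = Z * Z + 4 * Z + 4 by rewrite -mulnn; lia.
  rewrite stepsE /=; split; [lia|lia|].
  apply/safe_op; split; [apply: safe_le a3; lia|apply: safe_le b3; lia|rewrite /=; lia].
- by exists 0 => G env delta X _.
- exists (rcomp 0 (rcomp rb ra)) => G env delta X hX /= /andP [ka kb].
  have [a1 a2 a3] := IHa G env delta X hX ka.
  set Y := grow ra X in a1 a2 a3.
  have XY : X <= Y by apply: grow_ge.
  have [b1 b2 b3] := IHb _ _ delta Y (kenv_cat (vs := [:: _]) (kenv_le XY hX) (introT andP (conj a1 isT))) kb.
  set Z := grow rb Y in b1 b2 b3.
  have YZ : Y <= Z by apply: grow_ge.
  have ZW : grow 0 Z <= grow (rcomp 0 (rcomp rb ra)) X.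
    by apply: leq_trans (grow_comp _ _ _); apply: grow_mono; apply: grow_comp.
  have W0 := grow0_sq Z; set W := grow 0 Z in ZW W0.
  have sq : (Z + 2) ^ 2 = Z * Z + 4 * Z + 4 by rewrite -mulnn; lia.
  rewrite stepsE /=; split; [lia|lia|].
  by apply/safe_let; split; [apply: safe_le a3; lia|apply: safe_le b3; lia].
(* The growth in one round: rank [rc] for the body, then rank 0 for the squaring that [comb] may
   cause. *)
pose r' := rcomp 0 rc.
exists (rcomp 0 (rcomp rc (rcomp r'.+1 (rcomp ra rb)))) => G env delta X hX /= /and3P [kb ka kc].
have [b1 b2 b3] := IHb G env delta X hX kb.
set X1 := grow rb X in b1 b2 b3; have XX1 : X <= X1 by apply: grow_ge.
set x := eval delta env b in b1 *.
have al1 : all (leq^~ X1) [:: x; 0] by rewrite /= b1.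
have [a1 a2 a3] := IHa _ _ delta X1 (kenv_cat (kenv_le XX1 hX) al1) ka.
set X2 := grow ra X1 in a1 a2 a3; have X12 : X1 <= X2 by apply: grow_ge.
set N := eval delta _ a in a1 *.
pose acc := loop_acc delta md env c x N.
have body i Z : i < N -> X2 <= Z -> acc i <= Z ->
    [/\ eval delta (env ++ [:: acc i; i; N - i]) c <= grow rc Z,
       steps delta (env ++ [:: acc i; i; N - i]) c <= grow rc Z &
       safe delta (grow rc Z) (env ++ [:: acc i; i; N - i]) c].
  move=> iN Z2 aZ; apply: IHc kc.
  apply: (@kenv_cat G env Z [:: acc i; i; N - i]); first by apply: kenv_le hX; lia.
  by rewrite /= aZ !andbT; apply/andP; lia.
have accZ i : i <= N -> acc i <= iter i (grow r') X2.
  elim: i => [_|i IH iN]; first by rewrite /acc /loop_acc /=; lia.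
  have {}IH := IH (ltnW iN).
  have X2i : X2 <= iter i (grow r') X2.
    rewrite -[X in X <= _]/(iter 0 (grow r') X2).
    by apply: iter_grow_mono => //; [exact: grow_gt|exact: grow_mono].
  have [h1 _ _] := body i _ iN X2i IH.
  rewrite /acc /loop_acc /= -/(loop_acc delta md env c x N i) -/(acc i).
  apply: leq_trans (comb_le md (leq_trans IH (grow_ge rc _)) h1) _.
  by apply: leq_trans (grow0_sq _) (grow_comp _ _ _).
set X3 := grow r'.+1 X2.
have acc3 i : i <= N -> acc i <= X3.
  move=> iN; apply: leq_trans (accZ i iN) _.
  by apply: iter_grow_mono; [exact: grow_gt|exact: grow_mono|lia|].
have X23 : X2 <= X3 by apply: grow_ge.
set W := grow rc X3; have W3 : X3 <= W by apply: grow_ge.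
have W0 := grow0_sq W.
have WW : grow 0 W <= grow (rcomp 0 (rcomp rc (rcomp r'.+1 (rcomp ra rb)))) X.
  apply: leq_trans (grow_comp _ _ _); apply: grow_mono.
  apply: leq_trans (grow_comp _ _ _); apply: grow_mono.
  by apply: leq_trans (grow_comp _ _ _); apply: grow_mono; apply: grow_comp.
have sq : (W + 2) ^ 2 = W * W + 4 * W + 4 by rewrite -mulnn; lia.
split.
- by have := acc3 N (leqnn _); rewrite /acc /loop_acc; lia.
- rewrite steps_loop; cbv zeta; rewrite -/x -/N.
  have hs : \sum_(i < N) (steps delta (env ++ [:: acc i; nat_of_ord i; N - i]) c).+1 <= N * W.+1.
    rewrite -[X in X * _]card_ord -sum_nat_const; apply: leq_sum => i _; rewrite ltnS.
    by have [] := body i X3 (ltn_ord i) X23 (acc3 i (ltnW (ltn_ord i))).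
  apply: leq_trans WW; apply: leq_trans W0; rewrite sq.
  have NW : N * W.+1 <= W * W.+1 by rewrite leq_mul2r; lia.
  by move: hs NW; rewrite -/x -/N; move: (\sum_(i < N) _) => S; lia.
apply/safe_loop; cbv zeta; rewrite -/x -/N; split.
- by apply: safe_le b3; lia.
- by apply: safe_le a3; lia.
move=> i iN; have [h1 h2 h3] := body i X3 iN X23 (acc3 i (ltnW iN)); split.
  by apply: safe_le h3; lia.
by apply: leq_trans (acc3 i.+1 iN) _; lia.
Qed.
(** A single rank plays the part of all constants, so raising it weakens the bound. In [VP] the
    logarithm is raised to a power depending on [k]; this is the source of [e]. The value at [VTop]
    is a placeholder, as [bdd] accepts that type without a bound. *)
Definition bnd (k n w r : nat) (t : vtype) : nat :=
  match t with
  | VQ4 => k %/ 4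
  | VK => grow r k
  | VP j q => (grow r k * w) ^ grow r k * n ^ (j + q * (k %/ 4))
  | VBig => (grow r k * w * n) ^ grow r k
  | VTop => 0
  end.

Definition tjoin (s t : vtype) : vtype :=
  match s, t with
  | VTop, _ | _, VTop => VTop
  | VBig, _ | _, VBig => VBig
  | VP j q, VP j' q' => VP (maxn j j') (maxn q q')
  | VP j q, _ | _, VP j q => VP j q
  | _, _ => VK
  end.

Definition tmul (s t : vtype) : vtype :=
  match s, t with
  | VTop, _ | _, VTop => VTop
  | VBig, _ | _, VBig => VBig
  | VP j q, VP j' q' => VP (j + j') (q + q')
  | VP j q, _ | _, VP j q => VP j q
  | _, _ => VK
  end.

(** Only a number of factors of type [VQ4] turns a power of [n] into a power of [n ^ (k / 4)]. With
    a number of factors bounded in [k], powers of [lg n] stay of their type, and higher powers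
    become [VBig]: harmless as the size of a number, but not accepted as the number of rounds of a
    loop. *)
Definition tpow (count base : vtype) : vtype :=
  match count, base with
  | _, VTop => VTop
  | VQ4, VP j 0 => VP 0 j
  | VK, VP 0 0 => VP 0 0
  | (VQ4 | VK), (VQ4 | VK) => VK
  | (VQ4 | VK), _ => VBig
  | _, _ => VTop
  end.

(** The body of a loop is typed with an accumulator of unknown size, so no fixed point has to be
    found. Its value must be bounded for another reason, such as a second argument of [AMin] or a
    comparison; loops over quantities depending on [k] alone are caught beforehand by [kexp]. *)
Fixpoint vt (G : seq vtype) (e : expr) : vtype :=
  if kexp G e then (if e is EVar j then nth VTop G j else VK) else
  match e with
  | ECst _ => VK
  | EVar j => nth VTop G j
  | EOp o a b =>
      let s := vt G a in let t := vt (G ++ [:: s]) b in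
      match o with
      | AAdd => tjoin s t
      | AMul => tmul s t
      | ASub | ADiv | AMod => s
      | AMin => t
      | AEq | ALt => VK
      end
  | ERead _ => VP 1 0
  | ELet a b => vt (G ++ [:: vt G a]) b
  | ELoop md b a c =>
      let s := vt G b in
      let u := vt (G ++ [:: s; VK]) a in
      let t := vt (G ++ [:: VTop; u; u]) c in
      match md with
      | LSet => tjoin s t
      | LSum => tjoin s (tmul u t)
      | LProd => tmul s (tpow u t)
      end
  end.

Definition isTop (t : vtype) : bool := if t is VTop then true else false.

Definition cmax (x y : option (nat * nat)) : option (nat * nat) :=
  if x is Some (a, b) then
    if y is Some (c, d) then Some (maxn a c, maxn b d) else None
  else None.

Definition ccount (t : vtype) (x : option (nat * nat)) : option (nat * nat) :=
  match t, x with
  | (VQ4 | VK), _ => x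
  | VP j q, Some (a, b) => Some (j + a, q + b)
  | _, _ => None
  end.

(** The pair holds the exponents of [n] and of [n ^ (k / 4)]. Here the accumulator of a loop
    receives the type that [vt] found for the whole loop. An expression of unknown size gets no
    cost, since its values could not be shown [safe]. *)
Fixpoint ct (G : seq vtype) (e : expr) : option (nat * nat) :=
  if kexp G e then Some (0, 0) else
  if isTop (vt G e) then None else
  match e with
  | ECst _ | EVar _ => Some (0, 0)
  | EOp o a b => cmax (ct G a) (ct (G ++ [:: vt G a]) b)
  | ERead a => ct G a
  | ELet a b => cmax (ct G a) (ct (G ++ [:: vt G a]) b)
  | ELoop md b a c =>
      let s := vt G b in
      let u := vt (G ++ [:: s; VK]) a in
      cmax (cmax (ct G b) (ct (G ++ [:: s; VK]) a))
           (ccount u (ct (G ++ [:: vt G e; u; u]) c))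
  end.

Lemma leq_prod3 a b x y : a <= b -> a * x * y <= b * x * y.
Proof. by move=> h; rewrite !leq_mul2r h !orbT. Qed.

Lemma leq_prod3_gt0 a b x y : 0 < x -> 0 < y -> a <= b -> a <= b * x * y.
Proof.
by move=> hx hy h; apply: leq_trans h _; rewrite -mulnA leq_pmulr // muln_gt0 hx.
Qed.

(** * Arithmetic of bounds uniform over a family of instances *)

Section Bounded.
Variables (D : Type) (k n w : D -> nat).
Hypotheses (n0 : forall d, 0 < n d) (w0 : forall d, 0 < w d).

Definition bdd (t : vtype) (f : D -> nat) : Prop :=
  isTop t \/ exists r, forall d, f d <= bnd (k d) (n d) (w d) r t.

Lemma bnd_mono_rank t r s d : r <= s ->
  bnd (k d) (n d) (w d) r t <= bnd (k d) (n d) (w d) s t.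
Proof.
move=> rs; have g := grow_mono_rank (k d) rs; have w1 := w0 d; have n1 := n0 d.
have g1 := grow_gt1 r (k d).
case: t => //= [j q|].
- rewrite leq_mul2r; apply/orP; right.
  apply: (@leq_trans ((grow s (k d) * w d) ^ grow r (k d))).
    by rewrite leq_exp2r ?leq_mul2r ?g ?orbT //; lia.
  have [->|h] := eqVneq (grow s (k d) * w d) 1; first by rewrite !exp1n.
  by rewrite leq_exp2l //; nia.
- apply: (@leq_trans ((grow s (k d) * w d * n d) ^ grow r (k d))).
    by rewrite leq_exp2r ?leq_mul2r ?g ?orbT //; lia.
  by apply: leq_pexp2l; rewrite ?muln_gt0 ?w1 ?n1 ?andbT; first [done|lia|nia].
Qed.

Lemma bdd_le t f g : (forall d, f d <= g d) -> bdd t g -> bdd t f.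
Proof. by move=> fg [h|[r h]]; [by left|right; exists r => d; apply: leq_trans (h d)]. Qed.

Lemma bnd_gt0 t r d : ~~ isTop t -> t <> VQ4 -> 0 < bnd (k d) (n d) (w d) r t.
Proof.
have g1 := grow_gt1 r (k d); have w1 := w0 d; have n1 := n0 d.
by case: t => //= [|j q|] _ _; rewrite ?muln_gt0 ?expn_gt0 ?muln_gt0 ?n1 ?w1 ?andbT /=; lia.
Qed.

(** A factor depending on [k] costs one rank. The type [VQ4] has no room for it. *)
Lemma bnd_scale t r d : ~~ isTop t -> t <> VQ4 ->
  grow r (k d) * bnd (k d) (n d) (w d) r t <= bnd (k d) (n d) (w d) r.+1 t.
Proof.
have g1 := grow_gt1 r (k d); have w1 := w0 d; have n1 := n0 d.
have gs : (grow r (k d) + 2) ^ 2 <= grow r.+1 (k d).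
  by apply: leq_trans (grow0_sq _) _; apply: leq_trans (grow_comp _ _ _) _; rewrite /rcomp max0n.
have sq : (grow r (k d) + 2) ^ 2 = grow r (k d) * grow r (k d) + 4 * grow r (k d) + 4.
  by rewrite -mulnn; lia.
case: t => //= [|j q|] _ _; first by lia.
- rewrite mulnA leq_mul2r; apply/orP; right.
  apply: (@leq_trans ((grow r.+1 (k d) * w d) ^ (grow r (k d)).+1)).
    rewrite expnS; apply: leq_mul; first by nia.
    by rewrite leq_exp2r; [nia|lia].
  by apply: leq_pexp2l; rewrite ?muln_gt0 ?w1 ?n1 ?andbT; first [done|lia|nia].
- apply: (@leq_trans ((grow r.+1 (k d) * w d * n d) ^ (grow r (k d)).+1)).
    rewrite expnS; apply: leq_mul; first by apply: leq_prod3_gt0 => //; lia.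
    by rewrite leq_exp2r; [apply: leq_prod3; lia|lia].
  by apply: leq_pexp2l; rewrite ?muln_gt0 ?w1 ?n1 ?andbT; first [done|lia|nia].
Qed.

Lemma bdd_K f r : (forall d, f d <= grow r (k d)) -> bdd VK f.
Proof. by move=> h; right; exists r. Qed.

Lemma exp_big_rank j q : exists s, forall x, j + q * (x %/ 4) <= grow s x.
Proof.
exists (j + q).+1 => x; apply: (@leq_trans (grow 0 (grow (j + q) x))).
  apply: leq_trans (grow0_sq _).
  have h : j + q <= grow (j + q) x.
    by apply: leq_trans (ltnW (grow_rank_ge _)) (grow_mono _ _).
  have h2 : x <= grow (j + q) x by apply: grow_ge.
  have h3 : x %/ 4 <= x by apply: leq_div.
  by rewrite -mulnn; nia.
by apply: leq_trans (grow_comp _ _ _) _; rewrite /rcomp max0n.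
Qed.

Lemma bdd_big t f : ~~ isTop t -> bdd t f -> bdd VBig f.
Proof.
case: t => //= [||j q] _ [//|[r h]].
- right; exists 0 => d; apply: leq_trans (h d) _ => /=.
  have g1 := grow_gt 0 (k d); have w1 := w0 d; have n1 := n0 d.
  apply: (@leq_trans (grow 0 (k d))); first by apply: leq_trans (ltnW g1); apply: leq_div.
  by apply: leq_trans (ltnW (ltn_expl _ (grow_gt1 0 (k d)))) _; rewrite leq_exp2r; [apply: leq_prod3_gt0|lia].
- right; exists r => d; apply: leq_trans (h d) _ => /=.
  have g1 := grow_gt1 r (k d); have w1 := w0 d; have n1 := n0 d.
  by apply: leq_trans (ltnW (ltn_expl _ g1)) _; rewrite leq_exp2r; [apply: leq_prod3_gt0|lia].
right; have [s hs] := exp_big_rank j q; exists (maxn r s) => d; apply: leq_trans (h d) _ => /=.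
have g1 := grow_gt1 r (k d); have w1 := w0 d; have n1 := n0 d.
have gr : grow r (k d) <= grow (maxn r s) (k d) by apply: grow_mono_rank; lia.
have gs : grow s (k d) <= grow (maxn r s) (k d) by apply: grow_mono_rank; lia.
rewrite [leqRHS]expnMn; apply: leq_mul.
  apply: (@leq_trans ((grow (maxn r s) (k d) * w d) ^ grow r (k d))).
    by rewrite leq_exp2r; nia.
  by apply: leq_pexp2l; rewrite ?muln_gt0 ?w1 ?n1 ?andbT; first [done|lia|nia].
by apply: leq_pexp2l => //; apply: leq_trans (hs _) gs.
Qed.

Lemma bdd_toK t f : isK t -> bdd t f -> bdd VK f.
Proof.
case: t => //= _ [//|[r h]]; apply: (@bdd_K _ 0) => d.
by apply: leq_trans (h d) _; apply: leq_trans (leq_div _ _) (grow_ge _ _).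
Qed.

Lemma bdd_toP t j q f : isK t -> bdd t f -> bdd (VP j q) f.
Proof.
move=> /bdd_toK h /h [//|[r {}h]]; right; exists r => d; apply: leq_trans (h d) _ => /=.
have g1 := grow_gt1 r (k d); have w1 := w0 d; have n1 := n0 d.
apply: (@leq_trans ((grow r (k d) * w d) ^ grow r (k d))).
  by apply: leq_trans (ltnW (ltn_expl _ g1)) _; rewrite leq_exp2r; nia.
by rewrite -[leqLHS]muln1 leq_mul2l expn_gt0 n1 orbT.
Qed.

Lemma bdd_PP j q j' q' f : j <= j' -> q <= q' -> bdd (VP j q) f -> bdd (VP j' q') f.
Proof.
move=> hj hq [//|[r h]]; right; exists r => d; apply: leq_trans (h d) _ => /=.
rewrite leq_mul2l; apply/orP; right; apply: leq_pexp2l; first exact: n0.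
by apply: leq_add => //; rewrite leq_mul2r hq orbT.
Qed.

Lemma bdd_joinl s t f : bdd s f -> ~~ isTop t -> bdd (tjoin s t) f.
Proof.
case: s => [||j q||] h; case: t => [||j' q'||] // _; rewrite /tjoin;
  try (by []); try (by apply: bdd_toK h); try (by apply: bdd_toP h);
  try (by apply: bdd_big h); try (by left).
by apply: bdd_PP h; lia.
Qed.

Lemma tjoinC s t : tjoin s t = tjoin t s.
Proof. by case: s t => [||j q||] [||j' q'||] //=; rewrite (maxnC j) (maxnC q). Qed.

Lemma bdd_joinr s t f : bdd t f -> ~~ isTop s -> bdd (tjoin s t) f.
Proof. by rewrite tjoinC; apply: bdd_joinl. Qed.

Lemma bdd_scale t f c : ~~ isTop t -> t <> VQ4 -> bdd t f -> bdd t (fun d => c * f d).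
Proof.
move=> h1 h2 [ht|[r h]]; first by left.
right; exists (maxn r c).+1 => d.
apply: leq_trans (bnd_scale (maxn r c) d h1 h2); apply: leq_mul.
  apply: leq_trans (leq_maxr r c) _.
  by apply: leq_trans (ltnW (grow_rank_ge _)) (grow_mono _ _).
by apply: leq_trans (h d) _; apply: bnd_mono_rank; lia.
Qed.

Lemma isTop_join s t : isTop (tjoin s t) = isTop s || isTop t.
Proof. by case: s t => [||j q||] [||j' q'||]. Qed.

Lemma bdd_max t f g : bdd t f -> bdd t g -> bdd t (fun d => maxn (f d) (g d)).
Proof.
move=> [ht|[r h]]; first by left.
move=> [ht|[r' h']]; first by left.
right; exists (maxn r r') => d; rewrite geq_max; apply/andP; split.
  by apply: leq_trans (h d) _; apply: bnd_mono_rank; lia.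
by apply: leq_trans (h' d) _; apply: bnd_mono_rank; lia.
Qed.

Lemma tjoin_Q4 s t : tjoin s t <> VQ4.
Proof. by case: s t => [||j q||] [||j' q'||]. Qed.

Lemma bdd_add s t f g : bdd s f -> bdd t g -> bdd (tjoin s t) (fun d => f d + g d).
Proof.
move=> hf hg; have [ht|ht] := boolP (isTop (tjoin s t)); first by left.
have := ht; rewrite isTop_join negb_or => /andP [h1 h2].
have h := bdd_max (bdd_joinl hf h2) (bdd_joinr hg h1).
by apply: bdd_le (bdd_scale 2 ht (@tjoin_Q4 s t) h) => d; lia.
Qed.

Lemma bdd_mulPP j q j' q' f g : bdd (VP j q) f -> bdd (VP j' q') g ->
  bdd (VP (j + j') (q + q')) (fun d => f d * g d).
Proof.
move=> [//|[r h]] [//|[r' h']]; right; exists (maxn r r').+1 => d.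
pose s := maxn r r'.
have hs := h d; have hs' := h' d.
have {}hs := leq_trans hs (@bnd_mono_rank _ r s d (leq_maxl _ _)).
have {}hs' := leq_trans hs' (@bnd_mono_rank _ r' s d (leq_maxr _ _)).
apply: leq_trans (leq_mul hs hs') _ => /=; rewrite -/s.
have g1 := grow_gt1 s (k d); have w1 := w0 d; have n1 := n0 d.
have gs : (grow s (k d) + 2) ^ 2 <= grow s.+1 (k d).
  by apply: leq_trans (grow0_sq _) _; apply: leq_trans (grow_comp _ _ _) _; rewrite /rcomp max0n.
have {}gs : grow s (k d) + grow s (k d) <= grow s.+1 (k d).
  by apply: leq_trans gs; rewrite -mulnn; nia.
rewrite mulnACA -!expnD; apply: leq_mul; last by apply: leq_pexp2l; rewrite ?muln_gt0 ?w1 ?n1 ?andbT; first [done|lia|nia].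
apply: (@leq_trans ((grow s.+1 (k d) * w d) ^ (grow s (k d) + grow s (k d)))).
  by rewrite leq_exp2r; nia.
by apply: leq_pexp2l; rewrite ?muln_gt0 ?w1 ?n1 ?andbT; first [done|lia|nia].
Qed.

Lemma bdd_mulKK f g : bdd VK f -> bdd VK g -> bdd VK (fun d => f d * g d).
Proof.
move=> [//|[r h]] [//|[r' h']]; right; exists (maxn r r').+1 => d /=.
have {}h : f d <= grow (maxn r r') (k d) by apply: leq_trans (h d) (grow_mono_rank _ _); lia.
have {}h' : g d <= grow (maxn r r') (k d) by apply: leq_trans (h' d) (grow_mono_rank _ _); lia.
apply: (@leq_trans (grow 0 (grow (maxn r r') (k d)))).
  by apply: leq_trans (grow0_sq _); rewrite -mulnn; nia.
by apply: leq_trans (grow_comp _ _ _) _; rewrite /rcomp max0n.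
Qed.

Lemma bdd_mulBB f g : bdd VBig f -> bdd VBig g -> bdd VBig (fun d => f d * g d).
Proof.
move=> [//|[r h]] [//|[r' h']]; right; exists (maxn r r').+1 => d.
pose s := maxn r r'.
have hs := h d; have hs' := h' d.
have {}hs := leq_trans hs (@bnd_mono_rank _ r s d (leq_maxl _ _)).
have {}hs' := leq_trans hs' (@bnd_mono_rank _ r' s d (leq_maxr _ _)).
apply: leq_trans (leq_mul hs hs') _ => /=; rewrite -/s.
have g1 := grow_gt1 s (k d); have w1 := w0 d; have n1 := n0 d.
have gs : (grow s (k d) + 2) ^ 2 <= grow s.+1 (k d).
  by apply: leq_trans (grow0_sq _) _; apply: leq_trans (grow_comp _ _ _) _; rewrite /rcomp max0n.
have {}gs : grow s (k d) + grow s (k d) <= grow s.+1 (k d).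
  by apply: leq_trans gs; rewrite -mulnn; nia.
rewrite -!expnD.
apply: (@leq_trans ((grow s.+1 (k d) * w d * n d) ^ (grow s (k d) + grow s (k d)))).
  by rewrite leq_exp2r; [apply: leq_prod3; lia|lia].
by apply: leq_pexp2l; rewrite ?muln_gt0 ?w1 ?n1 ?andbT; first [done|lia|nia].
Qed.

Lemma bdd_mul s t f g : bdd s f -> bdd t g -> bdd (tmul s t) (fun d => f d * g d).
Proof.
have KP j q f' g' : bdd VK f' -> bdd (VP j q) g' -> bdd (VP j q) (fun d => f' d * g' d).
  by move=> h h'; have := bdd_mulPP (@bdd_toP VK 0 0 _ isT h) h'.
have PK j q f' g' : bdd (VP j q) f' -> bdd VK g' -> bdd (VP j q) (fun d => f' d * g' d).
  by move=> h h'; have := bdd_mulPP h (@bdd_toP VK 0 0 _ isT h'); rewrite !addn0.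
have QK f' : bdd VQ4 f' -> bdd VK f' by apply: bdd_toK.
move=> hf hg.
case: s hf => [||j q||] hf; case: t hg => [||j' q'||] hg; rewrite /tmul; try (by left);
  first [by apply: bdd_mulKK; auto | by apply: bdd_mulPP | by apply: KP; auto
        | by apply: PK; auto | by apply: bdd_mulBB; [exact: bdd_big hf|exact: bdd_big hg]].
Qed.

Lemma bdd_max1 t T : bdd t T -> t <> VQ4 -> bdd t (fun d => maxn 1 (T d)).
Proof.
move=> [ht|[r h]] tQ; first by left.
have [ht|ht] := boolP (isTop t); first by left.
right; exists r => d; rewrite geq_max h andbT.
exact: bnd_gt0.
Qed.

(** The maximum with 1 makes the power monotone in its exponent, as needed when [N d] is replaced by
    its bound. *)
Lemma bdd_pow u t N T : bdd u N -> bdd t T ->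
  bdd (tpow u t) (fun d => maxn 1 (T d) ^ N d).
Proof.
move=> hN hT.
have [ht|ht] := boolP (isTop (tpow u t)); first by left.
have uK : isK u by move: ht; case: u hN => [||j q||] _; case: t hT => [||j' q'||] _ /=.
have tT : ~~ isTop t by move: ht; case: u hN uK => [||j q||] _ //=; case: t hT => [||j' q'||] _.
have [r hr] : exists r, forall d, N d <= grow r (k d).
  by case: (bdd_toK uK hN) => // -[r h]; exists r.
have big : bdd VBig (fun d => maxn 1 (T d) ^ N d).
  have nQ : VBig <> VQ4 by [].
  have [//|[s hs]] := bdd_max1 (bdd_big tT hT) nQ.
  right; exists (maxn r s).+1 => d /=.
  have g1 := grow_gt1 (maxn r s) (k d); have w1 := w0 d; have n1 := n0 d.
  have gs : (grow (maxn r s) (k d) + 2) ^ 2 <= grow (maxn r s).+1 (k d).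
    by apply: leq_trans (grow0_sq _) _; apply: leq_trans (grow_comp _ _ _) _; rewrite /rcomp max0n.
  have {}gs : grow (maxn r s) (k d) * grow (maxn r s) (k d) <= grow (maxn r s).+1 (k d).
    by apply: leq_trans gs; rewrite -mulnn; nia.
  have Nd : N d <= grow (maxn r s) (k d).
    by apply: leq_trans (hr d) (grow_mono_rank _ _); lia.
  have Td := leq_trans (hs d) (@bnd_mono_rank VBig s (maxn r s) d (leq_maxr _ _)).
  apply: (@leq_trans (((grow (maxn r s) (k d) * w d * n d) ^ grow (maxn r s) (k d)) ^ N d)).
    by case: (N d) => // m; rewrite leq_exp2r.
  rewrite -expnM.
  apply: (@leq_trans ((grow (maxn r s).+1 (k d) * w d * n d) ^ (grow (maxn r s) (k d) * N d))).
    case: (N d) => [|m]; first by rewrite muln0.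
    rewrite leq_exp2r; last by lia.
    by apply: leq_prod3; apply: grow_mono_rank.
  apply: leq_pexp2l; first by rewrite !muln_gt0 w1 n1; have := grow_gt1 (maxn r s).+1 (k d); lia.
  by apply: leq_trans gs; rewrite leq_mul2l Nd orbT.
(* The hypothesis [cN] treats two cases at once: at most [k / 4] factors, and [j = 0] with any
   number of factors bounded in [k]. *)
have PJ j (cN : forall d, N d * j <= j * (k d %/ 4)) : bdd (VP j 0) T ->
    bdd (VP 0 j) (fun d => maxn 1 (T d) ^ N d).
  move=> hT'; have nQ : VP j 0 <> VQ4 by [].
  have [//|[s hs]] := bdd_max1 hT' nQ.
  right; exists (maxn r s).+1 => d /=.
  have g1 := grow_gt1 (maxn r s) (k d); have w1 := w0 d; have n1 := n0 d.
  have gs : (grow (maxn r s) (k d) + 2) ^ 2 <= grow (maxn r s).+1 (k d).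
    by apply: leq_trans (grow0_sq _) _; apply: leq_trans (grow_comp _ _ _) _; rewrite /rcomp max0n.
  have {}gs : grow (maxn r s) (k d) * grow (maxn r s) (k d) <= grow (maxn r s).+1 (k d).
    by apply: leq_trans gs; rewrite -mulnn; nia.
  have Nd : N d <= grow (maxn r s) (k d).
    by apply: leq_trans (hr d) (grow_mono_rank _ _); lia.
  have Td := leq_trans (hs d) (@bnd_mono_rank (VP j 0) s (maxn r s) d (leq_maxr _ _)).
  apply: (@leq_trans (bnd (k d) (n d) (w d) (maxn r s) (VP j 0) ^ N d)).
    by case: (N d) => // m; rewrite leq_exp2r.
  rewrite /= mul0n addn0 expnMn -!expnM; apply: leq_mul.
    apply: (@leq_trans ((grow (maxn r s).+1 (k d) * w d) ^ (grow (maxn r s) (k d) * N d))).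
      case: (N d) => [|m]; first by rewrite muln0.
      by rewrite leq_exp2r ?leq_mul2r; [rewrite grow_mono_rank ?orbT|lia].
    apply: leq_pexp2l; first by rewrite !muln_gt0 w1; have := grow_gt1 (maxn r s).+1 (k d); lia.
    by apply: leq_trans gs; rewrite leq_mul2l Nd orbT.
  by apply: leq_pexp2l => //; rewrite mulnC add0n.
have KK : isK t -> bdd VK (fun d => maxn 1 (T d) ^ N d).
  move=> tK; have [s hs] : exists s, forall d, T d <= grow s (k d).
    by case: (bdd_toK tK hT) => // -[s h]; exists s.
  right; exists (maxn r s).+1 => d /=; set m := maxn r s.
  have hr' : N d <= grow m (k d) by apply: leq_trans (hr d) (grow_mono_rank _ (leq_maxl _ _)).
  have hs' : T d <= grow m (k d) by apply: leq_trans (hs d) (grow_mono_rank _ (leq_maxr _ _)).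
  have := grow_gt1 m (k d) => g1.
  apply: (@leq_trans (grow 0 (grow m (k d)))).
    by apply: grow0_exp; lia.
  by apply: leq_trans (grow_comp _ _ _) _; rewrite /rcomp max0n.
move: ht; case: u hN uK PJ => [||j q||] //= hN _ PJ; case: t hT tT KK => [||j' q'||] //= hT _ KK _;
  try (by apply: KK); try exact: big.
- case: q' hT => [|q'] hT; last exact: big.
  apply: PJ hT => d; case: hN => // -[r' h]; rewrite mulnC leq_mul2l.
  by apply/orP; right; exact: h.
- case: j' hT => [|j'] hT; case: q' hT => [|q'] hT; try exact: big.
  by apply: PJ hT => d; rewrite muln0.
Qed.

End Bounded.

Arguments bdd {D} k n w t f.

(** Instances paired with a round of their loop. A bound for the body over this family has one rank
    for all instances and all rounds. *)
Definition TD (D : Type) (N : D -> nat) := {d : D & 'I_(N d)}.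

Section BoundedLoop.
Variables (D : Type) (k n w : D -> nat) (N : D -> nat).
Hypotheses (n0 : forall d, 0 < n d) (w0 : forall d, 0 < w d).

Lemma bdd_tag t f : bdd k n w t f ->
  bdd (D := TD N) (k \o @tag _ _) (n \o @tag _ _) (w \o @tag _ _) t (f \o @tag _ _).
Proof. by move=> [h|[r h]]; [left|right; exists r => d; apply: h]. Qed.

Lemma bdd_bigmax t (g : forall d, nat -> nat) :
  bdd (D := TD N) (k \o @tag _ _) (n \o @tag _ _) (w \o @tag _ _) t
    (fun x => g (tag x) (tagged x)) ->
  bdd k n w t (fun d => \max_(i < N d) g d i).
Proof.
move=> [h|[r h]]; [by left|right; exists r => d; apply/bigmax_leqP => i _].
exact: (h (existT _ d i)).
Qed.

Lemma bdd_index u : bdd k n w u N ->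
  bdd (D := TD N) (k \o @tag _ _) (n \o @tag _ _) (w \o @tag _ _) u
    (fun x => tagged x).
Proof.
move=> [h|[r h]]; [by left|right; exists r => -[d i]].
exact: leq_trans (ltnW (ltn_ord i)) (h d).
Qed.

Lemma bdd_rest u : bdd k n w u N ->
  bdd (D := TD N) (k \o @tag _ _) (n \o @tag _ _) (w \o @tag _ _) u
    (fun x => N (tag x) - tagged x).
Proof.
move=> [h|[r h]]; [by left|right; exists r => -[d i]].
exact: leq_trans (leq_subr _ _) (h d).
Qed.

Lemma bdd_sum u t (g : forall d, nat -> nat) :
  bdd k n w u N ->
  bdd (D := TD N) (k \o @tag _ _) (n \o @tag _ _) (w \o @tag _ _) t
    (fun x => g (tag x) (tagged x)) ->
  bdd k n w (tmul u t) (fun d => \sum_(i < N d) g d i).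
Proof.
move=> hN /bdd_bigmax hg; apply: bdd_le (bdd_mul n0 w0 hN hg) => d.
rewrite -[X in X * _]card_ord -sum_nat_const; apply: leq_sum => i _.
exact: (@leq_bigmax _ (fun i : 'I_(N d) => g d i)).
Qed.

End BoundedLoop.

(** * Soundness of the value and cost types *)

Definition benv D (k n w : D -> nat) (G : seq vtype) (env : D -> seq nat) : Prop :=
  (forall d, size (env d) = size G) /\
  forall j, bdd k n w (nth VTop G j) (fun d => nth 0 (env d) j).

Lemma benv_cat D (k n w : D -> nat) G env t v :
  benv k n w G env -> bdd k n w t v ->
  benv k n w (G ++ [:: t]) (fun d => env d ++ [:: v d]).
Proof.
move=> [h1 h2] hv; split=> [d|j]; first by rewrite !size_cat h1.
have e d : nth 0 (env d ++ [:: v d]) j =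
    if j < size G then nth 0 (env d) j else nth 0 [:: v d] (j - size G).
  by rewrite nth_cat h1.
rewrite nth_cat; case: ltnP e => jl e.
  by apply: bdd_le (h2 j) => d; rewrite e.
case: (j - size G) e => [|m] e; first by apply: bdd_le hv => d; rewrite e.
by left; rewrite /= nth_nil.
Qed.

Lemma benv_kenv D (k n w : D -> nat) G env : benv k n w G env ->
  exists r, forall d, kenv G (env d) (grow r (k d)).
Proof.
move=> [h1 h2].
suff: forall m, exists r, forall j d, j < m -> isK (nth VTop G j) ->
    nth 0 (env d) j <= grow r (k d).
  move=> /(_ (size G)) [r h]; exists r => d; split=> // j jK; apply: h => //.
  by rewrite ltnNge; apply/negP => jl; move: jK; rewrite nth_default.
elim=> [|m [r IH]]; first by exists 0.
have [mK|mK] := boolP (isK (nth VTop G m)); last first.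
  exists r => j d; rewrite ltnS leq_eqVlt => /orP [/eqP -> jK|/IH]; last by apply.
  by rewrite jK in mK.
have [//|[s hs]] := bdd_toK mK (h2 m).
exists (maxn r s) => j d; rewrite ltnS leq_eqVlt => /orP [/eqP -> _|jm jK].
  by apply: leq_trans (hs d) (grow_mono_rank _ _); lia.
by apply: leq_trans (IH j d jm jK) (grow_mono_rank _ _); lia.
Qed.
Lemma benv_ext D (k n w : D -> nat) G env env' : (forall d, env d = env' d) ->
  benv k n w G env -> benv k n w G env'.
Proof.
move=> e [h1 h2]; split=> [d|j]; first by rewrite -e h1.
by apply: bdd_le (h2 j) => d; rewrite e.
Qed.

Lemma benv_tag D (k n w : D -> nat) N G env : benv k n w G env ->
  benv (D := TD N) (k \o @tag _ _) (n \o @tag _ _) (w \o @tag _ _) G (env \o @tag _ _).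
Proof. by move=> [h1 h2]; split=> [d|j]; [apply: h1|apply: bdd_tag (h2 j)]. Qed.

Definition lvt md s u t : vtype :=
  match md with
  | LSet => tjoin s t
  | LSum => tjoin s (tmul u t)
  | LProd => tmul s (tpow u t)
  end.

(** The running values are bounded together with the result, as [safe] asks for them. The start
    value is added in the case of [LSet] because it is the value before the first round. *)
Lemma loop_bound D (k n w : D -> nat) md s u t (x N : D -> nat) (acc T : D -> nat -> nat) :
  (forall d, 0 < n d) -> (forall d, 0 < w d) ->
  (forall d, acc d 0 = x d) ->
  (forall d i, i < N d -> acc d i.+1 = comb md (acc d i) (T d i)) ->
  bdd k n w s x -> bdd k n w u N ->
  bdd (D := TD N) (k \o @tag _ _) (n \o @tag _ _) (w \o @tag _ _) t
    (fun x => T (tag x) (tagged x)) ->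
  exists2 B, bdd k n w (lvt md s u t) B & forall d i, i <= N d -> acc d i <= B d.
Proof.
move=> n0 w0 acc0 accS hx hN hT.
have Tmax d i : i < N d -> T d i <= \max_(j < N d) T d j.
  by move=> iN; apply: (@leq_bigmax _ (fun j : 'I_(N d) => T d j) (Ordinal iN)).
have hM := bdd_bigmax hT.
case: md accS => accS.
- exists (fun d => x d + \max_(j < N d) T d j); first exact: bdd_add.
  move=> d [|i] iN; first by rewrite acc0; lia.
  by rewrite accS //=; apply: leq_trans (Tmax d i iN) (leq_addl _ _).
- exists (fun d => x d + \sum_(j < N d) T d j).
    by apply: bdd_add => //; apply: bdd_sum.
  move=> d i iN; suff -> : acc d i = x d + \sum_(j < i) T d j.
    rewrite leq_add2l -(big_mkord xpredT (T d)) -(big_mkord xpredT (T d)).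
    by rewrite [leqRHS](@big_cat_nat _ _ _ i 0 (N d)) //= leq_addr.
  elim: i iN => [|i IH] iN; first by rewrite acc0 big_ord0 addn0.
  by rewrite accS //= (IH (ltnW iN)) big_ord_recr /= addnA.
- exists (fun d => x d * maxn 1 (\max_(j < N d) T d j) ^ N d).
    by apply: bdd_mul => //; apply: bdd_pow.
  move=> d i iN; apply: (@leq_trans (x d * maxn 1 (\max_(j < N d) T d j) ^ i)).
    elim: i iN => [|i IH] iN; first by rewrite acc0 muln1.
    rewrite accS //= expnSr mulnA; apply: leq_mul; first exact: IH (ltnW iN).
    by apply: leq_trans (Tmax d i iN) (leq_maxr _ _).
  by rewrite leq_mul2l; apply/orP; right; apply: leq_pexp2l; lia.
Qed.

Definition bdata D (k n w : D -> nat) (delta : D -> nat -> nat) : Prop :=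
  exists r, forall d a, delta d a <= bnd (k d) (n d) (w d) r (VP 1 0).

Lemma vt_var G j : vt G (EVar j) = nth VTop G j.
Proof. by rewrite /=; case: ifP. Qed.

Lemma vt_kexp G e : kexp G e -> ~~ (if e is EVar _ then true else false) -> vt G e = VK.
Proof. by case: e => [c|j|o a b|a|a b|md b a c] //= ->. Qed.

Lemma ct_kexp G e : kexp G e -> ct G e = Some (0, 0).
Proof. by case: e => [c|j|o a b|a|a b|md b a c] //= ->. Qed.

Lemma kexp_sound D (k n w : D -> nat) G env delta e :
  benv k n w G env -> kexp G e ->
  exists r, forall d,
   [/\ eval (delta d) (env d) e <= grow r (k d), steps (delta d) (env d) e <= grow r (k d) &
      safe (delta d) (grow r (k d)) (env d) e].
Proof.
move=> /benv_kenv [r hr] ke; have [s hs] := kexp_bound e.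
exists (rcomp s r) => d; have [h1 h2 h3] := hs _ _ (delta d) _ (hr d) ke.
have c := grow_comp s r (k d).
by split; [exact: leq_trans c|exact: leq_trans c|exact: safe_le c h3].
Qed.

Lemma loop_accS delta md env c x N i : loop_acc delta md env c x N i.+1 =
  comb md (loop_acc delta md env c x N i)
    (eval delta (env ++ [:: loop_acc delta md env c x N i; i; N - i]) c).
Proof. by []. Qed.

Lemma benv_body D (k n w : D -> nat) G env s u (N : D -> nat) (acc : D -> nat -> nat) :
  benv k n w G env -> bdd k n w u N ->
  bdd (D := TD N) (k \o @tag _ _) (n \o @tag _ _) (w \o @tag _ _) s
    (fun x => acc (tag x) (tagged x)) ->
  benv (D := TD N) (k \o @tag _ _) (n \o @tag _ _) (w \o @tag _ _)
    (G ++ [:: s; u; u])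
    (fun x => env (tag x) ++ [:: acc (tag x) (tagged x); nat_of_ord (tagged x); N (tag x) - tagged x]).
Proof.
move=> hE hN hs.
have -> : G ++ [:: s; u; u] = ((G ++ [:: s]) ++ [:: u]) ++ [:: u] by rewrite -!catA.
have := benv_cat (benv_cat (benv_cat (benv_tag N hE) hs) (bdd_index hN)) (bdd_rest hN).
by apply: benv_ext => d; rewrite /= -!catA.
Qed.

Lemma bdata_tag D (k n w : D -> nat) delta N : bdata k n w delta ->
  bdata (D := TD N) (k \o @tag _ _) (n \o @tag _ _) (w \o @tag _ _) (delta \o @tag _ _).
Proof. by move=> [r h]; exists r => d; apply: h. Qed.

Lemma bdd_zero D (k n w : D -> nat) : bdd k n w VK (fun=> 0).
Proof. by right; exists 0. Qed.

Lemma vt_sound e : forall D (k n w : D -> nat) G env delta,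
  (forall d, 0 < n d) -> (forall d, 0 < w d) ->
  benv k n w G env -> bdata k n w delta ->
  bdd k n w (vt G e) (fun d => eval (delta d) (env d) e).
Proof.
elim: e => [c|j|o a IHa b IHb|a IHa|a IHa b IHb|md b IHb a IHa c IHc] D k n w G env delta n0 w0 hE hD.
2: by rewrite vt_var; have [_] := hE; apply.
all: match goal with |- bdd _ _ _ (vt _ ?e) _ => have [ke|ke] := boolP (kexp G e);
  [rewrite (vt_kexp ke isT); have [r hr] := kexp_sound delta hE ke; right; exists r => d; by have [] := hr d|] end.
- by [].
- have ha := IHa _ _ _ _ _ _ _ n0 w0 hE hD.
  have hE1 := benv_cat hE ha.
  have hb := IHb _ _ _ _ _ _ _ n0 w0 hE1 hD.
  move: ke; rewrite /= => /negPf ->.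
  case: o; cbn [aval].
  + exact: bdd_add.
  + by apply: bdd_le ha => d; lia.
  + exact: bdd_mul.
  + by apply: bdd_le ha => d; apply: leq_div.
  + by apply: bdd_le ha => d; apply: leq_mod.
  + by apply: bdd_le hb => d; apply: geq_minr.
  + by right; exists 0 => d; apply: leq_trans (leq_b1 _) (ltnW (grow_gt1 _ _)).
  + by right; exists 0 => d; apply: leq_trans (leq_b1 _) (ltnW (grow_gt1 _ _)).
- by rewrite /=; have [r h] := hD; right; exists r => d; apply: h.
- have ha := IHa _ _ _ _ _ _ _ n0 w0 hE hD.
  have hE1 := benv_cat hE ha.
  by move: ke; rewrite /= => /negPf ->; apply: IHb _ _ _ _ _ _ _ n0 w0 hE1 hD.
- have hb := IHb _ _ _ _ _ _ _ n0 w0 hE hD.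
  have hE1 : benv k n w (G ++ [:: vt G b; VK]) (fun d => env d ++ [:: eval (delta d) (env d) b; 0]).
    have := benv_cat (benv_cat hE hb) (bdd_zero k n w).
    by rewrite -catA; apply: benv_ext => d; rewrite -catA.
  have ha := IHa _ _ _ _ _ _ _ n0 w0 hE1 hD.
  set x := fun d => eval (delta d) (env d) b in hb.
  set N := fun d => eval (delta d) (env d ++ _) a in ha.
  pose acc d i := loop_acc (delta d) md (env d) c (x d) (N d) i.
  (* Type [VTop] demands nothing of the accumulator, so the body can be bounded before anything is
     known about it. *)
  have hE2 := @benv_body D k n w G env VTop _ N acc hE ha (or_introl isT).
  have hc := IHc _ _ _ _ _ _ _ (fun d => n0 (tag d)) (fun d => w0 (tag d)) hE2 (bdata_tag N hD).
  pose T d i := eval (delta d) (env d ++ [:: acc d i; i; N d - i]) c.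
  have [B hB1 hB2] := @loop_bound D k n w md _ _ _ x N acc T n0 w0 (fun d => erefl)
    (fun d i _ => loop_accS _ _ _ _ _ _ _) hb ha hc.
  move: ke; rewrite [kexp _ _]/= [vt _ _]/= => /negPf ->.
  apply: bdd_le hB1 => d; exact: hB2 (leqnn _).
Qed.

Definition cbdd D (k n w : D -> nat) (c : nat * nat) (f : D -> nat) : Prop :=
  bdd k n w (VP c.1 c.2) f.

(** Closed upwards in [V], so that the demands of several parts are met together by the largest of
    their ranks. *)
Definition bsafe D (k n w : D -> nat) (P : D -> nat -> Prop) : Prop :=
  exists r, forall d V, bnd (k d) (n d) (w d) r VBig <= V -> P d V.

Lemma bsafe_and D (k n w : D -> nat) (P Q : D -> nat -> Prop) :
  (forall d, 0 < n d) -> (forall d, 0 < w d) ->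
  bsafe k n w P -> bsafe k n w Q -> bsafe k n w (fun d V => P d V /\ Q d V).
Proof.
move=> n0 w0 [r hr] [s hs]; exists (maxn r s) => d V h.
have h1 := @bnd_mono_rank D k n w n0 w0 VBig r (maxn r s) d (leq_maxl _ _).
have h2 := @bnd_mono_rank D k n w n0 w0 VBig s (maxn r s) d (leq_maxr _ _).
by split; [apply: hr|apply: hs]; apply: leq_trans h.
Qed.

Lemma bsafe_imp D (k n w : D -> nat) (P Q : D -> nat -> Prop) :
  (forall d V, P d V -> Q d V) -> bsafe k n w P -> bsafe k n w Q.
Proof. by move=> h [r hr]; exists r => d V /hr /h. Qed.

Lemma bsafe_bdd D (k n w : D -> nat) t f :
  (forall d, 0 < n d) -> (forall d, 0 < w d) -> ~~ isTop t ->
  bdd k n w t f -> bsafe k n w (fun d V => f d <= V).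
Proof.
move=> n0 w0 tT /(bdd_big n0 w0 tT) [//|[r h]].
by exists r => d V; apply: leq_trans.
Qed.

Lemma bsafe_body D (k n w : D -> nat) N (P : forall d, nat -> nat -> Prop) :
  bsafe (D := TD N) (k \o @tag _ _) (n \o @tag _ _) (w \o @tag _ _)
    (fun x V => P (tag x) (tagged x) V) ->
  bsafe k n w (fun d V => forall i, i < N d -> P d i V).
Proof. by move=> [r h]; exists r => d V hV i iN; apply: (h (existT _ d (Ordinal iN))). Qed.

Lemma cmax_some x y c : cmax x y = Some c ->
  exists c1 c2, [/\ x = Some c1, y = Some c2, c1.1 <= c.1, c1.2 <= c.2 & (c2.1 <= c.1) && (c2.2 <= c.2)].
Proof.
case: x => // -[a b]; case: y => // -[a' b'] [<-].
by exists (a, b), (a', b'); rewrite /= !leq_max !leqnn !orbT.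
Qed.

Lemma cbdd_leq D (k n w : D -> nat) c f g : (forall d, f d <= g d) ->
  cbdd k n w c g -> cbdd k n w c f.
Proof. exact: bdd_le. Qed.

Lemma cbdd_le D (k n w : D -> nat) c1 c f : (forall d, 0 < n d) ->
  c1.1 <= c.1 -> c1.2 <= c.2 -> cbdd k n w c1 f -> cbdd k n w c f.
Proof. by move=> n0 h1 h2; apply: bdd_PP. Qed.

Lemma cbdd_add D (k n w : D -> nat) c f g : (forall d, 0 < n d) -> (forall d, 0 < w d) ->
  cbdd k n w c f -> cbdd k n w c g -> cbdd k n w c (fun d => f d + g d).
Proof. by move=> n0 w0 h1 h2; have := bdd_add n0 w0 h1 h2; rewrite /= !maxnn. Qed.

Lemma cbdd_cst D (k n w : D -> nat) c x : (forall d, 0 < n d) -> (forall d, 0 < w d) ->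
  cbdd k n w c (fun=> x).
Proof.
move=> n0 w0; apply: (@bdd_toP _ _ _ _ n0 w0 VK) => //; right; exists x => d.
by apply: leq_trans (ltnW (grow_rank_ge _)) (grow_mono _ _).
Qed.

Lemma cbdd_loop D (k n w : D -> nat) u c0 c (N : D -> nat) (g : forall d, nat -> nat) :
  (forall d, 0 < n d) -> (forall d, 0 < w d) -> bdd k n w u N ->
  ccount u (Some c0) = Some c ->
  cbdd (D := TD N) (k \o @tag _ _) (n \o @tag _ _) (w \o @tag _ _) c0
    (fun x => g (tag x) (tagged x)) ->
  cbdd k n w c (fun d => \sum_(i < N d) (g d i).+1).
Proof.
move=> n0 w0 hN hc hg.
have {}hg : cbdd (D := TD N) (k \o @tag _ _) (n \o @tag _ _) (w \o @tag _ _) c0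
    (fun x => (g (tag x) (tagged x)).+1).
  have n0' (x : TD N) : 0 < (n \o @tag _ _) x by apply: n0.
  have w0' (x : TD N) : 0 < (w \o @tag _ _) x by apply: w0.
  apply: cbdd_leq (cbdd_add n0' w0' hg (cbdd_cst _ _ 1 n0' w0')) => x.
  by rewrite addn1.
have := @bdd_sum D k n w N n0 w0 u _ (fun d i => (g d i).+1) hN hg; case: u hN hc => [||j q||] //= hN; case: c0 hg => a b hg [<-] //.
Qed.

Lemma ct_top G e : ~~ kexp G e -> isTop (vt G e) -> ct G e = None.
Proof. by case: e => [c|j|o a b|a|a b|md b a c] h1 h2; cbn [ct]; rewrite (negPf h1) h2. Qed.

Lemma ct_loop G md b a c : ~~ kexp G (ELoop md b a c) ->
  ~~ isTop (vt G (ELoop md b a c)) -> ct G (ELoop md b a c) =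
  let u := vt (G ++ [:: vt G b; VK]) a in
  cmax (cmax (ct G b) (ct (G ++ [:: vt G b; VK]) a))
       (ccount u (ct (G ++ [:: vt G (ELoop md b a c); u; u]) c)).
Proof. by move=> h1 h2; cbn [ct]; rewrite (negPf h1) (negPf h2). Qed.

Lemma ccount_some u x c : ccount u x = Some c -> exists c0, x = Some c0.
Proof. by case: x => [c0 _|]; [exists c0|case: u]. Qed.

Lemma ct_sound e : forall D (k n w : D -> nat) G env delta c,
  (forall d, 0 < n d) -> (forall d, 0 < w d) ->
  benv k n w G env -> bdata k n w delta -> ct G e = Some c ->
  cbdd k n w c (fun d => steps (delta d) (env d) e) /\
  bsafe k n w (fun d V => safe (delta d) V (env d) e).
Proof.
elim: e => [c|j|o a IHa b IHb|a IHa|a IHa b IHb|md b IHb a IHa c IHc] D k n w G env delta cc n0 w0 hE hD.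
(* Expressions in variables bounded by [k] are settled by [kexp_sound]; those of unknown size
   contradict the assumption that there is a cost. *)
all: match goal with |- ct _ ?e = _ -> _ => have [ke|ke] := boolP (kexp G e);
  [rewrite (ct_kexp ke) => -[<-]; have [r hr] := kexp_sound delta hE ke; split;
   [ apply: (@bdd_toP _ _ _ _ n0 w0 VK) => //; right; exists r => d; by have [] := hr d
   | have [] := @bdd_big _ _ _ _ n0 w0 VK (fun d => grow r (k d)) isT (or_intror (ex_intro _ r (fun d => leqnn _))) => // -[s hs];
     exists s => d V hV; have [_ _ h] := hr d; exact: safe_le (leq_trans (hs d) hV) h ]
  |]; have ht := @vt_sound e D k n w G env delta n0 w0 hE hD;
  have [tt|ntop] := boolP (isTop (vt G e)); [by rewrite (ct_top ke tt)|] end.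
- by [].
- cbn [ct]; rewrite (negPf ke) (negPf ntop) => -[<-].
  by split; [exact: cbdd_cst|exact: bsafe_bdd ht].
- have ha := @vt_sound a _ _ _ _ _ _ _ n0 w0 hE hD.
  have hE1 := benv_cat hE ha.
  cbn [ct]; rewrite (negPf ke) (negPf ntop).
  move=> /cmax_some [c1 [c2 [e1 e2 h1 h2 /andP [h3 h4]]]].
  have [A1 A2] := IHa _ _ _ _ _ _ _ _ n0 w0 hE hD e1.
  have [B1 B2] := IHb _ _ _ _ _ _ _ _ n0 w0 hE1 hD e2.
  split.
    apply: cbdd_leq (cbdd_add n0 w0 (cbdd_add n0 w0 (cbdd_le n0 h1 h2 A1) (cbdd_le n0 h3 h4 B1)) (cbdd_cst k cc 1 n0 w0)).
    by move=> d; rewrite stepsE.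
  apply: bsafe_imp (bsafe_and n0 w0 (bsafe_and n0 w0 A2 B2) (bsafe_bdd n0 w0 ntop ht)).
  by move=> d V [[? ?] ?]; apply/safe_op.
- cbn [ct]; rewrite (negPf ke) (negPf ntop) => e1.
  have [A1 A2] := IHa _ _ _ _ _ _ _ _ n0 w0 hE hD e1.
  split.
    by apply: cbdd_leq (cbdd_add n0 w0 A1 (cbdd_cst k cc 1 n0 w0)) => d; rewrite stepsE.
  apply: bsafe_imp (bsafe_and n0 w0 A2 (bsafe_bdd n0 w0 ntop ht)).
  by move=> d V [? ?]; apply/safe_read.
- have ha := @vt_sound a _ _ _ _ _ _ _ n0 w0 hE hD.
  have hE1 := benv_cat hE ha.
  cbn [ct]; rewrite (negPf ke) (negPf ntop).
  move=> /cmax_some [c1 [c2 [e1 e2 h1 h2 /andP [h3 h4]]]].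
  have [A1 A2] := IHa _ _ _ _ _ _ _ _ n0 w0 hE hD e1.
  have [B1 B2] := IHb _ _ _ _ _ _ _ _ n0 w0 hE1 hD e2.
  split.
    apply: cbdd_leq (cbdd_add n0 w0 (cbdd_add n0 w0 (cbdd_le n0 h1 h2 A1) (cbdd_le n0 h3 h4 B1)) (cbdd_cst k cc 1 n0 w0)).
    by move=> d; rewrite stepsE.
  by apply: bsafe_imp (bsafe_and n0 w0 A2 B2) => d V [? ?]; apply/safe_let.
have hb := @vt_sound b _ _ _ _ _ _ _ n0 w0 hE hD.
have hE1 : benv k n w (G ++ [:: vt G b; VK]) (fun d => env d ++ [:: eval (delta d) (env d) b; 0]).
  have := benv_cat (benv_cat hE hb) (bdd_zero k n w).
  by rewrite -catA; apply: benv_ext => d; rewrite -catA.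
have ha := @vt_sound a _ _ _ _ _ _ _ n0 w0 hE1 hD.
set x := fun d => eval (delta d) (env d) b in hb.
set N := fun d => eval (delta d) (env d ++ _) a in ha.
pose acc d i := loop_acc (delta d) md (env d) c (x d) (N d) i.
pose T d i := eval (delta d) (env d ++ [:: acc d i; i; N d - i]) c.
have [B hB1 hB2] : exists2 B, bdd k n w (vt G (ELoop md b a c)) B &
    forall d i, i <= N d -> acc d i <= B d.
  have hE2 := @benv_body D k n w G env VTop _ N acc hE ha (or_introl isT).
  have hc := @vt_sound c _ _ _ _ _ _ _ (fun d => n0 (tag d)) (fun d => w0 (tag d)) hE2 (bdata_tag N hD).
  have [B hB1 hB2] := @loop_bound D k n w md _ _ _ x N acc T n0 w0 (fun d => erefl)
    (fun d i _ => loop_accS _ _ _ _ _ _ _) hb ha hc.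
  by exists B => //; move: ke; rewrite [kexp _ _]/= [vt _ _]/= => /negPf ->.
rewrite (ct_loop ke ntop); cbv zeta.
set u := vt (G ++ [:: vt G b; VK]) a in ha *.
move=> /cmax_some [c1 [c2 [/cmax_some [c3 [c4 [e3 e4 h5 h6 /andP [h7 h8]]]] e2 h1 h2 /andP [h3 h4]]]].
have [c5 e5] := ccount_some e2; rewrite e5 in e2.
(* The second pass: with the accumulator bounded by the type of the loop, the cost of the body can
   be estimated. *)
have hacc : bdd (D := TD N) (k \o @tag _ _) (n \o @tag _ _) (w \o @tag _ _)
    (vt G (ELoop md b a c)) (fun y => acc (tag y) (tagged y)).
  apply: bdd_le (bdd_tag N hB1) => y.
  exact: hB2 (ltnW (ltn_ord _)).
have hE2 := @benv_body D k n w G env _ _ N acc hE ha hacc.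
have [B1 B2] := IHb _ _ _ _ _ _ _ _ n0 w0 hE hD e3.
have [A1 A2] := IHa _ _ _ _ _ _ _ _ n0 w0 hE1 hD e4.
have [C1 C2] := IHc _ _ _ _ _ _ _ _ (fun d => n0 (tag d)) (fun d => w0 (tag d)) hE2 (bdata_tag N hD) e5.
have C3 := @cbdd_loop D k n w u c5 c2 N
  (fun d i => steps (delta d) (env d ++ [:: acc d i; i; N d - i]) c) n0 w0 ha e2 C1.
split.
  have {}B1 := cbdd_le n0 h1 h2 (cbdd_le n0 h5 h6 B1).
  have {}A1 := cbdd_le n0 h1 h2 (cbdd_le n0 h7 h8 A1).
  have {}C3 := cbdd_le n0 h3 h4 C3.
  apply: cbdd_leq (cbdd_add n0 w0 (cbdd_add n0 w0 (cbdd_add n0 w0 B1 A1) (cbdd_cst k cc 1 n0 w0)) C3).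
  by move=> d; rewrite steps_loop.
have S1 := @bsafe_body D k n w N (fun d i V => safe (delta d) V (env d ++ [:: acc d i; i; N d - i]) c) C2.
have S2 := bsafe_bdd n0 w0 ntop hB1.
apply: bsafe_imp (bsafe_and n0 w0 (bsafe_and n0 w0 B2 A2) (bsafe_and n0 w0 S1 S2)).
move=> d V [[s1 s2] [s3 s4]]; apply/safe_loop; split=> // i iN; split; first exact: s3.
exact: leq_trans (hB2 d i.+1 iN) s4.
Qed.

(** * Cost of statements *)

(* Every stored value must be clipped at the value of variable 2. *)
Definition clipped (e : expr) : bool :=
  if e is EOp AMin _ (EVar 2) then true else false.

Fixpoint sclipped (s : stmt) : bool :=
  match s with
  | SStore _ b => clipped b
  | SSeq s1 s2 => sclipped s1 && sclipped s2
  | SLet _ s | SFor _ s => sclipped s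
  end.

Fixpoint sct (G : seq vtype) (s : stmt) : option (nat * nat) :=
  match s with
  | SStore a b => cmax (ct G a) (ct (G ++ [:: vt G a]) b)
  | SSeq s1 s2 => cmax (sct G s1) (sct G s2)
  | SLet a s => cmax (ct G a) (sct (G ++ [:: vt G a]) s)
  | SFor a s =>
      let u := vt (G ++ [:: VK]) a in
      cmax (ct (G ++ [:: VK]) a) (ccount u (sct (G ++ [:: u; u]) s))
  end.

Lemma nth2_cat (env l : seq nat) : 2 < size env -> nth 0 (env ++ l) 2 = nth 0 env 2.
Proof. by move=> h; rewrite nth_cat h. Qed.

(** This invariant keeps the type [VP 1 0] of a read sound while the data change. *)
Lemma srun_le s env delta : sclipped s -> 2 < size env ->
  (forall a, delta a <= nth 0 env 2) -> forall a, srun env s delta a <= nth 0 env 2.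
Proof.
elim: s env delta => [a b|s1 IH1 s2 IH2|a s IHs|a s IHs] env delta /=.
- case: b => // -[] // b1 [] // [|[|[|]]] // _ h2 hd x; rewrite /update.
  case: eqP => // _ /=; rewrite !nth2_cat ?size_cat ?ltn_addr //.
  exact: geq_minr.
- move=> /andP [c1 c2] h2 hd a; apply: IH2 => // x; exact: IH1.
- move=> c h2 hd x; rewrite -(nth2_cat [:: eval delta env a] h2); apply: IHs => //.
    by rewrite size_cat ltn_addr.
  by move=> y; rewrite nth2_cat.
- move=> c h2 hd; set N := eval _ _ a; elim: {1}N => [|m IH] //= x.
  rewrite -(nth2_cat [:: m; N - m] h2); apply: IHs => //.
    by rewrite size_cat ltn_addr.
  by move=> y; rewrite nth2_cat.
Qed.

Lemma for_state_le s env delta N i : sclipped s -> 2 < size env ->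
  (forall a, delta a <= nth 0 env 2) -> forall a, for_state env s N delta i a <= nth 0 env 2.
Proof.
move=> c h2 hd; elim: i => [|i IH] //= x; rewrite /for_state /=.
rewrite -(nth2_cat [:: i; N - i] h2); apply: srun_le => //.
  by rewrite size_cat ltn_addr.
by move=> y; rewrite nth2_cat //; exact: IH.
Qed.

Lemma bdata_le D (k n w : D -> nat) env (delta : D -> nat -> nat) :
  bdd k n w (VP 1 0) (fun d => nth 0 (env d) 2) ->
  (forall d a, delta d a <= nth 0 (env d) 2) -> bdata k n w delta.
Proof. by move=> [//|[r h]] hd; exists r => d a; apply: leq_trans (hd d a) (h d). Qed.

Lemma sct_sound s : forall D (k n w : D -> nat) G env delta c,
  (forall d, 0 < n d) -> (forall d, 0 < w d) -> 2 < size G -> sclipped s ->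
  benv k n w G env -> bdd k n w (VP 1 0) (fun d => nth 0 (env d) 2) ->
  (forall d a, delta d a <= nth 0 (env d) 2) -> sct G s = Some c ->
  cbdd k n w c (fun d => ssteps (env d) s (delta d)) /\
  bsafe k n w (fun d V => ssafe V (env d) s (delta d)).
Proof.
elim: s => [a b|s1 IH1 s2 IH2|a s IHs|a s IHs] D k n w G env delta cc n0 w0 G2 cl hE h2 hd.
- have hD := bdata_le h2 hd.
  have ha := @vt_sound a _ _ _ _ _ _ _ n0 w0 hE hD.
  have hE1 := benv_cat hE ha.
  move=> /cmax_some [c1 [c2 [e1 e2 h3 h4 /andP [h5 h6]]]].
  have [A1 A2] := @ct_sound a _ _ _ _ _ _ _ _ n0 w0 hE hD e1.
  have [B1 B2] := @ct_sound b _ _ _ _ _ _ _ _ n0 w0 hE1 hD e2.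
  split.
    apply: cbdd_leq (cbdd_add n0 w0 (cbdd_add n0 w0 (cbdd_le n0 h3 h4 A1) (cbdd_le n0 h5 h6 B1)) (cbdd_cst k cc 1 n0 w0)).
    by move=> d; rewrite ssteps_store.
  by apply: bsafe_imp (bsafe_and n0 w0 A2 B2) => d V [? ?]; apply/ssafe_store.
- move: cl => /= /andP [cl1 cl2].
  move=> /cmax_some [c1 [c2 [e1 e2 h3 h4 /andP [h5 h6]]]].
  have [A1 A2] := IH1 _ _ _ _ _ _ _ _ n0 w0 G2 cl1 hE h2 hd e1.
  have hd1 d a : srun (env d) s1 (delta d) a <= nth 0 (env d) 2.
    by apply: srun_le => //; have [-> _] := hE.
  have [B1 B2] := IH2 _ _ _ _ _ _ _ _ n0 w0 G2 cl2 hE h2 hd1 e2.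
  split.
    apply: cbdd_leq (cbdd_add n0 w0 (cbdd_le n0 h3 h4 A1) (cbdd_le n0 h5 h6 B1)).
    by move=> d; rewrite ssteps_seq.
  by apply: bsafe_imp (bsafe_and n0 w0 A2 B2) => d V [? ?]; apply/ssafe_seq.
- have hD := bdata_le h2 hd.
  have ha := @vt_sound a _ _ _ _ _ _ _ n0 w0 hE hD.
  have hE1 := benv_cat hE ha.
  move=> /cmax_some [c1 [c2 [e1 e2 h3 h4 /andP [h5 h6]]]].
  have [A1 A2] := @ct_sound a _ _ _ _ _ _ _ _ n0 w0 hE hD e1.
  have n2 d l : nth 0 (env d ++ l) 2 = nth 0 (env d) 2.
    by apply: nth2_cat; have [-> _] := hE.
  have [||| B1 B2] := IHs _ _ _ _ _ _ delta _ n0 w0 _ cl hE1 _ _ e2.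
  + by rewrite size_cat ltn_addr.
  + by apply: bdd_le h2 => d; rewrite n2.
  + by move=> d x; rewrite n2.
  split.
    apply: cbdd_leq (cbdd_add n0 w0 (cbdd_le n0 h3 h4 A1) (cbdd_le n0 h5 h6 B1)).
    by move=> d; rewrite ssteps_let.
  by apply: bsafe_imp (bsafe_and n0 w0 A2 B2) => d V [? ?]; apply/ssafe_let.
have hD := bdata_le h2 hd.
have hE1 := benv_cat hE (bdd_zero k n w).
have ha := @vt_sound a _ _ _ _ _ _ _ n0 w0 hE1 hD.
cbn [sct]; cbv zeta.
set u := vt _ a in ha *; set N := fun d => eval _ _ a in ha.
move=> /cmax_some [c1 [c2 [e1 e2 h3 h4 /andP [h5 h6]]]].
have [c5 e5] := ccount_some e2; rewrite e5 in e2.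
have [A1 A2] := @ct_sound a _ _ _ _ _ _ _ _ n0 w0 hE1 hD e1.
have n2 d l : nth 0 (env d ++ l) 2 = nth 0 (env d) 2.
  by apply: nth2_cat; have [-> _] := hE.
have hE2 : benv (D := TD N) (k \o @tag _ _) (n \o @tag _ _) (w \o @tag _ _)
    (G ++ [:: u; u])
    (fun x => env (tag x) ++ [:: nat_of_ord (tagged x); N (tag x) - tagged x]).
  have := benv_cat (benv_cat (benv_tag N hE) (bdd_index ha)) (bdd_rest ha).
  by rewrite -catA; apply: benv_ext => d; rewrite /= -!catA.
have [||| B1 B2] := IHs _ _ _ _ _ _
    (fun x : TD N => for_state (env (tag x)) s (N (tag x)) (delta (tag x)) (tagged x)) _
    (fun d => n0 (tag d)) (fun d => w0 (tag d)) _ cl hE2 _ _ e5.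
- by rewrite size_cat ltn_addr.
- by apply: bdd_le (bdd_tag N h2) => d; rewrite n2.
- move=> d x; rewrite n2; apply: for_state_le => //.
  by have [-> _] := hE.
have B3 := @cbdd_loop D k n w u c5 c2 N
  (fun d i => ssteps (env d ++ [:: i; N d - i]) s (for_state (env d) s (N d) (delta d) i)) n0 w0 ha e2 B1.
split.
  apply: cbdd_leq (cbdd_add n0 w0 (cbdd_add n0 w0 (cbdd_le n0 h3 h4 A1) (cbdd_cst k cc 1 n0 w0)) (cbdd_le n0 h5 h6 B3)).
  by move=> d; rewrite ssteps_for.
have S1 := @bsafe_body D k n w N (fun d i V => ssafe V (env d ++ [:: i; N d - i]) s
   (for_state (env d) s (N d) (delta d) i)) B2.
by apply: bsafe_imp (bsafe_and n0 w0 A2 S1) => d V [? ?]; apply/ssafe_for.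
Qed.
(** * Plans for placing the pattern *)

(** Every vertex of a path from [x] to [y] lies between them in the sense of [hU], so the same path
    works. *)
Lemma connect_sub_restrict (T : finType) (e : rel T) (U : pred T) x y :
  (forall z, connect e x z -> connect e z y -> U z) ->
  connect e x y -> connect [rel a b | e a b && U b] x y.
Proof.
move=> hU /connectP [p]; elim: p x hU => [|z p IH] x hU /=; first by move=> _ ->.
move=> /andP [xz pz] ly.
have zy : connect e z y by apply/connectP; exists p.
apply: (@connect_trans _ _ z).
  by apply: connect1; rewrite /= xz hU // connect1.
apply: IH => // t zt ty; apply: hU => //; exact: connect_trans (connect1 xz) zt.
Qed.

Section Plan.
Variables (k : nat) (e : rel 'I_k).

(* [lev] is the stage in which a vertex is placed (0: reached from the base set,
   1: reached from the root of its piece, 2: alone), [rt] the root of its piece,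
   [an] the vertex from which it is reached, and [ix] numbers the base set. *)
Record plan := Plan {
  lev : 'I_k -> nat;
  rt : 'I_k -> 'I_k;
  an : 'I_k -> 'I_k;
  ix : 'I_k -> nat
}.

(** The vertices placed together with [v]: stage 0 is placed as a whole, the later stages piece by
    piece. *)
Definition group (P : plan) (v : 'I_k) : pred 'I_k :=
  fun u => (lev P u == lev P v) && ((lev P v == 0) || (rt P u == rt P v)).

(** The clause on [ix] limits the anchors of stage 0 to [k / 4], by injectivity in the last one. The
    rest of the last clause is what makes placements independent: outside stage 0 related vertices
    share a piece, and two distinct leaves are never related. *)
Definition good_plan (P : plan) : Prop :=
  [/\ forall v, lev P v <= 2,
      forall v, lev P v = 0 -> lev P (an P v) = 0 /\ an P (an P v) = an P v
        /\ ix P (an P v) < k %/ 4,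
      forall v, lev P v != 0 -> [/\ lev P (rt P v) = 1, rt P (rt P v) = rt P v
        & lev P v = 1 -> an P v = rt P v],
      forall v, lev P v != 2 -> connect [rel a b | e a b && group P v b] (an P v) v &
      (forall u v, lev P u = 0 -> lev P v = 0 -> an P u = u -> an P v = v ->
         ix P u = ix P v -> u = v) /\
      forall u v, e u v -> lev P u != 0 -> lev P v != 0 ->
        rt P u = rt P v /\ (lev P u = 2 -> lev P v = 2 -> u = v)].

Let spans (S : {set 'I_k}) := [forall v, exists s in S, connect e s v].

(** In an inclusion-minimal spanning set, a member reached from another one could be dropped. *)
Lemma minimal_span : exists2 S : {set 'I_k}, forall v, exists2 s, s \in S & connect e s v &
  {in S &, forall s t, connect e s t -> s = t}.
Proof.
have spT : spans setT by apply/forallP => v; apply/exists_inP; exists v; rewrite ?inE.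
have [S /minsetP [spS minS] _] := minset_exists spT.
exists S; first by move=> v; apply/exists_inP; exact: (forallP spS).
move=> s t sS tS st; apply/eqP/negPn/negP => nst.
have : S :\ t = S.
  apply: minS; last exact: subsetDl.
  apply/forallP => v; have /exists_inP [u uS uv] := forallP spS v.
  apply/exists_inP; have [ut|ut] := eqVneq u t.
    by exists s; [rewrite !inE nst|rewrite ut in uv; apply: connect_trans uv].
  by exists u; rewrite // !inE ut.
by move=> h; have := tS; rewrite -h !inE eqxx.
Qed.

Variable S : {set 'I_k}.
Hypothesis spanS : forall v, exists2 s, s \in S & connect e s v.
Hypothesis antiS : {in S &, forall s t, connect e s t -> s = t}.

Definition reachset (B : {set 'I_k}) := [set v | [exists b in B, connect e b v]].
Definition resid (B : {set 'I_k}) (s : 'I_k) :=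
  [set v | [&& v \notin S, connect e s v & v \notin reachset B]].
(* The base set is taken maximal with [4 * #|B| + potential B <= k]: then no further
   vertex lowers the potential by 4 or more. *)
Definition potential (B : {set 'I_k}) :=
  #|[set v | (v \notin S) && (v \notin reachset B)]| + #|[set s in S | 1 < #|resid B s|]|.

Lemma reachsetU s B v : (v \in reachset (s |: B)) = connect e s v || (v \in reachset B).
Proof.
rewrite !inE; apply/exists_inP/orP => [[b]|[sv|/exists_inP [b bB bv]]].
- by rewrite !inE => /orP [/eqP ->|bB] bv; [left|right; apply/exists_inP; exists b].
- by exists s; rewrite // !inE eqxx.
- by exists b; rewrite // !inE bB orbT.
Qed.

Lemma resid_sub s B t : resid (s |: B) t = resid B t :\: resid B s.
Proof.
apply/setP => v; rewrite !inE -/(v \in reachset _).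
have -> : [exists b in s |: B, connect e b v] = (v \in reachset (s |: B)) by rewrite inE.
have -> : [exists b in B, connect e b v] = (v \in reachset B) by rewrite inE.
rewrite reachsetU; case: (v \in S) => //=; case: (connect e s v); case: (connect e t v) => //=;
  by case: (v \in reachset B).
Qed.

(** Adding [s] reaches the whole residue of [s], and the sources in [X] cease to count. *)
Lemma potential_drop s B (X : {set 'I_k}) :
  X \subset [set t in S | 1 < #|resid B t|] ->
  {in X, forall t, #|resid (s |: B) t| <= 1} ->
  potential (s |: B) + #|resid B s| + #|X| <= potential B.
Proof.
move=> sX hX; rewrite /potential.
have -> : #|[set v | (v \notin S) && (v \notin reachset B)]| =
    #|[set v | (v \notin S) && (v \notin reachset (s |: B))]| + #|resid B s|.
  rewrite -cardsUI.
  have -> : [set v | (v \notin S) && (v \notin reachset (s |: B))] :&: resid B s = set0.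
    apply/setP => v; rewrite in_setI !inE -/(v \in reachset _).
    have -> : [exists b in s |: B, connect e b v] = (v \in reachset (s |: B)) by rewrite inE.
    by rewrite reachsetU; case: (connect e s v); rewrite ?andbF //= ?andbF.
  rewrite cards0 addn0; congr #|pred_of_set _|; apply/setP => v.
  rewrite in_setU !in_set -!/(v \in reachset _).
  have -> : [exists b in s |: B, connect e b v] = (v \in reachset (s |: B)) by rewrite inE.
  have -> : [exists b in B, connect e b v] = (v \in reachset B) by rewrite inE.
  by rewrite reachsetU; case: (v \in S); case: (connect e s v); case: (v \in reachset B).
have : #|[set t in S | 1 < #|resid (s |: B) t|]| + #|X| <= #|[set t in S | 1 < #|resid B t|]|.
  rewrite -cardsUI; have -> : [set t in S | 1 < #|resid (s |: B) t|] :&: X = set0.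
    apply/setP => t; rewrite !inE; apply/negbTE; rewrite -andbA.
    apply/negP => /and3P [_ h1 h2]; have := hX t h2; lia.
  rewrite cards0 addn0; apply: subset_leq_card; rewrite subUset sX andbT.
  apply/subsetP => t; rewrite !inE => /andP [-> h] /=; apply: leq_trans h _.
  by rewrite resid_sub; apply: subset_leq_card; apply: subsetDl.
by lia.
Qed.

(** The empty set qualifies, its potential being at most the number of non-sources plus that of
    sources. By maximality every new source lowers the potential by less than 4. A residue of three
    vertices would save three units and one more for its source; two residues of two vertices with a
    common element would save two units and one for each of the two sources. *)
Lemma good_base : exists B : {set 'I_k},
  [/\ B \subset S, 4 * #|B| <= k, {in S, forall s, #|resid B s| <= 2} &
      {in S &, forall s t, 1 < #|resid B s| -> 1 < #|resid B t| ->
         resid B s :&: resid B t != set0 -> s = t}].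
Proof.
pose good (B : {set 'I_k}) := (B \subset S) && (4 * #|B| + potential B <= k).
have good0 : good set0.
  rewrite /good sub0set cards0 muln0 add0n /=.
  have : #|[set v | (v \notin S) && (v \notin reachset set0)]| <= #|~: S|.
    by apply: subset_leq_card; apply/subsetP => v; rewrite !inE => /andP [].
  have : #|[set s in S | 1 < #|resid set0 s|]| <= #|S|.
    by apply: subset_leq_card; apply/subsetP => v; rewrite !inE => /andP [].
  by have := cardsC S; rewrite card_ord /potential; lia.
have [B /maxsetP [/andP [BS gB] maxB] _] := maxset_exists good0.
have resB s : s \in B -> resid B s = set0.
  move=> sB; apply/setP => v; rewrite !inE; apply/negbTE/negP => /and3P [_ sv /negP]; apply.
  by apply/exists_inP; exists s.
have drop s (X : {set 'I_k}) : s \in S -> s \notin B ->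
    X \subset [set t in S | 1 < #|resid B t|] ->
    {in X, forall t, #|resid (s |: B) t| <= 1} -> #|resid B s| + #|X| < 4.
  move=> sS sB h1 h2; have := potential_drop h1 h2.
  have ng : ~~ good (s |: B).
    apply/negP => g; have := maxB _ g (subsetUr _ _) => h.
    by move: sB; rewrite -h !inE eqxx.
  move: ng; rewrite /good subUset sub1set sS BS /= -ltnNge cardsU1 sB; lia.
have selfdrop s : #|resid (s |: B) s| = 0 by rewrite resid_sub setDv cards0.
have le2 : {in S, forall s, #|resid B s| <= 2}.
  move=> s sS; have [/resB ->|sB] := boolP (s \in B); first by rewrite cards0.
  rewrite leqNgt; apply/negP => h.
  have : #|resid B s| + #|[set s]| < 4.
    apply: drop => //; first by rewrite sub1set inE sS; lia.
    by move=> t /set1P ->; rewrite selfdrop.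
  by rewrite cards1; lia.
exists B; split=> //; first by apply: leq_trans gB; apply: leq_addr.
move=> s t sS tS hs ht /set0Pn [v]; rewrite inE => /andP [vs vt].
have sB : s \notin B by apply: contraL hs => /resB ->; rewrite cards0.
apply/eqP/negPn/negP => nst.
have : #|resid B s| + #|[set s; t]| < 4.
  apply: drop => //.
    by apply/subsetP => u; rewrite !inE => /orP [] /eqP ->; rewrite ?sS ?tS.
  move=> u; rewrite !inE => /orP [/eqP ->|/eqP ->]; first by rewrite selfdrop.
  rewrite resid_sub -ltnS; apply: (@leq_ltn_trans #|resid B t :\ v|).
    by apply: subset_leq_card; apply: setDS; rewrite sub1set.
  by have := cardsD1 v (resid B t); rewrite vt; have := le2 t tS; lia.
by rewrite cards2 nst; lia.
Qed.

End Plan.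

(** Beyond what [B] reaches, a source with two residual vertices is the root of the piece containing
    them, and any other non-source is a root itself. A source with exactly one residual vertex
    becomes a leaf in the piece of that vertex; a source with none is a piece of its own. Leaves are
    sources, hence unrelated. *)
Lemma plan_exists (k : nat) (e : rel 'I_k) : exists P, good_plan e P.
Proof.
have [S spanS antiS] := minimal_span e.
have [B [BS cB le2 disj]] := @good_base k e S.
pose A0 := reachset e B; pose N := resid e S B.
have memN v s : (v \in N s) = [&& v \notin S, connect e s v & v \notin A0] by rewrite inE.
have A0P v : reflect (exists2 b, b \in B & connect e b v) (v \in A0).
  by rewrite inE; apply: exists_inP.
have A0_closed u v : u \in A0 -> connect e u v -> v \in A0.
  by move=> /A0P [b bB bu] uv; apply/A0P; exists b => //; apply: connect_trans uv.
have SA0 s : s \in S -> (s \in A0) = (s \in B).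
  move=> sS; apply/A0P/idP => [[b bB /antiS bs]|sB]; last by exists s.
  by rewrite -bs // (subsetP BS).
have NB s : s \in B -> N s = set0.
  move=> sB; apply/setP => v; rewrite memN in_set0; apply/negbTE/negP => /and3P [_ sv /negP]; apply.
  by apply/A0P; exists s.
have N_notA0 s x : s \in S -> x \in N s -> s \notin A0.
  by move=> sS xs; rewrite SA0 //; apply: contraL xs => /NB ->; rewrite inE.
(* At most one source qualifies, since residues of two vertices do not overlap. *)
pose src2 x := [pick s in S | (1 < #|N s|) && (x \in N s)].
pose rtN x := if src2 x is Some s then s else x.
have rtNP s x : s \in S -> 1 < #|N s| -> x \in N s -> rtN x = s.
  move=> sS s2 xs; rewrite /rtN /src2; case: pickP => [t /and3P [tS t2 xt]|/(_ s)]; last by rewrite sS s2 xs.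
  by apply: disj => //; apply/set0Pn; exists x; rewrite inE xt.
pose sngl s := if [pick x in N s] is Some x then x else s.
pose rt v := if v \in S then (if #|N v| == 1 then rtN (sngl v) else v) else rtN v.
pose lev v := if v \in A0 then 0 else if (v \in S) && (#|N v| == 1) then 2 else 1.
pose anB v := if [pick b in B | connect e b v] is Some b then b else v.
pose an v := if v \in A0 then anB v else if lev v == 2 then v else rt v.
pose ix v := index v (enum B).
have lev0 v : (lev v == 0) = (v \in A0) by rewrite /lev; case: ifP => //; case: ifP.
have anBP v : v \in A0 -> anB v \in B /\ connect e (anB v) v.
  by move=> /A0P [b bB bv]; rewrite /anB; case: pickP => [c /andP [] //|/(_ b)]; rewrite bB bv.
have BA0 b : b \in B -> b \in A0 by move=> bB; apply/A0P; exists b.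
have anBB b : b \in B -> anB b = b.
  move=> bB; have [h1 h2] := anBP b (BA0 b bB).
  by apply: antiS h2; apply: (subsetP BS).
have snglP s x : s \in S -> #|N s| == 1 -> x \in N s -> sngl s = x.
  move=> sS /cards1P [y Ns]; rewrite /sngl Ns inE => /eqP ->.
  by case: pickP => [z|/(_ y)]; rewrite inE ?eqxx // => /eqP.
have rt_key s x : s \in S -> x \in N s -> rt s = rt x.
  move=> sS xs; have := xs; rewrite memN => /and3P [xS _ _].
  rewrite /rt sS (negPf xS); case: ifP => [h1|h1]; first by rewrite (snglP s x).
  have h0 : 0 < #|N s| by rewrite card_gt0; apply/set0Pn; exists x.
  by rewrite (@rtNP s) //; lia.
have lev1_N x s : s \in S -> x \in N s -> lev x = 1.
  by move=> sS; rewrite memN => /and3P [xS _ xA]; rewrite /lev (negPf xA) (negPf xS).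
have two s : s \in S -> 1 < #|N s| -> lev s = 1 /\ rt s = s.
  move=> sS s2; have [x xs] : exists x, x \in N s.
    by apply/set0Pn; rewrite -cards_eq0; lia.
  have sA := N_notA0 s x sS xs.
  by rewrite /lev /rt (negPf sA) sS; case: eqP => //; lia.
have rt1 v : v \notin S -> v \notin A0 -> [/\ lev (rt v) = 1, rt (rt v) = rt v &
    rt v = v \/ [/\ rt v \in S, 1 < #|N (rt v)| & v \in N (rt v)]].
  move=> vS vA; have e1 : rt v = rtN v by rewrite /rt (negPf vS).
  have [[s [sS s2 vs]]|n] : (exists s, [/\ s \in S, 1 < #|N s| & v \in N s]) \/ rtN v = v.
  - rewrite /rtN /src2; case: pickP => [s /and3P [? ? ?]|_]; last by right.
    by left; exists s.
  - have [h1 h2] := two s sS s2; rewrite e1 (rtNP s) //.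
    by split=> //; right.
  - by rewrite e1 n e1 n /lev (negPf vA) (negPf vS); split=> //; left.
pose P := Plan lev rt an ix.
have levA v : (lev v == 0) = false -> v \notin A0 by rewrite lev0 => ->.
have rt_lev v : v \notin A0 -> lev (rt v) = 1 /\ rt (rt v) = rt v.
  move=> vA; have [vS|vS] := boolP (v \in S); last by have [] := rt1 v vS vA.
  have [N1|N1] := eqVneq #|N v| 1.
    have /cards1P [x Nx] : #|N v| == 1 by rewrite N1.
    have xv : x \in N v by rewrite Nx inE.
    rewrite (rt_key v x vS xv).
    by have := xv; rewrite memN => /and3P [xS _ xA]; have [] := rt1 x xS xA.
  have e1 : rt v = v by rewrite /rt vS (negPf N1).
  by rewrite !e1 /lev (negPf vA) vS (negPf N1).
have anA v : v \in A0 -> an v = anB v by move=> vA; rewrite /an vA.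
have an1 v : v \notin A0 -> lev v = 1 -> an v = rt v.
  by move=> vA l1; rewrite /an (negPf vA) l1.
exists P; split => /=.
- by move=> v; rewrite /lev; case: ifP => //; case: ifP.
- move=> v /eqP; rewrite lev0 => vA; have [bB bv] := anBP v vA.
  have bA := BA0 _ bB; rewrite (anA v vA) (anA _ bA) (anBB _ bB); split; first by apply/eqP; rewrite lev0.
  split=> //; rewrite /ix; apply: (@leq_trans #|B|).
    by rewrite cardE index_mem mem_enum.
  by rewrite leq_divRL // mulnC.
- move=> v; rewrite lev0 => vA; have [h1 h2] := rt_lev v vA; split=> //.
  exact: an1.
- move=> v l2; have [vA|vA] := boolP (v \in A0).
    have lv : lev v == 0 by rewrite lev0.
    rewrite anA //; have [bB bv] := anBP v vA.
    apply: connect_sub_restrict bv => z bz _.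
    by rewrite /group /= (eqP lv) /= lev0 andbT (A0_closed _ _ (BA0 _ bB) bz).
  have l1 : lev v = 1 by move: l2; rewrite /lev (negPf vA); case: ifP.
  rewrite an1 //; have [vS|vS] := boolP (v \in S).
    have -> : rt v = v; last exact: connect0.
    by move: l1; rewrite /lev /rt (negPf vA) vS /=; case: ifP.
  have [_ _ [->|[sS s2 vs]]] := rt1 v vS vA; first exact: connect0.
  set s := rt v in sS s2 vs *.
  have := vs; rewrite memN => /and3P [_ sv _].
  apply: connect_sub_restrict sv => z sz zv.
  have zA : z \notin A0 by apply: contra vA => zA; apply: A0_closed zA zv.
  rewrite /group /= l1 /=; have [zS|zS] := boolP (z \in S).
    have -> : z = s by rewrite (antiS _ _ sS zS sz).
    have [e1 e2] := two s sS s2; by rewrite e1 e2 -/s !eqxx.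
  have zN : z \in N s by rewrite memN zS sz.
  by rewrite (lev1_N z s sS zN) -(rt_key s z sS zN) -/s; have [_ e2] := two s sS s2; rewrite e2 !eqxx.
split.
- move=> u v /eqP; rewrite lev0 => uA /eqP; rewrite lev0 => vA; rewrite !anA // => eu ev.
  have uB : u \in B by have [] := anBP u uA; rewrite eu.
  have vB : v \in B by have [] := anBP v vA; rewrite ev.
  by move=> /(congr1 (nth u (enum B))); rewrite /ix !nth_index ?mem_enum.
move=> u v uv; rewrite !lev0 => uA vA.
(* Both ends of the arc are reached from one source [s], and everything that [s] reaches outside
   [A0] has the root of [s]. *)
have [s sS su] := spanS u.
have sv : connect e s v by apply: connect_trans su (connect1 uv).
have rtS x : x \notin A0 -> connect e s x -> rt x = rt s.
  move=> xA sx; have [xS|xS] := boolP (x \in S); first by rewrite (antiS _ _ sS xS sx).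
  by apply/esym; apply: rt_key => //; rewrite memN xS sx.
split; first by rewrite !rtS.
have lev2S x : lev x = 2 -> x \in S.
  by rewrite /lev; case: ifP => // _; case: ifP => // /andP [].
move=> /lev2S uS /lev2S vS.
by rewrite -(antiS _ _ sS uS su) -(antiS _ _ sS vS sv).
Qed.

(** * Counting maps with conditions on pairs *)

Section Extensions.
Variables (I V : finType) (c : I -> I -> V -> V -> bool).
Implicit Types (phi : {ffun I -> V}) (T U : {set I}).

Definition compat T phi : bool :=
  [forall u in T, forall v in T, c u v (phi u) (phi v)].

Lemma compatP T phi : reflect {in T &, forall u v, c u v (phi u) (phi v)} (compat T phi).
Proof.
apply: (iffP forall_inP) => [h u v uT vT|h u uT]; first exact: (forall_inP (h u uT)).
by apply/forall_inP => v vT; apply: h.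
Qed.

(** Total maps are used, frozen to [phi0] outside [U]. Conditions are imposed on [T :|: U] only, so
    the remaining values are placeholders. *)
Definition extension phi0 U T : {set {ffun I -> V}} :=
  [set phi : {ffun I -> V} | [forall v, (v \notin U) ==> (phi v == phi0 v)] && compat (T :|: U) phi].

Lemma extensionP phi0 U T phi :
  reflect ((forall v, v \notin U -> phi v = phi0 v) /\ compat (T :|: U) phi)
    (phi \in extension phi0 U T).
Proof.
rewrite inE; apply: (iffP andP) => -[h1 h2]; split=> //.
  by move=> v vU; apply/eqP; apply: (implyP (forallP h1 v)).
by apply/forallP => v; apply/implyP => vU; rewrite h1.
Qed.

Lemma extension_split phi0 U1 U2 T (F : {ffun I -> V} -> nat) :
  [disjoint U1 & U2] -> [disjoint T & U2] ->
  \sum_(phi in extension phi0 (U1 :|: U2) T) F phi =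
  \sum_(phi1 in extension phi0 U1 T) \sum_(phi in extension phi1 U2 (T :|: U1)) F phi.
Proof.
move=> d12 dT2.
have out2 v : (v \in T) || (v \in U1) -> v \notin U2.
  by case/orP => h; apply/negP => h2; [move/pred0P: dT2 => /(_ v)|move/pred0P: d12 => /(_ v)];
     rewrite /= h h2.
(* The first stage of a map is recovered by resetting its values on [U2]. *)
pose rst phi := [ffun v => if v \in U2 then phi0 v else phi v].
rewrite (partition_big rst [in extension phi0 U1 T]).
  apply: eq_bigr => phi1 /extensionP [e1 c1]; apply: eq_bigl => phi.
  apply/andP/idP.
    move=> [/extensionP [e2 c2] /eqP e3]; apply/extensionP; split; last by rewrite -setUA.
    by move=> v vU; rewrite -e3 ffunE (negPf vU).
  move=> /extensionP [e2 c2]; split.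
    apply/extensionP; split; last by rewrite setUA.
    by move=> v; rewrite inE negb_or => /andP [v1 v2]; rewrite e2 // e1.
  apply/eqP/ffunP => v; rewrite ffunE; case: ifP => v2; last by rewrite e2 ?v2.
  by rewrite e1 //; apply/negP => v1; have := out2 v; rewrite v1 orbT v2 => /(_ isT).
move=> phi /extensionP [e2 /compatP c2]; apply/extensionP; split.
  move=> v v1; rewrite ffunE; case: ifP => v2 //.
  by rewrite e2 // inE negb_or v1 v2.
apply/compatP => u v; rewrite !in_setU => hu hv.
rewrite !ffunE (negPf (out2 u hu)) (negPf (out2 v hv)).
by apply: c2; rewrite !in_setU orbA ?hu ?hv.
Qed.

Lemma card_extension_split phi0 U1 U2 T :
  [disjoint U1 & U2] -> [disjoint T & U2] ->
  #|extension phi0 (U1 :|: U2) T| =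
  \sum_(phi1 in extension phi0 U1 T) #|extension phi1 U2 (T :|: U1)|.
Proof.
move=> d1 d2; rewrite -sum1_card extension_split //.
by apply: eq_bigr => phi _; rewrite sum1_card.
Qed.

(** Overwriting the values on [U1] by those of [phi1] is a bijection between the two sets of
    extensions, since no condition links [U1] to [U2]. *)
Lemma card_extension_indep phi0 phi1 U1 U2 T :
  [disjoint U1 & U2] -> [disjoint T & U1] -> [disjoint T & U2] ->
  (forall u v x y, u \in U1 -> v \in U2 -> c u v x y && c v u x y) ->
  phi1 \in extension phi0 U1 T ->
  #|extension phi1 U2 (T :|: U1)| = #|extension phi0 U2 T|.
Proof.
move=> d12 dT1 dT2 free /extensionP [e1 /compatP c1].
have n1 v : (v \in T) || (v \in U2) -> v \notin U1.
  by case/orP => h; apply/negP => h2; [move/pred0P: dT1 => /(_ v)|move/pred0P: d12 => /(_ v)];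
     rewrite /= h h2.
have n2 v : (v \in T) || (v \in U1) -> v \notin U2.
  by case/orP => h; apply/negP => h2; [move/pred0P: dT2 => /(_ v)|move/pred0P: d12 => /(_ v)];
     rewrite /= h h2.
pose f phi := [ffun v => if v \in U1 then phi1 v else phi v] : {ffun I -> V}.
have -> : extension phi1 U2 (T :|: U1) = f @: extension phi0 U2 T.
  apply/setP => phi; apply/idP/imsetP.
    move=> /extensionP [e2 /compatP c2].
    exists [ffun v => if v \in U1 then phi0 v else phi v].
      apply/extensionP; split.
        move=> v v2; rewrite ffunE; case: ifP => // v1.
        by rewrite e2 // e1 ?v1.
      apply/compatP => u v; rewrite !in_setU => hu hv.
      rewrite !ffunE (negPf (n1 u hu)) (negPf (n1 v hv)).
      by apply: c2; rewrite !in_setU orbAC ?hu ?hv.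
    apply/ffunP => v; rewrite !ffunE; case: ifP => v1; rewrite ?v1 //.
    by rewrite e2 // n2 // v1 orbT.
  move=> [psi /extensionP [e2 /compatP c2] ->]; apply/extensionP; split.
    move=> v v2; rewrite ffunE; case: ifP => // v1; rewrite e2 //.
    by rewrite e1 ?v1.
  have out v : v \in T -> f psi v = phi1 v.
    move=> vT; rewrite ffunE; case: ifP => // v1; rewrite e2 ?e1 ?v1 //.
    by apply: n2; rewrite vT.
  have in1 v : v \in U1 -> f psi v = phi1 v by move=> v1; rewrite ffunE v1.
  have in2 v : v \in U2 -> f psi v = psi v.
    by move=> v2; rewrite ffunE (negPf (n1 v _)) // v2 orbT.
  have outT v : v \in T -> f psi v = psi v.
    by move=> vT; rewrite ffunE (negPf (n1 v _)) // vT.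
  apply/compatP => u v; rewrite !in_setU => /orP [hu|u2] /orP [hv|v2].
  - have -> : f psi u = phi1 u by case/orP: hu => h; [exact: out|exact: in1].
    have -> : f psi v = phi1 v by case/orP: hv => h; [exact: out|exact: in1].
    by apply: c1; rewrite in_setU.
  - case/orP: hu => hu.
      by rewrite (outT u hu) (in2 v v2); apply: c2; rewrite in_setU ?hu ?v2 ?orbT.
    by have /andP [] := free u v (f psi u) (f psi v) hu v2.
  - case/orP: hv => hv.
      by rewrite (outT v hv) (in2 u u2); apply: c2; rewrite in_setU ?hv ?u2 ?orbT.
    by have /andP [] := free v u (f psi u) (f psi v) hv u2.
  - by rewrite !in2 //; apply: c2; rewrite in_setU ?u2 ?v2 ?orbT.
apply: card_in_imset => psi1 psi2 /extensionP [h1 _] /extensionP [h2 _] /ffunP h.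
apply/ffunP => v; have [v1|v1] := boolP (v \in U1).
  by rewrite h1 ?h2 // n2 // v1 orbT.
by have := h v; rewrite !ffunE (negPf v1).
Qed.

(** Splitting off one piece leaves an inner count that is the same for all its placements, so the
    sum becomes a product. *)
Lemma card_extension_prod (J : eqType) (r : seq J) (U : J -> {set I}) phi0 T :
  uniq r ->
  {in r &, forall i j, i != j -> [disjoint U i & U j]} ->
  {in r, forall i, [disjoint T & U i]} ->
  {in r &, forall i j, i != j ->
     forall u v x y, u \in U i -> v \in U j -> c u v x y} ->
  compat T phi0 ->
  #|extension phi0 (\bigcup_(i <- r) U i) T| = \prod_(i <- r) #|extension phi0 (U i) T|.
Proof.
move=> + + + + cT; elim: r => [|i r IH] /=.
  move=> _ _ _ _; rewrite !big_nil.
  rewrite (_ : extension _ _ _ = [set phi0]) ?cards1 //.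
  apply/setP => phi; rewrite in_set1; apply/extensionP/eqP => [[h _]|->].
    by apply/ffunP => v; apply: h; rewrite inE.
  by rewrite setU0.
move=> /andP [ir ur] disj dT free; rewrite !big_cons.
have rr : {subset r <= i :: r} by move=> j jr; rewrite inE jr orbT.
have di j : j \in r -> [disjoint U i & U j].
  move=> jr; apply: disj; rewrite ?mem_head ?rr //.
  by apply: contraNneq ir => ->.
have dU : [disjoint U i & \bigcup_(j <- r) U j].
  by rewrite big_tnth; apply/bigcup_disjointP => j _; apply: di; apply: mem_tnth.
have dTU : [disjoint T & \bigcup_(j <- r) U j].
  by rewrite big_tnth; apply/bigcup_disjointP => j _; apply: dT; apply: rr; apply: mem_tnth.
rewrite card_extension_split // -IH //; first last.
- by move=> a b ha hb; apply: free; apply: rr.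
- by move=> a ha; apply: dT; apply: rr.
- by move=> a b ha hb; apply: disj; apply: rr.
rewrite -sum_nat_const; apply: eq_bigr => phi1 h1.
apply: card_extension_indep h1 => //; first by apply: dT; rewrite mem_head.
move=> u v x y ui; rewrite big_tnth => /bigcupP [j _ vj].
have jr : tnth (in_tuple r) j \in r by apply: mem_tnth.
have nij : i != tnth (in_tuple r) j by apply: contraNneq ir => ->.
have nji : tnth (in_tuple r) j != i by rewrite eq_sym.
by rewrite (free _ _ (mem_head _ _) (rr _ jr) nij) // (free _ _ (rr _ jr) (mem_head _ _) nji).
Qed.

End Extensions.

(** * Enumerating placements by walks from anchors *)

Section Enumeration.
Variables (I V : finType) (c : I -> I -> V -> V -> bool) (D q : nat).
Variables (walk : V -> 'I_D -> V) (c0 : 'I_D) (v0 : V).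

(* A map may arise from several walks; only the first one is counted. *)
Definition minrep (f : 'I_D -> V) (d : 'I_D) : bool :=
  [forall d' : 'I_D, (d' < d) ==> (f d' != f d)].

Lemma minrep_inj f d1 d2 : minrep f d1 -> minrep f d2 -> f d1 = f d2 -> d1 = d2.
Proof.
move=> /forallP h1 /forallP h2 e; apply/val_inj; case: (ltngtP d1 d2) => // h.
  by have := h2 d1; rewrite h e eqxx.
by have := h1 d2; rewrite h e eqxx.
Qed.

Lemma minrep_exists (f : 'I_D -> V) d : exists2 d', minrep f d' & f d' = f d.
Proof.
have [d' /eqP e hmin] := @arg_minnP _ d (fun d' => f d' == f d) val (eqxx _).
exists d' => //; apply/forallP => d2; apply/implyP => h.
by apply: contraTneq h => h; rewrite -leqNgt; apply: hmin; rewrite h e.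
Qed.

Lemma sum_minrep (h : I -> 'I_D -> V) (F : {ffun I -> V} -> nat) :
  \sum_(ch : {ffun I -> 'I_D})
     [forall v, minrep (h v) (ch v)] * F [ffun v => h v (ch v)] =
  \sum_(phi : {ffun I -> V}) [forall v, [exists d, h v d == phi v]] * F phi.
Proof.
pose g (ch : {ffun I -> 'I_D}) := [ffun v => h v (ch v)] : {ffun I -> V}.
pose g' (phi : {ffun I -> V}) : {ffun I -> 'I_D} :=
  [ffun v => odflt c0 [pick d | minrep (h v) d && (h v d == phi v)]].
have mulb (b : bool) m : b * m = if b then m else 0 by case: b; rewrite ?mul1n.
under eq_bigr => ch _ do rewrite mulb; under [RHS]eq_bigr => phi _ do rewrite mulb.
rewrite -!big_mkcond /= [RHS](reindex_onto g g') /=; last first.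
  move=> phi /forallP hphi; apply/ffunP => v; rewrite !ffunE.
  have /existsP [d /eqP e] := hphi v.
  case: pickP => [d' /andP [_ /eqP] //|n].
  by have [d' m' e'] := minrep_exists (h v) d; have := n d'; rewrite m' e' e eqxx.
apply: eq_bigl => ch; apply/forallP/andP => [hm|[_ /eqP <-] v].
  split; first by apply/forallP => v; apply/existsP; exists (ch v); rewrite ffunE.
  apply/eqP/ffunP => v; rewrite !ffunE; case: pickP => [d /andP [md]|/(_ (ch v))].
    by move=> /eqP e /=; apply: minrep_inj e => //; apply: hm.
  by rewrite hm eqxx.
rewrite ffunE; case: pickP => [d /andP [] //|n].
have [d m e] := minrep_exists (h v) (ch v).
by have := n d; rewrite m e /g ffunE eqxx.
Qed.

Definition anchor_value (Y : {ffun 'I_q -> V}) (j : nat) : V :=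
  if insub j is Some j' then Y j' else v0.

Definition candidate (U : {set I}) (aj : I -> nat) (phi0 : {ffun I -> V})
    (Y : {ffun 'I_q -> V}) (v : I) (d : 'I_D) : V :=
  if v \in U then walk (anchor_value Y (aj v)) d else phi0 v.

(** The second clause pins the slots used by no anchor to [v0]; otherwise a map would be counted
    once for each way of filling them. *)
Definition anchored (A : {set I}) (aj : I -> nat) (Y : {ffun 'I_q -> V})
    (phi : {ffun I -> V}) : bool :=
  [forall a in A, phi a == anchor_value Y (aj a)] &&
  [forall j : 'I_q, [exists a in A, aj a == j] || (Y j == v0)].

(** The left side is the sum that the algorithm carries out: [Y] guesses the images of the anchors
    and [ch] a walk for each vertex. The ball condition says that a compatible map takes each vertex
    of [U] to the end of a walk from the image of an anchor with the same slot. So every extension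
    arises, and the tests on [Y] and [ch] make it arise once. *)
Lemma sum_extension (U T A : {set I}) (aj : I -> nat) (phi0 : {ffun I -> V})
    (F : {ffun I -> V} -> nat) :
  A \subset U -> {in U, forall v, aj v < q} -> {in A &, injective aj} ->
  (forall phi, compat c (T :|: U) phi -> forall v, v \in U ->
     exists a, [/\ a \in A, aj a = aj v & exists d, walk (phi a) d = phi v]) ->
  \sum_(Y : {ffun 'I_q -> V}) \sum_(ch : {ffun I -> 'I_D})
     (let phi := [ffun v => candidate U aj phi0 Y v (ch v)] in
      [forall v, minrep (candidate U aj phi0 Y v) (ch v)] *
        ((anchored A aj Y phi && compat c (T :|: U) phi) * F phi)) =
  \sum_(phi in extension c phi0 U T) F phi.
Proof.
move=> AU ajq ajinj ball.
transitivity (\sum_(Y : {ffun 'I_q -> V}) \sum_(phi : {ffun I -> V})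
    [forall v, [exists d, candidate U aj phi0 Y v d == phi v]] *
    ((anchored A aj Y phi && compat c (T :|: U) phi) * F phi)).
  apply: eq_bigr => Y _; rewrite -(sum_minrep (candidate U aj phi0 Y)
    (fun phi => (anchored A aj Y phi && compat c (T :|: U) phi) * F phi)).
  by [].
rewrite exchange_big /= [RHS]big_mkcond /=; apply: eq_bigr => phi _.
have av Y a : a \in U -> exists2 j : 'I_q, val j = aj a & anchor_value Y (aj a) = Y j.
  move=> /ajq h; exists (Ordinal h) => //.
  by rewrite /anchor_value (insubT (fun j => j < q) h) /=; congr (Y _); apply: val_inj.
transitivity ((\sum_(Y : {ffun 'I_q -> V})
   ([forall v, [exists d, candidate U aj phi0 Y v d == phi v]] &&
     (anchored A aj Y phi && compat c (T :|: U) phi))) * F phi).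
  by rewrite big_distrl /=; apply: eq_bigr => Y _; rewrite mulnA mulnb.
case: extensionP => [[e1 e2]|ne]; last first.
  rewrite big1 // => Y _; apply/eqP; rewrite eqb0; apply/negP.
  move=> /and3P [/forallP h1 _ h2]; apply: ne; split=> // v vU.
  by have /existsP [d] := h1 v; rewrite /candidate (negPf vU) => /eqP.
(* The only [Y] that can yield [phi]: images of anchors in their slots, [v0] elsewhere. *)
pose Y0 : {ffun 'I_q -> V} := [ffun j : 'I_q =>
  if [pick a in A | aj a == j] is Some a then phi a else v0].
have Y0A a (j : 'I_q) : a \in A -> val j = aj a -> Y0 j = phi a.
  move=> aA ej; rewrite ffunE; case: pickP => [b /andP [bA /eqP eb]|/(_ a)].
    by congr (phi _); apply: ajinj => //; rewrite eb ej.
  by rewrite aA ej eqxx.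
rewrite (eq_bigr (fun Y => nat_of_bool (Y == Y0))).
  by rewrite -big_mkcond /= sum1dep_card (_ : #|_| = 1) ?mul1n //; rewrite -(cards1 Y0); congr #|pred_of_set _|; apply/setP => Y; rewrite !inE.
move=> Y _; congr nat_of_bool; apply/and3P/eqP => [[_ /andP [h1 h2] _]|->].
  apply/ffunP => j; rewrite ffunE; case: pickP => [a /andP [aA /eqP ea]|n].
    have /eqP := forall_inP h1 a aA; have [j' ej' ->] := av Y a (subsetP AU a aA).
    by move=> ->; congr (Y _); apply: val_inj; rewrite ej' ea.
  have /orP [/exists_inP [a aA ea]|/eqP //] := forallP h2 j.
  by have := n a; rewrite aA ea.
split=> //.
  apply/forallP => v; apply/existsP; have [vU|vU] := boolP (v \in U); last first.
    by exists c0; rewrite /candidate (negPf vU) e1.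
  have [a [aA ea [d ed]]] := ball phi e2 v vU; exists d.
  rewrite /candidate vU -ea; have [j ej ->] := av Y0 a (subsetP AU a aA).
  by rewrite (Y0A a j aA ej) ed.
apply/andP; split.
  apply/forall_inP => a aA; have [j ej ->] := av Y0 a (subsetP AU a aA).
  by rewrite (Y0A a j aA ej).
apply/forallP => j; rewrite ffunE; case: pickP => [a /andP [aA ea]|n]; last by rewrite eqxx orbT.
by apply/orP; left; apply/exists_inP; exists a.
Qed.

End Enumeration.

(** * Walks coded by digits *)

Lemma digit_lt B c i j m : j < m -> (c + i * B ^ m) %/ B ^ j %% B = c %/ B ^ j %% B.
Proof.
case: B => [|B]; first by rewrite !modn0; case: m => [|m] // _; rewrite exp0n // muln0 addn0.
move=> jm; have -> : B.+1 ^ m = B.+1 ^ (m - j) * B.+1 ^ j by rewrite -expnD subnK // ltnW.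
rewrite mulnA addnC divnMDl ?expn_gt0 // -modnDml.
have -> : i * B.+1 ^ (m - j) %% B.+1 = 0.
  by apply/eqP; rewrite -/(dvdn _ _) dvdn_mull // dvdn_exp // subn_gt0.
by rewrite add0n.
Qed.

Lemma digit_eq B c i m : c < B ^ m -> i < B -> (c + i * B ^ m) %/ B ^ m %% B = i.
Proof.
move=> h1 h2; rewrite addnC divnMDl ?(leq_ltn_trans _ h1) //.
by rewrite divn_small // addn0 modn_small.
Qed.

Definition walkn (T : Type) (nb : T -> nat -> T) (B m : nat) (x : T) (c : nat) : T :=
  iteri m (fun j y => nb y (c %/ B ^ j %% B)) x.

(** A step may stay in place, so a shorter path is padded to exactly [m] steps; the choice at step
    [j] is digit [j] of the code. *)
Lemma walkn_path (T : eqType) (r : rel T) (nb : T -> nat -> T) B m x p :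
  (forall x y, (y == x) || r x y -> exists2 i, i < B & nb x i = y) ->
  path [rel x y | (y == x) || r x y] x p -> size p <= m ->
  exists2 c, c < B ^ m & walkn nb B m x c = last x p.
Proof.
move=> cov; elim: m p => [|m IH] p xp; first by rewrite leqn0 => /nilP ->; exists 0.
move=> sp; pose p' := take m p.
have [c cB ec] : exists2 c, c < B ^ m & walkn nb B m x c = last x p'.
  by apply: IH; [exact: take_path|rewrite size_take_min geq_minl].
have [i iB ei] : exists2 i, i < B & nb (last x p') i = last x p.
  apply: cov; rewrite /p'; have [h|h] := leqP (size p) m; first by rewrite take_oversize ?eqxx.
  have sp1 : size p = m.+1 by apply/eqP; rewrite eqn_leq sp.
  have [z dz] : exists z, drop m p = [:: z].
    have : size (drop m p) = 1 by rewrite size_drop sp1 subSnn.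
    by case: (drop m p) => [|z []] // _; exists z.
  have ep : p = take m p ++ [:: z] by rewrite -dz cat_take_drop.
  by move: xp; rewrite {1 2 5}ep cat_path last_cat /= andbT => /andP [_].
exists (c + i * B ^ m); first by rewrite expnS; nia.
have H t : t <= m -> walkn nb B t x (c + i * B ^ m) = walkn nb B t x c.
  by elim: t => // t IHt tm; rewrite /walkn !iteriS -!/(walkn _ _ _ _ _) IHt ?(ltnW tm) // digit_lt.
by rewrite /walkn iteriS -/(walkn _ _ _ _ _) digit_eq // H // ec ei.
Qed.

(** * Counting along a plan *)

Section Levels.
Variables (k n : nat) (arc : rel 'I_n) (L : 'I_k -> 'I_k -> nat).

Definition pair_rel (t : nat) (x y : 'I_n) : bool :=
  [|| t == 0, (t == 1) && arc x y, (t == 2) && arc y x | (t == 3) && (x == y)].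

Definition pair_ok (u v : 'I_k) (x y : 'I_n) : bool := pair_rel (L u v) x y.

(** The directions with few candidates: given the image of [u], that of [v] is equal to it or one of
    its out-neighbours. An arc read backwards gives nothing, as in-degrees are not bounded. *)
Definition forced : rel 'I_k :=
  [rel u v | (L u v \in [:: 1; 3]) || (L v u \in [:: 2; 3])].

Lemma forced_step T phi u v : compat pair_ok T phi -> u \in T -> v \in T ->
  forced u v -> (phi v == phi u) || arc (phi u) (phi v).
Proof.
move=> /compatP h uT vT; have := h u v uT vT; have := h v u vT uT.
rewrite /pair_ok /pair_rel /forced /= !inE.
move=> h1 h2 /orP [] /orP [] /eqP e; rewrite e /= in h1 h2.
- by rewrite orbF in h2; rewrite h2 orbT.
- by rewrite eq_sym h2.
- by rewrite orbF in h1; rewrite h1 orbT.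
- by rewrite h1.
Qed.

(** Every label other than 0 forces one end from the other in at least one direction. *)
Lemma free_pair u v x y : ~~ forced u v -> ~~ forced v u -> L u v <= 3 ->
  pair_ok u v x y.
Proof.
by rewrite /forced /pair_ok /pair_rel /= !inE; case: (L u v) => [|[|[|[|m]]]] //=;
  rewrite ?orbT.
Qed.

Variable P : plan k.
Hypothesis gP : good_plan forced P.
Hypothesis L3 : forall u v, L u v <= 3.

Definition base : {set 'I_k} := [set v | lev P v == 0].
Definition trunk (r : 'I_k) : {set 'I_k} := [set v | (lev P v == 1) && (rt P v == r)].
Definition is_root (r : 'I_k) : bool := (lev P r == 1) && (rt P r == r).
Definition is_leaf (r p : 'I_k) : bool := (lev P p == 2) && (rt P p == r).
Definition branch (r : 'I_k) : {set 'I_k} := [set v | (lev P v != 0) && (rt P v == r)].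

Lemma branch_leaves r : branch r = trunk r :|: \bigcup_(p <- enum (is_leaf r)) [set p].
Proof.
have [h2 _ _ _ _] := gP.
apply/setP => v; rewrite !inE big_enum /=.
have -> : (v \in \bigcup_(p in is_leaf r) [set p]) = is_leaf r v.
  apply/bigcupP/idP => [[p pr /set1P ->] //|vr]; exists v => //; exact: set11.
by rewrite /is_leaf -andb_orl; have := h2 v; case: (lev P v) => [|[|[]]].
Qed.

Lemma base_branches : [set: 'I_k] = base :|: \bigcup_(r <- enum is_root) branch r.
Proof.
have [_ _ h1 _ _] := gP.
apply/setP => v; rewrite !inE big_enum /=; case: eqVneq => //= l0.
apply/esym/bigcupP; exists (rt P v); last by rewrite inE l0 eqxx.
by have [e1 e2 _] := h1 v l0; rewrite /is_root unfold_in e1 e2 !eqxx.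
Qed.

Lemma free_branches r1 r2 u v x y : r1 != r2 -> u \in branch r1 -> v \in branch r2 ->
  pair_ok u v x y.
Proof.
have [_ _ _ _ [_ h]] := gP.
rewrite !inE => n12 /andP [lu /eqP ru] /andP [lv /eqP rv].
by apply: free_pair => //; apply/negP => /h [] // e _; move: n12; rewrite -ru -rv e eqxx.
Qed.

Lemma free_leaves r p1 p2 x y : p1 != p2 -> is_leaf r p1 -> is_leaf r p2 ->
  pair_ok p1 p2 x y.
Proof.
have [_ _ _ _ [_ h]] := gP.
move=> n12 /andP [/eqP l1 _] /andP [/eqP l2 _].
have l1' : lev P p1 != 0 by rewrite l1.
have l2' : lev P p2 != 0 by rewrite l2.
apply: free_pair => //; apply/negP => hf.
  by have [_ e] := h _ _ hf l1' l2'; move: n12; rewrite e ?eqxx.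
by have [_ e] := h _ _ hf l2' l1'; move: n12; rewrite e ?eqxx.
Qed.

(** Given the base the pieces are independent, and given the trunk of a piece so are its leaves. The
    sums over roots and over leaves therefore appear as factors instead of being nested, which
    limits the exponent beyond the base to two. *)
Lemma card_levels phi0 :
  #|[set phi : {ffun 'I_k -> 'I_n} | compat pair_ok setT phi]| =
  \sum_(phi in extension pair_ok phi0 base set0)
    \prod_(r | is_root r)
      \sum_(phi1 in extension pair_ok phi (trunk r) base)
        \prod_(p | is_leaf r p)
          #|extension pair_ok phi1 [set p] (base :|: trunk r)|.
Proof.
have -> : [set phi : {ffun 'I_k -> 'I_n} | compat pair_ok setT phi] =
    extension pair_ok phi0 setT set0.
  apply/setP => phi; rewrite inE; apply/idP/extensionP => [h|[_]]; last by rewrite setUT.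
  by rewrite setUT; split=> // v; rewrite inE.
have dbr r : [disjoint base & branch r].
  by rewrite -setI_eq0; apply/eqP/setP => v; rewrite !inE; case: eqP.
rewrite base_branches card_extension_split; first last.
- by rewrite -setI_eq0 set0I.
- by rewrite big_tnth; apply/bigcup_disjointP.
apply: eq_bigr => phi /extensionP [_ cphi].
rewrite set0U in cphi *.
rewrite card_extension_prod ?enum_uniq //; first last.
- by move=> r1 r2 _ _ n12 u v x y; apply: free_branches.
- move=> r1 r2 _ _ n12; rewrite -setI_eq0; apply/eqP/setP => v; rewrite !inE.
  by apply/negbTE/negP => /andP [/andP [_ /eqP ->] /andP [_]]; apply/negP.
rewrite big_enum; apply: eq_bigr => r _.
rewrite branch_leaves card_extension_split; first last.
- rewrite big_tnth; apply/bigcup_disjointP => j _; rewrite -setI_eq0; apply/eqP/setP => v.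
  have := mem_tnth j (in_tuple (enum (is_leaf r))); rewrite mem_enum => /andP [/eqP l2 _].
  by rewrite !inE; apply/negbTE/negP => /andP [/eqP l0 /eqP e]; rewrite e l2 in l0.
- rewrite big_tnth; apply/bigcup_disjointP => j _; rewrite -setI_eq0; apply/eqP/setP => v.
  have := mem_tnth j (in_tuple (enum (is_leaf r))); rewrite mem_enum => /andP [/eqP l2 _].
  by rewrite !inE; apply/negbTE/negP => /andP [/andP [/eqP l0 _] /eqP e]; rewrite e l2 in l0.
apply: eq_bigr => phi1 /extensionP [_ cphi1].
rewrite card_extension_prod ?enum_uniq ?big_enum //.
- move=> p1 p2 _ _ n12; rewrite -setI_eq0; apply/eqP/setP => v; rewrite !inE.
  by apply/negbTE/negP => /andP [/eqP ->]; apply/negP.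
- move=> p; rewrite mem_enum => /andP [/eqP l2 _]; rewrite -setI_eq0; apply/eqP/setP => v.
  rewrite !inE; apply/negbTE/negP => /andP [h /eqP e]; move: h; rewrite e l2 //.
move=> p1 p2; rewrite !mem_enum => h1 h2 n12 u v x y /set1P -> /set1P ->.
exact: free_leaves n12 h1 h2.
Qed.

Variables (nb : 'I_n -> nat -> 'I_n) (B : nat).
Hypothesis cov : forall x y, (y == x) || arc x y -> exists2 i, i < B & nb x i = y.

(** A path without repetition inside the group has fewer than [k] steps, and [phi] maps each step to
    an arc or to a standstill. *)
Lemma walk_anchor (X : {set 'I_k}) phi a v : compat pair_ok X phi ->
  a \in X -> (forall w, group P v w -> w \in X) ->
  connect [rel x y | forced x y && group P v y] a v ->
  exists2 d, d < B ^ k & walkn nb B k (phi a) d = phi v.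
Proof.
move=> cX aX hX /connectP [p0 p0p ->]; case/shortenP: p0p => p pp up _.
have ap : all (group P v) p.
  apply/allP => w wp; have /path_sorted := pp.
  by move: wp pp => /splitPr [p1 p2]; rewrite cat_path /= => /andP [_ /andP [/andP [_ ->]]].
rewrite -last_map; apply: walkn_path cov _ _; last first.
  rewrite size_map; have := card_uniqP up => /= e.
  by have := max_card [in a :: p]; rewrite e card_ord => /ltnW.
clear up; elim: p a aX pp ap => //= w p IH a aX /andP [/andP [e _] pp] /andP [gw gp].
have wX := hX w gw; apply/andP; split; first exact: forced_step cX aX wX e.
exact: IH.
Qed.

End Levels.
(** * Reduction to sums over labellings *)

Lemma set2_eqP (T : finType) (x y a b : T) :
  reflect ((x = a /\ y = b) \/ (x = b /\ y = a)) ([set x; y] == [set a; b]).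
Proof.
apply: (iffP eqP) => [h|[[-> ->] //|[-> ->]]]; last by rewrite setUC.
have : x \in [set a; b] by rewrite -h set21.
have : y \in [set a; b] by rewrite -h set22.
have : a \in [set x; y] by rewrite h set21.
have : b \in [set x; y] by rewrite h set22.
by rewrite !inE; do 4 (case/orP => /eqP ?); subst; auto.
Qed.

Section Edges.
Variables (V : finType) (K : sgraph V).

Lemma mem_edges x y : ([set x; y] \in edges K) = adj K x y.
Proof.
apply/imsetP/idP => [[[a b]]|h]; last by exists (x, y); rewrite ?inE.
rewrite inE /= => ab /eqP /set2_eqP [[-> ->] //|[-> ->]].
by rewrite adj_sym.
Qed.

Lemma edgesP (e : {set V}) : reflect (exists x y, e = [set x; y] /\ adj K x y) (e \in edges K).
Proof.
apply: (iffP imsetP) => [[[a b]]|[x [y [-> h]]]]; first by rewrite inE => ab ->; exists a, b.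
by exists (x, y); rewrite ?inE.
Qed.

End Edges.

Lemma imset_set2 (I V : finType) (f : I -> V) x y : f @: [set x; y] = [set f x; f y].
Proof. by rewrite imsetU1 imset_set1. Qed.

Section Copies.
Variables (I V : finType) (H : sgraph I) (G : sgraph V).
Implicit Types (phi psi : {ffun I -> V}) (s : {ffun I -> I}).

Definition auts : {set {ffun I -> I}} :=
  [set s : {ffun I -> I} | injectiveb s &&
     [forall u, forall v, adj H (s u) (s v) == adj H u v]].
Definition inj_homs : {set {ffun I -> V}} :=
  [set phi : {ffun I -> V} | injectiveb phi && is_hom H G phi].
Definition embeddings : {set {ffun I -> V}} :=
  [set phi : {ffun I -> V} | injectiveb phi &&
     [forall u, forall v, adj G (phi u) (phi v) == adj H u v]].

Definition edge_image phi : {set {set V}} := [set phi @: (e : {set I}) | e in edges H].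

Lemma mem_edge_image phi u v : injective phi ->
  ([set phi u; phi v] \in edge_image phi) = adj H u v.
Proof.
move=> inj; rewrite -imset_set2 mem_imset ?mem_edges //.
exact: imset_inj.
Qed.

Lemma autsP s : reflect (injective s /\ forall u v, adj H (s u) (s v) = adj H u v) (s \in auts).
Proof.
rewrite inE; apply: (iffP andP) => [[/injectiveP h1 /forallP h2]|[h1 h2]]; split=> //.
- by move=> u v; apply/eqP; apply: (forallP (h2 u)).
- exact/injectiveP.
- by apply/forallP => u; apply/forallP => v; rewrite h2.
Qed.

Definition fcomp phi s : {ffun I -> V} := [ffun v => phi (s v)].

(** Automorphisms act on injective maps by composition, freely, and the fibres of [key] are the
    orbits. With the image as [key] this counts copies of [H]. *)
Lemma card_fibres (K : finType) (E : {set {ffun I -> V}}) (key : {ffun I -> V} -> K) :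
  {in E, forall phi, injective phi} ->
  {in E & auts, forall phi s, fcomp phi s \in E /\ key (fcomp phi s) = key phi} ->
  {in E &, forall phi psi, key phi = key psi -> exists2 s, s \in auts & psi = fcomp phi s} ->
  #|E| = #|key @: E| * #|auts|.
Proof.
move=> inj comp fib.
rewrite -sum1_card (partition_big key [in key @: E]) /=; last first.
  by move=> phi phiE; apply: imset_f.
rewrite -sum_nat_const; apply: eq_bigr => _ /imsetP [phi phiE ->].
rewrite sum1dep_card (_ : [set psi | _] = fcomp phi @: auts).
  apply: card_in_imset => s t _ _ /ffunP h; apply/ffunP => v.
  by have := h v; rewrite !ffunE => /(inj _ phiE).
apply/setP => psi; rewrite inE; apply/andP/imsetP => [[psiE /eqP /esym e]|[s sA ->]].
  by have [s sA ->] := fib _ _ phiE psiE e; exists s.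
by have [-> ->] := comp _ _ phiE sA; rewrite eqxx.
Qed.

Lemma aut_surj s (v : I) : s \in auts -> exists u, s u = v.
Proof. by move=> /autsP [/injF_onto h _]; have /codomP [u ->] := h v; exists u. Qed.

Lemma fcomp_inj phi s : injective phi -> s \in auts -> injective (fcomp phi s).
Proof. by move=> h /autsP [hs _] u v; rewrite !ffunE => /h /hs. Qed.

Lemma fcomp_range phi s : s \in auts -> [set fcomp phi s x | x in I] = [set phi x | x in I].
Proof.
move=> sA; apply/setP => y; apply/imsetP/imsetP => [[x _ ->]|[x _ ->]].
  by exists (s x); rewrite ?ffunE.
by have [u <-] := aut_surj x sA; exists u; rewrite ?ffunE.
Qed.

Lemma fcomp_edges phi s : s \in auts -> edge_image (fcomp phi s) = edge_image phi.
Proof.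
move=> sA; have [_ sadj] := autsP _ sA.
apply/setP => e; apply/imsetP/imsetP => [[e' /edgesP [u [v [-> uv]]] ->]|[e' /edgesP [u [v [-> uv]]] ->]].
  exists [set s u; s v]; first by rewrite mem_edges sadj.
  by rewrite !imset_set2 !ffunE.
have [u' eu] := aut_surj u sA; have [v' ev] := aut_surj v sA.
exists [set u'; v']; first by rewrite mem_edges -sadj eu ev.
by rewrite !imset_set2 !ffunE eu ev.
Qed.

Lemma same_range phi psi : injective phi -> injective psi ->
  [set phi x | x in I] = [set psi x | x in I] ->
  exists2 s : {ffun I -> I}, injective s & psi = fcomp phi s.
Proof.
move=> i1 i2 e.
have h v : exists u, phi u == psi v.
  have : psi v \in [set phi x | x in I] by rewrite e; apply: imset_f.
  by move=> /imsetP [u _ ->]; exists u.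
pose s : {ffun I -> I} := [ffun v => xchoose (h v)].
have sE v : phi (s v) = psi v by rewrite ffunE; apply/eqP; exact: (xchooseP (h v)).
exists s; last by apply/ffunP => v; rewrite ffunE sE.
by move=> u v suv; apply: i2; rewrite -!sE suv.
Qed.

Lemma is_homP phi : reflect (forall u v, adj H u v -> adj G (phi u) (phi v)) (is_hom H G phi).
Proof.
apply: (iffP forallP) => [h u v|h u]; first by apply/implyP; apply: (forallP (h u)).
by apply/forallP => v; apply/implyP; apply: h.
Qed.

Lemma card_inj_homs : #|inj_homs| = num_subgraphs H G * #|auts|.
Proof.
pose key phi := ([set phi x | x in I], edge_image phi).
rewrite (card_fibres (key := key)).
- congr (#|pred_of_set _| * _); apply/setP => -[A F]; rewrite !inE.
  apply/imsetP/andP => [[phi]|[/andP [/= FE FA] /existsP [phi /and3P [/injectiveP inj /eqP eA /eqP eF]]]].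
    rewrite inE => /andP [/injectiveP inj /is_homP hom] [-> ->]; split; last first.
      by apply/existsP; exists phi; rewrite /= !eqxx !andbT; apply/injectiveP.
    apply/andP; split => /=.
      apply/subsetP => _ /imsetP [e /edgesP [u [v [-> uv]]] ->].
      by rewrite imset_set2 mem_edges hom.
    apply/forall_inP => _ /imsetP [e _ ->]; apply/subsetP => _ /imsetP [u _ ->].
    exact: imset_f.
  rewrite /= in eA eF; exists phi; last by rewrite /key eA /edge_image eF.
  rewrite inE; apply/andP; split; first exact/injectiveP.
  apply/is_homP => u v uv; rewrite -mem_edges; apply: (subsetP FE).
  by rewrite /= -eF mem_edge_image.
- by move=> phi; rewrite inE => /andP [/injectiveP].
- move=> phi s; rewrite inE => /andP [/injectiveP inj /is_homP hom] sA; split.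
    rewrite inE; apply/andP; split; first by apply/injectiveP; apply: fcomp_inj.
    have [_ sadj] := autsP _ sA.
    by apply/is_homP => u v uv; rewrite !ffunE hom ?sadj.
  by rewrite /key fcomp_range // fcomp_edges.
move=> phi psi; rewrite !inE => /andP [/injectiveP i1 _] /andP [/injectiveP i2 _] [er ee].
have [s si es] := same_range i1 i2 er; exists s => //.
apply/autsP; split=> // u v.
by rewrite -(mem_edge_image u v i2) -ee es !ffunE mem_edge_image.
Qed.

Lemma card_embeddings : #|embeddings| = num_induced H G * #|auts|.
Proof.
have embP phi : reflect (injective phi /\ forall u v, adj G (phi u) (phi v) = adj H u v)
    (phi \in embeddings).
  rewrite inE; apply: (iffP andP) => [[/injectiveP h1 /forallP h2]|[h1 h2]]; split=> //.
  - by move=> u v; apply/eqP; apply: (forallP (h2 u)).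
  - exact/injectiveP.
  - by apply/forallP => u; apply/forallP => v; rewrite h2.
rewrite (card_fibres (key := fun phi => [set phi x | x in I])).
- congr (#|pred_of_set _| * _); apply/setP => A; rewrite !inE.
  apply/imsetP/existsP => [[phi /embP [inj hom] ->]|[phi /and3P [/injectiveP inj /eqP eA /eqP eF]]].
    exists phi; rewrite /= eqxx andTb; apply/andP; split; first exact/injectiveP.
    apply/eqP/setP => e; apply/imsetP/idP => [[e' /edgesP [u [v [-> uv]]] ->]|].
      rewrite inE imset_set2 mem_edges hom uv /=; apply/subsetP => y.
      by rewrite !inE => /orP [] /eqP ->; apply: imset_f.
    rewrite inE => /andP [/edgesP [x [y [-> xy]]] /subsetP sub].
    have /imsetP [u _ eu] := sub x (set21 _ _); have /imsetP [v _ ev] := sub y (set22 _ _).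
    by exists [set u; v]; rewrite ?mem_edges ?imset_set2 -?eu -?ev // -hom -eu -ev.
  rewrite /= in eA eF; exists phi; last by rewrite eA.
  apply/embP; split=> // u v.
  rewrite -(mem_edge_image u v inj) /edge_image eF inE mem_edges.
  rewrite [X in _ = _ && X](_ : _ = true) ?andbT //; apply/subsetP => y.
  by rewrite -eA !inE => /orP [] /eqP ->; apply: imset_f.
- by move=> phi /embP [].
- move=> phi s /embP [inj hom] sA; split; last exact: fcomp_range.
  have [_ sadj] := autsP _ sA.
  by apply/embP; split; [exact: fcomp_inj|move=> u v; rewrite !ffunE hom sadj].
move=> phi psi /embP [i1 h1] /embP [i2 h2] er.
have [s si es] := same_range i1 i2 er; exists s => //.
by apply/autsP; split=> // u v; rewrite -h1 -h2 es !ffunE.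
Qed.

Lemma auts_gt0 : 0 < #|auts|.
Proof.
apply/card_gt0P; exists [ffun v => v]; apply/autsP; split=> [u v|u v]; by rewrite !ffunE.
Qed.

End Copies.

(** * Expansion over labellings of pairs *)

Section Pairs.
Variable k : nat.

Lemma pair_fst_subproof (i : 'I_(k * k)) : i %/ k < k.
Proof. by case: k i => [[]|m] i //; rewrite ltn_divLR. Qed.

Lemma pair_snd_subproof (i : 'I_(k * k)) : i %% k < k.
Proof. by case: k i => [[]|m] i //; rewrite ltn_mod. Qed.

Lemma pair_idx_subproof (u v : 'I_k) : u * k + v < k * k.
Proof. by have := ltn_ord u; have := ltn_ord v; nia. Qed.

Definition pfst (i : 'I_(k * k)) : 'I_k := Ordinal (pair_fst_subproof i).
Definition psnd (i : 'I_(k * k)) : 'I_k := Ordinal (pair_snd_subproof i).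
Definition pidx (u v : 'I_k) : 'I_(k * k) := Ordinal (pair_idx_subproof u v).

Lemma pfstK u v : pfst (pidx u v) = u.
Proof.
apply: val_inj => /=; have := ltn_ord v => h.
by rewrite divnMDl ?divn_small ?addn0 //; lia.
Qed.

Lemma psndK u v : psnd (pidx u v) = v.
Proof. by apply: val_inj => /=; rewrite modnMDl modn_small. Qed.

Lemma pidxK i : pidx (pfst i) (psnd i) = i.
Proof. by apply: val_inj; rewrite /= -divn_eq. Qed.

Definition lab_of (lab : {ffun 'I_(k * k) -> 'I_4}) (u v : 'I_k) : nat := lab (pidx u v).

End Pairs.

(* The modes 0, 1 and 2 stand for homomorphisms, injective homomorphisms and
   strong embeddings.  The labels of pairs [u < v] expand the indicators
   [adj = arc + arc^-1], [x != y = 1 - eq] and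
   [x != y && ~~ adj = 1 - arc - arc^-1 - eq]. *)
Definition allowed (md : nat) (a h : bool) (t : nat) : bool :=
  if a then
    if h then (t == 1) || (t == 2)
    else (t == 0) || ((md != 0) && (t == 3)) || ((md == 2) && ((t == 1) || (t == 2)))
  else t == 0.

Definition negative (a h : bool) (t : nat) : bool := [&& a, ~~ h & t != 0].

(** Here [a] says that the pair is increasing, [h] and [g] that it is an edge of [H] and that its
    image is one of [G], and [q] that the two images coincide. Each unordered pair is tested
    once. *)
Definition wanted (md : nat) (a h g q : bool) : bool :=
  ~~ a || (if h then g else (md == 0) || (~~ q && ((md != 2) || ~~ g))).

Section Expansion.
Variables (k n : nat) (H : rel 'I_k) (G : sgraph 'I_n) (arc : rel 'I_n) (md : nat).
Hypothesis arcG : forall x y, adj G x y = arc x y (+) arc y x.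
Hypothesis arcN : forall x y, arc x y -> ~~ arc y x.

Definition wanted_map (phi : {ffun 'I_k -> 'I_n}) : bool :=
  [forall i : 'I_(k * k), wanted md (pfst i < psnd i) (H (pfst i) (psnd i))
     (adj G (phi (pfst i)) (phi (psnd i))) (phi (pfst i) == phi (psnd i))].

Definition allowed_lab (lab : {ffun 'I_(k * k) -> 'I_4}) : bool :=
  [forall i, allowed md (pfst i < psnd i) (H (pfst i) (psnd i)) (lab i)].

Definition negatives (lab : {ffun 'I_(k * k) -> 'I_4}) : nat :=
  \sum_i negative (pfst i < psnd i) (H (pfst i) (psnd i)) (lab i).

Definition lab_count (lab : {ffun 'I_(k * k) -> 'I_4}) : nat :=
  #|[set phi : {ffun 'I_k -> 'I_n} | compat (pair_ok arc (lab_of lab)) setT phi]|.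

Import GRing.Theory Num.Theory.
Local Open Scope ring_scope.

(** The two arcs between [x] and [y] exclude each other, so their indicators add up to that of an
    edge; for [x = y] neither is present, so the events subtracted from 1 are disjoint. *)
Lemma wanted_expand (a h : bool) (x y : 'I_n) :
  (wanted md a h (adj G x y) (x == y))%:R =
  \sum_(t < 4) (allowed md a h t)%:R * (-1) ^+ negative a h t *
     (pair_rel arc t x y)%:R :> int.
Proof.
rewrite !big_ord_recl big_ord0 /wanted /allowed /negative /pair_rel /=.
have := @arcN x y; have := @arcN y x; rewrite arcG.
have [->|nxy] := eqVneq x y.
  by case: (arc y y) => [_ /(_ isT) //|_ _]; case: a; case: h; case: md => [|[|[|m]]] //=.
by case: (arc x y) (arc y x) => [] [] // h1 h2; try (by have := h1 isT);
  case: a; case: h; case: md => [|[|[|m]]] //=.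
Qed.

Lemma compat_lab lab (phi : {ffun 'I_k -> 'I_n}) :
  compat (pair_ok arc (lab_of lab)) setT phi =
  [forall i, pair_rel arc (lab i) (phi (pfst i)) (phi (psnd i))].
Proof.
apply/compatP/forallP => [h i|h u v _ _].
  by have := h (pfst i) (psnd i) (in_setT _) (in_setT _); rewrite /pair_ok /lab_of pidxK.
by have := h (pidx u v); rewrite pfstK psndK.
Qed.

Lemma prod_bool (J : finType) (p : pred J) :
  \prod_(i : J) (p i)%:R = [forall i, p i]%:R :> int.
Proof.
case: forallP => [h|h]; first by rewrite big1 // => i _; rewrite h.
have /existsP [i ni] : [exists i, ~~ p i].
  by rewrite -negb_forall; apply/forallP.
by rewrite (bigD1 i) //= (negPf ni) mul0r.
Qed.

Lemma count_expand :
  (#|[set phi | wanted_map phi]|%:R : int) =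
  \sum_(lab | allowed_lab lab) (-1) ^+ negatives lab * (lab_count lab)%:R.
Proof.
rewrite -sum1_card natr_sum big_mkcond /=.
transitivity (\sum_(phi : {ffun 'I_k -> 'I_n}) \prod_(i : 'I_(k * k))
   \sum_(t < 4) ((allowed md (pfst i < psnd i)%N (H (pfst i) (psnd i)) t)%:R *
     (-1) ^+ negative (pfst i < psnd i)%N (H (pfst i) (psnd i)) t *
     (pair_rel arc t (phi (pfst i)) (phi (psnd i)))%:R : int)).
  apply: eq_bigr => phi _; rewrite inE.
  rewrite (eq_bigr (fun i => (wanted md (pfst i < psnd i)%N (H (pfst i) (psnd i))
     (adj G (phi (pfst i)) (phi (psnd i))) (phi (pfst i) == phi (psnd i)))%:R)).
    by rewrite prod_bool -/(wanted_map phi); case: wanted_map.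
  by move=> i _; rewrite wanted_expand.
pose term (phi : {ffun 'I_k -> 'I_n}) (i : 'I_(k * k)) (t : 'I_4) : int :=
  (allowed md (pfst i < psnd i)%N (H (pfst i) (psnd i)) t)%:R *
  (-1) ^+ negative (pfst i < psnd i)%N (H (pfst i) (psnd i)) t *
  (pair_rel arc t (phi (pfst i)) (phi (psnd i)))%:R.
rewrite (eq_bigr (fun phi => \sum_(lab : {ffun 'I_(k * k) -> 'I_4})
   \prod_i term phi i (lab i))); last first.
  move=> phi _; exact: (bigA_distr_bigA (term phi)).
rewrite /term.
rewrite exchange_big /= [RHS]big_mkcond /=; apply: eq_bigr => lab _.
under eq_bigr => phi _ do rewrite !big_split /= prod_bool prod_bool -compat_lab.
rewrite -big_distrr /= -/(allowed_lab lab).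
rewrite (_ : \prod_i _ = (-1) ^+ negatives lab); last first.
  by rewrite /negatives; elim/big_rec2: _ => [//|i x y _ ->]; rewrite exprD.
case: allowed_lab; last by rewrite !mul0r.
rewrite mul1r; congr (_ * _); rewrite -natr_sum; congr (_%:R).
rewrite /lab_count -sum1dep_card [RHS]big_mkcond /=.
by apply: eq_bigr => phi _; case: compat.
Qed.

(** Positive and negative terms are summed separately because the machine has only truncated
    subtraction, which is exact for these two sums. *)
Lemma count_expand_nat :
  #|[set phi | wanted_map phi]| =
  (\sum_(lab : {ffun 'I_(k * k) -> 'I_4})
      (allowed_lab lab && ~~ odd (negatives lab)) * lab_count lab -
   \sum_(lab : {ffun 'I_(k * k) -> 'I_4})
      (allowed_lab lab && odd (negatives lab)) * lab_count lab)%N.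
Proof.
set p := (\sum_lab _)%N; set m := (\sum_lab _)%N.
suff : (p%:R : int) = (#|[set phi | wanted_map phi]| + m)%:R.
  by move=> /eqP; rewrite eqr_nat => /eqP ->; rewrite addnK.
rewrite natrD count_expand -(subrK m%:R p%:R); congr (_ + _).
rewrite /p /m !natr_sum -sumrB [RHS]big_mkcond /=; apply: eq_bigr => lab _.
rewrite -signr_odd; case: allowed_lab; case: odd => //=;
  by rewrite ?mul1n ?mul0n ?subr0 ?sub0r ?expr0 ?expr1 ?mul1r ?mulN1r ?subrr.
Qed.

End Expansion.

Section Modes.
Variables (k n : nat) (H : sgraph 'I_k) (G : sgraph 'I_n).

Lemma wanted_mapP md (phi : {ffun 'I_k -> 'I_n}) :
  reflect (forall u v : 'I_k, u < v ->
      if adj H u v then adj G (phi u) (phi v)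
      else (md == 0) || ((phi u != phi v) && ((md != 2) || ~~ adj G (phi u) (phi v))))
    (wanted_map H G md phi).
Proof.
apply: (iffP forallP) => [h u v uv|h i].
  by have := h (pidx u v); rewrite pfstK psndK uv.
by rewrite /wanted; case: ltnP => //= uv; apply: h.
Qed.

Lemma wanted_hom phi : wanted_map H G 0 phi = is_hom H G phi.
Proof.
apply/wanted_mapP/is_homP => [h u v uv|h u v _].
  case: (ltngtP u v) => [luv|lvu|/val_inj e].
  - by have := h u v luv; rewrite uv.
  - by have := h v u lvu; rewrite adj_sym uv adj_sym.
  - by rewrite e adj_irrefl in uv.
by case: ifP => // /h.
Qed.

Lemma ord_sym_inj (phi : {ffun 'I_k -> 'I_n}) :
  (forall u v : 'I_k, u < v -> phi u != phi v) -> injective phi.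
Proof.
move=> h u v e; apply: val_inj; case: (ltngtP u v) => // luv.
  by have := h u v luv; rewrite e eqxx.
by have := h v u luv; rewrite e eqxx.
Qed.

(** No inequality is required on edges of [H]: their images are edges of [G], which has no loops. *)
Lemma wanted_inj phi : wanted_map H G 1 phi = (phi \in inj_homs H G).
Proof.
rewrite inE; apply/wanted_mapP/andP => [h|[/injectiveP inj /is_homP hom] u v uv].
  split.
    apply/injectiveP/ord_sym_inj => u v uv; have := h u v uv.
    case: ifP => [huv|_ /andP [] //]; apply: contraTneq => ->.
    by rewrite adj_irrefl.
  rewrite -wanted_hom; apply/wanted_mapP => u v uv; have := h u v uv.
  by case: ifP.
case: ifP => [/hom //|_]; rewrite andbT /=; apply/eqP => /inj e.
by rewrite e ltnn in uv.
Qed.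

Lemma wanted_emb phi : wanted_map H G 2 phi = (phi \in embeddings H G).
Proof.
rewrite inE; apply/wanted_mapP/andP => [h|[/injectiveP inj /forallP emb] u v uv].
  split.
    apply/injectiveP/ord_sym_inj => u v uv; have := h u v uv.
    case: ifP => [huv|_ /andP [] //]; apply: contraTneq => ->.
    by rewrite adj_irrefl.
  have lt (u v : 'I_k) : u < v -> adj G (phi u) (phi v) = adj H u v.
    by move=> /h; case: (adj H u v) => //= /andP [_ /negbTE].
  apply/forallP => u; apply/forallP => v; apply/eqP.
  case: (ltngtP u v) => [/lt //|/lt e|/val_inj ->]; last by rewrite !adj_irrefl.
  by rewrite adj_sym e adj_sym.
have := forallP (emb u) v => /eqP ->; case: (adj H u v) => //=; rewrite andbT.
by apply/eqP => /inj e; rewrite e ltnn in uv.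
Qed.

Lemma num_homs_wanted : num_homs H G = #|[set phi | wanted_map H G 0 phi]|.
Proof. by congr #|pred_of_set _|; apply/setP => phi; rewrite !inE wanted_hom. Qed.

Lemma num_subgraphs_wanted :
  num_subgraphs H G = #|[set phi | wanted_map H G 1 phi]| %/ #|auts H|.
Proof.
have -> : [set phi | wanted_map H G 1 phi] = inj_homs H G.
  by apply/setP => phi; rewrite in_set wanted_inj.
by rewrite card_inj_homs mulnK // auts_gt0.
Qed.

Lemma num_induced_wanted :
  num_induced H G = #|[set phi | wanted_map H G 2 phi]| %/ #|auts H|.
Proof.
have -> : [set phi | wanted_map H G 2 phi] = embeddings H G.
  by apply/setP => phi; rewrite in_set wanted_emb.
by rewrite card_embeddings mulnK // auts_gt0.
Qed.

End Modes.
(** * Orientations of small out-degree *)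

Section Peeling.
Variables (n : nat) (G : sgraph 'I_n) (delta : nat).

Definition peel_state : Type := ({set 'I_n} * {set 'I_n * 'I_n})%type.

Definition live_nbrs (R : {set 'I_n}) (v : 'I_n) : {set 'I_n} :=
  [set w | adj G v w && (w \notin R)].

Definition peelable (R : {set 'I_n}) (v : 'I_n) : bool :=
  (v \notin R) && (#|live_nbrs R v| <= delta).

(** A vertex is removed with arcs to all its remaining neighbours. These are all the arcs it ever
    sends out, so its out-degree is at most [delta]. *)
Definition peel_step (st : peel_state) (v : 'I_n) : peel_state :=
  if peelable st.1 v then
    (v |: st.1, [set a | (a \in st.2) || ((a.1 == v) && (a.2 \in live_nbrs st.1 v))])
  else st.

Definition peel_at (j : nat) (st : peel_state) : peel_state :=
  if insub j is Some v then peel_step st v else st.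

Definition peel_upto (st : peel_state) (i : nat) : peel_state := iteri i peel_at st.

Definition peel (r : nat) : peel_state :=
  iter r (fun st => peel_upto st n) (set0, set0).

Definition peel_inv (st : peel_state) : Prop :=
  [/\ forall v w, (v, w) \in st.2 -> adj G v w && (v \in st.1),
      forall v, #|[set w | (v, w) \in st.2]| <= delta &
      forall v w, adj G v w -> (v \in st.1) || (w \in st.1) ->
        ((v, w) \in st.2) (+) ((w, v) \in st.2)].

Lemma peel_step_inv st v : peel_inv st -> peel_inv (peel_step st v).
Proof.
rewrite /peel_step; case: ifP => // /andP [vR dv] [h1 h2 h3]; split=> /=.
- move=> x y; rewrite inE /= => /orP [/h1 /andP [-> xR]|/andP [/eqP ->]].
    by rewrite !inE xR orbT.
  by rewrite !inE eqxx => /andP [->].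
- move=> x; have [->|xv] := eqVneq x v.
    apply: leq_trans dv; apply: subset_leq_card; apply/subsetP => y.
    rewrite !inE /= eqxx /= => /orP [/h1 /andP [_]|//]; by rewrite (negPf vR).
  apply: leq_trans (h2 x); apply: subset_leq_card; apply/subsetP => y.
  by rewrite !inE /= (negPf xv) /= orbF.
move=> x y xy; rewrite !inE /= => hxy.
have nloop z : adj G z z = false by apply: adj_irrefl.
have vout z : (v, z) \in st.2 -> false by move=> /h1 /andP [_]; rewrite (negPf vR).
have [ex|nx] := eqVneq x v; have [ey|ny] := eqVneq y v.
- by rewrite ex ey nloop in xy.
- rewrite ex in xy hxy *; rewrite xy orbF /=; case yR : (y \in st.1); rewrite ?andbF ?orbF /=.
    by have := h3 v y xy; rewrite yR orbT => /(_ isT).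
  rewrite ?orbT /=; apply/negP => /h1 /andP [_]; by rewrite yR.
- rewrite ey in xy hxy *; rewrite orbF adj_sym xy /=; case xR : (x \in st.1); rewrite ?andbF ?orbF /=.
    by have := h3 x v xy; rewrite xR => /(_ isT).
  rewrite ?orbT /= addbT; apply/negP => /h1 /andP [_]; by rewrite xR.
rewrite /= !orbF; apply: h3 => //.
by move: hxy; rewrite (negPf nx) (negPf ny).
Qed.

Lemma peel_at_inv j st : peel_inv st -> peel_inv (peel_at j st).
Proof. by rewrite /peel_at; case: insubP => // v _ _; apply: peel_step_inv. Qed.

Lemma peel_upto_inv i st : peel_inv st -> peel_inv (peel_upto st i).
Proof. by elim: i => //= i IH /IH; apply: peel_at_inv. Qed.

Lemma peel_inv_all r : peel_inv (peel r).
Proof.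
elim: r => [|r IH] /=; last exact: peel_upto_inv.
split=> /=.
- by move=> v w; rewrite inE.
- by move=> v; rewrite (_ : [set w | _] = set0) ?cards0 //; apply/setP => w; rewrite !inE.
- by move=> v w _; rewrite !inE.
Qed.

Lemma peel_at_sub j (st : peel_state) : st.1 \subset (peel_at j st).1.
Proof.
by rewrite /peel_at; case: insubP => // v _ _; rewrite /peel_step; case: ifP => //= _; apply: subsetUr.
Qed.

Lemma peel_upto_sub i j (st : peel_state) : i <= j -> (peel_upto st i).1 \subset (peel_upto st j).1.
Proof.
elim: j => [|j IH]; first by rewrite leqn0 => /eqP ->.
rewrite leq_eqVlt => /orP [/eqP -> //|/IH h]; apply: subset_trans h _.
exact: peel_at_sub.
Qed.

(** Live neighbours only disappear during a round. A vertex kept at its turn has more than [delta]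
    of them then, hence also at the start. *)
Lemma peel_round_left (st : peel_state) v : v \notin (peel_upto st n).1 -> delta < #|live_nbrs st.1 v|.
Proof.
move=> vn; have vi : v \notin (peel_upto st v).1.
  by apply: contra vn; apply: subsetP; apply: peel_upto_sub; apply: ltnW.
have : (peel_upto st v.+1).1 \subset (peel_upto st n).1 by apply: peel_upto_sub.
have ev : insub (nat_of_ord v) = Some v by rewrite valK.
rewrite /peel_upto iteriS -/(peel_upto _ _) /peel_at ev /peel_step => sub.
have [p|np] := boolP (peelable (peel_upto st v).1 v).
  by rewrite p in sub; have := subsetP sub v; rewrite /= !inE eqxx => /(_ isT) h; rewrite h in vn.
move: np; rewrite /peelable vi /= -ltnNge => h; apply: leq_trans h _.
apply: subset_leq_card; apply/subsetP => w; rewrite !inE => /andP [-> /=]; apply: contra.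
exact: (subsetP (@peel_upto_sub 0 v st (leq0n v)) w).
Qed.

Variables (d : nat) (A : {set 'I_n * 'I_n}).
Hypothesis oA : orientation G A.
Hypothesis dA : forall u, outdeg A u <= d.
Hypothesis d4 : 4 * d <= delta.

Lemma orient_adj u v : adj G u v -> ((u, v) \in A) || ((v, u) \in A).
Proof.
move=> uv; have := forallP (forallP oA u) v; rewrite uv.
by case: ((u, v) \in A); case: ((v, u) \in A).
Qed.

(** Each remaining edge is counted at its two ends and charged to the tail of its arc in [A]. *)
Lemma sum_live (R : {set 'I_n}) : \sum_(v in ~: R) #|live_nbrs R v| <= 2 * d * #|~: R|.
Proof.
have card_sum (v : 'I_n) (P : pred 'I_n) : #|[set w in ~: R | P w]| = \sum_(w in ~: R) P w.
  by rewrite -sum1_card big_mkcond /= [RHS]big_mkcond /=; apply: eq_bigr => w _; rewrite inE; case: (w \in ~: R).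
apply: (@leq_trans (\sum_(v in ~: R) \sum_(w in ~: R) (((v, w) \in A) + ((w, v) \in A)))).
  apply: leq_sum => v _; apply: (@leq_trans (\sum_(w in ~: R) adj G v w)).
    rewrite -card_sum //; apply: subset_leq_card; apply/subsetP => w; rewrite !inE => /andP [-> ->] //.
  by apply: leq_sum => w _; case: (boolP (adj G v w)) => // /orient_adj; case: (_ \in A); case: (_ \in A).
under eq_bigr => v _ do rewrite big_split /=.
rewrite big_split /= [X in _ + X]exchange_big /= addnn -mul2n -mulnA leq_mul2l /=.
rewrite mulnC -sum_nat_const; apply: leq_sum => v _; rewrite -card_sum //.
apply: leq_trans (dA v); apply: subset_leq_card; apply/subsetP => w.
by rewrite !inE => /andP [].
Qed.

(** The live degrees average at most [2 * d], while those of the surviving vertices exceed [4 * d];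
    hence at most half of the vertices survive. *)
Lemma peel_half (st : peel_state) : 2 * #|~: (peel_upto st n).1| <= #|~: st.1|.
Proof.
set U := ~: st.1; set U' := ~: _.
have sub : U' \subset U.
  by rewrite setCS; exact: (@peel_upto_sub 0 n st (leq0n n)).
have h1 : delta.+1 * #|U'| <= \sum_(v in U') #|live_nbrs st.1 v|.
  rewrite mulnC -sum_nat_const; apply: leq_sum => v; rewrite inE => vn.
  exact: peel_round_left.
have h2 : \sum_(v in U') #|live_nbrs st.1 v| <= \sum_(v in U) #|live_nbrs st.1 v|.
  by rewrite [leqRHS](big_setID U') /= (setIidPr sub) leq_addr.
have h3 := sum_live st.1.
have h4 := leq_trans h1 (leq_trans h2 h3); rewrite -/U in h4.
(* For [d = 0] nothing can be divided by [d], but then [h4] already says that no vertex survives. *)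
have [d0|d0] := posnP d.
  by move: h4; rewrite d0 muln0 mul0n leqn0 muln_eq0 /= => /eqP ->; rewrite muln0.
rewrite -(leq_pmul2l d0); have : 4 * d * #|U'| <= delta * #|U'| by rewrite leq_mul2r d4 orbT.
by move: h4; rewrite mulSn; move: #|U'| #|U| => x y; nia.
Qed.

Lemma peel_all : (peel (lg n)).1 = setT.
Proof.
have h r : 2 ^ r * #|~: (peel r).1| <= n.
  elim: r => [|r IH]; first by rewrite mul1n; apply: leq_trans (max_card _) _; rewrite card_ord.
  apply: leq_trans IH; rewrite expnS -mulnA mulnCA leq_mul2l.
  by rewrite peel_half orbT.
have := h (lg n); have : n < 2 ^ lg n by apply: trunc_log_ltn.
case: (posnP #|~: (peel (lg n)).1|) => [/eqP|c0 h1 h2]; last by nia.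
by rewrite cards_eq0 => /eqP e _ _; rewrite -[LHS]setCK e setC0.
Qed.

Lemma peel_arcs : let arc := fun x y => (x, y) \in (peel (lg n)).2 in
  [/\ forall x y, adj G x y = arc x y (+) arc y x,
      forall x y, arc x y -> ~~ arc y x &
      forall x, #|[set y | arc x y]| <= delta].
Proof.
have [h1 h2 h3] := peel_inv_all (lg n) => arc.
have xorA x y : adj G x y = arc x y (+) arc y x.
  have [xy|nxy] := boolP (adj G x y).
    by apply/esym; apply: h3 => //; rewrite peel_all inE.
  have -> : arc x y = false by apply/negbTE/negP => /h1 /andP []; rewrite (negPf nxy).
  by have -> : arc y x = false by apply/negbTE/negP => /h1 /andP []; rewrite adj_sym (negPf nxy).
split=> // x y axy; have /andP [] := h1 _ _ axy; rewrite xorA.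
by rewrite axy; case: (arc y x).
Qed.

End Peeling.

Lemma degeneracy_orientation (n : nat) (G : sgraph 'I_n) : exists A : {set 'I_n * 'I_n},
  orientation G A /\ forall u, outdeg A u <= degeneracy G.
Proof.
rewrite /degeneracy; case: ex_minnP => d /existsP [A /and3P [h1 _ /forallP h2]] _.
by exists A.
Qed.
(** * Building expressions *)

(** An expression as a function of the size of the environment where it is used. Binders hand the
    fresh variable to a function, so that programs are written without indices. *)
Definition xp := nat -> expr.
Definition xc (c : nat) : xp := fun _ => ECst c.
Definition xv (j : nat) : xp := fun _ => EVar j.
Definition xop (o : aop) (X Y : xp) : xp := fun l => EOp o (X l) (Y l.+1).
Definition xread (X : xp) : xp := fun l => ERead (X l).
Definition xlet (X : xp) (f : xp -> xp) : xp := fun l => ELet (X l) (f (xv l) l.+1).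
Definition xloop (md : lmode) (b N : xp) (f : xp -> xp -> xp) : xp :=
  fun l => ELoop md (b l) (N l.+2) (f (xv l) (xv l.+1) l.+3).

Definition xadd := xop AAdd.
Definition xsub := xop ASub.
Definition xmul := xop AMul.
Definition xdiv := xop ADiv.
Definition xmod := xop AMod.
Definition xmin := xop AMin.
Definition xeq := xop AEq.
Definition xlt := xop ALt.
Definition xsum (N : xp) (f : xp -> xp) : xp := xloop LSum (xc 0) N (fun _ i => f i).
Definition xprod (N : xp) (f : xp -> xp) : xp := xloop LProd (xc 1) N (fun _ i => f i).
Definition xnot (X : xp) : xp := xsub (xc 1) X.
Definition xor (X Y : xp) : xp := xlt (xc 0) (xadd X Y).
Definition ximp (X Y : xp) : xp := xor (xnot X) Y.
(** Both values are computed and the test selects one by multiplication; the language has no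
    branching. *)
Definition xif (C X Y : xp) : xp := xadd (xmul C X) (xmul (xnot C) Y).
Definition xall (N : xp) (f : xp -> xp) : xp := xeq (xsum N (fun i => xnot (f i))) (xc 0).
Definition xex (N : xp) (f : xp -> xp) : xp := xlt (xc 0) (xsum N f).
Definition xpow (X N : xp) : xp := xprod N (fun _ => X).
Definition xdig (C X J : xp) : xp := xmod (xdiv C (xpow X J)) X.
(** Eight arrays are interleaved: number 0 is the input, 1 the adjacency matrix, 2 marks the removed
    vertices, 3 is the matrix of arcs and 5 the table of steps for walks. *)
Definition xarr (a : nat) (X : xp) : xp := xread (xadd (xmul (xc 8) X) (xc a)).

Definition extends (env env' : seq nat) : Prop := exists e, env' = env ++ e.

Lemma extends_refl env : extends env env.
Proof. by exists [::]; rewrite cats0. Qed.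

Lemma extends_trans e1 e2 e3 : extends e1 e2 -> extends e2 e3 -> extends e1 e3.
Proof. by move=> [a ->] [b ->]; exists (a ++ b); rewrite catA. Qed.

Lemma extends_cat env e : extends env (env ++ e). Proof. by exists e. Qed.

(* The value of an expression is the same at all deeper nesting levels, so that
   it may be used below further binders. *)
Definition denotes (d : nat -> nat) (env : seq nat) (X : xp) (v : nat) : Prop :=
  forall env', extends env env' -> eval d env' (X (size env')) = v.

Lemma val_sub d env env' X v : extends env env' -> denotes d env X v -> denotes d env' X v.
Proof. by move=> h1 h e h2; apply: h; apply: extends_trans h2. Qed.

Lemma val_eq d env X v v' : denotes d env X v -> v = v' -> denotes d env X v'.
Proof. by move=> h <-. Qed.

Lemma val_c d env c : denotes d env (xc c) c. Proof. by []. Qed.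

Lemma val_v d env j : j < size env -> denotes d env (xv j) (nth 0 env j).
Proof. by move=> jl _ [e ->]; rewrite /= nth_cat jl. Qed.

Lemma val_last d env e v t j : j = size env -> extends (env ++ v :: t) e -> denotes d e (xv j) v.
Proof.
move=> -> h e' h'; have [x ->] := extends_trans h h'.
by rewrite /= -catA nth_cat ltnn subnn.
Qed.

Lemma val_op d env o X Y x y : denotes d env X x -> denotes d env Y y ->
  denotes d env (xop o X Y) (aval o x y).
Proof.
move=> hX hY e he; rewrite /xop /= hX //; congr (aval _ _ _).
by rewrite -(hY (e ++ [:: x])) ?size_cat ?addn1 //; apply: extends_trans he (extends_cat _ _).
Qed.

Lemma val_add d env X Y x y : denotes d env X x -> denotes d env Y y -> denotes d env (xadd X Y) (x + y).
Proof. exact: val_op. Qed.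
Lemma val_subn d env X Y x y : denotes d env X x -> denotes d env Y y -> denotes d env (xsub X Y) (x - y).
Proof. exact: val_op. Qed.
Lemma val_mul d env X Y x y : denotes d env X x -> denotes d env Y y -> denotes d env (xmul X Y) (x * y).
Proof. exact: val_op. Qed.
Lemma val_div d env X Y x y : denotes d env X x -> denotes d env Y y -> denotes d env (xdiv X Y) (x %/ y).
Proof. exact: val_op. Qed.
Lemma val_mod d env X Y x y : denotes d env X x -> denotes d env Y y -> denotes d env (xmod X Y) (x %% y).
Proof. exact: val_op. Qed.
Lemma val_min d env X Y x y : denotes d env X x -> denotes d env Y y -> denotes d env (xmin X Y) (minn x y).
Proof. exact: val_op. Qed.
Lemma val_eqb d env X Y x y : denotes d env X x -> denotes d env Y y ->
  denotes d env (xeq X Y) (x == y)%N.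
Proof. exact: val_op. Qed.
Lemma val_ltb d env X Y x y : denotes d env X x -> denotes d env Y y ->
  denotes d env (xlt X Y) (x < y)%N.
Proof. exact: val_op. Qed.

Lemma val_read d env X x : denotes d env X x -> denotes d env (xread X) (d x).
Proof. by move=> h e he; rewrite /xread /= h. Qed.

Lemma val_arr d env a X x : denotes d env X x -> denotes d env (xarr a X) (d (8 * x + a)).
Proof. by move=> h; apply: val_read; apply: val_add => //; apply: val_mul. Qed.

Lemma val_let d env X f x v : denotes d env X x ->
  (forall env' Z, extends env env' -> denotes d env' Z x -> denotes d env' (f Z) v) ->
  denotes d env (xlet X f) v.
Proof.
move=> hX hf e he; rewrite /xlet /= hX //.
have h1 : extends env (e ++ [:: x]) by apply: extends_trans he (extends_cat _ _).
have h2 : denotes d (e ++ [:: x]) (xv (size e)) x.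
  exact: (@val_last d e _ x [::] _ (erefl _) (extends_refl _)).
by have := hf _ _ h1 h2 _ (extends_refl _); rewrite size_cat addn1.
Qed.

Lemma val_loop d env md b N f x n (g : nat -> nat -> nat) :
  denotes d env b x -> denotes d env N n ->
  (forall i a env' Za Zi, i < n -> extends env env' -> denotes d env' Za a -> denotes d env' Zi i ->
     a = iteri i (fun i acc => comb md acc (g i acc)) x ->
     denotes d env' (f Za Zi) (g i a)) ->
  denotes d env (xloop md b N f) (iteri n (fun i acc => comb md acc (g i acc)) x).
Proof.
move=> hb hN hf e he; rewrite /xloop /= hb //.
have hN' : eval d (e ++ [:: x; 0]) (N (size e).+2) = n.
  rewrite -(hN (e ++ [:: x; 0])) ?size_cat ?addn2 //.
  exact: extends_trans he (extends_cat _ _).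
rewrite hN'; have : n <= n by []; elim: {1 3 5}n => // i IH iN.
rewrite !iteriS IH ?(ltnW iN) //; congr (comb _ _ _).
set a := iteri _ _ _; set e' := e ++ _.
have h1 : extends env e' by apply: extends_trans he (extends_cat _ _).
have h2 : denotes d e' (xv (size e)) a by apply: (@val_last d e e' a [:: i; n - i]) => //; apply: extends_refl.
have h3 : denotes d e' (xv (size e).+1) i.
  apply: (@val_last d (e ++ [:: a]) e' i [:: n - i]); first by rewrite size_cat addn1.
  by rewrite -catA; apply: extends_refl.
have := hf i a e' _ _ iN h1 h2 h3 (erefl _) _ (extends_refl _).
by rewrite /e' size_cat addn3.
Qed.

Lemma val_sum d env N f n (g : nat -> nat) : denotes d env N n ->
  (forall i env' Z, i < n -> extends env env' -> denotes d env' Z i -> denotes d env' (f Z) (g i)) ->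
  denotes d env (xsum N f) (\sum_(i < n) g i).
Proof.
move=> hN hf.
have h : denotes d env (xloop LSum (xc 0) N (fun _ i => f i))
    (iteri n (fun i acc => comb LSum acc (g i)) 0).
  apply: (@val_loop d env LSum (xc 0) N (fun _ i => f i) 0 n (fun i _ => g i)) => //.
  by move=> i a e' Za Zi iN h1 _ h3 _; apply: hf.
apply: val_eq h _.
by elim: n {hN hf} => [|n IH]; rewrite ?big_ord0 // big_ord_recr iteriS IH.
Qed.

Lemma val_prod d env N f n (g : nat -> nat) : denotes d env N n ->
  (forall i env' Z, i < n -> extends env env' -> denotes d env' Z i -> denotes d env' (f Z) (g i)) ->
  denotes d env (xprod N f) (\prod_(i < n) g i).
Proof.
move=> hN hf.
have h : denotes d env (xloop LProd (xc 1) N (fun _ i => f i))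
    (iteri n (fun i acc => comb LProd acc (g i)) 1).
  apply: (@val_loop d env LProd (xc 1) N (fun _ i => f i) 1 n (fun i _ => g i)) => //.
  by move=> i a e' Za Zi iN h1 _ h3 _; apply: hf.
apply: val_eq h _.
by elim: n {hN hf} => [|n IH]; rewrite ?big_ord0 // big_ord_recr iteriS IH.
Qed.

Lemma val_not d env X (x : bool) : denotes d env X x -> denotes d env (xnot X) (~~ x).
Proof. move=> h; have h2 : denotes d env (xnot X) (1 - x) by apply: val_subn h; apply: val_c.
by apply: val_eq h2 _; case: x h. Qed.

Lemma val_and d env X Y (x y : bool) : denotes d env X x -> denotes d env Y y ->
  denotes d env (xmul X Y) (x && y).
Proof. by move=> h h'; apply: val_eq (val_mul h h') _; rewrite mulnb. Qed.

Lemma val_or d env X Y (x y : bool) : denotes d env X x -> denotes d env Y y ->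
  denotes d env (xor X Y) (x || y).
Proof.
move=> h h'; have h2 : denotes d env (xor X Y) (0 < x + y).
  by apply: val_ltb; [apply: val_c|apply: val_add].
by apply: val_eq h2 _; case: x h; case: y h'.
Qed.

Lemma val_imp d env X Y (x y : bool) : denotes d env X x -> denotes d env Y y ->
  denotes d env (ximp X Y) (x ==> y).
Proof. by move=> h h'; rewrite implybE; apply: val_or => //; apply: val_not. Qed.

Lemma val_if d env C X Y (c : bool) x y : denotes d env C c -> denotes d env X x -> denotes d env Y y ->
  denotes d env (xif C X Y) (if c then x else y).
Proof.
move=> hc hx hy; have h2 : denotes d env (xif C X Y) (c * x + ~~ c * y).
  by apply: val_add; apply: val_mul => //; apply: val_not.
apply: val_eq h2 _.
by case: c hc => _; rewrite ?mul1n ?mul0n ?addn0.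
Qed.

Lemma val_all d env N f n (p : nat -> bool) : denotes d env N n ->
  (forall i env' Z, i < n -> extends env env' -> denotes d env' Z i -> denotes d env' (f Z) (p i)) ->
  denotes d env (xall N f) [forall i : 'I_n, p i].
Proof.
move=> hN hf; have h : denotes d env (xall N f) (\sum_(i < n) ~~ p i == 0).
  apply: val_eqb; last exact: val_c; apply: (val_sum (g := fun i => ~~ p i)) => //.
  by move=> i e' Z iN h1 h2; apply: val_not; apply: hf.
apply: val_eq h _; congr nat_of_bool; rewrite sum_nat_eq0; apply: eq_forallb => i.
by rewrite eqb0 negbK.
Qed.

Lemma val_ex d env N f n (p : nat -> bool) : denotes d env N n ->
  (forall i env' Z, i < n -> extends env env' -> denotes d env' Z i -> denotes d env' (f Z) (p i)) ->
  denotes d env (xex N f) [exists i : 'I_n, p i].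
Proof.
move=> hN hf; have h : denotes d env (xex N f) (0 < \sum_(i < n) p i).
  by apply: val_ltb; [apply: val_c|apply: (val_sum (g := fun i => nat_of_bool (p i)))].
apply: val_eq h _; congr nat_of_bool; rewrite lt0n sum_nat_eq0 negb_forall; apply: eq_existsb => i.
by rewrite eqb0 negbK.
Qed.

Lemma val_pow d env X N x n : denotes d env X x -> denotes d env N n -> denotes d env (xpow X N) (x ^ n).
Proof.
move=> hx hn; have h : denotes d env (xpow X N) (\prod_(i < n) x).
  by apply: (val_prod (g := fun _ => x)) => // i e' Z _ h _; apply: val_sub hx.
apply: val_eq h _; by rewrite prod_nat_const card_ord.
Qed.

Definition ndig (c b j : nat) : nat := c %/ b ^ j %% b.

Lemma val_dig d env C X J c b j : denotes d env C c -> denotes d env X b -> denotes d env J j ->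
  denotes d env (xdig C X J) (ndig c b j).
Proof. by move=> h1 h2 h3; apply: val_mod => //; apply: val_div => //; apply: val_pow. Qed.

(** Facts known in an outer environment are transported along [extends] to the current one. *)
Ltac vfind :=
  first [ eassumption
        | match goal with H : forall d, denotes d ?e ?X _ |- denotes _ ?e ?X _ => apply: H end
        | match goal with H : extends _ ?e |- denotes _ ?e _ _ => apply: (val_sub H); vfind end ].

Ltac vstep :=
  lazymatch goal with
  | |- denotes _ _ (xc _) _ => apply: val_c
  | |- denotes _ _ (xadd _ _) _ => apply: val_add
  | |- denotes _ _ (xsub _ _) _ => apply: val_subn
  | |- denotes _ _ (xmul _ _) (nat_of_bool (_ && _)) => apply: val_and
  | |- denotes _ _ (xmul _ _) _ => apply: val_mul
  | |- denotes _ _ (xdiv _ _) _ => apply: val_div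
  | |- denotes _ _ (xmod _ _) _ => apply: val_mod
  | |- denotes _ _ (xmin _ _) _ => apply: val_min
  | |- denotes _ _ (xeq _ _) _ => apply: val_eqb
  | |- denotes _ _ (xlt _ _) _ => apply: val_ltb
  | |- denotes _ _ (xarr _ _) _ => apply: val_arr
  | |- denotes _ _ (xread _) _ => apply: val_read
  | |- denotes _ _ (xnot _) _ => apply: val_not
  | |- denotes _ _ (xor _ _) _ => apply: val_or
  | |- denotes _ _ (ximp _ _) _ => apply: val_imp
  | |- denotes _ _ (xif _ _ _) _ => apply: val_if
  | |- denotes _ _ (xpow _ _) _ => apply: val_pow
  | |- denotes _ _ (xdig _ _ _) _ => apply: val_dig
  | |- denotes _ _ (xsum _ _) _ => apply: val_sum; [|intros ? ? ? ? ? ?]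
  | |- denotes _ _ (xprod _ _) _ => apply: val_prod; [|intros ? ? ? ? ? ?]
  | |- denotes _ _ (xall _ _) _ => apply: val_all; [|intros ? ? ? ? ? ?]
  | |- denotes _ _ (xex _ _) _ => apply: val_ex; [|intros ? ? ? ? ? ?]
  | |- denotes _ _ (xlet _ _) _ => apply: val_let; [|intros ? ? ? ?]
  end.

Ltac vauto := repeat first [ vfind | vstep ].

(** * Weakest preconditions of statements *)

Definition xs := nat -> stmt.
Definition sstore (X Y : xp) : xs := fun l => SStore (X l) (Y l.+1).
Definition sseq (s t : xs) : xs := fun l => SSeq (s l) (t l).
Definition slet (X : xp) (f : xp -> xs) : xs := fun l => SLet (X l) (f (xv l) l.+1).
Definition sfor (N : xp) (f : xp -> xs) : xs := fun l => SFor (N l.+1) (f (xv l) l.+2).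

Definition wp (d : nat -> nat) (env : seq nat) (s : xs) (Q : (nat -> nat) -> Prop) : Prop :=
  forall env', extends env env' -> Q (srun env' (s (size env')) d).

Lemma wp_sub d env env' s Q : extends env env' -> wp d env s Q -> wp d env' s Q.
Proof. by move=> h hw e he; apply: hw; apply: extends_trans he. Qed.

Lemma wp_store d env X Y x y (Q : (nat -> nat) -> Prop) :
  denotes d env X x -> denotes d env Y y -> Q (update d x y) -> wp d env (sstore X Y) Q.
Proof.
move=> hX hY hQ e he; rewrite /sstore /= hX //.
have h1 : extends env (e ++ [:: x]) by apply: extends_trans he (extends_cat _ _).
by have := hY _ h1; rewrite size_cat addn1 => ->.
Qed.

Lemma wp_seq d env s t Q : wp d env s (fun d' => wp d' env t Q) -> wp d env (sseq s t) Q.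
Proof. by move=> h e he; apply: h. Qed.

(** The bound variable denotes [x] for every state of the data, because the statement under the
    binder may change them. *)
Lemma wp_let d env X f x Q : denotes d env X x ->
  (forall env' Z, extends env env' -> (forall d', denotes d' env' Z x) -> wp d env' (f Z) Q) ->
  wp d env (slet X f) Q.
Proof.
move=> hX hf e he; rewrite /slet /= hX //.
have h1 : extends env (e ++ [:: x]) by apply: extends_trans he (extends_cat _ _).
have h2 d' : denotes d' (e ++ [:: x]) (xv (size e)) x.
  exact: (@val_last d' e _ x [::] _ (erefl _) (extends_refl _)).
by have := hf _ _ h1 h2 _ (extends_refl _); rewrite size_cat addn1.
Qed.

Lemma wp_for (Inv : nat -> (nat -> nat) -> Prop) d env N f n (Q : (nat -> nat) -> Prop) :
  denotes d env N n -> Inv 0 d ->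
  (forall i d' env' Z, i < n -> Inv i d' -> extends env env' ->
     (forall d'', denotes d'' env' Z i) -> wp d' env' (f Z) (Inv i.+1)) ->
  (forall d', Inv n d' -> Q d') ->
  wp d env (sfor N f) Q.
Proof.
move=> hN I0 hf hQ e he; rewrite /sfor /=; apply: hQ.
have -> : eval d (e ++ [:: 0]) (N (size e).+1) = n.
  rewrite -(hN (e ++ [:: 0])) ?size_cat ?addn1 //.
  exact: extends_trans he (extends_cat _ _).
have : n <= n by []; elim: {1 3 4}n => // i IH iN.
rewrite iteriS; set e' := e ++ _.
have h1 : extends env e' by apply: extends_trans he (extends_cat _ _).
have h2 d' : denotes d' e' (xv (size e)) i.
  by apply: (@val_last d' e e' i [:: n - i]) => //; apply: extends_refl.
have := hf i _ e' _ iN (IH (ltnW iN)) h1 h2 _ (extends_refl _).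
by rewrite /e' size_cat addn2.
Qed.

Definition sarr (a : nat) (X Y : xp) : xs := sstore (xadd (xmul (xc 8) X) (xc a)) Y.

Lemma update_arr d i a v j b : a < 8 -> b < 8 ->
  update d (8 * i + a) v (8 * j + b) =
  if (j == i) && (b == a) then v else d (8 * j + b).
Proof.
move=> ha hb; rewrite /update; case: eqP => e; case: andP => h //.
  by case: h; split; apply/eqP; lia.
by case: h => /eqP h1 /eqP h2; case: e; rewrite h1 h2.
Qed.

Lemma wp_arr d env a X Y x y (Q : (nat -> nat) -> Prop) :
  denotes d env X x -> denotes d env Y y -> Q (update d (8 * x + a) y) ->
  wp d env (sarr a X Y) Q.
Proof. by move=> hX hY; apply: wp_store => //; apply: val_add => //; apply: val_mul. Qed.

(* A loop over 0 or 1 iterations. *)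
Definition swhen (C : xp) (s : xs) : xs := sfor C (fun _ => s).

Lemma wp_when d env C s (c : bool) (Q : (nat -> nat) -> Prop) :
  denotes d env C c -> (c -> wp d env s Q) -> (~~ c -> Q d) -> wp d env (swhen C s) Q.
Proof.
move=> hC h1 h0; apply: (@wp_for (fun i d' => if i == 0 then d' = d else Q d')
  d env C (fun _ => s) c) => //.
- by case: c {hC} h1 h0 => // h1 _ [|i] // d' env' Z _ -> h _; apply: wp_sub (h1 isT).
- by move=> d'; case: c {hC h1} h0 => //= h0 ->; apply: h0.
Qed.

(** * Finite maps as numbers *)

Definition ncode (N m : nat) (g : nat -> nat) : nat := \sum_(j < m) g j * N ^ j.

Lemma ncode_lt N m g : (forall j, j < m -> g j < N) -> ncode N m g < N ^ m.
Proof.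
elim: m => [|m IH] h; first by rewrite /ncode big_ord0.
rewrite /ncode big_ord_recr /= -/(ncode N m g) expnS.
have h1 := IH (fun j jm => h j (ltnW jm)); have := h m (leqnn _); nia.
Qed.

Lemma ndig_ncode N m g j : (forall j, j < m -> g j < N) -> j < m -> ndig (ncode N m g) N j = g j.
Proof.
elim: m => // m IH h; rewrite ltnS leq_eqVlt /ncode big_ord_recr /= -/(ncode N m g) /ndig.
have h' i : i < m -> g i < N by move=> im; apply: h; apply: ltnW.
move=> /orP [/eqP ->|jm]; last by rewrite digit_lt //; apply: IH.
by apply: digit_eq; [apply: ncode_lt|apply: h].
Qed.

(** A digit past the end reads as 0, which agrees with the default [v0] of [anchor_value]. *)
Lemma ndig_big c N m j : c < N ^ m -> m <= j -> ndig c N j = 0.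
Proof.
move=> h mj; have [N0|N0] := posnP N; last first.
  by rewrite /ndig divn_small ?mod0n //; apply: (leq_trans h); rewrite leq_pexp2l.
rewrite /ndig N0 modn0; case: j mj => [|j] mj; last by rewrite exp0n // divn0.
by move: mj h; rewrite leqn0 => /eqP ->; case: c.
Qed.

Definition fnat (m N : nat) (f : {ffun 'I_m -> 'I_N}) (j : nat) : nat :=
  if insub j is Some v then val (f v) else 0.

Lemma fnatE m N (f : {ffun 'I_m -> 'I_N}) (v : 'I_m) : fnat f v = f v.
Proof. by rewrite /fnat valK. Qed.

Lemma fnat_lt m N (f : {ffun 'I_m -> 'I_N}) j : j < m -> fnat f j < N.
Proof. by move=> jm; rewrite -[j]/(val (Ordinal jm)) fnatE. Qed.

Definition code (m N : nat) (f : {ffun 'I_m -> 'I_N}) : nat := ncode N m (fnat f).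

Lemma code_lt m N (f : {ffun 'I_m -> 'I_N}) : code f < N ^ m.
Proof. by apply: ncode_lt => j; apply: fnat_lt. Qed.

Lemma ndig_code m N (f : {ffun 'I_m -> 'I_N}) (v : 'I_m) : ndig (code f) N v = f v.
Proof. by rewrite ndig_ncode ?fnatE // => j; apply: fnat_lt. Qed.

Lemma code_inj m N : injective (@code m N).
Proof.
by move=> f g e; apply/ffunP => v; apply: val_inj; rewrite /= -!ndig_code e.
Qed.

(** This turns a sum over maps into a single loop of [N ^ m] rounds: codes are injective and the two
    sets are equally large. *)
Lemma sum_code m N (F : nat -> nat) :
  \sum_(i < N ^ m) F i = \sum_(f : {ffun 'I_m -> 'I_N}) F (code f).
Proof.
pose h (f : {ffun 'I_m -> 'I_N}) := Ordinal (code_lt f).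
have hi : injective h by move=> f g [] /code_inj.
have cd : #|'I_(N ^ m)| <= #|{: {ffun 'I_m -> 'I_N}}| by rewrite card_ffun !card_ord.
have [h' hK h'K] := inj_card_bij hi cd.
by rewrite (reindex h) //=; exists h' => ? _.
Qed.

Lemma exists_code m N (P : nat -> bool) :
  [exists i : 'I_(N ^ m), P i] = [exists f : {ffun 'I_m -> 'I_N}, P (code f)].
Proof.
apply/existsP/existsP => [[i Pi]|[f Pf]]; last by exists (Ordinal (code_lt f)).
pose h (f : {ffun 'I_m -> 'I_N}) := Ordinal (code_lt f).
have hi : injective h by move=> f g [] /code_inj.
have cd : #|'I_(N ^ m)| <= #|{: {ffun 'I_m -> 'I_N}}| by rewrite card_ffun !card_ord.
have [h' hK h'K] := inj_card_bij hi cd.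
by exists (h' i); rewrite -[code _]/(val (h (h' i))) h'K.
Qed.

(** * Searching for a plan *)

Definition nlab (k c u v : nat) : nat := ndig c 4 (u * k + v).
Definition xlab (K C U V : xp) : xp := xdig C (xc 4) (xadd (xmul U K) V).

Lemma val_lab d env K C U V k c u v : denotes d env K k -> denotes d env C c ->
  denotes d env U u -> denotes d env V v -> denotes d env (xlab K C U V) (nlab k c u v).
Proof. by move=> *; rewrite /xlab; vauto. Qed.

Definition nforced (k c u v : nat) : bool :=
  ((nlab k c u v == 1) || (nlab k c u v == 3)) ||
  ((nlab k c v u == 2) || (nlab k c v u == 3)).

Definition xforced (K C U V : xp) : xp :=
  xor (xor (xeq (xlab K C U V) (xc 1)) (xeq (xlab K C U V) (xc 3)))
      (xor (xeq (xlab K C V U) (xc 2)) (xeq (xlab K C V U) (xc 3))).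

Lemma val_forced d env K C U V k c u v : denotes d env K k -> denotes d env C c ->
  denotes d env U u -> denotes d env V v -> denotes d env (xforced K C U V) (nforced k c u v).
Proof. by move=> *; rewrite /xforced /nforced; repeat first [apply: val_lab | vfind | vstep]. Qed.

(* A plan is a number in base [k + 3] with four digits per vertex. *)
Definition nfield (k z f v : nat) : nat := ndig z (k + 3) (f * k + v).
Definition xfield (K Z : xp) (f : nat) (V : xp) : xp :=
  xdig Z (xadd K (xc 3)) (xadd (xmul (xc f) K) V).

Lemma val_field d env K Z f V k z v : denotes d env K k -> denotes d env Z z ->
  denotes d env V v -> denotes d env (xfield K Z f V) (nfield k z f v).
Proof. by move=> *; rewrite /xfield; vauto. Qed.

Notation nlev k z := (nfield k z 0).
Notation nrt k z := (nfield k z 1).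
Notation nan k z := (nfield k z 2).
Notation nix k z := (nfield k z 3).
Notation xlev K Z := (xfield K Z 0).
Notation xrt K Z := (xfield K Z 1).
Notation xan K Z := (xfield K Z 2).
Notation xix K Z := (xfield K Z 3).

Definition ngroup (k z v w : nat) : bool :=
  (nlev k z w == nlev k z v) && ((nlev k z v == 0) || (nrt k z w == nrt k z v)).
Definition xgroup (K Z V W : xp) : xp :=
  xmul (xeq (xlev K Z W) (xlev K Z V))
       (xor (xeq (xlev K Z V) (xc 0)) (xeq (xrt K Z W) (xrt K Z V))).

Lemma val_group d env K Z V W k z v w : denotes d env K k -> denotes d env Z z ->
  denotes d env V v -> denotes d env W w -> denotes d env (xgroup K Z V W) (ngroup k z v w).
Proof. by move=> *; rewrite /xgroup /ngroup; repeat first [apply: val_field | vfind | vstep]. Qed.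

(** Connectedness by exhaustive search: [w] codes the [k + 1] vertices of a walk of [k] steps that
    may stand still. The cost depends on [k] alone. *)
Definition nreach (k c z v : nat) : bool :=
  [exists w : 'I_(k ^ (k + 1)),
    ((ndig w k 0 == nan k z v) && (ndig w k k == v)) &&
    [forall j : 'I_k, (ndig w k j == ndig w k (j + 1)) ||
       (nforced k c (ndig w k j) (ndig w k (j + 1)) && ngroup k z v (ndig w k (j + 1)))]].
Definition xreach (K C Z V : xp) : xp :=
  xex (xpow K (xadd K (xc 1))) (fun W =>
    xmul (xmul (xeq (xdig W K (xc 0)) (xan K Z V)) (xeq (xdig W K K) V))
      (xall K (fun J => xor (xeq (xdig W K J) (xdig W K (xadd J (xc 1))))
         (xmul (xforced K C (xdig W K J) (xdig W K (xadd J (xc 1))))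
               (xgroup K Z V (xdig W K (xadd J (xc 1)))))))).

Lemma val_reach d env K C Z V k c z v : denotes d env K k -> denotes d env C c ->
  denotes d env Z z -> denotes d env V v -> denotes d env (xreach K C Z V) (nreach k c z v).
Proof.
move=> *; rewrite /xreach /nreach.
apply: (val_ex (p := fun w => ((ndig w k 0 == nan k z v) && (ndig w k k == v)) &&
    [forall j : 'I_k, (ndig w k j == ndig w k (j + 1)) ||
       (nforced k c (ndig w k j) (ndig w k (j + 1)) && ngroup k z v (ndig w k (j + 1)))])).
  by vauto.
intros; apply: val_and; first by repeat first [apply: val_field | vfind | vstep].
apply: (val_all (p := fun j => (ndig i k j == ndig i k (j + 1)) ||
       (nforced k c (ndig i k j) (ndig i k (j + 1)) && ngroup k z v (ndig i k (j + 1))))).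
  by vauto.
by intros; repeat first [apply: val_field | apply: val_forced | apply: val_group | vfind | vstep].
Qed.

Definition nvalid1 (k q c z v : nat) : bool :=
  [&& nlev k z v < 3, nrt k z v < k, nan k z v < k,
      (nlev k z v == 0) ==> [&& nlev k z (nan k z v) == 0, nan k z (nan k z v) == nan k z v
        & nix k z (nan k z v) < q],
      ~~ (nlev k z v == 0) ==> [&& nlev k z (nrt k z v) == 1, nrt k z (nrt k z v) == nrt k z v
        & (nlev k z v == 1) ==> (nan k z v == nrt k z v)] &
      ~~ (nlev k z v == 2) ==> nreach k c z v].
Definition xand3 X Y Z : xp := xmul X (xmul Y Z).
Definition xvalid1 (K Q C Z V : xp) : xp :=
  xmul (xlt (xlev K Z V) (xc 3)) (xmul (xlt (xrt K Z V) K) (xmul (xlt (xan K Z V) K)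
  (xmul (ximp (xeq (xlev K Z V) (xc 0))
       (xand3 (xeq (xlev K Z (xan K Z V)) (xc 0)) (xeq (xan K Z (xan K Z V)) (xan K Z V))
              (xlt (xix K Z (xan K Z V)) Q)))
  (xmul (ximp (xnot (xeq (xlev K Z V) (xc 0)))
       (xand3 (xeq (xlev K Z (xrt K Z V)) (xc 1)) (xeq (xrt K Z (xrt K Z V)) (xrt K Z V))
              (ximp (xeq (xlev K Z V) (xc 1)) (xeq (xan K Z V) (xrt K Z V)))))
       (ximp (xnot (xeq (xlev K Z V) (xc 2))) (xreach K C Z V)))))).

Lemma val_valid1 d env K Q C Z V k q c z v : denotes d env K k -> denotes d env Q q ->
  denotes d env C c -> denotes d env Z z -> denotes d env V v ->
  denotes d env (xvalid1 K Q C Z V) (nvalid1 k q c z v).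
Proof.
by move=> *; rewrite /xvalid1 /nvalid1 /xand3;
  repeat first [apply: val_reach | apply: val_field | vfind | vstep].
Qed.

Definition nvalid2 (k c z u v : nat) : bool :=
  ([&& nlev k z u == 0, nlev k z v == 0, nan k z u == u, nan k z v == v &
      nix k z u == nix k z v] ==> (u == v)) &&
  ([&& nforced k c u v, ~~ (nlev k z u == 0) & ~~ (nlev k z v == 0)] ==>
     ((nrt k z u == nrt k z v) &&
      ((nlev k z u == 2) && (nlev k z v == 2) ==> (u == v)))).
Definition xvalid2 (K C Z U V : xp) : xp :=
  xmul
  (ximp (xmul (xeq (xlev K Z U) (xc 0)) (xmul (xeq (xlev K Z V) (xc 0))
     (xand3 (xeq (xan K Z U) U) (xeq (xan K Z V) V) (xeq (xix K Z U) (xix K Z V)))))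
     (xeq U V))
  (ximp (xand3 (xforced K C U V) (xnot (xeq (xlev K Z U) (xc 0))) (xnot (xeq (xlev K Z V) (xc 0))))
     (xmul (xeq (xrt K Z U) (xrt K Z V))
       (ximp (xmul (xeq (xlev K Z U) (xc 2)) (xeq (xlev K Z V) (xc 2))) (xeq U V)))).

Lemma val_valid2 d env K C Z U V k c z u v : denotes d env K k ->
  denotes d env C c -> denotes d env Z z -> denotes d env U u -> denotes d env V v ->
  denotes d env (xvalid2 K C Z U V) (nvalid2 k c z u v).
Proof.
by move=> *; rewrite /xvalid2 /nvalid2 /xand3;
  repeat first [apply: val_forced | apply: val_field | vfind | vstep].
Qed.

Definition nvalid (k q c z : nat) : bool :=
  [forall v : 'I_k, nvalid1 k q c z v] &&
  [forall u : 'I_k, [forall v : 'I_k, nvalid2 k c z u v]].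
Definition xvalid (K Q C Z : xp) : xp :=
  xmul (xall K (fun V => xvalid1 K Q C Z V)) (xall K (fun U => xall K (fun V => xvalid2 K C Z U V))).

Lemma val_valid d env K Q C Z k q c z : denotes d env K k -> denotes d env Q q ->
  denotes d env C c -> denotes d env Z z ->
  denotes d env (xvalid K Q C Z) (nvalid k q c z).
Proof.
move=> *; apply: val_and.
  by apply: (val_all (p := nvalid1 k q c z)) => *; [vfind|apply: val_valid1; vfind].
apply: (val_all (p := fun u => [forall v : 'I_k, nvalid2 k c z u v])); [vfind|intros].
by apply: (val_all (p := nvalid2 k c z i)) => *; [vfind|apply: val_valid2; vfind].
Qed.

(** All codes are tried and the last valid one is kept. No data are read, so the whole search is
    covered by [kexp]. *)
Definition nfind (k q c : nat) : nat :=
  iteri ((k + 3) ^ (4 * k)) (fun z acc => if nvalid k q c z then z else acc) 0.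
Definition xfind (K Q C : xp) : xp :=
  xloop LSet (xc 0) (xpow (xadd K (xc 3)) (xmul (xc 4) K))
    (fun A Z => xif (xvalid K Q C Z) Z A).

Lemma val_find d env K Q C k q c : denotes d env K k -> denotes d env Q q ->
  denotes d env C c -> denotes d env (xfind K Q C) (nfind k q c).
Proof.
move=> *; apply: (val_loop (md := LSet) (g := fun z acc => if nvalid k q c z then z else acc)).
- by vauto.
- by vauto.
by intros; apply: val_if; [apply: val_valid; vfind|vfind|vfind].
Qed.

Lemma nfind_valid k q c z : z < (k + 3) ^ (4 * k) -> nvalid k q c z -> nvalid k q c (nfind k q c).
Proof.
rewrite /nfind; elim: (_ ^ _) => // m IH; rewrite ltnS leq_eqVlt iteriS.
set a := iteri m _ _ in IH *.
move=> /orP [/eqP ->|zm] hv; first by rewrite hv.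
by have := IH zm hv; case: ifP.
Qed.
Section PlanCodes.
Variables (k : nat) (lab : {ffun 'I_(k * k) -> 'I_4}) (z : nat) (P : plan k).
Let e := forced (lab_of lab).

Lemma nlab_code (u v : 'I_k) : nlab k (code lab) u v = lab_of lab u v.
Proof. by rewrite /nlab -[u * k + v]/(val (pidx u v)) ndig_code. Qed.

Lemma nforced_code (u v : 'I_k) : nforced k (code lab) u v = e u v.
Proof. by rewrite /nforced !nlab_code /e /forced /= !inE. Qed.

Hypothesis hlev : forall v, nlev k z (nat_of_ord v) = lev P v.
Hypothesis hrt : forall v, nrt k z (nat_of_ord v) = rt P v.
Hypothesis han : forall v, nan k z (nat_of_ord v) = an P v.
Hypothesis hix : forall v, nix k z (nat_of_ord v) = minn (ix P v) (k + 2).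

Lemma ngroup_code (v w : 'I_k) : ngroup k z v w = group P v w.
Proof. by rewrite /ngroup /group !hlev !hrt. Qed.

Lemma nreach_code (v : 'I_k) :
  nreach k (code lab) z v = connect [rel a b | e a b && group P v b] (an P v) v.
Proof.
rewrite /nreach addn1.
rewrite (@exists_code k.+1 k (fun w => ((ndig w k 0 == nan k z v) && (ndig w k k == v)) &&
    [forall j : 'I_k, (ndig w k j == ndig w k (j + 1)) ||
       (nforced k (code lab) (ndig w k j) (ndig w k (j + 1)) && ngroup k z v (ndig w k (j + 1)))])).
apply/existsP/connectP => [[f /andP [/andP [/eqP f0 /eqP fk] /forallP step]]|[p0 p0p]].
  suff h (j : 'I_k.+1) : connect [rel a b | e a b && group P v b] (f ord0) (f j).
    have := h ord_max; have -> : f ord_max = v.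
      by apply: val_inj; rewrite /= -fk -(ndig_code f ord_max).
    have -> : f ord0 = an P v.
      by apply: val_inj; rewrite /= -han -f0 -(ndig_code f ord0).
    by move=> /connectP [p pp lp]; exists p.
  case: j => j; elim: j => [|j IH] jk.
    by rewrite (_ : Ordinal jk = ord0) //; apply: val_inj.
  have jk' : j < k.+1 by apply: ltnW.
  apply: connect_trans (IH jk') _.
  have := step (Ordinal (jk : j < k)); rewrite addn1 /=.
  rewrite -[j in ndig _ _ j]/(nat_of_ord (Ordinal jk')) -[j.+1]/(nat_of_ord (Ordinal jk)) !ndig_code.
  move=> /orP [/eqP /val_inj -> //|]; rewrite nforced_code ngroup_code => h.
  exact: connect1.
move=> lp0; case/shortenP: p0p lp0 => p pp up _ lp.
have sp : size p < k.
  have := card_uniqP up => /= c; have := max_card [in an P v :: p].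
  by rewrite c card_ord.
pose f : {ffun 'I_k.+1 -> 'I_k} := [ffun j : 'I_k.+1 => nth v (an P v :: p) j].
have fE j : j <= k -> ndig (code f) k j = nth v (an P v :: p) j.
  by move=> jk; rewrite -[j]/(nat_of_ord (Ordinal (jk : j < k.+1))) ndig_code ffunE.
exists f; rewrite !fE // han eqxx andTb; apply/andP; split.
  by rewrite nth_default.
apply/forallP => j; rewrite !fE ?addn1 //; last exact: ltnW.
have [jp|jp] := ltnP j (size p).
  have := pathP v pp j jp => /= h; rewrite nforced_code ngroup_code.
  by move: h => /= ->; rewrite orbT.
rewrite [nth v _ j.+1]nth_default //.
have [->|jp'] := eqVneq (nat_of_ord j) (size p).
  by rewrite -[size p]/((size (an P v :: p)).-1) nth_last /= -lp eqxx.
by rewrite nth_default ?eqxx //= ltn_neqAle eq_sym jp'.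
Qed.

(** Cutting [ix] off at [k + 2], so that it fits into a digit, loses nothing: only the indices of
    anchors matter, and these are below [k / 4]. *)
Lemma nvalid_code : nvalid k (k %/ 4) (code lab) z <-> good_plan e P.
Proof.
have k4 : k %/ 4 <= k by apply: leq_div.
split.
  move=> /andP [/forallP h1 /forallP h2].
  have h1' v := h1 v; rewrite /nvalid1 in h1'.
  have {}h2 u v := forallP (h2 u) v; rewrite /nvalid2 in h2.
  split.
  - by move=> v; have /andP [] := h1' v; rewrite hlev.
  - move=> v lv; have /and5P [_ _ _ /implyP h _] := h1' v.
    move: h; rewrite !han !hlev lv hix => /(_ isT) /and3P [/eqP -> /eqP /val_inj -> h].
    by split=> //; split=> //; move: h; rewrite /minn; case: ifP => //; lia.
  - move=> v lv; have /and5P [_ _ _ _ /andP [/implyP h _]] := h1' v.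
    move: h; rewrite !hrt !hlev lv han => /(_ isT) /and3P [/eqP -> /eqP /val_inj -> /implyP h].
    by split=> // /eqP /h /eqP /val_inj.
  - move=> v lv; have /and5P [_ _ _ _ /andP [_ /implyP h]] := h1' v.
    by move: h; rewrite hlev nreach_code => /(_ lv).
  - split=> u v.
      move=> lu lv au av eix; have /andP [/implyP h _] := h2 u v.
      apply/val_inj/eqP; apply: h.
      by rewrite !hlev !han !hix lu lv au av eix !eqxx.
    move=> euv lu lv; have /andP [_ /implyP h] := h2 u v.
    move: h; rewrite nforced_code !hlev lu lv euv !hrt => /(_ isT) /andP [/eqP /val_inj -> /implyP h].
    by split=> // l2 l2'; apply/val_inj/eqP; apply: h; rewrite l2 l2'.
move=> [g1 g2 g3 g4 [g5 g6]]; apply/andP; split.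
  apply/forallP => v; rewrite /nvalid1 ?(hlev, hrt, han) ?(hlev, hrt, han) hix nreach_code.
  rewrite ltnS g1 !ltn_ord /=; apply/and3P; split.
  - apply/implyP => /eqP /g2 [-> [-> h]]; rewrite !eqxx /=.
    by apply: leq_ltn_trans h; apply: geq_minl.
  - by apply/implyP => /g3 [-> -> h]; rewrite !eqxx /=; apply/implyP => /eqP /h ->.
  - by apply/implyP => /g4.
apply/forallP => u; apply/forallP => v; rewrite /nvalid2 !hlev !han !hix !hrt nforced_code.
apply/andP; split.
  apply/implyP => /and5P [/eqP lu /eqP lv /eqP /val_inj au /eqP /val_inj av /eqP eix].
  rewrite (g5 u v) //.
  have [_ [_ h]] := g2 u lu; have [_ [_ h']] := g2 v lv; rewrite au in h; rewrite av in h'.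
  by move: eix; rewrite /minn; do 2 (case: ifP); lia.
apply/implyP => /and3P [euv lu lv]; have [-> h] := g6 u v euv lu lv; rewrite eqxx /=.
by apply/implyP => /andP [/eqP l2 /eqP l2']; rewrite (h l2 l2').
Qed.

End PlanCodes.

(** The defaults of [insubd] are taken only for codes that [nvalid] rejects. *)
Definition plan_of (k z : nat) : plan k :=
  Plan (fun v : 'I_k => nlev k z v) (fun v => insubd v (nrt k z v))
    (fun v => insubd v (nan k z v)) (fun v => nix k z v).

Lemma ndig_lt c b j : 0 < b -> ndig c b j < b.
Proof. by move=> h; rewrite /ndig ltn_mod. Qed.

Lemma good_plan_of k q (lab : {ffun 'I_(k * k) -> 'I_4}) z : q = k %/ 4 ->
  nvalid k q (code lab) z ->
  [/\ good_plan (forced (lab_of lab)) (plan_of k z),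
      forall v : 'I_k, nrt k z v = rt (plan_of k z) v &
      forall v : 'I_k, nan k z v = an (plan_of k z) v].
Proof.
move=> -> hv; have /andP [/forallP h1 _] := hv.
have hrt (v : 'I_k) : nrt k z v = rt (plan_of k z) v.
  by have /and5P [_ h _ _ _] := h1 v; rewrite /= val_insubd h.
have han (v : 'I_k) : nan k z v = an (plan_of k z) v.
  by have /and5P [_ _ h _ _] := h1 v; rewrite /= val_insubd h.
split=> //; apply/(@nvalid_code k lab z (plan_of k z)) => // v.
by rewrite /= minnC; apply/esym/minn_idPr; have := @ndig_lt z (k + 3) (3 * k + v); rewrite /nfield; lia.
Qed.

Lemma nvalid_exists k q (lab : {ffun 'I_(k * k) -> 'I_4}) : q = k %/ 4 ->
  exists2 z, z < (k + 3) ^ (4 * k) & nvalid k q (code lab) z.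
Proof.
move=> ->; have [P gP] := plan_exists (forced (lab_of lab)).
pose g (j : nat) : nat :=
  if insub (j %% k) is Some v then
    match j %/ k with
    | 0 => minn (lev P v) 2 | 1 => rt P v | 2 => an P v | _ => minn (ix P v) (k + 2)
    end
  else 0.
have glt j : j < 4 * k -> g j < k + 3.
  move=> _; rewrite /g; case: insub => [v|]; last by lia.
  case: (j %/ k) => [|[|[|m]]]; first by lia.
  - by have := ltn_ord (rt P v); lia.
  - by have := ltn_ord (an P v); lia.
  - by lia.
have gE f (v : 'I_k) : f < 4 -> nfield k (ncode (k + 3) (4 * k) g) f v = g (f * k + v).
  move=> f4; have := ltn_ord v => vk; apply: ndig_ncode => //.
  by nia.
have gE' f (v : 'I_k) : g (f * k + v) = match f with
    | 0 => minn (lev P v) 2 | 1 => rt P v | 2 => an P v | _ => minn (ix P v) (k + 2) end.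
  rewrite /g modnMDl modn_small // valK; have := ltn_ord v => vk.
  by rewrite divnMDl ?divn_small ?addn0 //; lia.
exists (ncode (k + 3) (4 * k) g); first exact: ncode_lt.
have [g1 _ _ _ _] := gP.
apply/(@nvalid_code _ _ _ P) => // v; rewrite gE // gE' //.
exact/minn_idPl.
Qed.

(** * Quantifiers and sums over ordinals and maps *)

Lemma val_ifb d env C X Y (c x y : bool) : denotes d env C c -> denotes d env X x ->
  denotes d env Y y -> denotes d env (xif C X Y) (if c then x else y).
Proof. by move=> h1 h2 h3; apply: val_eq (val_if h1 h2 h3) _; case: c h1. Qed.

Lemma val_sum_ord d env N f n (g : 'I_n -> nat) : denotes d env N n ->
  (forall (i : 'I_n) env' Z, extends env env' -> denotes d env' Z i -> denotes d env' (f Z) (g i)) ->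
  denotes d env (xsum N f) (\sum_(i < n) g i).
Proof.
move=> hN hf; have h : denotes d env (xsum N f)
    (\sum_(i < n) (if insub (nat_of_ord i) is Some j then g j else 0)).
  apply: (val_sum (g := fun i => if insub i is Some j then g j else 0)) => // i e Z iN h1 h2.
  by rewrite (insubT (fun i => i < n) iN); apply: hf.
by apply: val_eq h _; apply: eq_bigr => i _; rewrite valK.
Qed.

Lemma val_prod_ord d env N f n (g : 'I_n -> nat) : denotes d env N n ->
  (forall (i : 'I_n) env' Z, extends env env' -> denotes d env' Z i -> denotes d env' (f Z) (g i)) ->
  denotes d env (xprod N f) (\prod_(i < n) g i).
Proof.
move=> hN hf; have h : denotes d env (xprod N f)
    (\prod_(i < n) (if insub (nat_of_ord i) is Some j then g j else 0)).
  apply: (val_prod (g := fun i => if insub i is Some j then g j else 0)) => // i e Z iN h1 h2.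
  by rewrite (insubT (fun i => i < n) iN); apply: hf.
by apply: val_eq h _; apply: eq_bigr => i _; rewrite valK.
Qed.

Lemma val_all_ord d env N f n (p : 'I_n -> bool) : denotes d env N n ->
  (forall (i : 'I_n) env' Z, extends env env' -> denotes d env' Z i -> denotes d env' (f Z) (p i)) ->
  denotes d env (xall N f) [forall i : 'I_n, p i].
Proof.
move=> hN hf; have h : denotes d env (xall N f)
    [forall i : 'I_n, if insub (nat_of_ord i) is Some j then p j else true].
  apply: (val_all (p := fun i => if insub i is Some j then p j else true)) => // i e Z iN h1 h2.
  by rewrite (insubT (fun i => i < n) iN); apply: hf.
by apply: val_eq h _; congr nat_of_bool; apply: eq_forallb => i; rewrite valK.
Qed.

Lemma val_ex_ord d env N f n (p : 'I_n -> bool) : denotes d env N n ->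
  (forall (i : 'I_n) env' Z, extends env env' -> denotes d env' Z i -> denotes d env' (f Z) (p i)) ->
  denotes d env (xex N f) [exists i : 'I_n, p i].
Proof.
move=> hN hf; have h : denotes d env (xex N f)
    [exists i : 'I_n, if insub (nat_of_ord i) is Some j then p j else true].
  apply: (val_ex (p := fun i => if insub i is Some j then p j else true)) => // i e Z iN h1 h2.
  by rewrite (insubT (fun i => i < n) iN); apply: hf.
by apply: val_eq h _; congr nat_of_bool; apply: eq_existsb => i; rewrite valK.
Qed.

Lemma val_sum_code d env N f m n (g : {ffun 'I_m -> 'I_n} -> nat) : denotes d env N (n ^ m) ->
  (forall phi env' Z, extends env env' -> denotes d env' Z (code phi) ->
     denotes d env' (f Z) (g phi)) ->
  denotes d env (xsum N f) (\sum_phi g phi).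
Proof.
move=> hN hf; pose g' i := if [pick phi : {ffun 'I_m -> 'I_n} | code phi == i] is Some phi then g phi else 0.
have gE phi : g' (code phi) = g phi.
  by rewrite /g'; case: pickP => [psi /eqP /code_inj -> //|/(_ phi)]; rewrite eqxx.
have h : denotes d env (xsum N f) (\sum_(i < n ^ m) g' i).
  apply: (val_sum (g := g')) => // i e Z iN h1 h2.
  have : [exists j : 'I_(n ^ m), (fun x => x == i) j] by apply/existsP; exists (Ordinal iN).
  rewrite (@exists_code m n (fun x => x == i)) => /existsP [phi /eqP ei].
  by rewrite -ei gE; apply: hf => //; rewrite ei.
by apply: val_eq h _; rewrite sum_code; apply: eq_bigr => phi _; rewrite gE.
Qed.

Lemma val_code d env K N X k n (phi : {ffun 'I_k -> 'I_n}) : denotes d env K k -> denotes d env N n ->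
  (forall (v : 'I_k) env' Z, extends env env' -> denotes d env' Z v -> denotes d env' (X Z) (phi v)) ->
  denotes d env (xsum K (fun V => xmul (X V) (xpow N V))) (code phi).
Proof.
move=> hK hN hX.
have h : denotes d env (xsum K (fun V => xmul (X V) (xpow N V))) (\sum_(v < k) phi v * n ^ v).
  by apply: val_sum_ord => // v e Z h1 h2; apply: val_mul; [apply: hX|apply: val_pow; vfind].
by apply: val_eq h _; apply: eq_bigr => v _; rewrite fnatE.
Qed.

(** * Signs of the labellings, and automorphisms *)

Definition xbit (K HC U V : xp) : xp := xeq (xdig HC (xc 2) (xadd (xmul U K) V)) (xc 1).

Definition xallowed (md : nat) (A H T : xp) : xp :=
  xif A (xif H (xor (xeq T (xc 1)) (xeq T (xc 2)))
     (xor (xor (xeq T (xc 0)) (xmul (xc (md != 0)) (xeq T (xc 3))))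
        (xmul (xc (md == 2)) (xor (xeq T (xc 1)) (xeq T (xc 2))))))
   (xeq T (xc 0)).

Lemma val_allowed d env md A H T (a h : bool) t : denotes d env A a -> denotes d env H h ->
  denotes d env T t -> denotes d env (xallowed md A H T) (allowed md a h t).
Proof. by move=> *; rewrite /xallowed /allowed; repeat first [apply: val_ifb | vfind | vstep]. Qed.

Definition xordered (K I : xp) : xp := xlt (xdiv I K) (xmod I K).
Definition xhbit (HC I : xp) : xp := xeq (xdig HC (xc 2) I) (xc 1).

Definition xallowed_lab (md : nat) (K HC C : xp) : xp :=
  xall (xmul K K) (fun I => xallowed md (xordered K I) (xhbit HC I) (xdig C (xc 4) I)).

Definition xnegatives (K HC C : xp) : xp :=
  xsum (xmul K K) (fun I => xmul (xordered K I)
     (xmul (xnot (xhbit HC I)) (xnot (xeq (xdig C (xc 4) I) (xc 0))))).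

Definition is_code (k : nat) (H : rel 'I_k) (hc : nat) : Prop :=
  forall u v : 'I_k, ndig hc 2 (u * k + v) = H u v.

Lemma is_codeE k (H : rel 'I_k) hc (i : 'I_(k * k)) : is_code H hc ->
  (ndig hc 2 i == 1) = H (pfst i) (psnd i).
Proof. by move=> h; have := h (pfst i) (psnd i); rewrite /= -divn_eq => ->; case: (H _ _). Qed.

Lemma val_allowed_lab d env md K HC C k (H : rel 'I_k) hc (lab : {ffun 'I_(k * k) -> 'I_4}) :
  is_code H hc -> denotes d env K k -> denotes d env HC hc -> denotes d env C (code lab) ->
  denotes d env (xallowed_lab md K HC C) (allowed_lab H md lab).
Proof.
move=> hH h1 h2 h3; apply: val_all_ord => [|i e Z he hZ]; first by vauto.
apply: val_allowed; rewrite /xordered /xhbit.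
- by rewrite -[pfst i < psnd i]/(i %/ k < i %% k); vauto.
- by rewrite -(is_codeE i hH); vauto.
- by rewrite -ndig_code; vauto.
Qed.

Lemma val_negatives d env K HC C k (H : rel 'I_k) hc (lab : {ffun 'I_(k * k) -> 'I_4}) :
  is_code H hc -> denotes d env K k -> denotes d env HC hc -> denotes d env C (code lab) ->
  denotes d env (xnegatives K HC C) (negatives H lab).
Proof.
move=> hH h1 h2 h3; apply: val_sum_ord => [|i e Z he hZ]; first by vauto.
rewrite /negative -(is_codeE i hH) -ndig_code -[pfst i < psnd i]/(i %/ k < i %% k) /xordered /xhbit.
by vauto.
Qed.

Definition xauts (K HC : xp) : xp :=
  xsum (xpow K K) (fun S =>
    xmul (xall K (fun U => xall K (fun V =>
            ximp (xeq (xdig S K U) (xdig S K V)) (xeq U V))))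
         (xall K (fun U => xall K (fun V =>
            xeq (xbit K HC (xdig S K U) (xdig S K V)) (xbit K HC U V))))).

Lemma val_bit d env K HC U V k (H : rel 'I_k) hc (u v : 'I_k) :
  is_code H hc -> denotes d env K k -> denotes d env HC hc ->
  denotes d env U u -> denotes d env V v -> denotes d env (xbit K HC U V) (H u v).
Proof.
move=> hH *; have -> : H u v = (ndig hc 2 (u * k + v) == 1) :> bool by rewrite hH; case: (H u v).
by rewrite /xbit; vauto.
Qed.

Lemma val_digc d env K S U k n (f : {ffun 'I_k -> 'I_n}) (u : 'I_k) : denotes d env K n ->
  denotes d env S (code f) -> denotes d env U u -> denotes d env (xdig S K U) (f u).
Proof. by move=> *; rewrite -ndig_code; vauto. Qed.

Lemma val_auts d env K HC k (H : sgraph 'I_k) hc :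
  is_code (adj H) hc -> denotes d env K k -> denotes d env HC hc ->
  denotes d env (xauts K HC) #|auts H|.
Proof.
move=> hH hK hHC; have h : denotes d env (xauts K HC) (\sum_(s : {ffun 'I_k -> 'I_k})
   ([forall u, [forall v, (s u == s v) ==> (u == v)]] &&
    [forall u, [forall v, adj H (s u) (s v) == adj H u v]])).
  apply: val_sum_code => [|s e Z he hZ]; first by vauto.
  apply: val_and; apply: val_all_ord; try vfind.
    move=> u e1 Z1 he1 hZ1; apply: val_all_ord; try vfind.
    move=> v e2 Z2 he2 hZ2; apply: val_imp; apply: val_eqb; try vfind; apply: val_digc; vfind.
  move=> u e1 Z1 he1 hZ1; apply: val_all_ord; try vfind.
  move=> v e2 Z2 he2 hZ2.
  have -> : (adj H (s u) (s v) == adj H u v) = ((adj H (s u) (s v) : nat) == (adj H u v : nat)).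
    by case: (adj H (s u) (s v)); case: (adj H u v).
  by apply: val_eqb; apply: (val_bit hH); try vfind; apply: val_digc; vfind.
apply: val_eq h _; rewrite -sum1_card [RHS]big_mkcond /=; apply: eq_bigr => s _.
rewrite inE (_ : injectiveb s = [forall u, [forall v, (s u == s v) ==> (u == v)]]).
  by case: (_ && _).
apply/injectiveP/forallP => [inj u|h u v /eqP e].
  by apply/forallP => v; apply/implyP => /eqP /inj ->.
by apply/eqP; apply: (implyP (forallP (h u) v)).
Qed.
(** * Sums over the placements of a group of vertices *)

Definition xpair (N T X Y : xp) : xp :=
  xor (xeq T (xc 0)) (xor (xmul (xeq T (xc 1)) (xarr 3 (xadd (xmul X N) Y)))
  (xor (xmul (xeq T (xc 2)) (xarr 3 (xadd (xmul Y N) X))) (xmul (xeq T (xc 3)) (xeq X Y)))).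

Definition xcompat (K N C : xp) (inW : xp -> xp) (P : xp) : xp :=
  xall K (fun U => xall K (fun V =>
    ximp (xmul (inW U) (inW V)) (xpair N (xlab K C U V) (xdig P N U) (xdig P N V)))).

Definition xwalk (K B X W : xp) : xp :=
  xloop LSet X K (fun A J => xarr 5 (xadd (xmul A B) (xdig W B J))).

Definition xcand (K N B Phi Y : xp) (inU aj : xp -> xp) (V W : xp) : xp :=
  xif (inU V) (xwalk K B (xdig Y N (aj V)) W) (xdig Phi N V).

Definition xminreps (K N B D Phi Y : xp) (inU aj : xp -> xp) (W : xp) : xp :=
  xall K (fun V => xlet (xdig W D V) (fun E =>
    xlet (xcand K N B Phi Y inU aj V E) (fun X =>
      xall D (fun E' => ximp (xlt E' E)
        (xnot (xeq (xcand K N B Phi Y inU aj V E') X)))))).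

Definition xanchored (K N QQ Y : xp) (isA aj : xp -> xp) (P : xp) : xp :=
  xmul (xall K (fun V => ximp (isA V) (xeq (xdig P N V) (xdig Y N (aj V)))))
       (xall QQ (fun J => xor (xex K (fun V => xmul (isA V) (xeq (aj V) J)))
                              (xeq (xdig Y N J) (xc 0)))).

(** The number [M] of candidates for [Y] is passed apart from the number [QQ] of slots, because its
    type fixes the cost: it is [N] in stage 1 and a power with exponent of type [VQ4] in stage 0.
    The walks contribute only powers of [lg n]. *)
Definition xgsum (K N B D C M QQ : xp) (inU inT isA aj : xp -> xp) (Phi : xp)
    (F : xp -> xp) : xp :=
  xsum M (fun Y => xsum (xpow D K) (fun W =>
    xlet (xsum K (fun V => xmul (xcand K N B Phi Y inU aj V (xdig W D V)) (xpow N V))) (fun P =>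
      xmul (xminreps K N B D Phi Y inU aj W)
        (xmul (xmul (xanchored K N QQ Y isA aj P)
                    (xcompat K N C (fun V => xor (inT V) (inU V)) P))
              (F P))))).

Section GroupSums.
Variables (d : nat -> nat) (k n b : nat) (arc : rel 'I_n) (nb : 'I_n -> nat -> 'I_n) (v0 : 'I_n).
Variable (lab : {ffun 'I_(k * k) -> 'I_4}).
Hypothesis d_arc : forall x y : 'I_n, d (8 * (x * n + y) + 3) = arc x y.
Hypothesis d_nb : forall (x : 'I_n) i, i < b -> d (8 * (x * b + i) + 5) = nb x i.
Hypothesis hv0 : v0 = 0 :> nat.
Hypothesis b0 : 0 < b.

Let D := b ^ k.
Let ok := pair_ok arc (lab_of lab).

Definition denotes_set (env : seq nat) (f : xp -> xp) (U : {set 'I_k}) : Prop :=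
  forall (v : 'I_k) env' Z, extends env env' -> denotes d env' Z v ->
    denotes d env' (f Z) (v \in U).

Definition denotes_fun (env : seq nat) (f : xp -> xp) (g : 'I_k -> nat) : Prop :=
  forall (v : 'I_k) env' Z, extends env env' -> denotes d env' Z v ->
    denotes d env' (f Z) (g v).

Lemma denotes_set_sub env env' f U : extends env env' -> denotes_set env f U -> denotes_set env' f U.
Proof. by move=> h hf v e Z he; apply: hf; apply: extends_trans he. Qed.

Lemma denotes_fun_sub env env' f g : extends env env' -> denotes_fun env f g -> denotes_fun env' f g.
Proof. by move=> h hf v e Z he; apply: hf; apply: extends_trans he. Qed.

Lemma val_pair env N T X Y t (x y : 'I_n) : denotes d env N n -> denotes d env T t ->
  denotes d env X x -> denotes d env Y y -> denotes d env (xpair N T X Y) (pair_rel arc t x y).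
Proof.
move=> *; rewrite /xpair /pair_rel -(inj_eq val_inj x y).
apply: val_or; first by vauto.
apply: val_or; first by apply: val_and; [vauto|rewrite -d_arc; vauto].
by apply: val_or; last vauto; apply: val_and; [vauto|rewrite -d_arc; vauto].
Qed.

Lemma val_compat env K N C inW P (W : {set 'I_k}) (phi : {ffun 'I_k -> 'I_n}) :
  denotes d env K k -> denotes d env N n -> denotes d env C (code lab) ->
  denotes_set env inW W -> denotes d env P (code phi) ->
  denotes d env (xcompat K N C inW P) (compat ok W phi).
Proof.
move=> hK hN hC hW hP.
have h : denotes d env (xcompat K N C inW P) [forall u : 'I_k, [forall v : 'I_k,
    ((u \in W) && (v \in W)) ==> ok u v (phi u) (phi v)]].
  apply: val_all_ord => // u e Z he hZ; apply: val_all_ord => [|v e' Z' he' hZ']; first vfind.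
  apply: val_imp.
    apply: val_and; apply: hW; try vfind; first exact: extends_trans he'.
    exact: extends_trans he'.
  apply: val_pair; try vfind; try (by apply: val_digc; vfind).
  by rewrite -nlab_code; apply: val_lab; vfind.
apply: val_eq h _; congr nat_of_bool.
apply/forallP/compatP => [h u v uW vW|h u].
  by have := forallP (h u) v; rewrite uW vW.
by apply/forallP => v; apply/implyP => /andP [uW vW]; apply: h.
Qed.

Lemma val_walk env K B X W (x : 'I_n) c : denotes d env K k -> denotes d env B b ->
  denotes d env X x -> denotes d env W c ->
  denotes d env (xwalk K B X W) (walkn nb b k x c).
Proof.
move=> hK hB hX hW.
have h : denotes d env (xwalk K B X W)
    (iteri k (fun j a => d (8 * (a * b + ndig c b j) + 5)) x).
  by apply: (val_loop (md := LSet) (g := fun j a => d (8 * (a * b + ndig c b j) + 5))) => // *; vauto.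
apply: val_eq h _; rewrite /walkn; elim: k => [//|m IH].
by rewrite !iteriS IH d_nb // ndig_lt.
Qed.

Variables (q : nat) (U T A : {set 'I_k}) (aj : 'I_k -> nat).

Definition walk_in (x : 'I_n) (c : 'I_D) : 'I_n := walkn nb b k x c.

Lemma val_anchor env N Y f (Yf : {ffun 'I_q -> 'I_n}) (v : 'I_k) Z :
  denotes d env N n -> denotes d env Y (code Yf) -> denotes_fun env f aj ->
  denotes d env Z v ->
  denotes d env (xdig Y N (f Z)) (anchor_value v0 Yf (aj v)).
Proof.
move=> hN hY hf hZ; have h : denotes d env (xdig Y N (f Z)) (ndig (code Yf) n (aj v)).
  by apply: val_dig => //; apply: hf => //; apply: extends_refl.
apply: val_eq h _; rewrite /anchor_value; case: insubP => [j _ <-|]; first by rewrite ndig_code.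
by rewrite -leqNgt => qj; rewrite (ndig_big (code_lt Yf)) // hv0.
Qed.

Lemma val_cand env K N B Phi Y inU f (phi0 : {ffun 'I_k -> 'I_n}) (Yf : {ffun 'I_q -> 'I_n})
    V W (v : 'I_k) (c : 'I_D) :
  denotes d env K k -> denotes d env N n -> denotes d env B b ->
  denotes d env Phi (code phi0) -> denotes d env Y (code Yf) ->
  denotes_set env inU U -> denotes_fun env f aj ->
  denotes d env V v -> denotes d env W c ->
  denotes d env (xcand K N B Phi Y inU f V W) (candidate walk_in v0 U aj phi0 Yf v c).
Proof.
move=> hK hN hB hPhi hY hU hf hV hW.
have h : denotes d env (xcand K N B Phi Y inU f V W)
    (if v \in U then walkn nb b k (anchor_value v0 Yf (aj v)) c : nat else phi0 v).
  apply: val_if; first by apply: hU => //; apply: extends_refl.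
    by apply: val_walk => //; apply: val_anchor.
  by apply: val_digc.
by apply: val_eq h _; rewrite /candidate; case: ifP.
Qed.

Lemma val_minreps env K N B DX Phi Y inU f (phi0 : {ffun 'I_k -> 'I_n})
    (Yf : {ffun 'I_q -> 'I_n}) W (ch : {ffun 'I_k -> 'I_D}) :
  denotes d env K k -> denotes d env N n -> denotes d env B b -> denotes d env DX D ->
  denotes d env Phi (code phi0) -> denotes d env Y (code Yf) ->
  denotes_set env inU U -> denotes_fun env f aj -> denotes d env W (code ch) ->
  denotes d env (xminreps K N B DX Phi Y inU f W)
    [forall v, minrep (candidate walk_in v0 U aj phi0 Yf v) (ch v)].
Proof.
move=> hK hN hB hD hPhi hY hU hf hW.
apply: val_all_ord => // v e1 Z1 he1 hZ1.
apply: (val_let (x := ch v)); first by apply: val_digc; vfind.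
move=> e2 Z2 he2 hZ2.
have he12 := extends_trans he1 he2.
apply: (val_let (x := candidate walk_in v0 U aj phi0 Yf v (ch v))).
  by apply: val_cand; try vfind; [exact: denotes_set_sub hU|exact: denotes_fun_sub hf].
move=> e3 Z3 he3 hZ3; have he13 := extends_trans he12 he3.
apply: val_all_ord => [|c e4 Z4 he4 hZ4]; first vfind.
have he14 := extends_trans he13 he4.
apply: val_imp; first by apply: val_ltb; vfind.
apply: val_not; rewrite -(inj_eq val_inj); apply: val_eqb; last vfind.
by apply: val_cand; try vfind; [exact: denotes_set_sub hU|exact: denotes_fun_sub hf].
Qed.

Lemma val_anchored env K N QQ Y isA f P (Yf : {ffun 'I_q -> 'I_n}) (phi : {ffun 'I_k -> 'I_n}) :
  denotes d env K k -> denotes d env N n -> denotes d env QQ q -> denotes d env Y (code Yf) ->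
  denotes_set env isA A -> denotes_fun env f aj -> denotes d env P (code phi) ->
  denotes d env (xanchored K N QQ Y isA f P) (anchored v0 A aj Yf phi).
Proof.
move=> hK hN hQ hY hA hf hP; rewrite /anchored.
have -> : [forall a in A, phi a == anchor_value v0 Yf (aj a)] =
    [forall a, (a \in A) ==> ((phi a : nat) == anchor_value v0 Yf (aj a))].
  by apply: eq_forallb => a; rewrite (inj_eq val_inj).
apply: val_and; apply: val_all_ord; try vfind.
  move=> a e Z he hZ; apply: val_imp; first by apply: hA.
  apply: val_eqb; first by apply: val_digc; vfind.
  by apply: val_anchor; try vfind; exact: denotes_fun_sub hf.
move=> j e Z he hZ; apply: val_or.
  apply: val_ex_ord => [|a e' Z' he' hZ']; first vfind.
  have he2 := extends_trans he he'.
  by apply: val_and; [apply: hA|apply: val_eqb; [apply: hf|vfind]].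
by rewrite -(inj_eq val_inj) /= hv0; apply: val_eqb; [apply: val_digc; vfind|apply: val_c].
Qed.

Lemma val_gsum env K N B DX C M QQ inU inT isA f Phi F (phi0 : {ffun 'I_k -> 'I_n})
    (g : {ffun 'I_k -> 'I_n} -> nat) :
  denotes d env K k -> denotes d env N n -> denotes d env B b -> denotes d env DX D ->
  denotes d env C (code lab) -> denotes d env M (n ^ q) -> denotes d env QQ q ->
  denotes d env Phi (code phi0) ->
  denotes_set env inU U -> denotes_set env inT T -> denotes_set env isA A ->
  denotes_fun env f aj ->
  (forall phi env' Z, extends env env' -> denotes d env' Z (code phi) ->
     denotes d env' (F Z) (g phi)) ->
  A \subset U -> {in U, forall v, aj v < q} -> {in A &, injective aj} ->
  (forall phi, compat ok (T :|: U) phi -> forall v, v \in U ->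
     exists a, [/\ a \in A, aj a = aj v & exists c : 'I_D, walk_in (phi a) c = phi v]) ->
  denotes d env (xgsum K N B DX C M QQ inU inT isA f Phi F)
    (\sum_(phi in extension ok phi0 U T) g phi).
Proof.
move=> hK hN hB hD hC hM hQ hPhi hU hT hA hf hF AU ajq ajinj ball.
have c0 : 'I_D by exists 0; rewrite /D expn_gt0 b0.
rewrite -(sum_extension c0 v0 phi0 g AU ajq ajinj ball).
apply: val_sum_code => [|Yf e1 Y he1 hY]; first by vauto.
apply: val_sum_code => [|ch e2 W he2 hW]; first by apply: val_pow; vfind.
have he12 := extends_trans he1 he2.
set phi := [ffun v => _].
apply: (val_let (x := code phi)).
  apply: val_code; try vfind; move=> v e3 V he3 hV; have he13 := extends_trans he12 he3.
  rewrite ffunE; apply: val_cand; try vfind; try (by apply: val_digc; vfind).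
    exact: denotes_set_sub hU.
  exact: denotes_fun_sub hf.
move=> e3 P he3 hP; have he13 := extends_trans he12 he3.
apply: val_mul.
  by apply: val_minreps; try vfind; [exact: denotes_set_sub hU|exact: denotes_fun_sub hf].
apply: val_mul; last exact: hF.
apply: val_and.
  by apply: val_anchored; try vfind; [exact: denotes_set_sub hA|exact: denotes_fun_sub hf].
apply: val_compat; try vfind.
by move=> v e4 V he4 hV; rewrite in_setU; have he14 := extends_trans he13 he4;
  apply: val_or; [apply: hT|apply: hU].
Qed.

End GroupSums.

(** * Assembling the count of a labelling *)

Definition xbase (K Z V : xp) : xp := xeq (xlev K Z V) (xc 0).
Definition xtrunk (K Z R V : xp) : xp := xmul (xeq (xlev K Z V) (xc 1)) (xeq (xrt K Z V) R).
Definition xis_leaf (K Z R V : xp) : xp := xmul (xeq (xlev K Z V) (xc 2)) (xeq (xrt K Z V) R).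

(** A leaf is reached from nothing, so all [n] images are tried; with the loop over the image of the
    root this makes the two factors [n] beyond the base. *)
Definition xleaf (K N C Z P1 R L : xp) : xp :=
  xsum N (fun X =>
    xlet (xsum K (fun V => xmul (xif (xeq V L) X (xdig P1 N V)) (xpow N V))) (fun P =>
      xcompat K N C (fun V => xor (xor (xbase K Z V) (xtrunk K Z R V)) (xeq V L)) P)).

Definition xlevel1 (K N B D C Z P0 R : xp) : xp :=
  xgsum K N B D C N (xc 1) (xtrunk K Z R) (xbase K Z) (fun V => xeq V R) (fun _ => xc 0) P0
    (fun P1 => xprod K (fun L => xif (xis_leaf K Z R L) (xleaf K N C Z P1 R L) (xc 1))).

(** The argument [xc 0] in the place of the initial map is the code of the constant map [v0]. *)
Definition xlevel0 (K N Q B D C Z : xp) : xp :=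
  xgsum K N B D C (xpow N Q) Q (xbase K Z) (fun _ => xc 0)
    (fun V => xmul (xbase K Z V) (xeq (xan K Z V) V)) (fun V => xix K Z (xan K Z V)) (xc 0)
    (fun P0 => xprod K (fun R => xif (xtrunk K Z R R) (xlevel1 K N B D C Z P0 R) (xc 1))).

Definition xcount (K N Q B D C : xp) : xp :=
  xlet (xfind K Q C) (fun Z => xlevel0 K N Q B D C Z).

Definition xpart (md : nat) (odd_part : bool) (K N Q B D HC : xp) : xp :=
  xsum (xpow (xc 4) (xmul K K)) (fun C =>
    xmul (xmul (xallowed_lab md K HC C) (xeq (xmod (xnegatives K HC C) (xc 2)) (xc odd_part)))
         (xcount K N Q B D C)).

(** Without vertices in [G] there is no [v0], so this case is separate: there is one map if [k = 0]
    and none otherwise. *)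
Definition xresult (md : nat) (K N Q B HC : xp) : xp :=
  xlet (xpow B K) (fun D =>
    xdiv (xif (xlt (xc 0) N)
            (xsub (xpart md false K N Q B D HC) (xpart md true K N Q B D HC)) (xeq K (xc 0)))
         (if md == 0 then xc 1 else xauts K HC)).

(** A discarded branch needs no meaning. This matters for vertices that are not roots, where the
    expression for stage 1 has no specified value. *)
Lemma val_mul0 d env X (Y : xp) : denotes d env X 0 -> denotes d env (xmul X Y) 0.
Proof. by move=> h e he; rewrite /xmul /xop /= h. Qed.

Lemma val_if_false d env C X Y y : denotes d env C 0 -> denotes d env Y y ->
  denotes d env (xif C X Y) y.
Proof.
move=> hC hY; have h := val_add (val_mul0 X hC) (val_mul (val_not (x := false) hC) hY).
by apply: val_eq h _; rewrite mul1n.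
Qed.

Section CountSpec.
Variables (d : nat -> nat) (k n b : nat) (G : sgraph 'I_n) (arc : rel 'I_n).
Variables (nb : 'I_n -> nat -> 'I_n) (v0 : 'I_n).
Hypothesis d_arc : forall x y : 'I_n, d (8 * (x * n + y) + 3) = arc x y.
Hypothesis d_nb : forall (x : 'I_n) i, i < b -> d (8 * (x * b + i) + 5) = nb x i.
Hypothesis hv0 : v0 = 0 :> nat.
Hypothesis b0 : 0 < b.
Hypothesis cov : forall x y, (y == x) || arc x y -> exists2 i, i < b & nb x i = y.

Section Labelling.
Variable (lab : {ffun 'I_(k * k) -> 'I_4}) (z : nat).
Let P := plan_of k z.
Let ok := pair_ok arc (lab_of lab).
Hypothesis gP : good_plan (forced (lab_of lab)) P.
Hypothesis hrt : forall v : 'I_k, nrt k z v = rt P v.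
Hypothesis han : forall v : 'I_k, nan k z v = an P v.

Lemma lab_le3 u v : lab_of lab u v <= 3.
Proof. by rewrite /lab_of -ltnS; apply: ltn_ord. Qed.

Lemma val_base env K Z : denotes d env K k -> denotes d env Z z ->
  denotes_set d env (xbase K Z) (base P).
Proof.
move=> hK hZ v e V he hV; rewrite inE /=.
by apply: val_eqb; [apply: val_field; vfind|apply: val_c].
Qed.

Lemma val_trunk env K Z R (r : 'I_k) : denotes d env K k -> denotes d env Z z ->
  denotes d env R r -> denotes_set d env (xtrunk K Z R) (trunk P r).
Proof.
move=> hK hZ hR v e V he hV; rewrite inE -(inj_eq val_inj) -[val _]hrt /=.
by apply: val_and; apply: val_eqb; try vfind; try apply: val_c; apply: val_field; vfind.
Qed.

Lemma val_is_leaf env K Z R L (r l : 'I_k) : denotes d env K k -> denotes d env Z z ->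
  denotes d env R r -> denotes d env L l -> denotes d env (xis_leaf K Z R L) (is_leaf P r l).
Proof.
move=> hK hZ hR hL; rewrite /is_leaf -(inj_eq val_inj) -[val _]hrt /=.
by apply: val_and; apply: val_eqb; try vfind; try apply: val_c; apply: val_field; vfind.
Qed.

Lemma card_extension1 (phi : {ffun 'I_k -> 'I_n}) l T :
  #|extension ok phi [set l] T| =
  \sum_(x : 'I_n) compat ok (T :|: [set l]) [ffun v => if v == l then x else phi v].
Proof.
pose f (x : 'I_n) := [ffun v => if v == l then x else phi v] : {ffun 'I_k -> 'I_n}.
rewrite -big_mkcond /= sum1dep_card.
rewrite (_ : extension _ _ _ _ = f @: [set x | compat ok (T :|: [set l]) (f x)]).
  by apply: card_imset => x y /ffunP /(_ l); rewrite !ffunE eqxx.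
apply/setP => psi; apply/extensionP/imsetP => [[e c]|[x]].
  have ef : psi = f (psi l).
    by apply/ffunP => v; rewrite ffunE; case: eqP => [-> //|nv]; rewrite e // inE; apply/eqP.
  by exists (psi l); rewrite ?inE -?ef.
rewrite inE => c ->; split=> // v; rewrite inE => /negPf nv.
by rewrite ffunE nv.
Qed.

Lemma val_leaf env K N C Z P1 R L (r l : 'I_k) (phi : {ffun 'I_k -> 'I_n}) :
  denotes d env K k -> denotes d env N n -> denotes d env C (code lab) -> denotes d env Z z ->
  denotes d env P1 (code phi) -> denotes d env R r -> denotes d env L l ->
  denotes d env (xleaf K N C Z P1 R L) #|extension ok phi [set l] (base P :|: trunk P r)|.
Proof.
move=> hK hN hC hZ hP hR hL; rewrite card_extension1.
apply: val_sum_ord => // x e1 X he1 hX.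
set psi := [ffun v => _].
apply: (val_let (x := code psi)).
  apply: val_code; try vfind; move=> v e V he hV; rewrite ffunE.
  apply: val_eq (val_if (c := v == l) (x := x) (y := phi v) _ _ _) _; last by case: eqP.
  - by rewrite -(inj_eq val_inj); apply: val_eqb; vfind.
  - vfind.
  - by apply: val_digc; vfind.
move=> e2 P2 he2 hP2; have he12 := extends_trans he1 he2.
apply: (val_compat d_arc); try vfind.
move=> v e3 V he3 hV; have he13 := extends_trans he12 he3.
rewrite in_setU in_setU in_set1; apply: val_or.
  by apply: val_or; [apply: (val_base hK hZ)|apply: (val_trunk hK hZ hR)].
by rewrite -(inj_eq val_inj); apply: val_eqb; vfind.
Qed.

Lemma val_level1 env K N B DX C Z P0 R (r : 'I_k) (phi : {ffun 'I_k -> 'I_n}) :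
  denotes d env K k -> denotes d env N n -> denotes d env B b -> denotes d env DX (b ^ k) ->
  denotes d env C (code lab) -> denotes d env Z z ->
  denotes d env P0 (code phi) -> denotes d env R r -> is_root P r ->
  denotes d env (xlevel1 K N B DX C Z P0 R)
   (\sum_(phi1 in extension ok phi (trunk P r) (base P))
        \prod_(p | is_leaf P r p) #|extension ok phi1 [set p] (base P :|: trunk P r)|).
Proof.
move=> hK hN hB hD hC hZ hP hR hr.
apply: (@val_gsum d k n b arc nb v0 lab d_arc d_nb hv0 b0 1 (trunk P r) (base P) [set r] (fun _ => 0)) => //.
- exact: val_trunk.
- exact: val_base.
- by move=> v e V he hV; rewrite in_set1 -(inj_eq val_inj); apply: val_eqb; vfind.
- move=> phi1 e P1 he hP1; rewrite big_mkcond /=.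
  apply: val_prod_ord => [|l e2 L he2 hL]; first vfind.
  apply: val_eq (val_if (c := is_leaf P r l) (y := 1) _ _ _) _; last by [].
  + by apply: val_is_leaf; vfind.
  + by apply: val_leaf; vfind.
  + exact: val_c.
- by rewrite sub1set inE.
- by move=> u v; rewrite !inE => /eqP -> /eqP ->.
move=> psi cpsi v; rewrite inE => /andP [/eqP lv /eqP rv].
have [_ _ g3 g4 _] := gP.
exists r; rewrite inE eqxx; split=> //.
have l0 : lev P v != 0 by rewrite lv.
have [_ _ anr] := g3 v l0; have l2 : lev P v != 2 by rewrite lv.
have := g4 v l2; rewrite anr // rv => con.
have [||c cD ec] := walk_anchor cov cpsi _ _ con.
- by rewrite !inE -/(is_root P r) hr orbT.
- move=> w; rewrite /group lv -[1 == 0]/false orFb => /andP [/eqP lw /eqP rw].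
  by rewrite !inE lw rw rv !eqxx orbT.
by exists (Ordinal cD); rewrite /walk_in.
Qed.

Lemma val_level0 env K N Q B DX C Z :
  denotes d env K k -> denotes d env N n -> denotes d env Q (k %/ 4) ->
  denotes d env B b -> denotes d env DX (b ^ k) ->
  denotes d env C (code lab) -> denotes d env Z z ->
  denotes d env (xlevel0 K N Q B DX C Z) (lab_count arc lab).
Proof.
move=> hK hN hQ hB hD hC hZ.
pose phi0 : {ffun 'I_k -> 'I_n} := [ffun _ => v0].
rewrite /lab_count (card_levels arc gP lab_le3 phi0) -/ok.
have [_ g2 g3 g4 [g5 _]] := gP.
apply: (@val_gsum d k n b arc nb v0 lab d_arc d_nb hv0 b0 (k %/ 4) (base P) set0
  [set v | (lev P v == 0) && (an P v == v)] (fun v => ix P (an P v))) => //.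
- by vauto.
- apply: (@val_eq d env _ 0); [exact: val_c|rewrite /code /ncode big1 // => j _;
  by rewrite fnatE ffunE hv0 mul0n].
- exact: val_base.
- by move=> v e V he hV; rewrite inE; apply: val_c.
- move=> v e V he hV; rewrite inE -(inj_eq val_inj) -[val (an P v)]han /=.
  by apply: val_and; apply: val_eqb; try vfind; try apply: val_c; apply: val_field; vfind.
- move=> v e V he hV; rewrite -[ix P (an P v)]/(nix k z (an P v)) -han.
  by apply: val_field; try vfind; apply: val_field; vfind.
- move=> phi1 e P1 he hP1; rewrite big_mkcond /=.
  apply: val_prod_ord => [|r e2 R he2 hR]; first vfind.
  have he12 := extends_trans he he2.
  case hr : (is_root P r).
    apply: val_eq (val_if (c := true) (y := 1) _ _ _) _; last by [].
    + rewrite -hr /is_root; have := @val_trunk e2 K Z R r; rewrite /denotes_set => h.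
      have := h _ _ _ r e2 R (extends_refl _) hR; rewrite inE; apply; vfind.
    + by apply: val_level1; vfind.
    + exact: val_c.
  apply: val_if_false; last exact: val_c.
  rewrite -[0]/(nat_of_bool false) -hr /is_root.
  have := @val_trunk e2 K Z R r; rewrite /denotes_set => h.
  by have := h _ _ _ r e2 R (extends_refl _) hR; rewrite inE; apply; vfind.
- by apply/subsetP => v; rewrite !inE => /andP [].
- by move=> v; rewrite inE => /eqP /g2 [_ []].
- move=> u v; rewrite !inE => /andP [/eqP lu /eqP au] /andP [/eqP lv /eqP av].
  by rewrite au av; apply: g5.
move=> psi cpsi v; rewrite inE => /eqP lv.
have [la [aa _]] := g2 v lv.
exists (an P v); rewrite inE la aa !eqxx; split=> //.
have con : connect [rel a b | forced (lab_of lab) a b && group P v b] (an P v) v by apply: g4; rewrite lv.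
have [||c cD ec] := walk_anchor cov cpsi _ _ con.
- by rewrite !inE la.
- by move=> w; rewrite /group lv => /andP [/eqP lw _]; rewrite !inE lw.
by exists (Ordinal cD); rewrite /walk_in.
Qed.
End Labelling.

Lemma val_count env K N Q B DX C (lab : {ffun 'I_(k * k) -> 'I_4}) :
  denotes d env K k -> denotes d env N n -> denotes d env Q (k %/ 4) ->
  denotes d env B b -> denotes d env DX (b ^ k) -> denotes d env C (code lab) ->
  denotes d env (xcount K N Q B DX C) (lab_count arc lab).
Proof.
move=> hK hN hQ hB hD hC.
apply: (val_let (x := nfind k (k %/ 4) (code lab))); first exact: val_find.
move=> e Z he hZ.
have [z zlt zv] := nvalid_exists lab (erefl (k %/ 4)).
have [gP hrt han] := good_plan_of (erefl _) (nfind_valid zlt zv).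
by apply: (val_level0 gP hrt han); vfind.
Qed.

Variables (md : nat) (H : sgraph 'I_k) (hc : nat).
Hypothesis hH : is_code (adj H) hc.

Lemma val_part odd_part env K N Q B DX HC :
  denotes d env K k -> denotes d env N n -> denotes d env Q (k %/ 4) ->
  denotes d env B b -> denotes d env DX (b ^ k) -> denotes d env HC hc ->
  denotes d env (xpart md odd_part K N Q B DX HC)
   (\sum_(lab : {ffun 'I_(k * k) -> 'I_4})
      (allowed_lab (adj H) md lab && (odd (negatives (adj H) lab) == odd_part)) * lab_count arc lab).
Proof.
move=> *; apply: val_sum_code => [|lab e C he hC]; first by vauto.
apply: val_mul; last by apply: val_count; vfind.
apply: val_and; first by apply: (val_allowed_lab _ hH); vfind.
have h : denotes d e (xeq (xmod (xnegatives K HC C) (xc 2)) (xc odd_part))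
    ((negatives (adj H) lab %% 2 == odd_part :> nat)%N : bool).
  apply: val_eqb; last exact: val_c.
  by apply: val_mod; [apply: (val_negatives hH); vfind|apply: val_c].
by apply: val_eq h _; rewrite modn2; case: (odd _); case: odd_part.
Qed.

Hypothesis arcG : forall x y, adj G x y = arc x y (+) arc y x.
Hypothesis arcN : forall x y, arc x y -> ~~ arc y x.

Lemma val_result env K N Q B HC :
  denotes d env K k -> denotes d env N n -> denotes d env Q (k %/ 4) ->
  denotes d env B b -> denotes d env HC hc ->
  denotes d env (xresult md K N Q B HC)
    (#|[set phi | wanted_map (adj H) G md phi]| %/ (if md == 0 then 1 else #|auts H|)).
Proof.
move=> hK hN hQ hB hHC.
apply: (val_let (x := b ^ k)); first by vauto.
move=> e DX he hDX; apply: val_div; last first.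
  case: ifP => _; [exact: val_c|apply: (val_auts hH); exact: val_sub he _].
have n0 : 0 < n by apply: leq_ltn_trans (ltn_ord v0).
rewrite (@count_expand_nat k n (adj H) G arc md arcG arcN).
apply: val_eq (val_if (c := true) (y := (k == 0)) _ _ _) _; last by [].
- apply: (@val_eq d e _ (0 < n)); last by rewrite n0.
  by apply: val_ltb; [exact: val_c|exact: val_sub he _].
- apply: val_subn.
    apply: val_eq (val_part false _ _ _ _ _ _) _; try vfind.
    by apply: eq_bigr => lab _; rewrite eqbF_neg.
  apply: val_eq (val_part true _ _ _ _ _ _) _; try vfind.
  by apply: eq_bigr => lab _; rewrite eqb_id.
- by apply: val_eqb; [vfind|apply: val_c].
Qed.
End CountSpec.

Lemma val_result0 d k n (H : sgraph 'I_k) (G : sgraph 'I_n) hc md env K N Q B HC :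
  n = 0 -> is_code (adj H) hc -> denotes d env K k -> denotes d env N n -> denotes d env HC hc ->
  (exists b, denotes d env B b) ->
  denotes d env (xresult md K N Q B HC)
    (#|[set phi | wanted_map (adj H) G md phi]| %/ (if md == 0 then 1 else #|auts H|)).
Proof.
move=> n0; subst n => hH hK hN hHC [b hB].
apply: (val_let (x := b ^ k)); first by vauto.
move=> e DX he hDX; apply: val_div; last first.
  by case: ifP => _; [exact: val_c|apply: (val_auts hH); exact: val_sub he _].
apply: val_if_false.
  by rewrite -[0]/(nat_of_bool (0 < 0)); apply: val_ltb; [apply: val_c|vfind].
have h : denotes d e (xeq K (xc 0)) (k == 0) by apply: val_eqb; [vfind|apply: val_c].
apply: val_eq h _; case: (posnP k) => [k0|kp].
  subst k; rewrite (_ : [set _ | _] = setT) ?cardsT ?card_ffun ?card_ord //.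
  by apply/setP => phi; rewrite !inE; apply/forallP; case.
rewrite (_ : [set _ | _] = set0) ?cards0; last first.
  by apply/setP => phi; case: (phi (Ordinal kp)).
by [].
Qed.
(** * Reading the input *)

Definition nbrs (n : nat) (G : sgraph 'I_n) (u : 'I_n) : seq nat :=
  [seq val v | v <- enum 'I_n & adj G u v].

Lemma size_nbrs n (G : sgraph 'I_n) u : size (nbrs G u) = #|[set v | adj G u v]|.
Proof.
rewrite size_map size_filter enumT cardE /enum_mem size_filter; apply: eq_count => v /=.
by rewrite inE.
Qed.

Lemma mem_nbrs n (G : sgraph 'I_n) (u v : 'I_n) : ((v : nat) \in nbrs G u) = adj G u v.
Proof. by rewrite -[nat_of_ord v]/(val v) (mem_map val_inj) mem_filter mem_enum andbT. Qed.

Lemma nbrs_lt n (G : sgraph 'I_n) (u : 'I_n) j : j < size (nbrs G u) -> nth 0 (nbrs G u) j < n.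
Proof. by move=> h; have /mapP [v _ ->] := mem_nth 0 h; apply: ltn_ord. Qed.

Definition list_pos (n : nat) (G : sgraph 'I_n) (p u : nat) : nat :=
  p + size (flatten (take u [seq size (nbrs G v) :: nbrs G v | v <- enum 'I_n])).

Lemma list_posS n (G : sgraph 'I_n) p (u : 'I_n) :
  list_pos G p u.+1 = list_pos G p u + (size (nbrs G u)).+1.
Proof.
rewrite /list_pos; set ss := map _ _; have us : u < size ss by rewrite size_map size_enum_ord.
rewrite (take_nth [::] us) (nth_map u) ?size_enum_ord //.
by rewrite nth_ord_enum -cats1 flatten_cat size_cat /= cats0 addnA.
Qed.

Lemma list_posn n (G : sgraph 'I_n) p : list_pos G p n = p + size (adjacency_lists G).
Proof.
rewrite /list_pos take_oversize; last by rewrite size_map size_enum_ord.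
by congr (_ + size (flatten _)); apply: eq_map => u; rewrite size_nbrs.
Qed.

Lemma nth_adjacency_lists n (G : sgraph 'I_n) (pre post : seq nat) (u : 'I_n) j :
  j <= size (nbrs G u) ->
  nth 0 (pre ++ adjacency_lists G ++ post) (list_pos G (size pre) u + j) =
  nth 0 (size (nbrs G u) :: nbrs G u) j.
Proof.
move=> hj; rewrite nth_cat /list_pos -addnA ltnNge leq_addr addKn /=.
have -> : adjacency_lists G = flatten [seq size (nbrs G v) :: nbrs G v | v <- enum 'I_n].
  by congr flatten; apply: eq_map => v; rewrite size_nbrs.
set ss := map _ _; have us : u < size ss by rewrite size_map size_enum_ord.
rewrite -{1}(cat_take_drop u ss) flatten_cat -catA nth_cat ltnNge leq_addr addKn /=.
rewrite (drop_nth [::]) //= (nth_map u) ?size_enum_ord // nth_ord_enum.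
by rewrite -catA nth_cat /= ltnS hj.
Qed.

(** The accumulator is itself the reading position: each round skips one list, whose length stands
    in front of it. *)
Definition xoff (P V : xp) : xp := xloop LSum P V (fun A _ => xadd (xc 1) (xarr 0 A)).

Definition xlist_mem (O V : xp) : xp :=
  xex (xarr 0 O) (fun J => xeq (xarr 0 (xadd (xadd O (xc 1)) J)) V).

Section Lists.
Variables (d : nat -> nat) (n : nat) (G : sgraph 'I_n) (pre post : seq nat).
Hypothesis pre2 : 2 <= size pre.
Hypothesis hd : forall j, 2 <= j -> d (8 * j) = nth 0 (pre ++ adjacency_lists G ++ post) j.

Lemma list_pos2 u : 2 <= list_pos G (size pre) u.
Proof. exact: leq_trans pre2 (leq_addr _ _). Qed.

Lemma data_degree (u : 'I_n) : d (8 * list_pos G (size pre) u) = size (nbrs G u).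
Proof. by rewrite hd ?list_pos2 // -[list_pos _ _ _]addn0 nth_adjacency_lists. Qed.

Lemma data_nbr (u : 'I_n) j : j < size (nbrs G u) ->
  d (8 * (list_pos G (size pre) u + 1 + j)) = nth 0 (nbrs G u) j.
Proof.
move=> hj; rewrite -addnA hd ?nth_adjacency_lists //.
by apply: leq_trans (list_pos2 u) (leq_addr _ _).
Qed.

Lemma val_off env P V v : v <= n -> denotes d env P (size pre) -> denotes d env V v ->
  denotes d env (xoff P V) (list_pos G (size pre) v).
Proof.
move=> vn hP hV.
have e m : m <= n -> iteri m (fun i acc => comb LSum acc (1 + d (8 * acc))) (size pre) =
    list_pos G (size pre) m.
  elim: m => [|m IH] mn; first by rewrite /list_pos take0 addn0.
  have dm := data_degree (Ordinal mn); have pm := list_posS G (size pre) (Ordinal mn).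
  by rewrite /= in dm pm; rewrite iteriS IH ?(ltnW mn) // dm pm add1n.
apply: val_eq (e v vn).
apply: (val_loop (g := fun i acc => 1 + d (8 * acc))) => // i a e' Za Zi _ _ ha _ _.
apply: val_add; first exact: val_c.
by rewrite -[8 * a]addn0; apply: val_arr.
Qed.

Lemma val_list_mem env O V (u v : 'I_n) : denotes d env O (list_pos G (size pre) u) ->
  denotes d env V v -> denotes d env (xlist_mem O V) (adj G u v).
Proof.
move=> hO hV; have h : denotes d env (xlist_mem O V)
    [exists j : 'I_(size (nbrs G u)), d (8 * (list_pos G (size pre) u + 1 + j) + 0) == v].
  apply: (val_ex (p := fun j => d (8 * (list_pos G (size pre) u + 1 + j) + 0) == v)).
    by rewrite -data_degree -[8 * _]addn0; apply: val_arr.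
  by move=> j e Z _ he hZ; vauto.
apply: val_eq h _; congr nat_of_bool; rewrite -mem_nbrs; apply/existsP/idP => [[j /eqP <-]|].
  by rewrite addn0 data_nbr // mem_nth.
move=> h; have hi : index (v : nat) (nbrs G u) < size (nbrs G u) by rewrite index_mem.
by exists (Ordinal hi); rewrite addn0 data_nbr //= nth_index.
Qed.
End Lists.

(** Every entry ends in a comparison, so the code of [H] has type [VK] although data are read. *)
Definition xpattern (K : xp) : xp :=
  xsum (xmul K K) (fun I => xmul (xlet (xoff (xc 2) (xdiv I K)) (fun O => xlist_mem O (xmod I K)))
    (xpow (xc 2) I)).

Lemma val_pattern d env K k n (H : sgraph 'I_k) (G : sgraph 'I_n) :
  (forall j, 2 <= j -> d (8 * j) = nth 0 (encode H G) j) -> denotes d env K k ->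
  exists2 hc, is_code (adj H) hc & denotes d env (xpattern K) hc.
Proof.
move=> hd hK.
pose b (i : 'I_(k * k)) : 'I_2 := inord (adj H (pfst i) (psnd i)).
have bE i : b i = adj H (pfst i) (psnd i) :> nat by rewrite inordK //; case: (adj _ _ _).
exists (code [ffun i => b i]).
  by move=> u v; rewrite -[u * k + v]/(val (pidx u v)) ndig_code ffunE bE pfstK psndK.
apply: val_code; [by vauto|exact: val_c|move=> i e Z he hZ]; rewrite ffunE bE.
apply: val_let => [|e' O he' hO].
  apply: (@val_off d k H [:: k; n] (adjacency_lists G) _ _ _ _ _ (pfst i)) => //.
  - exact: ltnW.
  - by rewrite /=; vauto.
apply: (@val_list_mem d k H [:: k; n] (adjacency_lists G)) => //=.
by vauto.
Qed.

(** * Building the neighbour table *)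

(** The array starts out zero, so only the edges are written. The minimum with [S] has no effect on
    the value; it is there for [sclipped]. *)
Definition sparse_graph (K N S : xp) : xs :=
  slet (xoff (xc 2) K) (fun P => sfor N (fun U => slet (xoff P U) (fun O =>
    sfor (xarr 0 O) (fun J =>
      sarr 1 (xadd (xmul U N) (xarr 0 (xadd (xadd O (xc 1)) J))) (xmin (xc 1) S))))).

(* The data cells other than those of the arrays listed in [A] agree. *)
Definition same (A : seq nat) (d d' : nat -> nat) : Prop :=
  forall b j, b < 8 -> b \notin A -> d' (8 * j + b) = d (8 * j + b).

Lemma same_update A d d' x a y : a < 8 -> a \in A -> same A d d' ->
  same A d (update d' (8 * x + a) y).
Proof.
move=> a8 aA h b j b8 bA; rewrite update_arr // (h b j b8 bA).
by case: eqP => //= _; case: eqP => // ba; rewrite ba aA in bA.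
Qed.

Lemma eq_pair m x y u z : y < m -> z < m -> (x * m + y == u * m + z) = (x == u) && (y == z).
Proof.
move=> ym zm; apply/eqP/andP => [e|[/eqP -> /eqP -> //]].
have m0 : 0 < m by apply: leq_ltn_trans ym.
have := congr1 (divn^~ m) e; rewrite /= !divnMDl // !divn_small // !addn0 => xu.
by split; [rewrite xu|move: e; rewrite xu => /addnI ->].
Qed.

Lemma val_clip d env Y S y s : denotes d env Y y -> denotes d env S s -> y <= s ->
  denotes d env (xmin Y S) y.
Proof. by move=> hY hS ys; apply: val_eq (val_min hY hS) _; apply/minn_idPl. Qed.

Section Phases.
Variables (k n s : nat) (G : sgraph 'I_n) (env : seq nat) (K N S : xp).
Hypothesis hK : forall d, denotes d env K k.
Hypothesis hN : forall d, denotes d env N n.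
Hypothesis hS : forall d, denotes d env S s.

Lemma wp_parse (H : sgraph 'I_k) d (Q : (nat -> nat) -> Prop) :
  0 < s -> (forall j, 2 <= j -> d (8 * j) = nth 0 (encode H G) j) ->
  (forall j, d (8 * j + 1) = 0) ->
  (forall d', same [:: 1] d d' ->
     (forall x y : 'I_n, d' (8 * (x * n + y) + 1) = adj G x y) -> Q d') ->
  wp d env (sparse_graph K N S) Q.
Proof.
move=> s0 hd d0 hQ; pose pre := [:: k; n] ++ adjacency_lists H.
have hd' d' : same [:: 1] d d' ->
    forall j, 2 <= j -> d' (8 * j) = nth 0 (pre ++ adjacency_lists G ++ [::]) j.
  by move=> h j j2; rewrite cats0 -[8 * j]addn0 h // addn0 hd // /pre -catA.
apply: (wp_let (x := size pre)).
  apply: val_eq (@val_off d k H [:: k; n] (adjacency_lists G) _ hd _ _ _ _ (leqnn k) _ _) _ => //.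
  by rewrite list_posn /pre size_cat.
move=> e1 P he1 hP.
apply: (@wp_for (fun i d' => same [:: 1] d d' /\
   forall x y : 'I_n, d' (8 * (x * n + y) + 1) = (x < i) && adj G x y) d _ N _ n).
- exact: val_sub he1 _.
- by split=> // x y; rewrite d0.
- move=> i d' e2 U iN [h1 h2] he2 hU; pose u := Ordinal iN.
  have pre2 : 2 <= size pre by [].
  apply: (wp_let (x := list_pos G (size pre) u)).
    by apply: (@val_off d' n G pre [::] pre2 (hd' _ h1)); [apply: ltnW|vfind|vfind].
  move=> e3 O he3 hO.
  apply: (@wp_for (fun j d' => same [:: 1] d d' /\
     forall x y : 'I_n, d' (8 * (x * n + y) + 1) =
       ((x < i) && adj G x y) || ((x == u) && ((y : nat) \in take j (nbrs G u)))) d' _ _ _ (size (nbrs G u))).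
  + apply: val_eq (val_arr 0 (hO d')) _; rewrite addn0.
    exact: (data_degree pre2 (hd' _ h1)).
  + by split=> // x y; rewrite take0 in_nil andbF orbF.
  + move=> j d'' e4 J jn [h3 h4] he4 hJ.
    have he12 := extends_trans he1 he2; have he14 := extends_trans he12 (extends_trans he3 he4).
    apply: (wp_arr (x := i * n + nth 0 (nbrs G u) j) (y := 1)).
    * apply: val_add; first by vauto.
      apply: val_eq (val_arr 0 (x := list_pos G (size pre) u + 1 + j) _) _.
        by vauto.
      by rewrite addn0 (data_nbr pre2 (hd' _ h3)).
    * by apply: val_clip s0; [exact: val_c|exact: val_sub he14 _].
    split; first exact: same_update.
    move=> x y; rewrite update_arr // andbT eq_pair ?nbrs_lt // h4 (take_nth 0) // mem_rcons in_cons.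
    by rewrite -[x == u]/(x == i :> nat); case: (x =P i :> nat); case: (y =P nth _ _ _ :> nat);
      rewrite ?andbF ?orbT ?orbF.
  + move=> d'' [h3 h4]; split=> // x y; rewrite h4 take_size mem_nbrs [in RHS]ltnS [in RHS]leq_eqVlt.
    rewrite -[x == u]/(x == i :> nat); case: eqP => [xi|_] /=; last by rewrite orbF.
    by rewrite xi ltnn (_ : x = u) //; apply: val_inj.
by move=> d' [h1 h2]; apply: hQ => // x y; rewrite h2 ltn_ord.
Qed.

Definition sorient (LG DLT : xp) : xs :=
  sfor LG (fun _ => sfor N (fun V =>
    swhen (xmul (xnot (xarr 2 V)) (xnot (xlt DLT
             (xsum N (fun W => xmul (xarr 1 (xadd (xmul V N) W)) (xnot (xarr 2 W)))))))
      (sseq (sfor N (fun W => sarr 3 (xadd (xmul V N) W)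
               (xmin (xor (xarr 3 (xadd (xmul V N) W))
                          (xmul (xarr 1 (xadd (xmul V N) W)) (xnot (xarr 2 W)))) S)))
            (sarr 2 V (xmin (xc 1) S))))).

Definition peel_mem (d : nat -> nat) (st : peel_state n) (d' : nat -> nat) : Prop :=
  [/\ same [:: 2; 3] d d', forall v : 'I_n, d' (8 * v + 2) = (v \in st.1) &
      forall x y : 'I_n, d' (8 * (x * n + y) + 3) = ((x, y) \in st.2)].

Lemma wp_orient (d : nat -> nat) r delta LG DLT (Q : (nat -> nat) -> Prop) :
  0 < s -> (forall d, denotes d env LG r) -> (forall d, denotes d env DLT delta) ->
  (forall x y : 'I_n, d (8 * (x * n + y) + 1) = adj G x y) ->
  (forall j, d (8 * j + 2) = 0) -> (forall j, d (8 * j + 3) = 0) ->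
  (forall d', same [:: 2; 3] d d' ->
     (forall x y : 'I_n, d' (8 * (x * n + y) + 3) = ((x, y) \in (peel G delta r).2)) -> Q d') ->
  wp d env (sorient LG DLT) Q.
Proof.
move=> s0 hLG hD gm d2 d3 hQ.
apply: (@wp_for (fun i => peel_mem d (peel G delta i)) d _ LG _ r) => //.
- by split=> // *; rewrite ?d2 ?d3 inE.
- move=> i d' e1 _ _ I1 he1 _; set st := peel G delta i in I1.
  apply: (@wp_for (fun j => peel_mem d (peel_upto G delta st j)) d' _ N _ n) => //.
    exact: val_sub he1 _.
  move=> v0 d1 e2 V vn I2 he2 hV; pose v := Ordinal vn.
  set st1 := peel_upto G delta st v0 in I2; have [h1 h2 h3] := I2.
  have he12 := extends_trans he1 he2.
  have hS1 e : extends e2 e -> forall d, denotes d e S s.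
    by move=> he d''; apply: val_sub (extends_trans he12 he) _.
  have -> : peel_upto G delta st v0.+1 = peel_step G delta st1 v.
    by rewrite /peel_upto iteriS -/(peel_upto G delta st v0) /peel_at (insubT (fun i => i < n) vn).
  have live d'' e W (w : 'I_n) : same [:: 2; 3] d d'' -> d'' (8 * w + 2) = (w \in st1.1) ->
     extends e2 e -> denotes d'' e W w ->
     denotes d'' e (xmul (xarr 1 (xadd (xmul V N) W)) (xnot (xarr 2 W))) (w \in live_nbrs G st1.1 v).
    move=> sm hw he hW; rewrite inE; have he' := extends_trans he12 he.
    apply: val_and; last by apply: val_not; rewrite -hw; vauto.
    rewrite -gm -sm //; vauto.
  apply: (wp_when (c := peelable G delta st1.1 v)).
  + apply: val_and.
      by apply: val_not; rewrite -h2; vauto.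
    rewrite leqNgt; apply: val_not; apply: val_ltb; first by vauto.
    apply: val_eq (val_sum_ord (g := fun w => nat_of_bool (w \in live_nbrs G st1.1 v)) _ _) _.
    * exact: val_sub he12 _.
    * by move=> w e W he hW; apply: live.
    * by rewrite -sum1_card [RHS]big_mkcond; apply: eq_bigr => w _; case: (_ \in _).
  + move=> pv; rewrite /peel_step pv; apply: wp_seq.
    apply: (@wp_for (fun j d' => [/\ same [:: 2; 3] d d', forall v : 'I_n, d' (8 * v + 2) = (v \in st1.1) &
      forall x y : 'I_n, d' (8 * (x * n + y) + 3) = ((x, y) \in st1.2) ||
         [&& x == v, y < j & y \in live_nbrs G st1.1 v]]) d1 _ N _ n).
    * exact: val_sub he12 _.
    * by split=> // x y; rewrite h3 andbF orbF.
    * move=> w0 d4 e3 W wn [h4 h5 h6] he3 hW; pose w := Ordinal wn.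
      apply: (wp_arr (x := v * n + w) (y := ((v, w) \in st1.2) || (w \in live_nbrs G st1.1 v))).
      - by have he13 := extends_trans he12 he3; vauto.
      - have h : denotes d4 e3 (xor (xarr 3 (xadd (xmul V N) W))
            (xmul (xarr 1 (xadd (xmul V N) W)) (xnot (xarr 2 W))))
            (((v, w) \in st1.2) || (w \in live_nbrs G st1.1 v)).
          apply: val_or; last exact: live.
          have e : (v, w) \in st1.2 = d4 (8 * (v * n + w) + 3) :> nat by rewrite h6 ltnn andbF orbF.
          by rewrite e; have he13 := extends_trans he12 he3; vauto.
        by apply: val_clip h (hS1 _ he3 _) _; apply: leq_trans s0; case: (_ || _).
      split; [exact: same_update| |].
        by move=> u; rewrite update_arr // andbF.
      move=> x y; rewrite update_arr // andbT eq_pair // h6 ltnS.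
      rewrite -[w0]/(nat_of_ord w) !(inj_eq val_inj).
      have [->|_] := eqVneq x v; rewrite ?orbF //=.
      have [->|/negPf yw] := eqVneq y w; rewrite ?leqnn //=.
      by have -> : (y < w0) = (y <= w0) by rewrite ltn_neqAle -[nat_of_ord y == w0]/(y == w) yw.
    * move=> d4 [h4 h5 h6]; apply: (wp_arr (x := v) (y := 1)).
      - by vauto.
      - by apply: val_clip s0; [exact: val_c|exact: hS1 (extends_refl _) _].
      split=> /=; first exact: same_update.
        by move=> u; rewrite update_arr // andbT !inE h5 -[u == v]/(nat_of_ord u == v0); case: eqP.
      by move=> x y; rewrite update_arr // andbF h6 ltn_ord; congr nat_of_bool; rewrite [in RHS]in_set.
  by move=> /negPf np; rewrite /peel_step np.
by move=> d' [h1 _ h3]; apply: hQ.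
Qed.
End Phases.

(** * Tabulating the out-neighbours *)

Section Scan.
Variables (n i : nat) (a : pred nat).

(* Looks for the [i]-th [y < n] with [a y]: the running value is [n] plus the
   number of such [y] still to pass, or the [y] found. *)
Definition scan_step (y acc : nat) : nat :=
  minn (if a y && (n < acc) then if acc == n + 1 then y else acc - 1 else acc) (n + i).

Definition scan (m : nat) : nat := iteri m scan_step (n + i).

Definition hits (m : nat) : nat := \sum_(z < m) a z.

Lemma scanS m : scan m.+1 = scan_step m (scan m). Proof. by []. Qed.

Lemma scan_lt m : m <= n -> hits m < i -> scan m = n + (i - hits m).
Proof.
rewrite /hits; elim: m => [|m IH] mn; first by rewrite big_ord0 subn0.
rewrite scanS big_ord_recr => /= h; rewrite IH ?(ltnW mn) //; last first.
  by apply: leq_ltn_trans h; apply: leq_addr.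
rewrite /scan_step; move: h; set c := \sum_(z < m) a z.
case: (a m) => /= h; last by rewrite addn0; apply/minn_idPl; lia.
have -> : n < n + (i - c) by lia.
by case: eqP => e; lia.
Qed.

Lemma scan_found y m : a y -> y < m -> m <= n -> i = (hits y).+1 -> scan m = y.
Proof.
move=> ay; elim: m => // m IH; rewrite ltnS leq_eqVlt => /orP [/eqP e|ym] mn ei.
  rewrite -e scanS scan_lt ?ei //; last by lia.
  rewrite /scan_step ay /= subSn // subnn addn1 ltnSn eqxx; apply/minn_idPl; lia.
rewrite scanS IH ?(ltnW mn) // /scan_step.
by rewrite ltnNge (leq_trans (ltnW ym) (ltnW mn)) andbF; apply/minn_idPl; lia.
Qed.
End Scan.

Definition xscan (N X I : xp) : xp :=
  xloop LSet (xadd N I) N (fun A Y =>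
    xmin (xif (xmul (xarr 3 (xadd (xmul X N) Y)) (xlt N A))
            (xif (xeq A (xadd N (xc 1))) Y (xsub A (xc 1))) A) (xadd N I)).

Definition stable (N S B : xp) : xs :=
  sfor N (fun X => sfor B (fun I => sarr 5 (xadd (xmul X B) I)
    (xmin (xif (xeq I (xc 0)) X
             (xlet (xscan N X I) (fun R => xmul (xlt R N) R))) S))).

Section Table.
Variables (n s b : nat) (env : seq nat) (N S B : xp) (arc : rel 'I_n).
Hypothesis hN : forall d, denotes d env N n.
Hypothesis hS : forall d, denotes d env S s.
Hypothesis hB : forall d, denotes d env B b.

Definition row (x : 'I_n) (y : nat) : bool := if insub y is Some z then arc x z else false.

(** Slot 0 is the vertex itself, for steps that stand still. A later slot without neighbour holds
    vertex 0: a useless but harmless candidate, as every placement is checked. *)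
Definition entry (x : 'I_n) (i : nat) : 'I_n :=
  insubd x (if i == 0 then nat_of_ord x else (scan n i (row x) n < n) * scan n i (row x) n).

Lemma entryE (x : 'I_n) i : entry x i =
  (if i == 0 then nat_of_ord x else (scan n i (row x) n < n) * scan n i (row x) n) :> nat.
Proof.
rewrite val_insubd; case: ifP => // /negP []; case: ifP => _; first exact: ltn_ord.
have n0 : 0 < n by apply: leq_ltn_trans (ltn_ord x).
by case: (ltnP (scan n i (row x) n) n) => h; rewrite ?mul1n ?mul0n.
Qed.

Lemma entry_cover delta x y : (forall x, #|[set y | arc x y]| <= delta) ->
  (y == x) || arc x y -> exists2 i, i < delta.+1 & entry x i = y.
Proof.
move=> hd /orP [/eqP ->|axy].
  by exists 0 => //; apply: val_inj; rewrite /= entryE.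
have ry : row x y by rewrite /row valK.
(* The slot of [y] is one more than the number of out-neighbours before it, slot 0 being taken. *)
exists (hits (row x) y).+1; last first.
  by apply: val_inj; rewrite /= entryE /= (scan_found ry _ _ (erefl _)) // ltn_ord mul1n.
rewrite ltnS; apply: leq_trans (hd x).
rewrite -sum1dep_card (bigD1 y) //= add1n ltnS /hits.
rewrite (big_ord_widen n (fun z => nat_of_bool (row x z)) (ltnW (ltn_ord y))) big_mkcond /=.
rewrite [X in _ <= X]big_mkcond /=. apply: leq_sum => z _.
case: ltnP => // zy; rewrite /row valK; case: (arc x z) => //=.
by case: eqP => // e; rewrite e ltnn in zy.
Qed.

Lemma wp_table (d : nat -> nat) (Q : (nat -> nat) -> Prop) : n <= s ->
  (forall x y : 'I_n, d (8 * (x * n + y) + 3) = arc x y) ->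
  (forall d', same [:: 5] d d' ->
     (forall (x : 'I_n) i, i < b -> d' (8 * (x * b + i) + 5) = entry x i) -> Q d') ->
  wp d env (stable N S B) Q.
Proof.
move=> ns harc hQ.
have hscan d' e (x : 'I_n) i X I : same [:: 5] d d' -> extends env e ->
    denotes d' e X x -> denotes d' e I i -> denotes d' e (xscan N X I) (scan n i (row x) n).
  move=> sm he hX hI; apply: (val_loop (md := LSet) (g := scan_step n i (row x))).
  - by vauto.
  - vfind.
  move=> y acc e' A Y yn he' hA hY _; have he2 := extends_trans he he'.
  apply: val_min; last by vauto.
  apply: val_if; [|apply: val_if|]; try vfind; try by vauto.
  apply: val_and; last by vauto.
  by rewrite /row (insubT (fun y => y < n) yn) -harc -sm //; vauto.
apply: (@wp_for (fun i d' => same [:: 5] d d' /\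
   forall (x : 'I_n) j, j < b -> x < i -> d' (8 * (x * b + j) + 5) = entry x j) d _ N _ n) => //.
- move=> x0 d1 e1 X xn [h1 h2] he1 hX; pose x := Ordinal xn.
  apply: (@wp_for (fun i d' => same [:: 5] d d' /\
    forall (y : 'I_n) j, j < b -> (y < x) || ((y == x) && (j < i)) ->
     d' (8 * (y * b + j) + 5) = entry y j) d1 _ _ _ b).
  + exact: val_sub he1 _.
  + by split=> // y j jb; rewrite andbF orbF; apply: h2.
  + move=> i d2 e2 I ib [h3 h4] he2 hI; have he12 := extends_trans he1 he2.
    apply: (wp_arr (x := x * b + i) (y := entry x i)).
    * by apply: val_add; [apply: val_mul|]; vfind.
    * apply: val_clip (val_sub he12 (hS d2)) _; last by apply: ltnW; apply: leq_trans (ltn_ord _) ns.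
      apply: (@val_eq _ _ _ _ _ _ (esym (entryE x i))).
      apply: val_if; [by apply: val_eqb; [vfind|exact: val_c]|vfind|].
      apply: (val_let (x := scan n i (row x) n)); first by apply: hscan; vfind.
      by move=> e3 R he3 hR; have he13 := extends_trans he12 he3; vauto.
    split; first exact: same_update.
    move=> y j jb; rewrite update_arr // andbT eq_pair //.
    have [->|nyx] := eqVneq y x.
      rewrite eqxx ltnn /= ltnS leq_eqVlt; have [-> //|ji /= h] := eqVneq j i.
      by apply: (h4 x); rewrite // eqxx h orbT.
    rewrite -[nat_of_ord y == x0]/(y == x) (negPf nyx) orbF => h.
    by apply: h4 => //; rewrite h.
  + move=> d2 [h3 h4]; split=> // y j jb; rewrite ltnS leq_eqVlt => h; apply: h4 => //.
    by rewrite jb andbT -[y == x]/(nat_of_ord y == x0) orbC.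
by move=> d' [h1 h2]; apply: hQ => // x i ib; apply: h2.
Qed.
End Table.

(** Counts the [i < n] for which [n] halved [i] times is still positive; [n] rounds suffice as
    [lg n <= n]. The minimum only serves to bound the type of the accumulator. *)
Definition xlog (N : xp) : xp :=
  xsum N (fun I => xlt (xc 0) (xloop LSet N I (fun A _ => xmin (xdiv A (xc 2)) N))).

Lemma val_log d env N n : 0 < n -> denotes d env N n -> denotes d env (xlog N) (lg n).
Proof.
move=> n0 hN.
have ln : lg n <= n by have := trunc_logP (isT : 1 < 2) n0; have := ltn_expl (trunc_log 2 n) (isT : 1 < 2); rewrite /lg; lia.
have hs : \sum_(i < n) (i < lg n) = lg n.
  transitivity (\sum_(i < lg n) 1); last by rewrite sum1_card card_ord.
  rewrite (big_ord_widen n (fun _ => 1) ln) [RHS]big_mkcond.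
  by apply: eq_bigr => i _; case: (_ < _).
apply: val_eq hs; apply: (val_sum (g := fun i => nat_of_bool (i < lg n))) => // i e Z iN he hZ.
have e2 m : iteri m (fun _ a => minn (a %/ 2) n) n = n %/ 2 ^ m.
  elim: m => [|m IH]; first by rewrite divn1.
  by rewrite iteriS IH -divnMA -expnSr; apply/minn_idPl; apply: leq_div.
have h : denotes d e (xlt (xc 0) (xloop LSet N Z (fun A _ => xmin (xdiv A (xc 2)) N)))
    ((0 < n %/ 2 ^ i) : bool).
  apply: val_ltb; first exact: val_c.
  apply: val_eq (e2 i); apply: (val_loop (md := LSet) (g := fun _ a => minn (a %/ 2) n)).
  - vfind.
  - vfind.
  by move=> j a e' A J _ he' hA _ _; have he2 := extends_trans he he'; vauto.
apply: val_eq h _; rewrite divn_gt0 ?expn_gt0 //; congr nat_of_bool.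
rewrite /lg ltnS; apply/idP/idP => h; first exact: trunc_log_max.
by apply: leq_trans (trunc_logP (isT : 1 < 2) n0); rewrite leq_exp2l.
Qed.
(** * Moving the input out of the low cells *)

Definition instr : Type := (place * binop * operand * operand)%type.

Definition irun (m : memory) (i : instr) : memory :=
  let: (p, o, x, y) := i in update m (address m p) (apply_binop o (value m x) (value m y)).

Definition block (l : seq instr) : program :=
  foldr (fun i c => let: (p, o, x, y) := i in Seq (Assign p o x y) c) Skip l.

Definition pfits (M : nat) (m : memory) (p : place) : bool :=
  match p with Dir a => a <= M | Ind a => (a <= M) && (m a <= M) end.

Definition ofits (M : nat) (m : memory) (x : operand) : bool :=
  match x with Cst c => c <= M | At p => pfits M m p && (m (address m p) <= M) end.

Definition ifits (M : nat) (m : memory) (i : instr) : bool :=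
  let: (p, o, x, y) := i in
  [&& pfits M m p, ofits M m x, ofits M m y & apply_binop o (value m x) (value m y) <= M].

Fixpoint bfits (M : nat) (m : memory) (l : seq instr) : bool :=
  if l is i :: l' then ifits M m i && bfits M (irun m i) l' else true.

Lemma pfits_cost M m p : pfits M m p -> address_cost m p <= 2 * lg M.
Proof.
case: p => a /=; first by move=> /lg_mono; lia.
by move=> /andP [/lg_mono h1 /lg_mono h2]; lia.
Qed.

Lemma ofits_cost M m x : ofits M m x -> value_cost m x <= 3 * lg M.
Proof.
case: x => [c|p] /=; first by move=> /lg_mono; lia.
by move=> /andP [/pfits_cost h1 /lg_mono h2]; lia.
Qed.

(** The constant 9 allows 3 for each of two operands, 2 for the destination address and 1 for the
    result. *)
Lemma block_exec M l m : bfits M m l ->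
  exists2 t, exec (block l) m t (foldl irun m l) & t <= size l * (9 * lg M).
Proof.
elim: l m => [|[[[p o] x] y] l IH] m /=; first by exists 0 => //; apply: ExecSkip.
move=> /andP [/and4P [hp hx hy hv] /IH [t et ht]].
eexists; first exact: ExecSeq (ExecAssign _ _ _ _ _) et.
have := pfits_cost hp; have := ofits_cost hx; have := ofits_cost hy; have := lg_mono hv; lia.
Qed.

Definition copy_step : seq instr :=
  [:: (Ind 4, Add, At (Ind 3), Cst 0); (Dir 3, Add, At (Dir 3), Cst 1);
      (Dir 4, Add, At (Dir 4), Cst 16); (Dir 2, Defs.Sub, At (Dir 2), Cst 1)].

(** The source ends before the destination begins, so nothing is overwritten before it is read.
    Input cells land 16 apart because data address [8 * j] is the cell [16 * j] past the base. Four
    instructions cost at most 36 units and the test 2. *)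
Lemma copy_loop M c m : 5 <= m 3 -> m 3 + m 2 <= m 4 -> 16 <= M -> m 2 = c ->
  m 4 + 16 * c <= M -> (forall a, a < m 3 + c -> m a <= M) ->
  exists t m', [/\ exec (While (At (Dir 2)) (block copy_step)) m t m',
    m' 0 = m 0, m' 1 = m 1,
    (forall j, j < c -> m' (m 4 + 16 * j) = m (m 3 + j)) /\
    (forall a, 4 < a -> (forall j, j < c -> a != m 4 + 16 * j) -> m' a = m a) &
    t <= c.+1 * (39 * lg M)].
Proof.
elim: c m => [|c IH] m m3 m34 M16 m2 m4M hM.
  exists (value_cost m (At (Dir 2))), m; split=> //; first exact: ExecWhileF.
  rewrite /= m2 mul1n; have := lg_mono (_ : 2 <= M); have := lg_mono (leq0n M); lia.
have m3M : m (m 3) <= M by apply: hM; lia.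
have fits : bfits M m copy_step.
  rewrite /= /update /= !andbT; do ?[apply/andP; split]; do ?case: eqP => ? /=; lia.
have [t1 e1 T1] := block_exec fits.
set m1 := foldl irun m copy_step in e1.
have m1E a : m1 a = if a == 2 then c else if a == 4 then m 4 + 16 else if a == 3 then (m 3).+1
    else if a == m 4 then m (m 3) else m a.
  rewrite /m1 /= /update /=; do ?case: eqP => ? /=; try lia; by rewrite ?addn0.
have a1 : 5 <= m1 3 by rewrite m1E /=; lia.
have a2 : m1 3 + m1 2 <= m1 4 by rewrite !m1E /=; lia.
have a3 : m1 2 = c by rewrite m1E.
have a4 : m1 4 + 16 * c <= M by rewrite m1E /=; lia.
have a5 a : a < m1 3 + c -> m1 a <= M.
  by rewrite !m1E /= => ha; do ?case: eqP => ? //; try lia; apply: hM; lia.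
have [t2 [m' [e2 z0 z1 [z2 z3] T2]]] := IH m1 a1 a2 M16 a3 a4 a5.
have n2 : value m (At (Dir 2)) != 0 by rewrite /= m2.
exists (value_cost m (At (Dir 2)) + t1 + t2), m'; split.
- exact: ExecWhileT n2 e1 e2.
- by rewrite z0 m1E /=; case: eqP => // ?; lia.
- by rewrite z1 m1E /=; case: eqP => // ?; lia.
- rewrite !m1E /= in z2 z3; split=> [[|j] jc|a ha4 ha].
  + rewrite muln0 addn0 z3 ?m1E; [|lia|by move=> j _; apply/eqP; lia].
    by do ?case: eqP => ? //; rewrite ?addn0 //; lia.
  + have -> : m 4 + 16 * j.+1 = m 4 + 16 + 16 * j by lia.
    by rewrite z2 // m1E; do ?case: eqP => ? //; try lia; congr m; lia.
  rewrite z3 // => [|j jc].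
    have := ha 0 isT; rewrite muln0 addn0 m1E => /negPf ->.
    by do ?case: eqP => ? //; lia.
  by have := ha j.+1 jc; rewrite mulnS addnA.
have h2 : lg 2 <= lg M by apply: lg_mono; lia.
have h3 : lg (m 2) <= lg M by apply: lg_mono; rewrite m2; lia.
have -> : value_cost m (At (Dir 2)) = lg 2 + lg (m 2) by [].
move: T1; rewrite [size _]/=; lia.
Qed.

(** Cells 2, 3 and 4 serve as counter, source and target of the copy loop, so their contents are
    moved to their final places beforehand and the loop starts with cell 5. The length of the input
    is not given; its upper bound [s * s] is copied. *)
Definition relocate_head : seq instr :=
  [:: (Dir 0, Add, At (Dir 0), At (Dir 1)); (Dir 0, Add, At (Dir 0), Cst 4);
      (Dir 1, Add, At (Dir 1), At (Dir 0)); (Dir 1, Mul, At (Dir 1), At (Dir 0));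
      (Dir 1, Mul, At (Dir 1), Cst 2); (Dir 1, Add, At (Dir 1), Cst 33);
      (Ind 1, Add, At (Dir 2), Cst 0); (Dir 1, Add, At (Dir 1), Cst 16);
      (Ind 1, Add, At (Dir 3), Cst 0); (Dir 1, Add, At (Dir 1), Cst 16);
      (Ind 1, Add, At (Dir 4), Cst 0);
      (Dir 2, Mul, At (Dir 0), At (Dir 0)); (Dir 3, Add, Cst 5, Cst 0);
      (Dir 4, Add, At (Dir 1), Cst 16)].

Definition relocate_tail : seq instr :=
  [:: (Dir 1, Defs.Sub, At (Dir 1), Cst 64); (Dir 4, Div, At (Dir 1), Cst 2);
      (Dir 4, Div, At (Dir 4), At (Dir 0)); (Dir 4, Defs.Sub, At (Dir 4), At (Dir 0));
      (Dir 2, Defs.Sub, At (Dir 0), At (Dir 4)); (Dir 2, Defs.Sub, At (Dir 2), Cst 4);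
      (Dir 6, Add, At (Dir 0), Cst 0); (Dir 8, Div, At (Dir 2), Cst 4);
      (Dir 0, Add, At (Dir 1), Cst 0)].

(* [k] and [n] are recovered from the offset [2 (n + s) s + 1] and [s = k + n + 4]. *)
Definition relocate : program :=
  Seq (block relocate_head) (Seq (While (At (Dir 2)) (block copy_step)) (block relocate_tail)).

(** Odd, as [sim] requires, and beyond the [s * s] cells that may hold input. *)
Definition offset (n s : nat) : nat := (2 * ((n + s) * s)).+1.

(* Data cells with addresses divisible by 8 hold the input, except for [k] and [n]. *)
Definition input_data (l : seq nat) (a : nat) : nat :=
  if (8 %| a) && (16 <= a) then nth 0 l (a %/ 8) else 0.

Lemma relocate_ok k n l s M : s = k + n + 4 -> nth 0 l 0 = k -> nth 0 l 1 = n ->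
  size l <= s * s -> (forall j, nth 0 l j <= s) -> offset n s + 16 * (s * s) + 100 <= M ->
  exists t m, [/\ exec relocate (nth 0 l) t m, sim (input_data l) [:: k; n; s; k %/ 4] m,
     m 0 = offset n s & t <= (s * s + 10) * (39 * lg M)].
Proof.
move=> es l0 l1 ls lv hM; rewrite /offset in hM *.
set q := (n + s) * s in hM *; set p := s * s in ls hM *.
have pq : p <= q by rewrite /p /q leq_mul2r leq_addl orbT.
have p16 : 16 <= p by rewrite /p (@leq_mul 4 4) //; lia.
have sp : s <= p by rewrite /p leq_pmulr //; lia.
set m := nth 0 l; have mk : m 0 = k := l0; have mn : m 1 = n := l1.
(* The destinations beyond the input differ from all small cell numbers, so the updates do not
   interfere. *)
have z c : c < 33 -> (c == q * 2 + 33) = false by lia.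
have z16 c : c < 33 -> (c == q * 2 + 33 + 16) = false by lia.
have z32 c : c < 33 -> (c == q * 2 + 33 + 16 + 16) = false by lia.
pose zs := (z 0 isT, z 1 isT, z 2 isT, z 3 isT, z 4 isT, z16 0 isT, z16 1 isT, z16 2 isT,
    z16 3 isT, z16 4 isT, z32 0 isT, z32 1 isT, z32 2 isT, z32 3 isT, z32 4 isT).
have fitsA : bfits M m relocate_head.
  rewrite /= /update /= mk mn -es -/q -/p !addn0; do 2 rewrite ?zs.
  have := lv 2; have := lv 3; have := lv 4; rewrite -/m; lia.
have [t1 e1 T1] := block_exec fitsA.
set m1 := foldl irun m relocate_head in e1.
have m1E a : m1 a = if a == 4 then (2 * q).+1 + 80 else if a == 3 then 5 else if a == 2 then p
   else if a == 1 then (2 * q).+1 + 64 else if a == 0 then s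
   else if a == (2 * q).+1 + 64 then m 4 else if a == (2 * q).+1 + 48 then m 3
   else if a == (2 * q).+1 + 32 then m 2 else m a.
  rewrite /m1 /= /update /= mk mn -es -/q -/p.
  rewrite !addn0.
  do 2 rewrite ?zs.
  have -> : q * 2 + 33 + 16 + 16 + 16 = (2 * q).+1 + 80 by lia.
  have -> : q * 2 + 33 + 16 + 16 = (2 * q).+1 + 64 by lia.
  have -> : q * 2 + 33 + 16 = (2 * q).+1 + 48 by lia.
  have -> : q * 2 + 33 = (2 * q).+1 + 32 by lia.
  do 3 (case: eqP => // _).
  by do ?case: eqP => // ?; lia.
have mM j : m j <= M by apply: leq_trans (lv j) _; lia.
have b1 : m1 3 + m1 2 <= m1 4 by rewrite !m1E /=; lia.
have b2 : m1 4 + 16 * p <= M by rewrite m1E /=; lia.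
have b3 a : a < m1 3 + p -> m1 a <= M.
  move=> _; rewrite m1E; do ?case: eqP => ? //; try lia; exact: mM.
have b4 : m1 2 = p by rewrite m1E.
have b0 : 5 <= m1 3 by rewrite m1E.
have M16 : 16 <= M by lia.
have [t2 [m2 [e2 z0 z1 [z2 z3] T2]]] := copy_loop b0 b1 M16 b4 b2 b3.
rewrite !m1E /= in z0 z1 z2 z3.
have fitsB : bfits M m2 relocate_tail.
  rewrite /= /update /= z0 z1.
  have -> : (2 * q).+1 + 64 - 64 = (2 * q).+1 by lia.
  have -> : (2 * q).+1 %/ 2 = q by lia.
  have -> : q %/ s = n + s by rewrite /q mulnK //; lia.
  have -> : n + s - s = n by lia.
  have -> : s - n - 4 = k by lia.
  lia.
have [t3 e3 T3] := block_exec fitsB.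
set m3 := foldl irun m2 relocate_tail in e3.
have m3E a : m3 a = if a == 0 then (2 * q).+1 else if a == 8 then k %/ 4 else if a == 6 then s
   else if a == 2 then k else if a == 4 then n else if a == 1 then (2 * q).+1 else m2 a.
  rewrite /m3 /= /update /= z0 z1.
  have -> : (2 * q).+1 + 64 - 64 = (2 * q).+1 by lia.
  have -> : (2 * q).+1 %/ 2 = q by lia.
  have -> : q %/ s = n + s by rewrite /q mulnK //; lia.
  have -> : n + s - s = n by lia.
  have -> : s - n - 4 = k by lia.
  do ?case: eqP => ? //=; lia.
exists (t1 + (t2 + t3)), m3; split.
- exact: ExecSeq e1 (ExecSeq e2 e3).
- split.
  + by rewrite m3E /= mul2n odd_double.
  + by case=> [|[|[|[|j]]]] //= _; rewrite m3E.
  move=> a; rewrite [m3 0]m3E /= m3E.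
  have -> : m2 ((2 * q).+1 + a.*2) = input_data l a.
    rewrite /input_data; case: ifP => [/andP [/dvdnP [j ->] j2]|h].
      rewrite mulnK //; have [j5|j5] := ltnP j 5.
        rewrite z3; [|lia|by move=> i _; apply/eqP; lia].
        by rewrite m1E; do ?case: eqP => ? //; try lia; congr m; lia.
      have [jp|jp] := ltnP (j - 5) p.
        have -> : (2 * q).+1 + (j * 8).*2 = (2 * q).+1 + 80 + 16 * (j - 5) by lia.
        by rewrite z2 // m1E; do ?case: eqP => ? //; try lia; congr m; lia.
      rewrite z3; [|lia|by move=> i ip; apply/eqP; lia].
      rewrite m1E; do ?case: eqP => ? //; try lia.
      by rewrite /m !nth_default //; lia.
    rewrite z3; [|lia|].
      rewrite m1E; do ?case: eqP => ? //; try by move: h; lia.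
      by rewrite /m nth_default //; lia.
    move=> i _; apply/eqP => e; move: h; have -> : a = (i + 5) * 8 by lia.
    by rewrite dvdn_mull //= leqNgt; lia.
  by do ?case: eqP => ? //; lia.
- by rewrite m3E.
move: T1 T3; rewrite [size relocate_head]/= [size relocate_tail]/= => T1 T3.
by rewrite -/p; nia.
Qed.
(** * The counting programs *)

Lemma stage_ok delta e env m : scoped (size env) e -> sim delta env m ->
  exists t m',
  [/\ exec (compile e (size env)) m t m', sim delta (env ++ [:: eval delta env e]) m', m' 0 = m 0 &
      forall V L, 0 < V -> lg (m 0 + V.*2) <= L -> lg (reg (size env + height e)) <= L ->
        safe delta V env e -> t <= 40 * L * steps delta env e].
Proof.
move=> se S; have [t [m' [e1 v1 p1 T1]]] := compile_ok se S.
have [S1 z1] := sim_preserves S p1.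
by exists t, m'; split=> //; apply: sim_rcons.
Qed.

Section Program.
Variables (C c md : nat).

(** Four times the bound on the degeneracy, as required by [peel_half]. The degeneracy itself is
    never computed; [C] and [c] are constants of the program. *)
Definition xlimit : xp := xmul (xc (4 * C)) (xpow (xv 4) (xc c)).
Definition xwidth : xp := xadd (xv 5) (xc 1).

Definition log_expr : expr := xlog (xv 1) 4.
Definition limit_expr : expr := xlimit 5.
Definition pattern_expr : expr := xpattern (xv 0) 6.
Definition table_stmt : stmt :=
  sseq (sparse_graph (xv 0) (xv 1) (xv 2))
    (sseq (sorient (xv 1) (xv 2) (xv 4) (xv 5)) (stable (xv 1) (xv 2) xwidth)) 7.
Definition count_expr : expr := xresult md (xv 0) (xv 1) (xv 3) xwidth (xv 6) 7.

Definition count_program : program :=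
  Seq relocate (Seq (compile log_expr 4) (Seq (compile limit_expr 5)
    (Seq (compile pattern_expr 6) (Seq (scompile table_stmt 7) (Seq (compile count_expr 7)
      (Assign (Dir 0) Add (At (Dir (reg 7))) (Cst 0))))))).

Section Instance.
Variables (k n : nat) (H : sgraph 'I_k) (G : sgraph 'I_n).

Definition data0 : nat -> nat := input_data (encode H G).
Definition env4 : seq nat := [:: k; n; k + n + 4; k %/ 4].
Definition env5 : seq nat := env4 ++ [:: eval data0 env4 log_expr].
Definition env6 : seq nat := env5 ++ [:: eval data0 env5 limit_expr].
Definition env7 : seq nat := env6 ++ [:: eval data0 env6 pattern_expr].
Definition data1 : nat -> nat := srun env7 table_stmt data0.

Definition answer : nat :=
  #|[set phi : {ffun 'I_k -> 'I_n} | wanted_map (adj H) G md phi]| %/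
    (if md == 0 then 1 else #|auts H|).

Lemma data0E j : 2 <= j -> data0 (8 * j) = nth 0 (encode H G) j.
Proof.
by move=> j2; rewrite /data0 /input_data dvdn_mulr // (@leq_mul 8 2 8 j) // mulKn.
Qed.

Lemma data0_0 a j : 0 < a < 8 -> data0 (8 * j + a) = 0.
Proof.
move=> /andP [a0 a8]; rewrite /data0 /input_data; case: ifP => // /andP [].
by rewrite dvdn_addr ?dvdn_mulr // => /(dvdn_leq a0); rewrite leqNgt a8.
Qed.

Lemma eval_log : 0 < n -> eval data0 env4 log_expr = lg n.
Proof.
move=> n0; have h : denotes data0 env4 (xv 1) n by exact: (@val_v _ env4 1 isT).
by rewrite -(val_log n0 h (extends_refl _)).
Qed.

Lemma val_env7 d j : j < 7 -> denotes d env7 (xv j) (nth 0 env7 j).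
Proof. by move=> jl; exact: val_v. Qed.

Lemma answer_ok : (0 < n -> degeneracy G <= C * lg n ^ c) ->
  eval data1 env7 count_expr = answer.
Proof.
move=> hdeg.
have hK d : denotes d env7 (xv 0) k by exact: (@val_env7 d 0 isT).
have hN d : denotes d env7 (xv 1) n by exact: (@val_env7 d 1 isT).
have hS d : denotes d env7 (xv 2) (k + n + 4) by exact: (@val_env7 d 2 isT).
have hQ d : denotes d env7 (xv 3) (k %/ 4) by exact: (@val_env7 d 3 isT).
have hK6 : denotes data0 env6 (xv 0) k.
  by exact: (@val_v _ env6 0 isT).
have [hc codeH valH] := val_pattern data0E hK6.
have hHC d : denotes d env7 (xv 6) hc.
  apply: val_eq (@val_env7 d 6 isT) _; by rewrite -(valH _ (extends_refl _)).
have val7 d v : denotes d env7 (xresult md (xv 0) (xv 1) (xv 3) xwidth (xv 6)) v ->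
    eval d env7 count_expr = v.
  by move=> h; rewrite -(h _ (extends_refl _)).
have [n0|n0] := posnP n.
  apply: val7; rewrite /answer; apply: (@val_result0 _ k n H G hc md) => //.
  by exists (nth 0 env7 5 + 1); apply: val_add; [exact: val_env7|exact: val_c].
have hLG d : denotes d env7 (xv 4) (lg n).
  by apply: val_eq (@val_env7 d 4 isT) _; apply: eval_log.
set delta := 4 * C * lg n ^ c.
have hD d : denotes d env7 (xv 5) delta.
  apply: val_eq (@val_env7 d 5 isT) _.
  have h : denotes data0 env5 (xv 4) (lg n).
    by apply: val_eq (@val_v _ env5 4 isT) _; apply: eval_log.
  have h2 : denotes data0 env5 xlimit delta by rewrite /xlimit /delta; vauto.
  by rewrite -(h2 _ (extends_refl _)).
have hB d : denotes d env7 xwidth delta.+1.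
  by rewrite -addn1; apply: val_add; [exact: hD|exact: val_c].
have [A [oA dA]] := degeneracy_orientation G.
have d4 : 4 * degeneracy G <= delta by rewrite /delta -mulnA leq_mul2l hdeg.
have [arcG arcN arcd] := peel_arcs oA dA d4.
have s0 : 0 < k + n + 4 by lia.
suff : wp data0 env7 (sseq (sparse_graph (xv 0) (xv 1) (xv 2))
    (sseq (sorient (xv 1) (xv 2) (xv 4) (xv 5)) (stable (xv 1) (xv 2) xwidth)))
    (fun d => denotes d env7 (xresult md (xv 0) (xv 1) (xv 3) xwidth (xv 6)) answer).
  move=> /(_ _ (extends_refl _)); move=> h; exact: val7.
apply: wp_seq; apply: (wp_parse hK hN hS s0 data0E) => [j|d1 same1 gm]; first exact: data0_0.
apply: wp_seq; apply: (wp_orient (delta := delta) hN hS s0 hLG hD gm).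
- by move=> j; rewrite same1 // data0_0.
- by move=> j; rewrite same1 // data0_0.
move=> d2 same2 arc2; apply: (wp_table (arc := fun x y => (x, y) \in (peel G delta (lg n)).2) hN hS hB _ arc2) => [|d3 same3 tab]; first by lia.
have cov x y h := entry_cover (x := x) (y := y) arcd h.
rewrite /answer; apply: (@val_result _ k n delta.+1 G (fun x y => (x, y) \in (peel G delta (lg n)).2) _ (Ordinal n0) _ tab (erefl _) (ltn0Sn _) cov md H hc codeH arcG arcN) => //.
by move=> x y; rewrite same3 // arc2.
Qed.
End Instance.
End Program.

(** * Executing the whole program *)

Lemma size_nbrs_le n (G : sgraph 'I_n) u : size (nbrs G u) <= n.
Proof. by rewrite size_nbrs -[X in _ <= X]card_ord max_card. Qed.

Lemma size_adjacency_lists n (G : sgraph 'I_n) : size (adjacency_lists G) <= n * n.+1.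
Proof.
have h u : u <= n -> list_pos G 0 u <= u * n.+1.
  elim: u => [|u IH] un; first by rewrite /list_pos take0.
  have /= -> := list_posS G 0 (Ordinal un).
  by have := IH (ltnW un); have := size_nbrs_le G (Ordinal un); lia.
by have := h n (leqnn n); rewrite list_posn.
Qed.

Lemma mem_adjacency_lists n (G : sgraph 'I_n) x : x \in adjacency_lists G -> x <= n.
Proof.
move=> /flattenP [s /mapP [u _ ->]]; rewrite in_cons => /orP [/eqP ->|/mapP [v _ ->]].
  by rewrite -[X in _ <= X]card_ord max_card.
exact: ltnW (ltn_ord v).
Qed.

Lemma encode_le k n (H : sgraph 'I_k) (G : sgraph 'I_n) j : nth 0 (encode H G) j <= k + n + 4.
Proof.
have [h|h] := ltnP j (size (encode H G)); last by rewrite nth_default.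
have := mem_nth 0 h; set x := nth 0 _ j.
rewrite !in_cons mem_cat => /or3P [/eqP ->|/eqP ->|/orP [|] /mem_adjacency_lists]; lia.
Qed.

Lemma size_encode k n (H : sgraph 'I_k) (G : sgraph 'I_n) :
  size (encode H G) <= (k + n + 4) * (k + n + 4).
Proof.
rewrite /= size_cat; have := size_adjacency_lists H; have := size_adjacency_lists G; nia.
Qed.

Section ProgramTime.
Variables (C c md : nat).

Definition height_bound : nat :=
  7 + height log_expr + height (limit_expr C c) + height pattern_expr + sheight table_stmt +
  height (count_expr md).

Section Instance.
Variables (k n : nat) (H : sgraph 'I_k) (G : sgraph 'I_n).
Let s := k + n + 4.
Let e4 := env4 k n.
Let e5 := env5 H G.
Let e6 := env6 C c H G.
Let e7 := env7 C c H G.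
Let d0 := data0 H G.
Let d1 := data1 C c H G.

Definition total_steps : nat :=
  steps d0 e4 log_expr + steps d0 e5 (limit_expr C c) + steps d0 e6 pattern_expr +
  ssteps e7 table_stmt d0 + steps d1 e7 (count_expr md).

Definition total_safe (V : nat) : Prop :=
  [/\ safe d0 V e4 log_expr, safe d0 V e5 (limit_expr C c), safe d0 V e6 pattern_expr,
      ssafe V e7 table_stmt d0 & safe d1 V e7 (count_expr md)].

Definition memory_bound (V : nat) : nat :=
  offset n s + 16 * (s * s) + 100 + V.*2 + reg height_bound.

Lemma limit_scoped : scoped 5 (limit_expr C c). Proof. by []. Qed.

Lemma pattern_scoped : scoped 6 pattern_expr. Proof. by vm_compute. Qed.

Lemma table_scoped : sscoped 7 table_stmt. Proof. by vm_compute. Qed.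

Lemma count_scoped : scoped 7 (count_expr md).
Proof. by rewrite /count_expr /xresult; case: (md == 0); vm_compute. Qed.

Lemma count_program_exec : exists t m,
  [/\ exec (count_program C c md) (nth 0 (encode H G)) t m, m 0 = eval d1 e7 (count_expr md) &
      forall V, 0 < V -> total_safe V ->
        t <= lg (memory_bound V) * (39 * (s * s + 10) + 40 * total_steps + 5)].
Proof.
have [t1 [m1 [x1 S1 z1 T1]]] := relocate_ok (l := encode H G) (erefl s) (erefl k) (erefl n) (size_encode H G)
  (encode_le H G) (leqnn _).
have sc4 : scoped (size e4) log_expr by [].
have [t2 [m2 [x2 S2 z2 T2]]] := stage_ok sc4 S1.
have sc5 : scoped (size e5) (limit_expr C c) := limit_scoped.
have [t3 [m3 [x3 S3 z3 T3]]] := stage_ok sc5 S2.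
have sc6 : scoped (size e6) pattern_expr := pattern_scoped.
have [t4 [m4 [x4 S4 z4 T4]]] := stage_ok sc6 S3.
have sc7 : sscoped (size e7) table_stmt := table_scoped.
have [t5 [m5 [x5 S5 z5 T5]]] := scompile_ok sc7 S4.
have sc8 : scoped (size e7) (count_expr md) := count_scoped.
have [t6 [m6 [x6 S6 z6 T6]]] := stage_ok sc8 S5.
have v6 : m6 (reg 7) = eval d1 e7 (count_expr md) by have [_ /(_ 7 isT) -> _] := S6.
eexists; eexists; split.
- exact: ExecSeq x1 (ExecSeq x2 (ExecSeq x3 (ExecSeq x4 (ExecSeq x5 (ExecSeq x6 (ExecAssign _ _ _ _ _)))))).
- by rewrite -v6; exact: addn0.
move=> V V0 [s1 s2 s3 s4 s5]; set L := lg (memory_bound V).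
have mF : lg (m1 0 + V.*2) <= L by apply: lg_mono; rewrite z1 /memory_bound; lia.
have mF2 : lg (m2 0 + V.*2) <= L by rewrite z2.
have mF3 : lg (m3 0 + V.*2) <= L by rewrite z3.
have mF4 : lg (m4 0 + V.*2) <= L by rewrite z4.
have mF5 : lg (m5 0 + V.*2) <= L by rewrite z5.
have hr h : h <= height_bound -> lg (reg h) <= L.
  by move=> hh; apply: lg_mono; rewrite /memory_bound /reg; lia.
have {}T1 : t1 <= L * (39 * (s * s + 10)).
  have h : lg (offset n s + 16 * (s * s) + 100) <= L by apply: lg_mono; rewrite /memory_bound; lia.
  have e x y : x * (39 * y) = y * (39 * x) by lia.
  by apply: leq_trans T1 _; rewrite e leq_mul2r h orbT.
have q4 : size e4 = 4 by [].
have q5 : size e5 = 5 by [].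
have q6 : size e6 = 6 by [].
have q7 : size e7 = 7 by [].
have vV : m6 (reg 7) <= V by rewrite v6; apply: safe_eval s5.
have l1 : lg (m6 (reg 7)) <= L by apply: lg_mono; rewrite /memory_bound; lia.
have l2 : lg (reg 7) <= L by apply: hr; rewrite ?(q4, q5, q6, q7) /height_bound; lia.
have l3 : lg 0 <= L by apply: lg_mono.
rewrite /value_cost /address_cost /value /address /apply_binop addn0 /total_steps.
have {}T2 : t2 <= 40 * L * steps d0 e4 log_expr by apply: (T2 V L V0) => //; apply: hr; rewrite ?(q4, q5, q6, q7) /height_bound; lia.
have {}T3 : t3 <= 40 * L * steps d0 e5 (limit_expr C c) by apply: (T3 V L V0) => //; apply: hr; rewrite ?(q4, q5, q6, q7) /height_bound; lia.
have {}T4 : t4 <= 40 * L * steps d0 e6 pattern_expr by apply: (T4 V L V0) => //; apply: hr; rewrite ?(q4, q5, q6, q7) /height_bound; lia.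
have {}T5 : t5 <= 40 * L * ssteps e7 table_stmt d0.
  by apply: (T5 V L V0) => //; apply: hr; rewrite ?(q4, q5, q6, q7) /height_bound; lia.
have {}T6 : t6 <= 40 * L * steps d1 e7 (count_expr md).
  by apply: (T6 V L V0) => //; apply: hr; rewrite ?(q4, q5, q6, q7) /height_bound; lia.
nia.
Qed.
End Instance.
End ProgramTime.
(** * Running time *)

Lemma lg_le x m : 0 < m -> x < 2 ^ m -> lg x <= m.
Proof.
move=> m0 xm; have [->|x0] := posnP x; first by [].
rewrite /lg -(ltn_exp2l _ _ (isT : 1 < 2)).
by apply: leq_ltn_trans xm; apply: trunc_logP.
Qed.

Lemma lg_bound x : x < 2 ^ lg x.
Proof. exact: trunc_log_ltn. Qed.

Lemma lg_mul x y : lg (x * y) <= lg x + lg y.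
Proof. by apply: lg_le => //; rewrite expnD ltn_mul ?lg_bound. Qed.

Lemma lg_exp x m : lg (x ^ m) <= 1 + m * lg x.
Proof.
elim: m => [|m IH] //; rewrite expnS mulSn addnCA.
by apply: leq_trans (lg_mul _ _) _; rewrite leq_add2l.
Qed.

Lemma lg_leq x : 0 < x -> lg x <= x.
Proof. by move=> x0; apply: lg_le (ltn_expl _ _). Qed.

(** The family over which the size types are interpreted. *)
Record instance := Instance {
  in_k : nat;
  in_n : nat;
  in_H : sgraph 'I_in_k;
  in_G : sgraph 'I_in_n;
  in_n0 : 0 < in_n
}.

Definition in_w (d : instance) : nat := lg (in_n d).

Notation ibdd := (bdd in_k in_n in_w).

Lemma in_w0 d : 0 < in_w d. Proof. by []. Qed.

Lemma ibdd_cst c : ibdd VK (fun=> c).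
Proof. by right; exists c => d; apply: leq_trans (ltnW (grow_rank_ge c)) (grow_mono _ _). Qed.

Lemma ibdd_k : ibdd VK in_k.
Proof. by right; exists 0 => d; apply: ltnW (grow_gt _ _). Qed.

Lemma ibdd_n : ibdd (VP 1 0) in_n.
Proof.
right; exists 0 => d; rewrite /= addn0 expn1 leq_pmull // expn_gt0 muln_gt0 in_w0 andbT.
by rewrite (ltnW (grow_gt1 _ _)).
Qed.

Lemma ibdd_w : ibdd (VP 0 0) in_w.
Proof.
right; exists 0 => d; rewrite /= muln1; have g1 := grow_gt1 0 (in_k d).
have g0 : 0 < grow 0 (in_k d) by apply: ltnW.
apply: leq_trans (leq_pmull _ g0) _; rewrite -[X in X <= _]expn1.
by rewrite leq_pexp2l // muln_gt0 g0.
Qed.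

(** Bit lengths of numbers that are polynomial in [n] for fixed [k] cost no power of [n]; hence
    [VBig] suffices as a bound on sizes. *)
Lemma ibdd_lg f : ibdd VBig f -> ibdd (VP 0 0) (fun d => lg (f d)).
Proof.
move=> [//|[r h]]; have g : ibdd VK (fun d => grow r (in_k d)) by right; exists r.
have := bdd_add in_n0 in_w0 (ibdd_cst 1)
  (bdd_mul in_n0 in_w0 g (bdd_add in_n0 in_w0 (bdd_add in_n0 in_w0 g ibdd_w) ibdd_w)).
apply: bdd_le => d; apply: leq_trans (lg_mono (h d)) _ => /=.
apply: leq_trans (lg_exp _ _) _; rewrite leq_add2l leq_mul2l; apply/orP; right.
apply: leq_trans (lg_mul _ _) _; rewrite leq_add2r; apply: leq_trans (lg_mul _ _) _.
by apply: leq_add; apply: lg_leq; rewrite ?(ltnW (grow_gt1 _ _)).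
Qed.

Section Cost.
Variables (C c md : nat).
Local Notation ienv7 := (fun d => env7 C c (in_H d) (in_G d)).

Definition in_s (d : instance) : nat := in_k d + in_n d + 4.

Lemma ibdd_s : ibdd (VP 1 0) in_s.
Proof.
exact: (bdd_add in_n0 in_w0 (bdd_add in_n0 in_w0 ibdd_k ibdd_n) (ibdd_cst 4)).
Qed.

Definition ctx4 : seq vtype := [:: VK; VP 1 0; VP 1 0; VQ4].
Definition ctx7 : seq vtype := ctx4 ++ [:: VP 0 0; VP 0 0; VK].

Lemma benv4 : benv in_k in_n in_w ctx4 (fun d => env4 (in_k d) (in_n d)).
Proof.
split=> // -[|[|[|[|j]]]] /=; [exact: ibdd_k|exact: ibdd_n|exact: ibdd_s| |].
  by right; exists 0.
by rewrite nth_nil; left.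
Qed.

Lemma data0_le d a : data0 (in_H d) (in_G d) a <= in_s d.
Proof. by rewrite /data0 /input_data; case: ifP => // _; apply: encode_le. Qed.

Lemma bdata0 : bdata in_k in_n in_w (fun d => data0 (in_H d) (in_G d)).
Proof. exact: (bdata_le (env := fun d => env4 (in_k d) (in_n d)) ibdd_s data0_le). Qed.

Lemma data1_le d a : data1 C c (in_H d) (in_G d) a <= in_s d.
Proof.
rewrite -[in_s d]/(nth 0 (ienv7 d) 2); apply: srun_le => //; exact: data0_le.
Qed.

Lemma bdata1 : bdata in_k in_n in_w (fun d => data1 C c (in_H d) (in_G d)).
Proof. exact: (bdata_le (env := ienv7) ibdd_s data1_le). Qed.

Lemma benv5 : benv in_k in_n in_w (ctx4 ++ [:: VP 0 0]) (fun d => env5 (in_H d) (in_G d)).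
Proof.
apply: benv_cat benv4 _; apply: bdd_le ibdd_w => d.
by rewrite eval_log // in_n0.
Qed.

Lemma benv6 : benv in_k in_n in_w (ctx4 ++ [:: VP 0 0; VP 0 0]) (fun d => env6 C c (in_H d) (in_G d)).
Proof. exact: benv_cat benv5 (@vt_sound (limit_expr C c) _ _ _ _ _ _ _ in_n0 in_w0 benv5 bdata0). Qed.

Lemma vt_pattern : vt (ctx4 ++ [:: VP 0 0; VP 0 0]) pattern_expr = VK.
Proof. by vm_compute. Qed.

Lemma benv7 : benv in_k in_n in_w ctx7 ienv7.
Proof.
have := @vt_sound pattern_expr _ _ _ _ _ _ _ in_n0 in_w0 benv6 bdata0.
rewrite vt_pattern => h; exact: benv_cat benv6 h.
Qed.

Lemma ct_log : ct ctx4 log_expr = Some (2, 0). Proof. by vm_compute. Qed.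
Lemma ct_limit : ct (ctx4 ++ [:: VP 0 0]) (limit_expr C c) = Some (0, 0). Proof. by vm_compute. Qed.
Lemma ct_pattern : ct (ctx4 ++ [:: VP 0 0; VP 0 0]) pattern_expr = Some (1, 0).
Proof. by vm_compute. Qed.
Lemma sct_table : sct ctx7 table_stmt = Some (2, 0). Proof. by vm_compute. Qed.
Lemma table_clipped : sclipped table_stmt. Proof. by vm_compute. Qed.
(** The exponent of the theorem, found by evaluating the type checker: 2 for the images of a root
    and a leaf, 1 times [k / 4] for the base. *)
Lemma ct_count : ct ctx7 (count_expr md) = Some (2, 1).
Proof. by rewrite /count_expr /xresult; case: (md == 0); vm_compute. Qed.

Lemma total_steps_bdd :
  ibdd (VP 2 1) (fun d => total_steps C c md (in_H d) (in_G d)) /\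
  bsafe in_k in_n in_w (fun d V => total_safe C c md (in_H d) (in_G d) V).
Proof.
have [a1 a2] := @ct_sound log_expr _ _ _ _ _ _ _ _ in_n0 in_w0 benv4 bdata0 ct_log.
have [b1 b2] := @ct_sound (limit_expr C c) _ _ _ _ _ _ _ _ in_n0 in_w0 benv5 bdata0 ct_limit.
have [c1 c2] := @ct_sound pattern_expr _ _ _ _ _ _ _ _ in_n0 in_w0 benv6 bdata0 ct_pattern.
have [d1 d2] := @sct_sound table_stmt _ _ _ _ ctx7 ienv7 _ _ in_n0 in_w0 isT table_clipped benv7 ibdd_s data0_le sct_table.
have [e1 e2] := @ct_sound (count_expr md) _ _ _ _ _ _ _ _ in_n0 in_w0 benv7 bdata1 ct_count.
split.
  have up c0 f : c0.1 <= 2 -> c0.2 <= 1 -> cbdd in_k in_n in_w c0 f -> cbdd in_k in_n in_w (2, 1) f.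
    exact: (@cbdd_le _ in_k in_n in_w c0 (2, 1) f in_n0).
  have add f g := @cbdd_add _ in_k in_n in_w (2, 1) f g in_n0 in_w0.
  apply: (add _ _ _ (up _ _ _ _ e1)) => //; apply: (add _ _ _ (up _ _ _ _ d1)) => //.
  apply: (add _ _ _ (up _ _ _ _ c1)) => //; apply: (add _ _ _ (up _ _ _ _ b1)) => //.
  exact: up a1.
have band P Q := @bsafe_and _ in_k in_n in_w P Q in_n0 in_w0.
apply: bsafe_imp (band _ _ a2 (band _ _ b2 (band _ _ c2 (band _ _ d2 e2)))).
by move=> d V [? [? [? [? ?]]]].
Qed.

Lemma program_time : exists r, forall d : instance, exists t m,
  [/\ exec (count_program C c md) (nth 0 (encode (in_H d) (in_G d))) t m,
      m 0 = eval (data1 C c (in_H d) (in_G d)) (ienv7 d) (count_expr md) &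
      t <= bnd (in_k d) (in_n d) (in_w d) r (VP 2 1)].
Proof.
have [st [r0 sf]] := total_steps_bdd.
pose V d := bnd (in_k d) (in_n d) (in_w d) r0 VBig.
have bV : ibdd VBig V by right; exists r0.
have add := @bdd_add _ in_k in_n in_w in_n0 in_w0; have mul := @bdd_mul _ in_k in_n in_w in_n0 in_w0.
have bs2 : ibdd (VP 2 0) (fun d => in_s d * in_s d) := mul _ _ _ _ ibdd_s ibdd_s.
have bM : ibdd VBig (fun d => memory_bound C c md (in_k d) (in_n d) (V d)).
  have h1 := mul _ _ _ _ (add _ _ _ _ ibdd_n ibdd_s) ibdd_s.
  have := add _ _ _ _ (add _ _ _ _ (add _ _ _ _ (add _ _ _ _ (add _ _ _ _ (mul _ _ _ _ (ibdd_cst 2) h1)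
    (ibdd_cst 1)) (mul _ _ _ _ (ibdd_cst 16) bs2)) (ibdd_cst 100)) (mul _ _ _ _ (ibdd_cst 2) bV))
    (ibdd_cst (reg (height_bound C c md))).
  by apply: bdd_le => d; rewrite /memory_bound /offset -mul2n addn1.
have bT := mul _ _ _ _ (ibdd_lg bM) (add _ _ _ _ (add _ _ _ _
  (mul _ _ _ _ (ibdd_cst 39) (add _ _ _ _ bs2 (ibdd_cst 10))) (mul _ _ _ _ (ibdd_cst 40) st)) (ibdd_cst 5)).
have [//|[r h]] := bT.
exists r => d; have [t [m [e v T]]] := count_program_exec C c md (in_H d) (in_G d).
exists t, m; split=> //; apply: leq_trans (h d); apply: T; last exact: sf.
exact: (@bnd_gt0 _ _ _ _ in_n0 in_w0 VBig r0 d isT).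
Qed.
End Cost.

(** * Computability of the bounds *)

Fixpoint xgrow (r : nat) (X : xp) : xp :=
  if r is r'.+1 then xloop LSet X (xadd X (xc 2)) (fun A _ => xgrow r' A)
  else xpow (xadd X (xc 2)) (xadd X (xc 2)).

Lemma val_grow d r env X x : denotes d env X x -> denotes d env (xgrow r X) (grow r x).
Proof.
elim: r env X x => [|r IH] env X x hX.
  by apply: val_pow; apply: val_add => //; apply: val_c.
have e m : iteri m (fun _ a => grow r a) x = iter m (grow r) x by elim: m => //= m ->.
have -> : grow r.+1 x = iter (x + 2) (grow r) x by [].
rewrite -e; apply: (val_loop (md := LSet) (g := fun _ a => grow r a)) => //.
  by apply: val_add => //; apply: val_c.
by move=> i a e' A J _ _ hA _ _; apply: IH.
Qed.

Lemma scoped_grow r X l : (forall j, l <= j -> scoped j (X j)) -> scoped l (xgrow r X l).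
Proof.
elim: r X l => [|r IH] X l h; rewrite /= ?h //; try lia.
by rewrite andbT /=; apply: IH => j lj /=; lia.
Qed.

Lemma computable_grow r : computable (grow r).
Proof.
exists (Seq (Assign (Dir 2) Add (At (Dir 0)) (Cst 0)) (Seq (Assign (Dir 0) Add (Cst 1) (Cst 0))
  (Seq (compile (xgrow r (xv 0) 1) 1) (Assign (Dir 0) Add (At (Dir (reg 1))) (Cst 0))))) => k.
(* The input moves to register 0, and 1 becomes the base of the data, which are then the odd cells,
   all zero. *)
pose m0 := update (nth 0 [:: k]) 2 (k + 0); pose m1 := update m0 0 (1 + 0).
have [t0 e0] : exists t, exec (Assign (Dir 2) Add (At (Dir 0)) (Cst 0)) (nth 0 [:: k]) t m0.
  by eexists; apply: ExecAssign.
have [t1 e1] : exists t, exec (Assign (Dir 0) Add (Cst 1) (Cst 0)) m0 t m1.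
  by eexists; apply: ExecAssign.
have S : sim (fun=> 0) [:: k] m1.
  split=> // [[|j] //= _|a]; first by rewrite /m1 /m0 /update /= addn0.
  by rewrite /m1 /m0 /update /=; case: eqP => [|_]; [lia|rewrite nth_nil].
have sc : scoped (size [:: k]) (xgrow r (xv 0) 1) by apply: scoped_grow.
have [t [m [e v _ _]]] := compile_ok sc S.
have hX : denotes (fun=> 0) [:: k] (xv 0) k by exact: (@val_v _ [:: k] 0 isT).
have ev : eval (fun=> 0) [:: k] (xgrow r (xv 0) 1) = grow r k := val_grow r hX (extends_refl _).
eexists; eexists.
  exact: ExecSeq e0 (ExecSeq e1 (ExecSeq e (ExecAssign _ _ _ _ _))).
by rewrite -ev -v; exact: addn0.
Qed.

(** * From size types to the time bound *)

Section Main.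
Import Order.TTheory GRing.Theory Num.Theory.

(** With [g = grow r k], the factor [g ^ g] goes into [f], one rank function more, and the exponent
    [g] of the logarithm is [e]. Rounding [k / 4] down only helps. *)
Lemma bnd_time_bound (R : realType) k n d r : 0 < n ->
  ((bnd k n (lg n) r (VP 2 1))%:R <= time_bound R (grow (rcomp 0 r)) (grow r) k n d :> R)%R.
Proof.
move=> n0; rewrite /time_bound /bnd expnMn mul1n.
set g := grow r k; have g1 : 0 < g := ltnW (grow_gt1 _ _).
have h1 : g ^ g <= grow (rcomp 0 r) k.
  apply: leq_trans (grow_comp 0 r k); rewrite -/g -[grow 0 g]/((g + 2) ^ (g + 2)).
  by apply: (@leq_trans (g ^ (g + 2))); rewrite ?leq_pexp2l ?leq_exp2r ?leq_addr // addn2.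
have h2 : lg n ^ g <= lg (n * d.+1 * k.+1) ^ g.
  by rewrite leq_exp2r //; apply: lg_mono; rewrite -mulnA leq_pmulr.
have h3 : ((n ^ (2 + k %/ 4))%:R <= n%:R `^ (k%:R / 4%:R + 2%:R) :> R)%R.
  rewrite natrX -powR_mulrn ?ler0n // ler_powR ?ler1n //.
  rewrite natrD addrC lerD2r ler_pdivlMr ?ltr0n // -natrM ler_nat.
  exact: leq_trunc_div.
rewrite mulnAC; move: (g ^ g)%N (n ^ _)%N (lg n ^ g)%N h1 h2 h3 => x y z h1 h2 h3.
rewrite !natrM; apply: ler_pM; rewrite ?mulr_ge0 ?ler0n //.
  by apply: ler_pM; rewrite ?ler0n ?ler_nat.
by rewrite -natrX ler_nat.
Qed.

(** Any larger rank serves as well, which allows the three counts to share [f] and [e]. *)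
Lemma counting_time (R : realType) (D : nat -> nat) (C c md : nat)
    (count : forall VH VG : finType, sgraph VH -> sgraph VG -> nat) :
  (forall n, D n <= C * lg n ^ c) ->
  (forall k n (H : sgraph 'I_k) (G : sgraph 'I_n), count _ _ H G = answer md H G) ->
  exists r0, forall r, r0 <= r ->
    computed_in_time count D (time_bound R (grow (rcomp 0 r)) (grow r)).
Proof.
move=> hD hcount; have [r0 hr] := program_time C c md.
exists r0 => r r0r; exists (count_program C c md) => k n H G deg.
have ok : eval (data1 C c H G) (env7 C c H G) (count_expr md) = count _ _ H G.
  by rewrite hcount; apply: answer_ok => _; apply: leq_trans deg (hD n).
have [n0|n0] := posnP n.
  have [t [m [e v _]]] := count_program_exec C c md H G.
  by exists t => //; exists m; rewrite ?v.
have [t [m [e v T]]] := hr (Instance H G n0).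
exists t; first by exists m; rewrite ?v.
move=> _; apply: le_trans (bnd_time_bound R k (degeneracy G) r n0).
rewrite ler_nat; apply: leq_trans T _.
exact: (@bnd_mono_rank _ in_k in_n in_w in_n0 in_w0 (VP 2 1) r0 r (Instance H G n0) r0r).
Qed.
End Main.

Theorem theorem1p2 (R : realType) (D : nat -> nat) (hD : polylogarithmic D) :
  exists f e : nat -> nat,
    [/\ computable f,
        computable e,
        computed_in_time (@num_homs) D (@time_bound R f e),
        computed_in_time (@num_subgraphs) D (@time_bound R f e)
      & computed_in_time (@num_induced) D (@time_bound R f e)].
Proof.
have [C [c hC]] := hD.
have [|r0 h0] := @counting_time R D C c 0 (@num_homs) hC.
  by move=> k n H G; rewrite num_homs_wanted /answer divn1.
have [|r1 h1] := @counting_time R D C c 1 (@num_subgraphs) hC.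
  by move=> k n H G; rewrite num_subgraphs_wanted.
have [|r2 h2] := @counting_time R D C c 2 (@num_induced) hC.
  by move=> k n H G; rewrite num_induced_wanted.
pose r := r0 + r1 + r2.
exists (grow (rcomp 0 r)), (grow r); split; try exact: computable_grow.
- by apply: h0; rewrite /r -addnA leq_addr.
- by apply: h1; rewrite /r addnAC leq_addl.
- by apply: h2; rewrite /r leq_addl.
Qed.
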